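(* Let $N>2$, let $\Omega\subset\mathbb{R}^N$ be a bounded open set with $C^1$ boundary, let $\nu$ be its unit outward normal, and let $\eta\ge 0$. Let $0\le f\in L^{\frac{2N}{N+2}}(\Omega)$, let $0\le\lambda\in L^\infty(\partial\Omega)$ be not identically null, and let $0\le g\in L^r(\partial\Omega)$ with $$r=\max\left(\frac{2(N-1)}{N+\eta(N-2)},\,1\right).$$ Then there exists a weak solution to the problem $$\begin{cases}-\Delta u=f & \text{in }\Omega,\\ u\ge 0 & \text{in }\Omega,\\ \dfrac{\partial u}{\partial\nu}+\lambda u=\dfrac{g}{u^\eta} & \text{on }\partial\Omega.\end{cases}$$
   Context: $\mathcal{H}^{N-1}$ is the $(N-1)$-dimensional Hausdorff measure, and Lebesgue spaces on $\partial\Omega$ are taken with respect to it. Values on $\partial\Omega$ of Sobolev functions are traces. Weak solution: a function $u\in H^1(\Omega)$, with $u\ge 0$ in $\Omega$ as required in the problem, such that $g u^{-\eta}\in L^1(\partial\Omega)$ and $$\int_\Omega\nabla u\cdot\nabla\varphi\,dx+\int_{\partial\Omega}\lambda u\varphi\,d\mathcal{H}^{N-1}=\int_\Omega f\varphi\,dx+\int_{\partial\Omega}\frac{g\varphi}{u^\eta}\,d\mathcal{H}^{N-1}$$ for all $\varphi\in H^1(\Omega)\cap L^\infty(\partial\Omega)$ (that is, $\varphi\in H^1(\Omega)$ with bounded trace).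
   Formalization: If Ω is disconnected, λ is also assumed not to be null a.e. on the boundary of any connected component of Ω; otherwise the claim fails (two disjoint balls, λ = 0 on one sphere and 1 on the other, f = 1, g = 0); for connected Ω nothing is added. *)

(* Defs.v *)
From HB Require Import structures.
From mathcomp Require Import all_boot all_order all_algebra.
From mathcomp Require Import all_classical all_reals all_analysis.

Set Implicit Arguments.
Unset Strict Implicit.
Unset Printing Implicit Defensive.

Import Order.TTheory GRing.Theory Num.Theory.
Import numFieldNormedType.Exports.

Local Open Scope classical_set_scope.
Local Open Scope ring_scope.

(* R^n is 'rV[R]_n; its library topology is the
   usual one, but its library norm is the sup norm, so the Euclidean norm (on
   which the Hausdorff measure depends) is defined here. *)

Section CoveringOuterMeasure.
Local Open Scope ereal_scope.
Context (R : realType) (T : pointedType).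
Implicit Types (c : set T -> \bar R) (X A : set T).

(* The empty set always costs nothing, also in dimension 0. *)
Definition cost0 c A : \bar R := if A == set0 then 0 else c A.

Definition covering_outer c X : \bar R :=
  ereal_inf [set \sum_(k <oo) cost0 c (A k) |
             A in [set A : (set T)^nat | X `<=` \bigcup_k A k]].

Variable c : set T -> \bar R.
Hypothesis c_ge0 : forall A, A !=set0 -> 0 <= c A.

Lemma cost0_ge0 A : 0 <= cost0 c A.
Proof. by rewrite /cost0; case: ifPn => // /set0P/c_ge0. Qed.

Lemma cost0_set0 : cost0 c set0 = 0.
Proof. by rewrite /cost0 eqxx. Qed.

Let D := g_sigma_algebraType [set: set T].

Lemma covering_outerE : covering_outer c = mu_ext (cost0 c : set D -> \bar R).
Proof.
apply/funext => X; congr ereal_inf; apply/seteqP; split => y [A hA <-].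
  by exists A => //; split => // i; exact: sub_gen_smallest.
by exists A => //; case: hA.
Qed.

Lemma covering_outer0 : covering_outer c set0 = 0.
Proof. by rewrite covering_outerE mu_ext0//; [exact: cost0_set0|exact: cost0_ge0]. Qed.

Lemma covering_outer_ge0 X : 0 <= covering_outer c X.
Proof. by rewrite covering_outerE; apply: mu_ext_ge0; exact: cost0_ge0. Qed.

Lemma le_covering_outer :
  {homo covering_outer c : A B / A `<=` B >-> A <= B}.
Proof. by rewrite covering_outerE => A B; exact: (@le_mu_ext _ D). Qed.

Lemma covering_outer_sigma_subadditive : sigma_subadditive (covering_outer c).
Proof.
rewrite covering_outerE.
exact: (@mu_ext_sigma_subadditive _ D R (cost0 c) cost0_ge0).
Qed.

End CoveringOuterMeasure.

Definition caratheodory_measure (R : realType) (T : pointedType)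
    (mu : {outer_measure set T -> \bar R}) :
    {measure set (caratheodory_type mu) -> \bar R} :=
  (mu : set (caratheodory_type mu) -> \bar R).

Section LebesgueRn.
Context (R : realType) (n : nat).

Definition box (a b : 'rV[R]_n) : set 'rV[R]_n :=
  [set x | forall i, a 0 i <= x 0 i <= b 0 i].

Definition box_volume (A : set 'rV[R]_n) : \bar R :=
  ereal_inf [set (\prod_i (ab.2 0 i - ab.1 0 i))%:E |
             ab in [set ab : 'rV[R]_n * 'rV[R]_n |
                    (forall i, ab.1 0 i <= ab.2 0 i) /\ A `<=` box ab.1 ab.2]].

Lemma box_volume_ge0 A : (0 <= box_volume A)%E.
Proof.
apply: le_ereal_inf_tmp => _ [ab [ab0 _] <-].
by rewrite lee_fin prodr_ge0// => i _; rewrite subr_ge0.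
Qed.

Definition lebesgue_outer : set 'rV[R]_n -> \bar R := covering_outer box_volume.

Let vol_ge0 A (_ : A !=set0) := box_volume_ge0 A.

HB.instance Definition _ := isOuterMeasure.Build R 'rV[R]_n lebesgue_outer
  (covering_outer0 vol_ge0) (covering_outer_ge0 vol_ge0)
  (@le_covering_outer _ _ _)
  (covering_outer_sigma_subadditive vol_ge0).

(* The measurable sets are the Caratheodory ones, i.e. the completed Lebesgue
   sigma-algebra. *)
Definition lebesgue_rV := caratheodory_measure lebesgue_outer.

Definition enorm (x : 'rV[R]_n) : R := Num.sqrt (\sum_i x 0 i ^+ 2).

Definition ediam (A : set 'rV[R]_n) : \bar R :=
  ereal_sup [set (enorm (x - y))%:E | x in A & y in A].

Lemma ediam_ge0 A : A !=set0 -> (0 <= ediam A)%E.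
Proof.
move=> [x Ax]; apply: (@le_trans _ _ (enorm (x - x))%:E).
  by rewrite lee_fin sqrtr_ge0.
by apply: ereal_sup_ubound; exists x => //; exists x.
Qed.

End LebesgueRn.

Section HausdorffRn.
Local Open Scope ereal_scope.
(* H^m on R^n, with the factor vol(B_1 in R^m) / 2^m under which it agrees
   with surface area (the weak formulation depends on this normalization). *)
Context (R : realType) (m n : nat).

Definition unit_ball_volume : \bar R :=
  @lebesgue_outer R m [set x | (enorm x <= 1)%R].

Definition hausdorff_cost (delta : R) (A : set 'rV[R]_n) : \bar R :=
  if ediam A <= delta%:E
  then unit_ball_volume * (ediam A * (2^-1)%:E) ^+ m else +oo.

Lemma hausdorff_cost_ge0 delta A : A !=set0 -> 0 <= hausdorff_cost delta A.
Proof.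
move=> A0; rewrite /hausdorff_cost; case: ifPn => // _.
by rewrite mule_ge0 ?outer_measure_ge0// expe_ge0// mule_ge0 ?ediam_ge0//.
Qed.

Definition hausdorff_outer (X : set 'rV[R]_n) : \bar R :=
  ereal_sup [set covering_outer (hausdorff_cost delta) X |
             delta in [set delta : R | (0 < delta)%R]].

Lemma hausdorff_outer0 : hausdorff_outer set0 = 0.
Proof.
apply/eqP; rewrite eq_le; apply/andP; split.
  apply: ge_ereal_sup => _ [d _ <-].
  by rewrite covering_outer0//; exact: hausdorff_cost_ge0.
apply: ereal_sup_ubound; exists 1%R => //=.
by rewrite covering_outer0//; exact: hausdorff_cost_ge0.
Qed.

Lemma hausdorff_outer_ge0 X : 0 <= hausdorff_outer X.
Proof.
apply: (@le_trans _ _ (covering_outer (hausdorff_cost 1) X)).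
  by apply: covering_outer_ge0; exact: hausdorff_cost_ge0.
by apply: ereal_sup_ubound; exists 1%R => //=.
Qed.

Lemma le_hausdorff_outer : {homo hausdorff_outer : A B / A `<=` B >-> A <= B}.
Proof.
move=> A B AB; apply: ge_ereal_sup => _ [d d0 <-].
apply: (le_trans (le_covering_outer _ AB)).
by apply: ereal_sup_ubound; exists d.
Qed.

Lemma hausdorff_outer_sigma_subadditive : sigma_subadditive hausdorff_outer.
Proof.
move=> F; apply: ge_ereal_sup => _ [d d0 <-].
apply: (le_trans
  (covering_outer_sigma_subadditive (@hausdorff_cost_ge0 d) F)).
apply: lee_nneseries => [i _ _|i _].
  by apply: covering_outer_ge0; exact: hausdorff_cost_ge0.
by apply: ereal_sup_ubound; exists d.
Qed.

HB.instance Definition _ := isOuterMeasure.Build R 'rV[R]_n hausdorff_outer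
  hausdorff_outer0 hausdorff_outer_ge0 le_hausdorff_outer
  hausdorff_outer_sigma_subadditive.

Definition hausdorff_measure := caratheodory_measure hausdorff_outer.

End HausdorffRn.

Definition Lp d (T : measurableType d) (R : realType)
    (mu : {measure set T -> \bar R}) (D : set T) (p : \bar R) (f : T -> R) :=
  (f \_ D) \in Lfun mu p.

Definition Lp_dist d (T : measurableType d) (R : realType)
    (mu : {measure set T -> \bar R}) (D : set T) (p : \bar R) (f g : T -> R) :=
  ('N[mu]_p [EFin \o ((f \- g)%R \_ D)])%E.

Section Sobolev.
Context (R : realType) (n : nat).
Implicit Types (Omega : set 'rV[R]_n) (u phi t : 'rV[R]_n -> R)
  (G : 'rV[R]_n -> 'rV[R]_n).

Definition partial m (i : 'I_m) (f : 'rV[R]_m -> R) : 'rV[R]_m -> R :=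
  fun x => 'D_(delta_mx 0 i) f x.

Fixpoint Ck m (k : nat) (f : 'rV[R]_m -> R) : Prop :=
  if k is k'.+1 then
    continuous f /\ forall i : 'I_m,
      (forall x, derivable f x (delta_mx 0 i)) /\ Ck k' (partial i f)
  else continuous f.

Definition boundary (A : set 'rV[R]_n) := closure A `\` interior A.

(* Near each boundary point, after relabelling and possibly reversing the
   coordinate axes, Omega is the strict epigraph of a C^1 function. *)
Definition C1_boundary Omega :=
  forall x0, boundary Omega x0 ->
  exists (r : R) (i : 'I_n) (s : bool) (gamma : 'rV[R]_n.-1 -> R),
    [/\ 0 < r, Ck 1 gamma &
        Omega `&` ball x0 r =
        [set x | ball x0 r x /\ gamma (col' i x) < (-1) ^+ s * x 0 i]].

Definition test_function Omega phi :=
  [/\ forall k, Ck k phi,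
      compact (closure [set x | phi x != 0]) &
      closure [set x | phi x != 0] `<=` Omega].

Definition surface := hausdorff_measure R n.-1 n.

(* u is in H^1(Omega), with weak gradient G *)
Definition H1_grad Omega u G :=
  [/\ Lp (lebesgue_rV R n) Omega 2%:E u,
      forall i, Lp (lebesgue_rV R n) Omega 2%:E (fun x => G x 0 i) &
      forall phi i, test_function Omega phi ->
        (\int[lebesgue_rV R n]_(x in Omega) (u x * partial i phi x)%:E
         = - \int[lebesgue_rV R n]_(x in Omega) (G x 0 i * phi x)%:E)%E].

(* t represents the trace of u: the L^2(boundary) limit of the restrictions of
   C^1 functions converging to u in H^1(Omega), i.e. the value at u of the
   extension by density of the restriction operator. *)
Definition is_trace Omega u t :=
  Lp surface (boundary Omega) 2%:E t /\
  exists G (w : nat -> 'rV[R]_n -> R),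
    [/\ H1_grad Omega u G,
        forall k, Ck 1 (w k) /\
          (Lp (lebesgue_rV R n) Omega 2%:E (w k) /\
           forall i, Lp (lebesgue_rV R n) Omega 2%:E (partial i (w k))),
        Lp_dist (lebesgue_rV R n) Omega 2%:E (w k) u @[k --> \oo] --> 0%E,
        forall i, Lp_dist (lebesgue_rV R n) Omega 2%:E
          (partial i (w k)) (fun x => G x 0 i) @[k --> \oo] --> 0%E &
        Lp_dist surface (boundary Omega) 2%:E (w k) t @[k --> \oo] --> 0%E].

(* g / u^eta.  The quotient is taken in \bar R, so that it is +oo where u = 0,
   g > 0 and eta > 0 (the real powR would give 0 ^ (- eta) = 0 there); it is 0
   where g = 0. *)
Definition singular_term (g t : 'rV[R]_n -> R) (eta : R) (x : 'rV[R]_n) :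
    \bar R :=
  ((g x)%:E / ((t x) `^ eta)%:E)%E.

Definition weak_solution Omega (f lambda g : 'rV[R]_n -> R) (eta : R) u :=
  exists Du tu,
  [/\ H1_grad Omega u Du, is_trace Omega u tu,
      {ae lebesgue_rV R n, forall x, Omega x -> 0 <= u x},
      surface.-integrable (boundary Omega) (singular_term g tu eta) &
      forall phi Dphi tphi,
        H1_grad Omega phi Dphi -> is_trace Omega phi tphi ->
        Lp surface (boundary Omega) +oo%E tphi ->
        (\int[lebesgue_rV R n]_(x in Omega)
            (\sum_(i < n) Du x 0 i * Dphi x 0 i)%:E
         + \int[surface]_(x in boundary Omega) (lambda x * tu x * tphi x)%:E
         = \int[lebesgue_rV R n]_(x in Omega) (f x * phi x)%:E
         + \int[surface]_(x in boundary Omega)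
             ((tphi x)%:E * singular_term g tu eta x))%E].

End Sobolev.

(* Main.v *)
Require Import Defs.
From HB Require Import structures.
From mathcomp Require Import all_boot all_order all_algebra.
From mathcomp Require Import all_classical all_reals all_analysis.
From mathcomp Require Import ring lra measurable_realfun.
Set Implicit Arguments.
Unset Strict Implicit.
Unset Printing Implicit Defensive.
Import Order.TTheory GRing.Theory Num.Theory.
Import numFieldNormedType.Exports.
Local Open Scope classical_set_scope.
Local Open Scope ring_scope.

(* With Phi' = - t^(-eta), the problem is the Euler-Lagrange equation of
   J w = (int |grad w|^2 + int_bd lambda w^2) / 2 - int f w + int_bd g Phi(w),
   which is minimised over the class K of C^1 functions that are positive on
   the closure of Omega.  (For eta = 1, g is first replaced by min(g, k), since
   g log w need not be bounded below.)  J is bounded below by the Sobolev, trace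
   and Poincare inequalities: the last one holds because lambda does not vanish
   on the boundary of any component, and all three are proved for C^1 functions
   from the interior cone property and from slicing.  Convexity of Phi makes
   near-minimisers Cauchy in H^1, and fast convergence along a subsequence
   gives almost everywhere limits with dominated convergence.
     For phi of class C^1, a near-minimiser w is compared with T_s(w - s phi),
   where T_s x = (x + sqrt(x^2 + 4 s^2)) / 2 is a 1-Lipschitz regularisation of
   the positive part that lies above it.  This gives
     int grad w . grad phi + int_bd lambda w phi - int f phi
       <= o(1) + int_bd g phi T_s(w - s phi)^(-eta).
   The limit along the near-minimisers is by domination for fixed s.  Then
   phi = -1 and Fatou's lemma show that g / u^eta is integrable, after which
   s -> 0 is again dominated and gives the inequality for phi and - phi.
   Truncation extends the equation to phi in H^1 with bounded trace. *)

(** * Borel sets, Lebesgue measure and slicing *)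

(** The trace in the statement is a limit of restrictions of C^1 functions, so the argument stays
    inside that class as long as possible: the near-minimisers are at once the approximants of [u],
    of its gradient and of its trace. The infimum over K need not be attained, since a limit of
    positive functions may vanish on the boundary. This possible vanishing is the main obstacle:
    without a lower bound on [u] the singular term cannot be differentiated in a direction [phi].
    The competitor T_s(w - s phi) stays above s / (M + 1) when |phi| <= M, which dominates the
    singular term for each fixed s. The exponents come from duality: 2N/(N+2) is conjugate to the
    Sobolev exponent 2N/(N-2), and for eta < 1 the exponent of [g] is conjugate to
    2(N-1)/((N-2)(1-eta)), the best exponent for the trace of |w|^(1-eta). For eta > 1 the potential
    Phi is nonnegative and integrability of [g] is enough; eta = 1 is the borderline, where Phi
    changes sign and is neither bounded below nor a power. *)

Section BorelRow.
Context (R : realType) (n : nat).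

Definition halfspaces : set (set 'rV[R]_n) :=
  [set A | exists j c, A = [set x : 'rV[R]_n | x 0 j < c]].

(** The common ground of the two completed sigma-algebras: sets measurable here are measurable for
    Lebesgue and for surface measure alike, and maps between spaces of different dimension are
    checked coordinate by coordinate. *)
Definition rvB := g_sigma_algebraType halfspaces.

Lemma measurable_rvB_coord (j : 'I_n) :
  measurable_fun setT (fun x : rvB => (x : 'rV[R]_n) 0 j).
Proof.
apply: (measurability _ (RGenInftyO.measurableE R)).
move=> _ [_ [c ->] <-]; rewrite setTI.
apply: sub_sigma_algebra; exists j, c.
by apply/seteqP; split=> x /=; rewrite in_itv.
Qed.

Lemma measurable_to_rvB d (X : measurableType d) (F : X -> 'rV[R]_n) :
  (forall j, measurable_fun setT (fun x => F x 0 j)) ->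
  measurable_fun setT (F : X -> rvB).
Proof.
move=> mF; apply: (@measurability _ _ X rvB setT F halfspaces) => //.
move=> _ [_ [j [c ->]] <-]; have := mF j measurableT (`]-oo, c[%classic)
  (measurable_itv _).
by rewrite !setTI; congr measurable; apply/seteqP; split=> x /=; rewrite in_itv.
Qed.

(** Balls of the library norm are boxes, so every point of [U] lies in a box with rational corners
    contained in [U], and there are countably many of these. *)
Lemma rvB_open (U : set 'rV[R]_n) : open U -> measurable (U : set rvB).
Proof.
move=> oU.
pose bx (ab : 'rV[rat]_n * 'rV[rat]_n) : set 'rV[R]_n :=
  [set x | forall j, ratr (ab.1 0 j) < x 0 j < ratr (ab.2 0 j)].
have mbx ab : measurable (bx ab : set rvB).
  rewrite (_ : bx ab = \bigcap_(j in [set: 'I_n])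
     ((fun x : rvB => (x : 'rV[R]_n) 0 j) @^-1` `]ratr (ab.1 0 j), ratr (ab.2 0 j)[%classic)).
    apply: fin_bigcap_measurable => // j _; rewrite -[X in measurable X]setTI.
    by apply: measurable_rvB_coord => //; exact: measurable_itv.
  apply/seteqP; split=> x /=.
    by move=> h j _ /=; rewrite in_itv/=.
  by move=> h j; have := h j I; rewrite /= in_itv.
rewrite (_ : U = \bigcup_(ab in [set ab | bx ab `<=` U]) bx ab); last first.
  apply/seteqP; split=> [x Ux|x [ab /=]]; last by apply.
  have /nbhs_ballP[e /= e0 eU] : nbhs x U by exact: open_nbhs_nbhs.
  have Ha (j : 'I_n) : exists q : rat, x 0 j - e < ratr q < x 0 j.
    have /rat_in_itvoo[q] : x 0 j - e < x 0 j by rewrite ltrBlDr ltrDl.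
    by rewrite in_itv/= => ?; exists q.
  have Hb (j : 'I_n) : exists q : rat, x 0 j < ratr q < x 0 j + e.
    have /rat_in_itvoo[q] : x 0 j < x 0 j + e by rewrite ltrDl.
    by rewrite in_itv/= => ?; exists q.
  have [a Pa] := choice Ha; have [b Pb] := choice Hb.
  exists (\row_j a j, \row_j b j) => /=.
    move=> y yb; apply: eU; split=> // i j; rewrite ord1.
    have := yb j; rewrite /= !mxE => /andP[h1 h2].
    have /andP[ha1 ha2] := Pa j; have /andP[hb1 hb2] := Pb j.
    rewrite /ball/= ltr_norml; apply/andP; split; lra.
  move=> j /=; rewrite !mxE.
  by have /andP[_ ->] := Pa j; have /andP[-> _] := Pb j.
rewrite bigcup_mkcond; apply: countable_bigcupT_measurable; first exact: countableP.
by move=> k; case: ifP => // _; exact: mbx.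
Qed.

Lemma rvB_closed (U : set 'rV[R]_n) : closed U -> measurable (U : set rvB).
Proof.
move=> cU; rewrite -(setCK U); apply: measurableC; apply: rvB_open.
exact: closed_openC.
Qed.

Lemma rvB_continuous (f : 'rV[R]_n -> R) :
  continuous f -> measurable_fun setT (f : rvB -> R).
Proof.
move=> cf; apply: (measurability _ (RGenInftyO.measurableE R)).
move=> _ [_ [c ->] <-]; rewrite setTI; apply: rvB_open.
by apply: open_comp => // x _; exact: cf.
Qed.

End BorelRow.

(** * Half-spaces are measurable for Lebesgue and for Hausdorff outer measure *)

Section CaratheodoryHalfspaces.
Local Open Scope ereal_scope.
Context (R : realType).

(** The cost inequality is applied to each member of a cover of [Z], whose two traces cover the two
    pieces. Three costs are allowed because for Hausdorff measure the scales on the two sides vary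
    independently. *)
Lemma covering_outer_split (T : pointedType) (c c1 c2 : set T -> \bar R)
    (X Y Z : set T) :
  (forall A, A !=set0 -> 0 <= c1 A) -> (forall A, A !=set0 -> 0 <= c2 A) ->
  (forall B, cost0 c1 (B `&` X) + cost0 c2 (B `&` Y) <= cost0 c B) ->
  covering_outer c1 (Z `&` X) + covering_outer c2 (Z `&` Y) <= covering_outer c Z.
Proof.
move=> c1_ge0 c2_ge0 h; apply: le_ereal_inf_tmp => _ [F ZF <-].
apply: (@le_trans _ _ (\sum_(k <oo) (cost0 c1 (F k `&` X) + cost0 c2 (F k `&` Y)))).
  rewrite nneseriesD; first last.
    by move=> i _ _; exact: cost0_ge0.
    by move=> i _ _; exact: cost0_ge0.
  apply: leeD; apply: ereal_inf_lbound.
    exists (fun k => F k `&` X) => // x [/ZF[k _ Fk] Xx].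
    by exists k.
  exists (fun k => F k `&` Y) => // x [/ZF[k _ Fk] Xx].
  by exists k.
apply: lee_nneseries => [i _ _|i _]; last exact: h.
by rewrite adde_ge0// cost0_ge0.
Qed.

Lemma box_volume_mono n (A B : set 'rV[R]_n) : A `<=` B ->
  box_volume A <= box_volume B.
Proof.
move=> AB; apply: ereal_inf_le_tmp => _ [ab [ab0 Bab] <-].
by exists ab => //; split => // x /AB /Bab.
Qed.

Lemma cost0_mono (T : pointedType) (c : set T -> \bar R) (A B : set T) :
  (forall A, A !=set0 -> 0 <= c A) ->
  (A `<=` B -> c A <= c B) -> A `<=` B -> cost0 c A <= cost0 c B.
Proof.
move=> c0 h AB; rewrite /cost0; have [_|A0] := eqVneq A set0.
  by case: ifPn => // /set0P/c0.
case: ifPn => [/eqP B0|_]; last exact: h.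
by move: AB; rewrite B0 subset0 => /eqP; rewrite (negbTE A0).
Qed.

Lemma box_volume_split n (j : 'I_n) (c : R) (B : set 'rV[R]_n) :
  cost0 (@box_volume R n) (B `&` [set x | (x 0 j < c)%R])
  + cost0 (@box_volume R n) (B `&` ~` [set x | (x 0 j < c)%R])
  <= cost0 (@box_volume R n) B.
Proof.
have ge0 A : A !=set0 -> 0 <= @box_volume R n A by move=> _; exact: box_volume_ge0.
pose H : set 'rV[R]_n := [set x : 'rV[R]_n | (x 0 j < c)%R]; rewrite -/H.
have [BH0|/set0P[x [Bx Hx]]] := eqVneq (B `&` H) set0.
  rewrite BH0 cost0_set0 add0e; apply: cost0_mono => //.
  exact: box_volume_mono.
have [BH0'|/set0P[y [By Hy]]] := eqVneq (B `&` ~` H) set0.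
  rewrite BH0' cost0_set0 adde0; apply: cost0_mono => //.
  exact: box_volume_mono.
rewrite {1 2 3}/cost0 !ifF; first last.
- by apply/negbTE/set0P; exists x.
- by apply/negbTE/set0P; exists y.
- by apply/negbTE/set0P; exists x.
apply: le_ereal_inf_tmp => _ [[a b] [/= ab Bab] <-].
(* Points of [B] on both sides of the cut force a_j < c <= b_j, so that both halves of the box are
   again boxes with ordered corners. *)
have axj : (a 0 j < c)%R.
  by apply: le_lt_trans Hx; have /andP[] := Bab _ Bx j.
have cyj : (c <= b 0 j)%R.
  rewrite /H/= in Hy; move/negP: Hy; rewrite -leNgt => Hy.
  by apply: le_trans Hy _; have /andP[] := Bab _ By j.
pose b' : 'rV[R]_n := \row_i (if i == j then c else b 0 i)%R.
pose a' : 'rV[R]_n := \row_i (if i == j then c else a 0 i)%R.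
apply: (@le_trans _ _ ((\prod_i (b' 0%R i - a 0%R i)%R)%:E
                      + (\prod_i (b 0%R i - a' 0%R i)%R)%:E)).
  apply: leeD; apply: ereal_inf_lbound.
    exists (a, b') => //=; split=> [i|z [/Bab Bz Hz] i]; rewrite mxE.
      by case: eqP => // ->; exact: ltW.
    by have /andP[-> zb] := Bz i; case: eqP => //= ->; exact: ltW.
  exists (a', b) => //=; split=> [i|z [/Bab Bz Hz] i]; rewrite mxE.
    by case: eqP => // ->.
  have /andP[az ->] := Bz i; rewrite andbT; case: eqP => //= ->.
  by rewrite leNgt; apply/negP.
rewrite -EFinD lee_fin (bigD1 j)//= [X in (_ + X)%R](bigD1 j)//=.
rewrite [leRHS](bigD1 j)//= !mxE eqxx.
rewrite [X in (_ * X + _)%R](_ : _ = \prod_(i < n | i != j) (b 0%R i - a 0%R i))%R; last first.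
  by apply: eq_bigr => i ij; rewrite mxE (negbTE ij).
rewrite [X in (_ + _ * X)%R](_ : _ = \prod_(i < n | i != j) (b 0%R i - a 0%R i))%R; last first.
  by apply: eq_bigr => i ij; rewrite mxE (negbTE ij).
by rewrite -mulrDl (_ : (c - a 0 j + (b 0 j - c) = b 0 j - a 0 j)%R)//; ring.
Qed.

Lemma lebesgue_outer_halfspace n (j : 'I_n) (c : R) :
  (@lebesgue_outer R n).-caratheodory [set x | (x 0 j < c)%R].
Proof.
apply: le_caratheodory_measurable => X; rewrite /=.
apply: covering_outer_split => [A _|A _|B]; try exact: box_volume_ge0.
exact: box_volume_split.
Qed.

(** Caratheodory's criterion for metric outer measures, with the distance replaced by the gap in
    coordinate [j]. The part of [X] below c is exhausted by the sets [A k], at gap 1/(k+1); the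
    remainder is a union of layers [L k] whose measures are summable, so that it disappears in the
    limit. *)
Lemma caratheodory_halfspace_of_separated n
    (mu : {outer_measure set 'rV[R]_n -> \bar R}) (j : 'I_n) :
  (forall (X Y : set 'rV[R]_n) (d : R), (0 < d)%R ->
     (forall x y : 'rV[R]_n, X x -> Y y -> (x 0 j + d <= y 0 j)%R) ->
     mu X + mu Y <= mu (X `|` Y)) ->
  forall c, mu.-caratheodory [set x : 'rV[R]_n | (x 0 j < c)%R].
Proof.
move=> sep c; apply: le_caratheodory_measurable => X; pose H : set 'rV[R]_n := [set x : 'rV[R]_n | (x 0 j < c)%R]; rewrite -/H.
have [->|] := eqVneq (mu X) +oo; first by rewrite leey.
rewrite -ltey => Xoo.
pose t (k : nat) : R := (c - k.+1%:R^-1)%R.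
have tlt k : (t k < c)%R by rewrite /t gtrBl invr_gt0.
have tinc k : (t k < t k.+1)%R.
  by rewrite /t ltrD2l ltrN2 ltf_pV2 ?posrE ?ltr0n// ltr_nat.
pose A k : set 'rV[R]_n := X `&` [set x : 'rV[R]_n | (x 0 j <= t k)%R].
pose L k : set 'rV[R]_n := X `&` [set x : 'rV[R]_n | (t k < x 0 j <= t k.+1)%R].
have AX k : mu (A k) <= mu X by apply: le_outer_measure => x [].
have Asep k : mu (A k) + mu (X `&` ~` H) <= mu X.
  apply: (@le_trans _ _ (mu (A k `|` (X `&` ~` H)))).
    apply: (sep (A k) (X `&` ~` H) (c - t k)%R); first by rewrite subr_gt0.
    move=> x y [_ /= xt] [_ /negP]; rewrite -leNgt => cy.
    by apply: le_trans cy; lra.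
  by apply: le_outer_measure => x [[]|[]].
have Lsep k : mu (A k) + mu (L k.+1) <= mu (A k.+2).
  apply: (@le_trans _ _ (mu (A k `|` L k.+1))).
    apply: (sep (A k) (L k.+1) (t k.+1 - t k)%R); first by rewrite subr_gt0.
    by move=> x y [_ /= xt] [_ /andP[ty _]]; lra.
  apply: le_outer_measure => x [[Xx /= xt]|[Xx /= /andP[_ xt]]]; split => //=.
  by apply: (le_trans xt); apply/ltW/(lt_trans (tinc k)).
have AS k : mu (A k) <= mu (A k.+1).
  by apply: le_outer_measure => x [Xx /= xt]; split => //=; apply/(le_trans xt)/ltW.
(* Layers of the same parity are separated from each other, so each parity adds up to at most the
   measure of a single [A]: one [A] bounds the even layers, the other the odd ones. *)
have Lsum K : \sum_(0 <= k < K) mu (L k) <= mu (A K) + mu (A K.-1).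
  elim: K => [|[|K] IH]; first by rewrite big_geq// adde_ge0// outer_measure_ge0.
    rewrite big_nat1; rewrite -[X in X <= _]adde0 leeD ?outer_measure_ge0//.
    by apply: le_outer_measure => x [Xx /= /andP[_ xt]].
  rewrite big_nat_recr//=; apply: (le_trans (leeD2r _ IH)).
  by rewrite /= -addeA [X in _ <= X]addeC leeD2l.
have Lfin : \sum_(0 <= k <oo) mu (L k) < +oo.
  apply: (@le_lt_trans _ _ (mu X + mu X)); last by rewrite lte_add_pinfty.
  apply: lime_le; first by apply: is_cvg_nneseries => *; exact: outer_measure_ge0.
  by near=> K; apply: (le_trans (Lsum K)); apply: leeD; exact: AX.
have key m : mu (X `&` H) + mu (X `&` ~` H) <= mu X + \sum_(m <= k <oo) mu (L k).
  apply: (@le_trans _ _ (mu (A m) + \sum_(m <= k <oo) mu (L k) + mu (X `&` ~` H))).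
    rewrite leeD2r//.
    apply: (@le_trans _ _ (mu (A m `|` \bigcup_(k in [set k | (m <= k)%N]) L k))).
      apply: le_outer_measure => x [Xx Hx].
      have [xm|xm] := leP (x 0%R j) (t m); first by left.
      right.
      have ex : exists k, (x 0%R j <= t k)%R.
        have cx : (0 < c - x 0%R j)%R by rewrite subr_gt0.
        have [k _ /(_ k (leqnn _)) hk] := near_infty_natSinv_lt (PosNum cx).
        have {}hk : (k.+1%:R^-1 < c - x 0%R j)%R := hk.
        by exists k; rewrite /t lerBrDr addrC -lerBrDr; exact: ltW.
      have [k xk mink] := ex_minnP ex.
      have mk : (m < k)%N.
        rewrite ltnNge; apply/negP => km.
        have : (t k <= t m)%R.
          by rewrite /t lerD2l lerN2 lef_pV2 ?posrE ?ltr0n// ler_nat.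
        lra.
      case: k xk mink mk => // k xk mink mk.
      exists k => //; split => //=; rewrite xk andbT ltNge; apply/negP => /mink.
      by rewrite ltnn.
    apply: (le_trans (outer_measureU2 _ _ _)); rewrite leeD2l//.
    rewrite (_ : [set k | (m <= k)%N] = ~` `I_m).
      exact: outer_measure_sigma_subadditive_tail.
    by apply/seteqP; split=> k /=; [move=> mk; apply/negP; rewrite -leqNgt|move/negP; rewrite -leqNgt].
  by rewrite -addeA [X in _ + X]addeC addeA leeD2r.
have tail := nneseries_tail_cvg Lfin (fun k _ => outer_measure_ge0 mu (L k)).
have lim : (mu X + \sum_(m <= k <oo) mu (L k)) @[m --> \oo] --> mu X + 0.
  by apply: cvgeD => //; [exact: fin_num_adde_defl|exact: cvg_cst].
rewrite -[X in _ <= X]adde0 -(cvg_lim _ lim)//.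
apply: lime_ge; first by apply/cvg_ex; eexists; exact: lim.
by near=> m; exact: key.
Unshelve. all: by end_near. Qed.

Lemma lee_expe m (x y : \bar R) : 0 <= x -> x <= y -> x ^+ m <= y ^+ m.
Proof.
move=> x0 xy; elim: m => [|m IH]; first by rewrite !expe0.
by rewrite !expeS; apply: lee_pmul => //; exact: expe_ge0.
Qed.

Lemma ediam_mono n (A B : set 'rV[R]_n) : A `<=` B -> ediam A <= ediam B.
Proof.
move=> AB; apply: ge_ereal_sup => _ [x Ax [y Ay <-]].
by apply: ereal_sup_ubound; exists x; [exact: AB|exists y => //; exact: AB].
Qed.

Lemma hausdorff_cost_mono m n (d d' : R) (A B : set 'rV[R]_n) :
  A !=set0 -> (d <= d')%R -> A `<=` B ->
  hausdorff_cost m d' A <= hausdorff_cost m d B.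
Proof.
move=> A0 dd' AB; rewrite /hausdorff_cost.
have [Bd|_] := ifPn (ediam B <= d%:E); last by rewrite leey.
have AB' := ediam_mono AB.
rewrite ifT; last by apply: (le_trans AB'); apply: (le_trans Bd); rewrite lee_fin.
have eA0 := ediam_ge0 A0.
apply: lee_pmul; rewrite ?outer_measure_ge0// ?expe_ge0// ?mule_ge0//.
by apply: lee_expe; rewrite ?mule_ge0//; apply: lee_pmul.
Qed.

Lemma coord_le_enorm n (x : 'rV[R]_n) j : (`|x 0 j| <= enorm x)%R.
Proof.
rewrite -sqrtr_sqr ler_wsqrtr// (bigD1 j)//= lerDl sumr_ge0// => i _.
exact: sqr_ge0.
Qed.

(** A set of diameter at most d/2 cannot meet both [X] and [Y], so a fine cover of the union splits
    into two covers. The cost grows as delta decreases, hence a cover at the scale e, the least of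
    d1, d2 and d/2, bounds both terms; the suprema over d1 and d2 are then taken separately. *)
Lemma hausdorff_outer_separated m n (j : 'I_n) (X Y : set 'rV[R]_n) (d : R) :
  (0 < d)%R -> (forall x y : 'rV[R]_n, X x -> Y y -> (x 0 j + d <= y 0 j)%R) ->
  hausdorff_outer m X + hausdorff_outer m Y <= hausdorff_outer m (X `|` Y).
Proof.
move=> d0 sep.
have key d1 d2 : (0 < d1)%R -> (0 < d2)%R ->
    covering_outer (hausdorff_cost m d1) X + covering_outer (hausdorff_cost m d2) Y
    <= hausdorff_outer m (X `|` Y).
  move=> d10 d20; pose e : R := (Num.min (Num.min d1 d2) (d / 2))%R.
  have e0 : (0 < e)%R by rewrite /e !lt_min d10 d20 divr_gt0.
  apply: (@le_trans _ _ (covering_outer (hausdorff_cost m e) (X `|` Y))); last first.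
    by apply: ereal_sup_ubound; exists e.
  have := @covering_outer_split 'rV[R]_n (hausdorff_cost m e) (hausdorff_cost m d1)
    (hausdorff_cost m d2) X Y (X `|` Y).
  have -> : (X `|` Y) `&` X = X.
    by apply/seteqP; split => [x []|x ?] //; split => //; left.
  have -> : (X `|` Y) `&` Y = Y.
    by apply/seteqP; split => [x []|x ?] //; split => //; right.
  apply => [A|A|B]; try exact: hausdorff_cost_ge0.
  have [->|B0] := eqVneq B set0; first by rewrite !set0I !cost0_set0 adde0.
  rewrite {3}/cost0 (negbTE B0).
  have [Be|Be] := boolP (ediam B <= e%:E); last first.
    by rewrite [X in _ <= X]/hausdorff_cost (negbTE Be) leey.
  have e1 : (e <= d1)%R by rewrite /e !ge_min lexx.
  have e2 : (e <= d2)%R by rewrite /e !ge_min lexx orbT.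
  have e3 : (e <= d / 2)%R by rewrite /e !ge_min lexx !orbT.
  have [BX0|/set0P[x [Bx Xx]]] := eqVneq (B `&` X) set0.
    rewrite BX0 cost0_set0 add0e /cost0; case: ifPn => [_|/set0P BY].
      by apply: hausdorff_cost_ge0; exact/set0P.
    by apply: hausdorff_cost_mono.
  have [BY0|/set0P[y [By Yy]]] := eqVneq (B `&` Y) set0.
    rewrite BY0 cost0_set0 adde0 /cost0; case: ifPn => [_|/set0P BX].
      by apply: hausdorff_cost_ge0; exact/set0P.
    by apply: hausdorff_cost_mono.
  exfalso; have := sep _ _ Xx Yy.
  have : (enorm (y - x))%:E <= e%:E.
    by apply: le_trans Be; apply: ereal_sup_ubound; exists y => //; exists x.
  rewrite lee_fin => exy; have := coord_le_enorm (y - x) j.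
  rewrite !mxE => h1 h2; have := ler_norm (y 0 j - x 0 j)%R.
  by move: d0 => /[dup] ?; lra.
rewrite {1}/hausdorff_outer.
have nneg D Z : 0 <= covering_outer (@hausdorff_cost R m n D) Z.
  by apply: covering_outer_ge0; exact: hausdorff_cost_ge0.
have [hY|hY] := eqVneq (hausdorff_outer m Y) +oo.
  suff -> : hausdorff_outer m (X `|` Y) = +oo by rewrite leey.
  apply/eqP; rewrite eq_le leey/= -hY; apply: le_hausdorff_outer.
  by move=> x; right.
have Yfin : hausdorff_outer m Y \is a fin_num.
  by rewrite ge0_fin_numE ?hausdorff_outer_ge0// ltey.
rewrite -leeBrDr//; apply: ge_ereal_sup => _ [d1 d10 <-].
rewrite leeBrDr// addeC.
have [hX|hX] := eqVneq (covering_outer (hausdorff_cost m d1) X) +oo.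
  have := key d1 1%R d10 ltr01; rewrite hX addye; last first.
    by rewrite -ltNye (lt_le_trans _ (nneg _ _)).
  by rewrite leye_eq => /eqP ->; rewrite leey.
have Xfin : covering_outer (hausdorff_cost m d1) X \is a fin_num.
  by rewrite ge0_fin_numE// ltey.
rewrite -leeBrDr//; apply: ge_ereal_sup => _ [d2 d20 <-].
by rewrite leeBrDr// addeC; exact: key.
Qed.

Lemma hausdorff_outer_halfspace m n (j : 'I_n) (c : R) :
  (@hausdorff_outer R m n).-caratheodory [set x | (x 0 j < c)%R].
Proof.
apply: caratheodory_halfspace_of_separated => X Y d d0 sep.
exact: hausdorff_outer_separated sep.
Qed.

Lemma measurable_caratheodory_rvB n (mu : {outer_measure set 'rV[R]_n -> \bar R}) :
  (forall (j : 'I_n) c, mu.-caratheodory [set x : 'rV[R]_n | (x 0 j < c)%R]) ->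
  measurable_fun setT (id : caratheodory_type mu -> rvB R n).
Proof.
move=> h; apply: (@measurability _ _ (caratheodory_type mu) (rvB R n) setT id (@halfspaces R n)) => //.
by move=> _ [_ [j [c ->]] <-]; rewrite setTI; exact: h.
Qed.

End CaratheodoryHalfspaces.

Section LebesgueBoxes.
Local Open Scope ereal_scope.
Context (R : realType).

(** The function underlying [lebesgue_rV], under a name of its own to which the sigma-finite
    structure required by the product measures can be attached. *)
Definition lebf n : set (caratheodory_type (@lebesgue_outer R n)) -> \bar R :=
  @lebesgue_outer R n.

HB.instance Definition _ n := isMeasure.Build _ _ _ (@lebf n)
  (measure0 (lebesgue_rV R n)) (measure_ge0 (lebesgue_rV R n))
  (@measure_semi_sigma_additive _ _ _ (lebesgue_rV R n)).

Lemma covering_outer_le_cost (T : pointedType) (c : set T -> \bar R) A :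
  (forall A, A !=set0 -> 0 <= c A) -> covering_outer c A <= cost0 c A.
Proof.
move=> c0; apply: ereal_inf_lbound; exists (fun k => if k == 0%N then A else set0).
  by move=> x Ax; exists 0%N.
rewrite nneseries_recl//= => [|k _]; last exact: cost0_ge0.
have E (i : nat) : (1 <= i)%N -> true -> cost0 c (if i == 0%N then A else set0) = 0.
  by case: i => [|i] // _ _; rewrite cost0_set0.
by rewrite (eseries0 E) adde0.
Qed.

Lemma box_volume_box_le n (a b : 'rV[R]_n) : (forall i, (a 0 i <= b 0 i)%R) ->
  box_volume (box a b) <= (\prod_i (b 0%R i - a 0%R i))%:E.
Proof. by move=> ab; apply: ereal_inf_lbound; exists (a, b) => //=; split. Qed.

Lemma lebesgue_outer_box_le n (a b : 'rV[R]_n) : (forall i, (a 0 i <= b 0 i)%R) ->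
  lebesgue_outer (box a b) <= (\prod_i (b 0%R i - a 0%R i))%:E.
Proof.
move=> ab; apply: (le_trans (covering_outer_le_cost _ _)).
  by move=> A _; exact: box_volume_ge0.
rewrite /cost0 ifF ?box_volume_box_le//.
by apply/negbTE/set0P; exists a => i; rewrite lexx ab.
Qed.

Lemma measurable_leb_rvB n :
  measurable_fun setT (id : caratheodory_type (@lebesgue_outer R n) -> rvB R n).
Proof. by apply: measurable_caratheodory_rvB => j c; exact: lebesgue_outer_halfspace. Qed.

Lemma measurable_rvB_leb n (A : set 'rV[R]_n) : measurable (A : set (rvB R n)) ->
  measurable (A : set (caratheodory_type (@lebesgue_outer R n))).
Proof.
move=> mA; rewrite -[X in measurable X]setTI.
exact: (@measurable_leb_rvB n measurableT).
Qed.

Lemma measurable_box n (a b : 'rV[R]_n) : measurable (box a b : set (rvB R n)).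
Proof.
rewrite (_ : box a b = \bigcap_(j in [set: 'I_n])
   ((fun x : rvB R n => (x : 'rV[R]_n) 0%R j) @^-1` `[a 0%R j, b 0%R j]%classic)).
  apply: fin_bigcap_measurable => // j _; rewrite -[X in measurable X]setTI.
  by apply: measurable_rvB_coord => //; exact: measurable_itv.
apply/seteqP; split=> x /=.
  by move=> h j _ /=; rewrite in_itv/=.
by move=> h j; have := h j I; rewrite /= in_itv.
Qed.

Definition kbox n (k : nat) : set 'rV[R]_n :=
  box (const_mx (- k%:R)%R) (const_mx k%:R).

Lemma bigcup_kbox n : \bigcup_k @kbox n k = setT.
Proof.
apply/seteqP; split=> // x _.
exists (Num.truncn (\sum_i `|x 0 i|)).+1 => // i; rewrite !mxE -ler_norml.
apply: (@le_trans _ _ (\sum_i `|x 0 i|)%R).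
  by rewrite (bigD1 i)//= lerDl sumr_ge0.
by apply/ltW; rewrite truncnS_gt.
Qed.

Lemma kbox_lty n k : @lebesgue_outer R n (@kbox n k) < +oo.
Proof.
apply: le_lt_trans (lebesgue_outer_box_le _) _ => [i|]; last exact: ltry.
by rewrite !mxE (@le_trans _ _ 0%R) ?oppr_le0.
Qed.

Lemma lebf_sigma_finite n : sigma_finite setT (@lebf n).
Proof.
exists (@kbox n); first by rewrite bigcup_kbox.
by move=> k; split; [apply: measurable_rvB_leb; exact: measurable_box|exact: kbox_lty].
Qed.

HB.instance Definition _ n := @Measure_isSigmaFinite.Build _ _ _ (@lebf n)
  (@lebf_sigma_finite n).

Definition boxes n : set (set 'rV[R]_n) := [set A | exists a b, A = box a b].

Lemma boxes_setI n : setI_closed (@boxes n).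
Proof.
move=> _ _ [a [b ->]] [a' [b' ->]].
exists (\row_i Num.max (a 0 i) (a' 0 i))%R, (\row_i Num.min (b 0 i) (b' 0 i))%R.
apply/seteqP; split=> x /=.
  by move=> [h h'] i; rewrite !mxE ge_max le_min;
    have /andP[-> ->] := h i; have /andP[-> ->] := h' i.
move=> h; split=> i; have := h i; rewrite !mxE ge_max le_min.
  by case/andP => /andP[-> _] /andP[-> _].
by case/andP => /andP[_ ->] /andP[_ ->].
Qed.

(** The strict inequality x_j < c is recovered from the closed bounds x_j <= c - 1/(k+1), together
    with the exhaustion of the space by [kbox]. *)
Lemma boxes_generate n : @measurable _ (rvB R n) = <<s @boxes n >>.
Proof.
apply/seteqP; split; apply: smallest_sub; try exact: smallest_sigma_algebra.
  move=> _ [j [c ->]].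
  rewrite (_ : [set x : 'rV[R]_n | (x 0 j < c)%R] = \bigcup_k
     (box (const_mx (- k%:R)%R) (\row_i (if i == j then c - k.+1%:R^-1 else k%:R)%R))).
    apply: (@bigcupT_measurable _ (g_sigma_algebraType (@boxes n))) => k.
    by apply: sub_sigma_algebra; eexists; eexists.
  apply/seteqP; split=> x /=.
    move=> xc; have : setT x by []; rewrite -(@bigcup_kbox n) => -[k1 _ hk1].
    have cx : (0 < c - x 0 j)%R by rewrite subr_gt0.
    have [k2 _ hk2] := near_infty_natSinv_lt (PosNum cx).
    exists (maxn k1 k2) => // i; rewrite !mxE.
    have := hk1 i; rewrite !mxE => /andP[h1 h2]; apply/andP; split.
      by apply: le_trans h1; rewrite lerN2 ler_nat leq_maxl.
    case: eqP => [->|_].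
      have := hk2 (maxn k1 k2) (leq_maxr _ _) => /= {}hk2.
      by rewrite lerBrDr addrC -lerBrDr; exact: ltW.
    by apply: (le_trans h2); rewrite ler_nat leq_maxl.
  move=> [k _ /(_ j)]; rewrite !mxE eqxx => /andP[_ h].
  by apply: (le_lt_trans h); rewrite gtrBl invr_gt0.
by move=> _ [a [b ->]]; exact: measurable_box.
Qed.

End LebesgueBoxes.

Section Slices.
Context (R : realType) (n : nat).

Definition ins (i : 'I_n.+1) (s : R) (y : 'rV[R]_n) : 'rV[R]_n.+1 :=
  \row_j (if unlift i j is Some k then y 0 k else s).

Lemma ins_at i s y : ins i s y 0 i = s.
Proof. by rewrite mxE unlift_none. Qed.

Lemma ins_lift i s y k : ins i s y 0 (lift i k) = y 0 k.
Proof. by rewrite mxE liftK. Qed.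

Lemma col'_ins i s y : col' i (ins i s y) = y.
Proof. by apply/rowP => k; rewrite mxE ins_lift. Qed.

Lemma ins_col' i (x : 'rV[R]_n.+1) : ins i (x 0 i) (col' i x) = x.
Proof.
apply/rowP => j; rewrite mxE; case: unliftP => [k ->|->] //.
by rewrite mxE.
Qed.

Lemma measurable_ins i d (X : measurableType d) (s : X -> R) (y : X -> 'rV[R]_n) :
  measurable_fun setT s -> measurable_fun setT (y : X -> rvB R n) ->
  measurable_fun setT ((fun x => ins i (s x) (y x)) : X -> rvB R n.+1).
Proof.
move=> ms my; apply: measurable_to_rvB => j.
under eq_fun do rewrite mxE.
case: (unlift i j) => // k.
by apply: (measurableT_comp (@measurable_rvB_coord R n k)).
Qed.

End Slices.

Definition pushforward_measure d1 d2 (T1 : measurableType d1)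
    (T2 : measurableType d2) (R : realType) (m : {measure set T1 -> \bar R})
    (f : T1 -> T2) (mf : measurable_fun setT f) : {measure set T2 -> \bar R} :=
  measure_function_pushforward__canonical__measure_function_Measure m mf.

(** * Volume of boxes, Tonelli's theorem in coordinates, translation invariance *)

Section LebesgueTonelli.
Local Open Scope ereal_scope.
Context (R : realType).

Local Notation lebT n := (caratheodory_type (@lebesgue_outer R n)).

Definition lebS n : {sigma_finite_measure set (lebT n) -> \bar R} := @lebf R n.

(** Lebesgue outer measure dominates every set function that is at most the volume on boxes and
    countably subadditive over families of boxes. This serves for product measures, for the
    Hausdorff measure of graphs and for Borel hulls. *)
Lemma le_lebesgue_outer_of_boxes n (m : set 'rV[R]_n -> \bar R)
    (A : set 'rV[R]_n) :
  (forall a b : 'rV[R]_n, (forall i, (a 0 i <= b 0 i)%R) ->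
     m (box a b) <= (\prod_i (b 0%R i - a 0%R i))%:E) ->
  (forall F : (set 'rV[R]_n)^nat,
     (forall k, F k = set0 \/ exists a b, F k = box a b) -> A `<=` \bigcup_k F k ->
     m A <= \sum_(k <oo) m (F k)) ->
  m set0 = 0 -> (forall X, 0 <= m X) ->
  m A <= lebesgue_outer A.
Proof.
move=> mbox msub m0 mge0; apply: le_ereal_inf_tmp => _ [F AF <-].
have c0 k : 0 <= cost0 (@box_volume R n) (F k).
  by apply: cost0_ge0 => ? _; exact: box_volume_ge0.
have [->|] := eqVneq (\sum_(k <oo) cost0 (@box_volume R n) (F k)) +oo.
  by rewrite leey.
rewrite -ltey => sfin.
apply/lee_addgt0Pr => e e0.
(* Each member of the cover is enlarged to a box at the price e / 2^(k+1). Empty members stay empty,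
   because in dimension 0 every box has volume 1. *)
have H k : exists G, [/\ F k `<=` G, G = set0 \/ (exists a b, G = box a b) &
    m G <= cost0 (@box_volume R n) (F k) + (e / (2 ^ k.+1)%:R)%:E].
  have ek : (0 < e / (2 ^ k.+1)%:R)%R by rewrite divr_gt0// ltr0n expn_gt0.
  have [F0|F0] := eqVneq (F k) set0.
    exists set0; split; [by rewrite F0|by left|].
    by rewrite m0 adde_ge0// lee_fin ltW.
  have cE : cost0 (@box_volume R n) (F k) = box_volume (F k).
    by rewrite /cost0 (negbTE F0).
  have fin : box_volume (F k) \is a fin_num.
    rewrite ge0_fin_numE ?box_volume_ge0// -cE.
    apply: le_lt_trans sfin; rewrite [leRHS](nneseries_split 0 k.+1)//= add0n.
    rewrite big_nat_recr//= -addeA addeCA -[leLHS]adde0 leeD2l// adde_ge0//.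
      by rewrite sume_ge0.
    exact: nneseries_ge0.
  have [_ [[a b] [/= ab Fab] <-] lt] := lb_ereal_inf_adherent ek fin.
  exists (box a b); split => //; first by right; exists a, b.
  by rewrite cE; apply: le_trans (mbox _ _ ab) _; exact: ltW.
have [G HG] := choice H.
apply: (@le_trans _ _ (\sum_(k <oo) m (G k))).
  apply: msub; first by move=> k; have [] := HG k.
  by move=> x /AF[k _ Fx]; exists k => //; have [s _ _] := HG k; exact: s.
apply: le_trans (epsilon_trick xpredT c0 (ltW e0)).
by apply: lee_nneseries => // k _; have [] := HG k.
Qed.

Definition leb_box n := forall a b : 'rV[R]_n, (forall i, (a 0 i <= b 0 i)%R) ->
  lebesgue_outer (box a b) = (\prod_i (b 0%R i - a 0%R i))%:E.

Lemma leb_box0 : leb_box 0.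
Proof.
move=> a b ab; apply/eqP; rewrite eq_le lebesgue_outer_box_le//= big_ord0.
apply: le_ereal_inf_tmp => _ [F AF <-].
have [k _ Fk] : (\bigcup_k F k) a by apply: AF => i; rewrite lexx ab.
have c0 j : 0 <= cost0 (@box_volume R 0) (F j).
  by apply: cost0_ge0 => ? _; exact: box_volume_ge0.
rewrite [leRHS](nneseries_split 0 k.+1)//= add0n big_nat_recr//=.
have : 1 <= cost0 (@box_volume R 0) (F k).
  rewrite /cost0 ifF; last by apply/negbTE/set0P; exists a.
  by apply: le_ereal_inf_tmp => _ [ab' _ <-]; rewrite big_ord0.
move/le_trans; apply.
rewrite -addeA addeCA -[leLHS]adde0 leeD2l// adde_ge0//.
  by rewrite sume_ge0.
exact: nneseries_ge0.
Qed.

Let slice_map n (i : 'I_n.+1) (z : lebT n * measurableTypeR R) : rvB R n.+1 :=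
  ins i z.2 z.1.

Let mslice_map n (i : 'I_n.+1) : measurable_fun setT (@slice_map n i).
Proof.
apply: measurable_ins; first exact: measurable_snd.
exact: measurableT_comp (@measurable_leb_rvB R n) measurable_fst.
Qed.

Definition slice_measure n (i : 'I_n.+1) : {measure set (rvB R n.+1) -> \bar R} :=
  pushforward_measure (@lebf R n \x lebesgue_measure) (mslice_map i).

Lemma slice_measure_box n (i : 'I_n.+1) (a b : 'rV[R]_n.+1) : leb_box n ->
  (forall i, (a 0 i <= b 0 i)%R) ->
  slice_measure i (box a b) = (\prod_i (b 0%R i - a 0%R i))%:E.
Proof.
move=> IH ab; rewrite /slice_measure /= /pushforward.
have -> : @slice_map n i @^-1` box a b =
    box (col' i a) (col' i b) `*` `[a 0%R i, b 0%R i]%classic.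
  apply/seteqP; split=> [[y s] /= h|[y s] /= [h1 h2] j].
    split=> [k|].
      by have := h (lift i k); rewrite /slice_map ins_lift !mxE.
    by have := h i; rewrite /slice_map ins_at/= in_itv.
  have [k ->|->] := unliftP i j.
    by have := h1 k; rewrite /slice_map ins_lift !mxE.
  by rewrite in_itv/= in h2; rewrite /slice_map ins_at.
rewrite product_measure1E//=; last first.
  by apply: measurable_rvB_leb; exact: measurable_box.
have E : @lebf R n (box (col' i a) (col' i b)) =
    (\prod_j (b 0%R (lift i j) - a 0%R (lift i j)))%:E.
  rewrite /lebf IH; last by move=> k; rewrite !mxE ab.
  by congr (_%:E); apply: eq_bigr => k _; rewrite !mxE.
have F : lebesgue_measure (`[a 0%R i, b 0%R i]%classic : set R) = (b 0 i - a 0 i)%:E.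
  rewrite lebesgue_measure_itv/= lte_fin; case: ltP => [_|ba].
    by rewrite EFinB.
  have -> : (b 0 i = a 0 i)%R by apply: le_anti; rewrite ba ab.
  by rewrite subrr.
rewrite [X in X * _]E [X in _ * X]F -EFinM; congr (_%:E).
by rewrite [RHS](bigD1_ord i)//= mulrC.
Qed.

Lemma le_slice_measure n (i : 'I_n.+1) (A : set 'rV[R]_n.+1) : leb_box n ->
  measurable (A : set (rvB R n.+1)) -> slice_measure i A <= lebesgue_outer A.
Proof.
move=> IH mA; apply: le_lebesgue_outer_of_boxes => [a b ab|F hF AF||X].
- by rewrite slice_measure_box.
- have mF k : measurable (F k : set (rvB R n.+1)).
    by case: (hF k) => [->|[a [b ->]]] //; exact: measurable_box.
  apply: (@le_trans _ _ (slice_measure i (\bigcup_k F k))).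
    by apply: le_measure => //; rewrite inE//; exact: bigcupT_measurable.
  apply: generalized_Boole_inequality => //; exact: bigcupT_measurable.
- exact: measure0.
- exact: measure_ge0.
Qed.

Definition leb_borel n : {measure set (rvB R n) -> \bar R} :=
  pushforward_measure (@lebf R n) (@measurable_leb_rvB R n).

(** Covers give only the upper bound. The lower bound comes by induction on the dimension from
    [slice_measure], which has the right value on boxes and is at most Lebesgue outer measure on
    Borel sets. *)
Lemma leb_box_ n : leb_box n.
Proof.
elim: n => [|n IH]; first exact: leb_box0.
move=> a b ab; apply/eqP; rewrite eq_le lebesgue_outer_box_le//=.
rewrite -(slice_measure_box ord0)//; apply: le_slice_measure => //.
exact: measurable_box.
Qed.

Lemma leb_slice n (i : 'I_n.+1) (A : set 'rV[R]_n.+1) :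
  measurable (A : set (rvB R n.+1)) ->
  leb_borel n.+1 A = slice_measure i A.
Proof.
move=> mA; apply: (@measure_unique _ _ (rvB R n.+1) (@boxes R n.+1) (@kbox R n.+1)
  _ _ _ _ (leb_borel n.+1) (slice_measure i)) => //.
- exact: boxes_generate.
- exact: boxes_setI.
- by move=> k; eexists; eexists; reflexivity.
- exact: bigcup_kbox.
- move=> _ [a [b ->]].
  have [ab|/existsNP[j /negP]] := pselect (forall i, (a 0 i <= b 0 i)%R).
    by rewrite slice_measure_box//; exact: leb_box_.
  rewrite -ltNge => ba; suff -> : box a b = set0 by rewrite !measure0.
  apply/seteqP; split=> // x /(_ j) /andP[h1 h2].
  by have := le_lt_trans (le_trans h1 h2) ba; rewrite ltxx.
- by move=> k; exact: kbox_lty.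
Qed.

Lemma integral_leb_borel n (F : rvB R n -> \bar R) :
  measurable_fun setT F -> (forall x, 0 <= F x) ->
  \int[lebesgue_rV R n]_x F x = \int[leb_borel n]_x F x.
Proof.
move=> mF F0; rewrite /leb_borel.
by rewrite (@ge0_integral_pushforward _ _ _ _ _ _ (@measurable_leb_rvB R n) (@lebf R n))// preimage_setT.
Qed.

(** Borel measurability of [F] makes every section measurable, which can fail for a function that is
    measurable only in the completed sense. *)
Lemma tonelli_ins n (i : 'I_n.+1) (F : rvB R n.+1 -> \bar R) :
  measurable_fun setT F -> (forall x, 0 <= F x) ->
  \int[lebesgue_rV R n.+1]_x F x =
  \int[lebesgue_rV R n]_y \int[lebesgue_measure]_s F (ins i s y).
Proof.
move=> mF F0; rewrite integral_leb_borel//.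
rewrite (eq_measure_integral (slice_measure i)); last first.
  by move=> A mA _; exact: leb_slice.
have mG : measurable_fun setT (F \o @slice_map n i).
  exact: measurableT_comp mF (@mslice_map n i).
have := @fubini_tonelli1 _ _ _ _ _ (lebS n) lebesgue_measure (F \o @slice_map n i)
  mG (fun z => F0 (slice_map i z)).
have := @ge0_integral_pushforward _ _ _ _ _ _ (@mslice_map n i)
  (@lebf R n \x lebesgue_measure) setT F measurableT mF (fun y _ => F0 y).
by rewrite preimage_setT => -> ->.
Qed.

Lemma tonelli_leb n m (F : lebT n * lebT m -> \bar R) :
  measurable_fun setT F -> (forall x, 0 <= F x) ->
  \int[lebesgue_rV R n]_x \int[lebesgue_rV R m]_y F (x, y) =
  \int[lebesgue_rV R m]_y \int[lebesgue_rV R n]_x F (x, y).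
Proof. exact: (@fubini_tonelli _ _ _ _ _ (lebS n) (lebS m)). Qed.

Lemma tonelli_leb1 n (F : lebT n * measurableTypeR R -> \bar R) :
  measurable_fun setT F -> (forall x, 0 <= F x) ->
  \int[lebesgue_rV R n]_x \int[lebesgue_measure]_y F (x, y) =
  \int[lebesgue_measure]_y \int[lebesgue_rV R n]_x F (x, y).
Proof. exact: (@fubini_tonelli _ _ _ _ _ (lebS n) lebesgue_measure). Qed.

Lemma lebesgue_outer_shift n (h : 'rV[R]_n) (A : set 'rV[R]_n) :
  lebesgue_outer [set x | A (x + h)%R] <= lebesgue_outer A.
Proof.
apply: le_ereal_inf_tmp => _ [F AF <-].
apply: (@le_trans _ _ (\sum_(k <oo) cost0 (@box_volume R n) [set x | F k (x + h)%R])).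
  apply: ereal_inf_lbound; exists (fun k => [set x | F k (x + h)%R]) => //.
  by move=> x /= /AF[k _ Fk]; exists k.
apply: lee_nneseries => [k _ _|k _].
  by apply: cost0_ge0 => ? _; exact: box_volume_ge0.
rewrite {1}/cost0; case: ifPn => [_|/set0P[x /= Fx]].
  by apply: cost0_ge0 => B _; exact: box_volume_ge0.
rewrite /cost0 ifF; last by apply/negbTE/set0P; exists (x + h)%R.
apply: le_ereal_inf_tmp => _ [[a b] [/= ab Fab] <-].
apply: ereal_inf_lbound; exists ((a - h)%R, (b - h)%R) => /=.
  split=> [i|y /= /Fab yab i]; first by rewrite !mxE lerD2r ab.
  by have := yab i; rewrite !mxE lerBlDr lerBrDr.
congr (_%:E); apply: eq_bigr => i _; rewrite !mxE; ring.
Qed.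

Lemma lebesgue_outer_translate n (h : 'rV[R]_n) (A : set 'rV[R]_n) :
  lebesgue_outer [set x | A (x + h)%R] = lebesgue_outer A.
Proof.
apply/eqP; rewrite eq_le lebesgue_outer_shift/=.
have := lebesgue_outer_shift (- h)%R [set x | A (x + h)%R].
have -> // : [set x | [set x | A (x + h)%R] (x - h)%R] = A.
by apply/seteqP; split=> x /=; rewrite subrK.
Qed.

Lemma measurable_translate n (h : 'rV[R]_n) (A : set 'rV[R]_n) :
  measurable (A : set (lebT n)) -> measurable ([set x | A (x + h)%R] : set (lebT n)).
Proof.
move=> mA.
change ((@lebesgue_outer R n).-caratheodory [set x | A (x + h)%R]) => X.
pose X' : set 'rV[R]_n := [set x | X (x - h)%R].
have := (mA : (@lebesgue_outer R n).-caratheodory A) X'; rewrite -(lebesgue_outer_translate (h) (X')) -(lebesgue_outer_translate h (X' `&` A)) -(lebesgue_outer_translate h (X' `&` ~` A)).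
have e1 : [set x | X' (x + h)%R] = X by apply/seteqP; split => x; rewrite /X' /= addrK.
have e2 : [set x | (X' `&` A) (x + h)%R] = X `&` [set x | A (x + h)%R].
  by apply/seteqP; split => x; rewrite /X' /= addrK.
have e3 : [set x | (X' `&` ~` A) (x + h)%R] = X `&` ~` [set x | A (x + h)%R].
  by apply/seteqP; split => x; rewrite /X' /= addrK.
by rewrite e1 e2 e3.
Qed.

Lemma measurable_shift n (h : 'rV[R]_n) :
  measurable_fun setT ((fun x => x + h)%R : lebT n -> lebT n).
Proof. by move=> _ Y mY; rewrite setTI; exact: measurable_translate. Qed.

Lemma integral_translate n (h : 'rV[R]_n) (F : lebT n -> \bar R) :
  measurable_fun setT F -> (forall x, 0 <= F x) ->
  \int[lebesgue_rV R n]_x F (x + h)%R = \int[lebesgue_rV R n]_x F x.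
Proof.
move=> mF F0.
have := @ge0_integral_pushforward _ _ _ _ _ _ (@measurable_shift n h) (@lebf R n) setT F measurableT mF (fun x _ => F0 x).
rewrite preimage_setT => <-.
apply: (@eq_measure_integral _ _ _ _ (@lebf R n)
  (pushforward_measure (@lebf R n) (@measurable_shift n h))).
by move=> A mA _; rewrite /= /pushforward; exact: lebesgue_outer_translate.
Qed.

End LebesgueTonelli.

(** * Functions of class C^1 *)

Section C1Calculus.
Context (R : realType) (n : nat).
Implicit Types (w : 'rV[R]_n -> R) (x h v : 'rV[R]_n).

Lemma is_derive_line w x v (t df : R) :
  is_derive t 1 (fun s : R => w (x + s *: v)) df <-> is_derive (x + t *: v) v w df.
Proof.
have E : (fun h : R => h^-1 *: (((fun s : R => w (x + s *: v)) \o shift t) (h *: 1)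
    - w (x + t *: v))) =
  (fun h : R => h^-1 *: ((w \o shift (x + t *: v)) (h *: v) - w (x + t *: v))).
  apply/funext => h /=; congr (_ *: (w _ - _)).
  by rewrite scaler1 scalerDl addrCA.
split=> -[dw dE]; apply: DeriveDef.
- by move: dw; rewrite /derivable E.
- by move: dE; rewrite /derive E.
- by rewrite /derivable E.
- by rewrite /derive E.
Qed.

Lemma C1_is_derive w i x : Ck 1 w -> is_derive x (delta_mx 0 i) w (partial i w x).
Proof. by move=> [_ /(_ i)[dw _]]; apply: DeriveDef. Qed.

Lemma C1_continuous w : Ck 1 w -> continuous w.
Proof. by case. Qed.

Lemma C1_continuous_partial w i : Ck 1 w -> continuous (partial i w).
Proof. by move=> [_ /(_ i)[]]. Qed.

Lemma C1P w (g : 'I_n -> 'rV[R]_n -> R) : continuous w ->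
  (forall i x, is_derive x (delta_mx 0 i) w (g i x)) ->
  (forall i, continuous (g i)) ->
  Ck 1 w /\ forall i, partial i w = g i.
Proof.
move=> cw dw cg.
have E i : partial i w = g i by apply/funext => x; rewrite /partial; case: (dw i x).
split => //; split => // i; split; last by rewrite /= E; exact: cg.
by move=> x; case: (dw i x).
Qed.

Lemma continuous_line x v : continuous (fun s : R => x + s *: v).
Proof.
move=> s; apply: cvgD; first exact: cvg_cst.
exact: scalel_continuous.
Qed.

(** The path from [x] to [x + h] changes one coordinate at a time (the points [p k]), and the
    one-dimensional mean value theorem applies on each leg. *)
Lemma C1_mean_value w x h : Ck 1 w -> exists xi : 'I_n -> 'rV[R]_n,
  (forall i j, `|xi i 0 j - x 0 j| <= `|h 0 j|) /\
  w (x + h) - w x = \sum_i h 0 i * partial i w (xi i).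
Proof.
move=> C1w.
pose p (k : nat) : 'rV[R]_n := \row_j (x 0 j + if (j < k)%N then h 0 j else 0).
have pS (k : 'I_n) : p k.+1 = p k + h 0 k *: delta_mx 0 k.
  apply/rowP => j; rewrite !mxE eqxx/= ltnS leq_eqVlt -addrA; congr (_ + _).
  have [->|jk] := eqVneq j k; first by rewrite eqxx ltnn/= mulr1 add0r.
  by rewrite -val_eqE in jk; rewrite (negbTE jk)/= mulr0 addr0.
have H (k : 'I_n) : exists c : R, 0 <= c <= 1 /\
    w (p k.+1) - w (p k) = h 0 k * partial k w (p k + (c * h 0 k) *: delta_mx 0 k).
  (* The leg is parametrised over [0, 1], so that h_k may be negative or zero. *)
  pose g s := w (p k + s *: (h 0 k *: delta_mx 0 k)).
  have dg (s : R) : is_derive s 1 g (h 0 k * partial k w (p k + (s * h 0 k) *: delta_mx 0 k)).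
    have := C1_is_derive k (p k + (s * h 0 k) *: delta_mx 0 k) C1w.
    move/(is_derive_line w (p k) (delta_mx 0 k) (s * h 0 k) _).2 => d.
    have d2 : is_derive s 1 (fun s : R => s * h 0 k) (h 0 k).
      have := @is_deriveZ R _ _ id (h 0 k) s 1 1 (is_derive_id _ _).
      by rewrite scaler1; congr is_derive; apply/funext => t; rewrite /= mulrC.
    have := @is_derive1_comp R (fun s => w (p k + s *: delta_mx 0 k)) (fun s => s * h 0 k) s _ _ d d2.
    rewrite mulrC.
    by congr is_derive; apply/funext => t /=; rewrite /g scalerA.
  have cg : {within `[0, 1], continuous g}.
    apply: derivable_within_continuous => s _.
    by have [] := dg s.
  have [c c01 Hc] := MVT_segment ler01 (fun s _ => dg s) cg.
  exists c; split; first by move: c01; rewrite in_itv.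
  by move: Hc; rewrite subr0 mulr1 {1 2}/g scale1r scale0r addr0 -pS.
have [c Hc] := choice H.
exists (fun k : 'I_n => p k + (c k * h 0 k) *: delta_mx 0 k); split.
  move=> i j; rewrite !mxE eqxx/=.
  have [/andP[c0 c1] _] := Hc i.
  have [->|ij] := eqVneq j i.
    rewrite ltnn addr0 mulr1 addrAC subrr add0r normrM ger0_norm//.
    by rewrite ler_piMl.
  rewrite mulr0 addr0 addrAC subrr add0r; case: ifP => // _.
  by rewrite normr0.
have -> : x + h = p n.
  by apply/rowP => j; rewrite !mxE ltn_ord.
have -> : x = p 0%N by apply/rowP => j; rewrite !mxE addr0.
rewrite -(telescope_sumr (fun k => w (p k)) (leq0n n)) big_mkord; apply: eq_bigr => k _.
by have [_ ->] := Hc k.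
Qed.

Lemma ball_rV x (r : R) y : ball x r y <-> 0 < r /\ forall j, `|x 0 j - y 0 j| < r.
Proof.
split=> [[r0 h]|[r0 h]]; first by split=> // j; exact: (h 0 j).
by split=> // i j; rewrite ord1; exact: h.
Qed.

(** Only partial derivatives are given. The difference quotient is expanded by [C1_mean_value],
    whose intermediate points tend to the base point, and continuity of the partial derivatives
    concludes. *)
Lemma C1_is_derive_line w x v (t : R) : Ck 1 w ->
  is_derive t 1 (fun s : R => w (x + s *: v))
    (\sum_i v 0 i * partial i w (x + t *: v)).
Proof.
move=> C1w; apply/is_derive_line; set y := x + t *: v.
set L := \sum_i _.
suff cv : (fun h : R => h^-1 *: ((w \o shift y) (h *: v) - w y)) @ 0^' --> L.
  apply: DeriveDef; last by apply/cvg_lim.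
  by apply/cvg_ex; exists L.
apply/cvgrPdist_lt => e e0.
(* |h| < r / S keeps every coordinate of h v below r, and an error e / S for each unit of |v_i| adds
   up to less than e. *)
pose S := 1 + \sum_i `|v 0 i|.
have S0 : 0 < S by rewrite ltr_pwDl// sumr_ge0.
have eS : 0 < e / S by rewrite divr_gt0.
have near_p i : \forall z \near y, `|partial i w y - partial i w z| < e / S.
  have /cvgrPdist_lt := @C1_continuous_partial w i C1w y; exact.
have := @filter_forall 'rV[R]_n _ (fun i z => `|partial i w y - partial i w z| < e / S)
  (nbhs (y : 'rV[R]_n)) (nbhs_filter _) near_p.
move=> Hn; have [r /= r0 Hr] := (nbhs_ballP (y : 'rV[R]_n) _).1 Hn.
apply/nbhs_ballP; exists (r / S) => /=; first by rewrite divr_gt0.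
move=> h; rewrite /ball/= sub0r normrN ltr_pdivlMr// => hr h0.
have [xi [xib E]] := C1_mean_value y (h *: v) C1w.
rewrite /= [h *: v + y]addrC E scaler_sumr -sumrB.
apply: (@le_lt_trans _ _ (\sum_i `|v 0 i| * (e / S))).
  apply: le_trans (ler_norm_sum _ _ _) _; apply: ler_sum => i _.
  rewrite mxE /GRing.scale/= mulrA mulKf// -mulrBr normrM ler_wpM2l//.
  apply/ltW/Hr; apply/ball_rV; split=> // j; rewrite distrC.
  apply: le_lt_trans (xib i j) _; rewrite mxE normrM.
  apply: le_lt_trans hr; rewrite ler_wpM2l// /S (bigD1 j)//= addrCA lerDl.
  by rewrite addr_ge0// sumr_ge0.
rewrite -mulr_suml mulrA ltr_pdivrMr// mulrC ltr_pM2l//.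
by rewrite /S ltrDr.
Qed.

Lemma contM (T : topologicalType) (f g : T -> R) :
  continuous f -> continuous g -> continuous (fun t => f t * g t).
Proof. by move=> cf cg t; exact: (continuousM (cf t) (cg t)). Qed.

Lemma contD (T : topologicalType) (f g : T -> R) :
  continuous f -> continuous g -> continuous (fun t => f t + g t).
Proof. by move=> cf cg t; exact: (continuousD (cf t) (cg t)). Qed.

Lemma contB (T : topologicalType) (f g : T -> R) :
  continuous f -> continuous g -> continuous (fun t => f t - g t).
Proof. by move=> cf cg t; exact: (continuousB (cf t) (cg t)). Qed.

Lemma contC (T : topologicalType) (a : R) : continuous (fun _ : T => a).
Proof. by move=> t; exact: cst_continuous. Qed.

Lemma cont_comp (T : topologicalType) (S : R -> R) (f : T -> R) :
  continuous S -> continuous f -> continuous (fun t => S (f t)).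
Proof. by move=> cS cf t; exact: (continuous_comp (cf t) (cS (f t))). Qed.

Lemma continuous_fsum (T : topologicalType) m (f : 'I_m -> T -> R) :
  (forall i, continuous (f i)) -> continuous (fun t : T => \sum_i f i t).
Proof.
move=> cf t; elim: m f cf => [|m IH] f cf.
  by under eq_fun do rewrite big_ord0; exact: cvg_cst.
under eq_fun do rewrite big_ord_recl.
by apply: cvgD; [exact: cf|exact: (IH (fun i => f (lift ord0 i)))].
Qed.

Lemma C1_comp (T T' : R -> R) w : Ck 1 w -> (forall t : R, is_derive t 1 T (T' t)) ->
  continuous T' ->
  Ck 1 (fun x => T (w x)) /\
  forall i, partial i (fun x => T (w x)) = (fun x => T' (w x) * partial i w x).
Proof.
move=> C1w dT cT'.
have cT : continuous T.
  move=> t; apply: differentiable_continuous; apply/derivable1_diffP.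
  by have [] := dT t.
apply: C1P.
- by apply: cont_comp => //; exact: C1_continuous.
- move=> i x.
  have := C1_is_derive i x C1w; rewrite -[x in is_derive x]addr0 -(scale0r (delta_mx 0 i)).
  move/(is_derive_line w x (delta_mx 0 i) 0 _).2 => d.
  have d2 : is_derive (w (x + 0 *: delta_mx 0 i)) 1 T (T' (w x)).
    by rewrite scale0r addr0.
  have := @is_derive1_comp _ T (fun s => w (x + s *: delta_mx 0 i)) 0 _ _ d2 d.
  by move/(is_derive_line (T \o w) x (delta_mx 0 i) 0 _).1; rewrite scale0r addr0.
- move=> i; apply: contM; last exact: C1_continuous_partial.
  by apply: cont_comp => //; exact: C1_continuous.
Qed.

Lemma C1M w (v : 'rV[R]_n -> R) : Ck 1 w -> Ck 1 v ->
  Ck 1 (fun x => w x * v x) /\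
  forall i, partial i (fun x => w x * v x) =
    (fun x => w x * partial i v x + v x * partial i w x).
Proof.
move=> hw hv; apply: C1P.
- by apply: contM; exact: C1_continuous.
- move=> i x; have d1 := C1_is_derive i x hw; have d2 := C1_is_derive i x hv.
  exact: is_deriveM.
- move=> i; apply: contD; apply: contM.
  + exact: (@C1_continuous w).
  + exact: (@C1_continuous_partial v).
  + exact: (@C1_continuous v).
  + exact: (@C1_continuous_partial w).
Qed.

Lemma C1D w (v : 'rV[R]_n -> R) : Ck 1 w -> Ck 1 v ->
  Ck 1 (fun x => w x + v x) /\
  forall i, partial i (fun x => w x + v x) = (fun x => partial i w x + partial i v x).
Proof.
move=> hw hv; apply: C1P.
- by apply: contD; exact: C1_continuous.
- move=> i x; have d1 := C1_is_derive i x hw; have d2 := C1_is_derive i x hv.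
  exact: is_deriveD.
- by move=> i; apply: contD; exact: C1_continuous_partial.
Qed.

Lemma C1Z a w : Ck 1 w ->
  Ck 1 (fun x => a * w x) /\
  forall i, partial i (fun x => a * w x) = (fun x => a * partial i w x).
Proof.
move=> hw; apply: C1P.
- by apply: contM; [exact: contC|exact: C1_continuous].
- move=> i x; have d1 := C1_is_derive i x hw.
  exact: is_deriveZ.
- by move=> i; apply: contM; [exact: contC|exact: C1_continuous_partial].
Qed.

Lemma C1_cst a : Ck 1 (cst a : 'rV[R]_n -> R) /\
  forall i, partial i (cst a : 'rV[R]_n -> R) = cst 0.
Proof.
apply: (@C1P (cst a) (fun _ => cst 0)).
- exact: contC.
- by move=> i; exact: contC.
Qed.

Lemma C1B w (v : 'rV[R]_n -> R) : Ck 1 w -> Ck 1 v ->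
  Ck 1 (fun x => w x - v x) /\
  forall i, partial i (fun x => w x - v x) = (fun x => partial i w x - partial i v x).
Proof.
move=> hw hv; apply: C1P.
- by apply: contB; exact: C1_continuous.
- move=> i x; have d1 := C1_is_derive i x hw; have d2 := C1_is_derive i x hv.
  exact: is_deriveB.
- by move=> i; apply: contB; exact: C1_continuous_partial.
Qed.

End C1Calculus.

Section OneDimensional.
Context (R : realType).
Implicit Types (p q B : R -> R).

Lemma is_derive_continuous p (p' : R -> R) :
  (forall t : R, is_derive t 1 p (p' t)) -> continuous p.
Proof.
move=> dp t; apply: differentiable_continuous; apply/derivable1_diffP.
by have [] := dp t.
Qed.

Lemma ftc_le q (q' B : R -> R) (a b : R) : a < b ->
  (forall t : R, is_derive t 1 q (q' t)) -> continuous q' -> continuous B ->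
  (forall t, a <= t <= b -> q' t <= B t) ->
  ((q b - q a)%:E <= \int[lebesgue_measure]_(t in `[a, b]) (B t)%:E)%E.
Proof.
move=> ab dq cq' cB qB.
have cq := is_derive_continuous dq.
have cint (f : R -> R) : continuous f ->
    lebesgue_measure.-integrable `[a, b]%classic (EFin \o f).
  move=> cf; apply: continuous_compact_integrable; first exact: segment_compact.
  exact: continuous_subspaceT.
have FTC : (\int[lebesgue_measure]_(x in `[a, b]) (q' x)%:E = (q b)%:E - (q a)%:E)%E.
  apply: continuous_FTC2 => //.
  - exact: continuous_subspaceT.
  - split.
    + by move=> t _; have [] := dq t.
    + by apply: cvg_at_right_filter; exact: cq.
    + by apply: cvg_at_left_filter; exact: cq.
  - by move=> t _; rewrite derive1E; have [_ ->] := dq t.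
rewrite EFinB -FTC; apply: le_integral => //; try exact: cint.
by move=> t /set_mem/=; rewrite in_itv/= => tab; rewrite lee_fin; exact: qB.
Qed.

(** Cauchy-Schwarz on [0, 1] in pointwise form: with m the increment, (p' - m)^2 >= 0 reads 2 m p' -
    m^2 <= p'^2, and the left side integrates to m^2. *)
Lemma sqr_increment_le p (p' : R -> R) :
  (forall t : R, is_derive t 1 p (p' t)) -> continuous p' ->
  (((p 1 - p 0) ^+ 2)%:E <= \int[lebesgue_measure]_(t in `[0%R, 1%R]) ((p' t) ^+ 2)%:E)%E.
Proof.
move=> dp cp'; set m := p 1 - p 0.
pose q (t : R) := (2 * m) * p t - m ^+ 2 * t.
have dq (t : R) : is_derive t 1 q ((2 * m) * p' t - m ^+ 2).
  have d1 := @is_deriveZ R _ _ p (2 * m) t 1 _ (dp t).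
  have d2 := @is_deriveZ R _ _ id (m ^+ 2) t 1 1 (is_derive_id _ _).
  by have := @is_deriveB R _ _ _ _ t 1 _ _ d1 d2; rewrite scaler1.
have -> : (m ^+ 2 = q 1 - q 0)%R by rewrite /q /m; ring.
apply: (@ftc_le q (fun t => (2 * m) * p' t - m ^+ 2)) => //.
- by apply: contB; [apply: contM => //; exact: contC|exact: contC].
- by under eq_fun do rewrite expr2; apply: contM.
- by move=> t _; rewrite -subr_ge0 (_ : _ - _ = (p' t - m) ^+ 2) ?sqr_ge0//; ring.
Qed.

Lemma cont_norm (T : topologicalType) (f : T -> R) :
  continuous f -> continuous (fun t => `|f t|).
Proof. by move=> cf t; apply: cvg_norm; exact: cf. Qed.

Lemma endpoint_le p (p' : R -> R) (a b c : R) : a < b -> c = a \/ c = b ->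
  (forall t : R, is_derive t 1 p (p' t)) -> continuous p' ->
  (((b - a) * `|p c|)%:E <=
   \int[lebesgue_measure]_(t in `[a, b]) (`|p t| + (b - a) * `|p' t|)%:E)%E.
Proof.
move=> ab cab dp cp'.
(* [d] is the endpoint opposite to [c]: the function (t - d) p(t) vanishes at [d], and at [c] it
   equals (b - a) p(c) up to sign. *)
pose d := a + b - c.
have cp := is_derive_continuous dp.
have cB : continuous (fun t => `|p t| + (b - a) * `|p' t|).
  apply: contD; first exact: cont_norm.
  by apply: contM; [exact: contC|exact: cont_norm].
have key (s : R) : `|s| = 1 ->
    ((s * ((b - d) * p b - (a - d) * p a))%:E <=
    \int[lebesgue_measure]_(t in `[a, b]) (`|p t| + (b - a) * `|p' t|)%:E)%E.
  move=> s1.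
  pose q (t : R) := s * ((t - d) * p t).
  have dq (t : R) : is_derive t 1 q (s * ((t - d) * p' t + p t)).
    have d0 : is_derive t 1 (fun t : R => t - d) 1.
      have := @is_deriveB R _ _ id (cst d) t 1 1 0 (is_derive_id _ _) (is_derive_cst _ _ _).
      by rewrite subr0.
    have d1 := @is_deriveM R _ _ p t 1 _ _ d0 (dp t).
    have := @is_deriveZ R _ _ _ s t 1 _ d1.
    by rewrite /GRing.scale/= mulr1.
  have := @ftc_le q (fun t => s * ((t - d) * p' t + p t))
    (fun t => `|p t| + (b - a) * `|p' t|) a b ab dq _ cB.
  rewrite /q -mulrBr; apply.
    apply: contM; first exact: contC.
    apply: contD => //; apply: contM => //.
    apply: contB; [by move=> t; exact: cvg_id|exact: contC].
  move=> t /andP[at_ tb]; apply: le_trans (ler_norm _) _.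
  rewrite normrM s1 mul1r addrC; apply: le_trans (ler_normD _ _) _.
  rewrite lerD2l normrM ler_wpM2r// /d; case: cab => ->.
    by rewrite ler_norml; apply/andP; split; lra.
  by rewrite ler_norml; apply/andP; split; lra.
(* The sign of p(c), replaced by 1 when p(c) = 0, turns the boundary term into its absolute
   value. *)
have [s [s1 sE]] : exists s : R, `|s| = 1 /\
    s * ((b - d) * p b - (a - d) * p a) = (b - a) * `|p c|.
  rewrite /d; case: cab => ->.
    exists (Num.sg (p a) + (p a == 0)%:R).
    have [->|pa] := eqVneq (p a) 0.
      by rewrite sgr0 normr0 add0r normr1; split => //; ring.
    rewrite addr0 normr_sg pa; split => //.
    rewrite (normrEsg (p a)); ring.
  exists (Num.sg (p b) + (p b == 0)%:R).
  have [->|pa] := eqVneq (p b) 0.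
    by rewrite sgr0 normr0 add0r normr1; split => //; ring.
  rewrite addr0 normr_sg pa; split => //.
  rewrite (normrEsg (p b)); ring.
by rewrite -sE; exact: key.
Qed.

End OneDimensional.

(** * The interior cone property and the Sobolev inequality *)

(** Induction over a compact set. The families that contain every [Q]-set above some fixed [Q]-set
    form a filter, and covering compactness along this filter yields one [Q]-set that contains
    [K]. *)
Lemma compact_local_union (T : topologicalType) (K : set T) (Q : set T -> Prop) :
  compact K -> Q set0 -> (forall A B, Q A -> Q B -> Q (A `|` B)) ->
  (forall A B, A `<=` B -> Q B -> Q A) ->
  (forall x, K x -> exists2 U, nbhs x U & Q U) -> Q K.
Proof.
move=> /compact_near_coveringP cK Q0 QU QS Qloc.
pose F : set_system (set T) := [set S | exists2 A, Q A & forall B, Q B -> A `<=` B -> S B].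
have FF : Filter F.
  split.
  - by exists set0.
  - move=> S1 S2 [A1 QA1 h1] [A2 QA2 h2]; exists (A1 `|` A2); first exact: QU.
    move=> B QB AB; split.
      by apply: h1 => // x ?; apply: AB; left.
    by apply: h2 => // x ?; apply: AB; right.
  - move=> S1 S2 S12 [A QA h]; exists A => // B QB AB; exact/S12/h.
have [|A QA /(_ A QA (@subset_refl _ A)) KA] :=
  cK (set T) F (fun B x => B x) FF; last exact: QS KA QA.
move=> x Kx; have [U xU QU'] := Qloc x Kx.
exists (U, [set B | U `<=` B]) => /=; last by move=> [y B] /= [Uy UB]; exact: UB.
by split => //; exists U.
Qed.

Section LocalGeometry.
Context (R : realType).

Lemma C1_loc_lipschitz n (w : 'rV[R]_n -> R) (y0 : 'rV[R]_n) : Ck 1 w ->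
  exists d L : R, [/\ 0 < d, 0 < L &
    forall y h : 'rV[R]_n, (forall j, `|y 0 j - y0 0 j| < d) ->
      (forall j, `|h 0 j| < d) ->
      `|w (y + h) - w y| <= L * \sum_j `|h 0 j|].
Proof.
move=> C1w; pose L := 1 + \sum_i `|partial i w y0|.
have L0 : 0 < L by rewrite /L ltr_pwDl// sumr_ge0.
have near_p i : \forall z \near y0, `|partial i w y0 - partial i w z| < 1.
  by have /cvgrPdist_lt := @C1_continuous_partial R n w i C1w y0; apply.
have Hn := @filter_forall 'rV[R]_n _ (fun i z => `|partial i w y0 - partial i w z| < 1)
  (nbhs y0) (nbhs_filter _) near_p.
have [r /= r0 Hr] := (nbhs_ballP (y0 : 'rV[R]_n) _).1 Hn.
exists (r / 2), L; split => //; first by rewrite divr_gt0.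
move=> y h yd hd; have [xi [xib ->]] := C1_mean_value y h C1w.
apply: le_trans (ler_norm_sum _ _ _) _; rewrite mulr_sumr; apply: ler_sum => i _.
rewrite normrM mulrC ler_wpM2r//.
have : `|partial i w y0 - partial i w (xi i)| < 1.
  apply: Hr; apply/ball_rV; split=> // j.
  have h1 := yd j; have h2 := hd j; have h3 := xib i j.
  rewrite distrC in h1; rewrite distrC in h3.
  have := ler_distD (y 0 j) (y0 0 j) (xi i 0 j); lra.
have h4 : `|partial i w y0| <= \sum_i `|partial i w y0|.
  by rewrite (bigD1 i)//= lerDl sumr_ge0.
have := ler_normD (partial i w y0) (partial i w (xi i) - partial i w y0).
rewrite [in X in _ <= X -> _]distrC addrCA subrr addr0 /L; lra.
Qed.

(** A uniform interior cone: the same cone, with axis [d], opening [eps] and length [rho], fits at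
    every point of [Om] near [x0]. The opening is measured in the sup norm, so that the
    cross-sections are cubes. *)
Definition cone_at n (Om : set 'rV[R]_n) (x0 d : 'rV[R]_n) (r rho eps : R) :=
  [/\ 0 < r, 0 < rho, 0 < eps <= 1, (forall j, `|d 0 j| <= 1) &
    forall (x q : 'rV[R]_n) (t : R), Om x -> ball x0 r x -> 0 <= t <= rho ->
      (forall j, `|q 0 j| <= 1) -> Om (x + t *: (d + eps *: q))].

Lemma cone_interior n (Om : set 'rV[R]_n) x0 : open Om -> Om x0 ->
  exists r rho eps, cone_at Om x0 0 r rho eps.
Proof.
move=> oOm Ox; have [r /= r0 Hr] := (nbhs_ballP x0 Om).1 (open_nbhs_nbhs (conj oOm Ox)).
exists (r / 2), (r / 4), 1; split; rewrite ?divr_gt0//; first by rewrite ltr01 lexx.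
  by move=> j; rewrite mxE normr0.
move=> x q t _ /ball_rV[_ xr] /andP[t0 tr] hq; apply: Hr; apply/ball_rV; split=> // j.
have h1 := xr j; rewrite !mxE add0r mul1r opprD addrA.
have h2 : `|t * q 0 j| <= r / 4.
  rewrite normrM (ger0_norm t0) -[r / 4]mulr1; apply: ler_pM => //.
have := ler_normB (x0 0 j - x 0 j) (t * q 0 j); lra.
Qed.

(** In the coordinates where [Om] is an epigraph, the axis is the vertical direction pointing into
    it. A displacement gains at least t (1 - eps) in height, while the graph rises by at most L n t
    eps. *)
Lemma cone_boundary n (Om : set 'rV[R]_n.+1) x0 : open Om -> C1_boundary Om ->
  boundary Om x0 -> exists d r rho eps, cone_at Om x0 d r rho eps.
Proof.
move=> oOm hC1 /hC1[r [i [s [gamma [r0 Cg E]]]]].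
have [de [L [de0 L0 HL]]] := C1_loc_lipschitz (col' i x0) Cg.
pose m := Num.min r de.
have m0 : 0 < m by rewrite lt_min r0.
have mr : m <= r by rewrite ge_min lexx.
have md : m <= de by rewrite ge_min lexx orbT.
(* K eps = 1/2 leaves a net gain t (1 - K eps) >= 0. The length m / 8 moves points by at most m / 4,
   so that points within m / 2 of [x0] stay in the chart. *)
pose K := L * n%:R + 1.
have K1 : 1 <= K by rewrite lerDr mulr_ge0// ltW.
have K0 : 0 < K by apply: lt_le_trans K1.
pose eps := (2 * K)^-1.
have eps0 : 0 < eps by rewrite invr_gt0 mulr_gt0.
have Keps : K * eps = 1 / 2 by rewrite /eps; field; rewrite gt_eqF.
have eps1 : eps <= 1 / 2 by rewrite -Keps ler_peMl// ltW.
have sgn1 : `|(-1) ^+ s : R| = 1 by rewrite normrX normrN1 expr1n.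
have sgn2 : (-1) ^+ s * (-1) ^+ s = 1 :> R by rewrite -expr2 sqrr_sign.
exists ((-1) ^+ s *: delta_mx 0 i), (m / 2), (m / 8), eps; split.
- by rewrite divr_gt0.
- by rewrite divr_gt0.
- by rewrite eps0; lra.
- move=> j; rewrite !mxE eqxx/= normrM sgn1 mul1r.
  by case: (j == i); rewrite ?normr1// normr0.
move=> x q t Ox /ball_rV[_ xm] /andP[t0 tm] hq.
set h := t *: _.
have hj j : `|h 0 j| <= t * 2.
  rewrite !mxE eqxx/= normrM (ger0_norm t0) ler_wpM2l//.
  apply: le_trans (ler_normD _ _) _; rewrite !normrM sgn1 mul1r (ger0_norm (ltW eps0)).
  have : `|(j == i)%:R : R| <= 1 by case: (j == i); rewrite ?normr1// normr0.
  have : eps * `|q 0 j| <= 1 by apply: mulr_ile1 => //; [exact: ltW|lra].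
  lra.
have xhr : ball x0 r (x + h).
  apply/ball_rV; split=> // j; rewrite !mxE opprD addrA.
  have := ler_normB (x0 0 j - x 0 j) (h 0 j); have := hj j; have := xm j.
  rewrite !mxE; lra.
have xr : ball x0 r x by apply/ball_rV; split=> // j; have := xm j; lra.
have [_ gx] : (ball x0 r x /\ gamma (col' i x) < (-1) ^+ s * x 0 i).
  by have : (Om `&` ball x0 r) x by []; rewrite E.
suff : (Om `&` ball x0 r) (x + h) by case.
rewrite E; split => //.
have -> : col' i (x + h) = col' i x + col' i h by apply/rowP => k; rewrite !mxE.
have HLx : `|gamma (col' i x + col' i h) - gamma (col' i x)| <= L * \sum_j `|col' i h 0 j|.
  apply: HL => j; rewrite !mxE.
    by rewrite distrC; have := xm (lift i j); lra.
  by have := hj (lift i j); rewrite !mxE; lra.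
have HS : \sum_j `|col' i h 0 j| <= n%:R * (t * eps).
  rewrite mulrC mulr_natr -[X in _ *+ X]card_ord -sumr_const; apply: ler_sum => j _.
  have lij : (lift i j == i) = false by rewrite eq_sym; exact/negbTE/neq_lift.
  rewrite !mxE lij andbF mulr0 add0r.
  rewrite !normrM (ger0_norm t0) (ger0_norm (ltW eps0)) mulrA ler_piMr//.
  by rewrite mulr_ge0// ltW.
have hi : (-1) ^+ s * h 0 i >= t * (1 - eps).
  rewrite !mxE !eqxx/= mulr1 mulrCA ler_wpM2l// mulrDr sgn2 lerD2l.
  rewrite lerNl; apply: le_trans (ler_norm _) _.
  rewrite normrN !normrM sgn1 mul1r (ger0_norm (ltW eps0)) ler_piMr//; exact: ltW.
rewrite !mxE mulrDr; have := ler_norm (gamma (col' i x + col' i h) - gamma (col' i x)).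
have : L * \sum_j `|col' i h 0 j| <= L * (n%:R * (t * eps)) by rewrite ler_wpM2l// ltW.
have : t * (1 - eps) - L * (n%:R * (t * eps)) = t * (1 - K * eps) by rewrite /K; ring.
have : 0 <= t * (1 - K * eps) by rewrite Keps mulr_ge0//; lra.
move: hi; rewrite !mxE; lra.
Qed.

Lemma cone_closure n (Om : set 'rV[R]_n.+1) x0 : open Om -> C1_boundary Om ->
  closure Om x0 -> exists d r rho eps, cone_at Om x0 d r rho eps.
Proof.
move=> oOm hC1 cx; have [Ox|nOx] := pselect (Om x0).
  by exists 0; exact: cone_interior.
by apply: cone_boundary => //; split => //; rewrite (interior_id Om).1.
Qed.

End LocalGeometry.

Section TranslationEstimates.
Local Open Scope ereal_scope.
Context (R : realType) (n : nat).
Local Notation lebT := (caratheodory_type (@lebesgue_outer R n)).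
Local Notation mu := (lebesgue_rV R n).

Lemma measurable_rvB_fun d (Y : measurableType d) (f : 'rV[R]_n -> Y) :
  measurable_fun setT (f : rvB R n -> Y) -> measurable_fun setT (f : lebT -> Y).
Proof. by move=> mf; exact: (measurableT_comp mf (@measurable_leb_rvB R n)). Qed.

Lemma measurable_cont (f : 'rV[R]_n -> R) : continuous f ->
  measurable_fun setT (f : lebT -> R).
Proof. by move=> cf; apply: measurable_rvB_fun; exact: rvB_continuous. Qed.

Lemma measurable_contE (f : 'rV[R]_n -> R) : continuous f ->
  measurable_fun setT (fun x : lebT => (f x)%:E).
Proof. by move=> cf; apply/measurable_EFinP; exact: measurable_cont. Qed.

Lemma cont_shift (f : 'rV[R]_n -> R) (h : 'rV[R]_n) : continuous f ->
  continuous (fun x : 'rV[R]_n => f (x + h)%R).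
Proof.
move=> cf x; have c1 : {for x, continuous (fun x : 'rV[R]_n => x + h)%R}.
  have c0 : {for x, continuous (@id 'rV[R]_n)} by move=> A.
  have c2 : {for x, continuous (cst h : 'rV[R]_n -> 'rV[R]_n)} by exact: cst_continuous.
  exact: (continuousD c0 c2).
exact: (continuous_comp c1 (cf _)).
Qed.

Lemma cont_on_line (f : 'rV[R]_n -> R) (x h : 'rV[R]_n) : continuous f ->
  continuous (fun t : R => f (x + t *: h)%R).
Proof. by move=> cf t; exact: (continuous_comp (@continuous_line R n x h t) (cf _)). Qed.

Definition gsq (w : 'rV[R]_n -> R) (x : 'rV[R]_n) : R := \sum_i partial i w x ^+ 2.

Lemma gsq_ge0 w x : (0 <= gsq w x)%R.
Proof. by apply: sumr_ge0 => i _; exact: sqr_ge0. Qed.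

Lemma continuous_gsq w : Ck 1 w -> continuous (gsq w).
Proof.
move=> C1w; apply: continuous_fsum => i; under eq_fun do rewrite expr2.
by apply: contM; exact: C1_continuous_partial.
Qed.

Lemma sqr_sum_le m (a b : 'I_m -> R) (H : R) : (forall i, `|a i| <= H)%R ->
  ((\sum_i a i * b i) ^+ 2 <= m%:R * H ^+ 2 * \sum_i b i ^+ 2)%R.
Proof.
move=> aH; have [m0|m0] := posnP m.
  by subst m; rewrite !big_ord0 expr0n/= mulr0.
have H0 : (0 <= H)%R by apply: le_trans (aH (Ordinal m0)).
apply: (@le_trans _ _ ((\sum_i H * `|b i|) ^+ 2)%R).
  rewrite -[leLHS]real_normK ?num_real// ler_pXn2r ?nnegrE//; last first.
    by apply: sumr_ge0 => i _; rewrite mulr_ge0.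
  apply: le_trans (ler_norm_sum _ _ _) _; apply: ler_sum => i _.
  by rewrite normrM ler_wpM2r.
rewrite -mulr_sumr exprMn [in leRHS]mulrAC [leRHS]mulrC ler_wpM2l ?sqr_ge0//.
rewrite expr2 big_distrlr/=.
apply: (@le_trans _ _ (\sum_i \sum_j (b i ^+ 2 + b j ^+ 2) / 2)%R).
  apply: ler_sum => i _; apply: ler_sum => j _; rewrite -normrM.
  rewrite ler_norml; apply/andP; split; rewrite -subr_ge0.
    rewrite (_ : _ - _ = (b i + b j) ^+ 2 / 2)%R; first by rewrite divr_ge0 ?sqr_ge0.
    by field.
  rewrite (_ : _ - _ = (b i - b j) ^+ 2 / 2)%R; first by rewrite divr_ge0 ?sqr_ge0.
  by field.
rewrite le_eqVlt; apply/orP; left; apply/eqP.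
have -> : (\sum_i \sum_j (b i ^+ 2 + b j ^+ 2) / 2 =
    \sum_(i < m) \sum_(j < m) b i ^+ 2 / 2 + \sum_(i < m) \sum_(j < m) b j ^+ 2 / 2)%R.
  rewrite -big_split/=; apply: eq_bigr => i _; rewrite -big_split/=.
  by apply: eq_bigr => j _; rewrite mulrDl.
have -> : (\sum_(i < m) \sum_(j < m) b i ^+ 2 / 2 = m%:R * (\sum_i b i ^+ 2) / 2)%R.
  rewrite mulr_sumr mulr_suml; apply: eq_bigr => i _.
  by rewrite sumr_const card_ord -[LHS]mulr_natl mulrA.
by rewrite sumr_const card_ord -mulr_suml -[X in (_ + X)%R]mulr_natl; field.
Qed.

(** [sqr_increment_le] on each segment from x to x + h; Tonelli exchanges x with the parameter s of
    the segment, and translation invariance removes the shift s h. *)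
Lemma translation_estimate w (h : 'rV[R]_n) (A Om : set 'rV[R]_n) : Ck 1 w ->
  measurable (A : set lebT) -> measurable (Om : set (rvB R n)) ->
  (forall x s, A x -> (0 <= s <= 1)%R -> Om (x + s *: h)%R) ->
  \int[mu]_(x in A) ((w (x + h) - w x) ^+ 2)%:E <=
  \int[mu]_(x in Om) ((\sum_i h 0%R i * partial i w x) ^+ 2)%:E.
Proof.
move=> C1w mA mOm hA.
pose D y := (\sum_i h 0 i * partial i w y)%R.
have cD : continuous D.
  apply: continuous_fsum => i; apply: contM; first exact: contC.
  exact: C1_continuous_partial.
pose G (y : rvB R n) : \bar R := (\1_Om y * D y ^+ 2)%:E.
have mG : measurable_fun setT G.
  apply/measurable_EFinP; apply: measurable_funM; first exact: measurable_indic.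
  by apply: measurable_funX; exact: rvB_continuous.
have G0 y : 0 <= G y by rewrite lee_fin mulr_ge0 ?sqr_ge0.
have mline : measurable_fun setT
    ((fun z => z.1 + z.2 *: h)%R : lebT * measurableTypeR R -> rvB R n).
  apply: measurable_to_rvB => j; under eq_fun do rewrite !mxE.
  apply: measurable_funD.
    exact: (measurableT_comp (@measurable_rvB_coord R n j)
      (measurableT_comp (@measurable_leb_rvB R n) measurable_fst)).
  by apply: measurable_funM => //; exact: measurable_snd.
pose F (z : lebT * measurableTypeR R) : \bar R :=
  (\1_(`[0%R, 1%R]%classic : set R) z.2)%:E * G (z.1 + z.2 *: h)%R.
have mF : measurable_fun setT F.
  apply: emeasurable_funM; last exact: (measurableT_comp mG mline).
  apply/measurable_EFinP.
  apply: (@measurableT_comp _ _ _ _ _ _ (\1_(`[0%R, 1%R]%classic : set R) : measurableTypeR R -> R)).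
    by apply: measurable_indic; exact: measurable_itv.
  exact: measurable_snd.
have F0 z : 0 <= F z by rewrite mule_ge0// lee_fin.
apply: (@le_trans _ _ (\int[mu]_x \int[lebesgue_measure]_s F (x, s))).
  rewrite [leLHS]integral_mkcond; apply: ge0_le_integral; first exact: measurableT.
  - by move=> x _; rewrite patchE; case: ifP => // _; rewrite lee_fin sqr_ge0.
  - apply: (measurable_restrictT _ _).1 => //.
    apply: measurable_funTS; apply: measurable_contE.
    under eq_fun do rewrite expr2.
    have cB : continuous (fun x : 'rV[R]_n => w (x + h) - w x)%R.
      by apply: contB; [exact: cont_shift (C1_continuous C1w)|exact: C1_continuous].
    exact: contM.
  - exact: (@measurable_fun_fubini_tonelli_F _ _ _ _ _ lebesgue_measure F mF F0).
  - move=> x _; rewrite patchE; case: ifPn => [/set_mem Ax|_]; last first.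
      by apply: integral_ge0 => s _.
    have dp (t : R) := C1_is_derive_line x h t C1w.
    have := @sqr_increment_le R (fun s => w (x + s *: h)%R)
      (fun t => D (x + t *: h)%R) dp.
    rewrite scale1r scale0r addr0 => /(_ _)/le_trans; apply.
      exact: cont_on_line.
    rewrite [leLHS]integral_mkcond; apply: ge0_le_integral; first exact: measurableT.
    + by move=> s _; rewrite patchE; case: ifP => // _; rewrite lee_fin sqr_ge0.
    + apply: (measurable_restrictT _ _).1 => //.
      apply: measurable_funTS; apply/measurable_EFinP.
      apply: continuous_measurable_fun; under eq_fun do rewrite expr2.
      by apply: contM; exact: cont_on_line.
    + exact: (measurableT_comp mF (measurable_pair1 x)).
    + move=> s _; rewrite patchE /F/= indicE; case: ifPn => s01.
        rewrite mul1e /G indicE mem_set ?mul1r//; apply: hA => //.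
        by move: s01; rewrite inE/= in_itv.
      by rewrite mul0e.
rewrite tonelli_leb1//.
apply: (@le_trans _ _ (\int[lebesgue_measure]_(s in `[0%R, 1%R]) \int[mu]_x G x)).
  rewrite [leRHS]integral_mkcond le_eqVlt; apply/orP; left; apply/eqP.
  apply: eq_integral => s _; rewrite patchE; case: ifPn => s01.
    rewrite -(@integral_translate R n (s *: h)%R G)//; last exact: measurable_rvB_fun.
    by apply: eq_integral => x _; rewrite /F/= indicE s01 mul1e.
  transitivity (\int[mu]_x (cst 0 x : \bar R)); last exact: integral0.
  by apply: eq_integral => x _; rewrite /F/= indicE (negbTE s01) mul0e.
have -> : \int[mu]_(x in Om) ((D x) ^+ 2)%:E = \int[mu]_x G x.
  rewrite [LHS]integral_mkcond; apply: eq_integral => x _.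
  by rewrite patchE /G indicE; case: ifPn => _; rewrite ?mul1r ?mul0r.
by rewrite integral_cst//= lebesgue_measure_itv/= lte01 oppr0 adde0 mule1.
Qed.

End TranslationEstimates.

Section SmallIntersections.
Local Open Scope ereal_scope.
Context (R : realType) (n : nat).
Local Notation lebT := (caratheodory_type (@lebesgue_outer R n)).
Local Notation mu := (lebesgue_rV R n).

Lemma measurable_shiftB (A : set 'rV[R]_n) (h : 'rV[R]_n) :
  measurable (A : set (rvB R n)) -> measurable ([set x | A (x + h)%R] : set (rvB R n)).
Proof.
move=> mA.
have ms : measurable_fun setT ((fun x => x + h)%R : rvB R n -> rvB R n).
  apply: measurable_to_rvB => j; under eq_fun do rewrite !mxE.
  by apply: measurable_funD; [exact: measurable_rvB_coord|].
by rewrite -[X in measurable X]setTI; exact: ms.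
Qed.

Lemma measurable_indic_comp (A : set 'rV[R]_n) d (T : measurableType d)
    (f : T -> rvB R n) : measurable (A : set (rvB R n)) ->
  measurable_fun setT f -> measurable_fun setT (fun z => \1_A (f z) : R).
Proof.
move=> mA mf; have m1 := @measurable_indic _ (rvB R n) R setT A mA.
exact: (measurableT_comp m1 mf).
Qed.

Lemma measure_indic (A : set 'rV[R]_n) : measurable (A : set lebT) ->
  \int[mu]_x (\1_A x)%:E = mu A.
Proof. by move=> mA; rewrite integral_indic// setIT. Qed.

Lemma measurable_indicE (A : set 'rV[R]_n) : measurable (A : set lebT) ->
  measurable_fun setT (fun x : lebT => (\1_A x : R)%:E).
Proof. by move=> mA; apply/measurable_EFinP; exact: (@measurable_indic _ lebT R setT A mA). Qed.

Lemma integral_indicZ (A : set 'rV[R]_n) (c : \bar R) : 0 <= c ->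
  measurable (A : set lebT) -> \int[mu]_x (c * (\1_A x)%:E) = c * mu A.
Proof.
move=> c0 mA.
have E := @ge0_integralZl _ lebT R mu setT measurableT
  (fun x => (\1_A x : R)%:E) (measurable_indicE mA).
by rewrite E//; congr (_ * _); exact: measure_indic.
Qed.

(* Averaging over [h]: the integral of mu (E :&: (F - h)) over H is at most
   mu E * mu F. *)
Lemma exists_small_intersection (E F H : set 'rV[R]_n) :
  measurable (E : set (rvB R n)) -> measurable (F : set (rvB R n)) ->
  measurable (H : set (rvB R n)) -> H !=set0 ->
  mu E < +oo -> mu F < +oo -> mu H < +oo ->
  mu F + mu F < mu H ->
  exists2 h, H h & mu (E `&` [set x | F (x + h)%R]) + mu (E `&` [set x | F (x + h)%R]) <= mu E.
Proof.
move=> mE mF mH [h0 Hh0] Efin Ffin Hfin FH; apply: contrapT => nex.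
have big h : H h -> mu E < mu (E `&` [set x | F (x + h)%R]) + mu (E `&` [set x | F (x + h)%R]).
  by move=> Hh; rewrite ltNge; apply/negP => le; apply: nex; exists h.
have mES h : measurable (E `&` [set x | F (x + h)%R] : set (rvB R n)).
  by apply: measurableI => //; exact: measurable_shiftB.
have lE h : mu (E `&` [set x | F (x + h)%R]) <= mu E.
  by apply: le_measure; rewrite ?inE; [exact: measurable_rvB_leb|exact: measurable_rvB_leb|move=> x []].
have E0 : 0 < mu E.
  rewrite lt_neqAle measure_ge0 andbT; apply/eqP => E0.
  have := big _ Hh0.
  have -> : mu (E `&` [set x | F (x + h0)%R]) = 0.
    by apply/eqP; rewrite eq_le measure_ge0 andbT (le_trans (lE h0))// -E0.
  by rewrite adde0 -E0 ltxx.
pose K (z : lebT * lebT) : \bar R := (\1_E z.1 * \1_H z.2 * \1_F (z.1 + z.2)%R)%:E.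
have madd : measurable_fun setT ((fun z => z.1 + z.2)%R : lebT * lebT -> rvB R n).
  apply: measurable_to_rvB => j; under eq_fun do rewrite !mxE.
  apply: measurable_funD.
    exact: (measurableT_comp (@measurable_rvB_coord R n j)
      (measurableT_comp (@measurable_leb_rvB R n) measurable_fst)).
  exact: (measurableT_comp (@measurable_rvB_coord R n j)
      (measurableT_comp (@measurable_leb_rvB R n) measurable_snd)).
have mI := measurable_indic_comp.
have mK : measurable_fun setT K.
  apply/measurable_EFinP; apply: measurable_funM; first apply: measurable_funM.
  - apply: (mI E _ (lebT * lebT)%type (fun z => z.1)) => //.
    exact: (measurableT_comp (@measurable_leb_rvB R n) measurable_fst).
  - apply: (mI H _ (lebT * lebT)%type (fun z => z.2)) => //.
    exact: (measurableT_comp (@measurable_leb_rvB R n) measurable_snd).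
  - exact: (mI F _ (lebT * lebT)%type (fun z => z.1 + z.2)%R).
have K0 z : 0 <= K z by rewrite lee_fin !mulr_ge0.
have up : \int[mu]_x \int[mu]_h K (x, h) <= mu E * mu F.
  rewrite muleC -(integral_indicZ (measure_ge0 _ _) (measurable_rvB_leb mE)).
  apply: ge0_le_integral; first exact: measurableT.
  - by move=> x _; apply: integral_ge0 => h _.
  - exact: (@measurable_fun_fubini_tonelli_F _ _ _ _ _ (lebS R n) K mK K0).
  - apply: emeasurable_funM; first exact: measurable_cst.
    by apply: measurable_indicE; exact: measurable_rvB_leb.
  move=> x _; rewrite muleC -(integral_indicZ _ (measurable_rvB_leb mF)) ?lee_fin//.
  have mF' : measurable_fun setT (fun h : lebT => ((\1_E x : R)%:E * (\1_F h : R)%:E)).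
    apply: emeasurable_funM; first exact: measurable_cst.
    by apply: measurable_indicE; exact: measurable_rvB_leb.
  rewrite -(@integral_translate R n x _ mF'); last by move=> h; rewrite mule_ge0 ?lee_fin.
  apply: ge0_le_integral; first exact: measurableT.
  - by [].
  - exact: (measurableT_comp mK (measurable_pair1 x)).
  - exact: (measurableT_comp mF' (@measurable_shift R n x)).
  move=> h _; rewrite /K/= -EFinM lee_fin addrC ler_wpM2r//.
  by rewrite ler_piMr// indicE; case: (_ \in _).
have low : mu E * mu H <= \int[mu]_x \int[mu]_h K (x, h) + \int[mu]_x \int[mu]_h K (x, h).
  rewrite tonelli_leb//.
  have mG := @measurable_fun_fubini_tonelli_G _ _ _ _ _ (lebS R n) K mK K0.
  rewrite -ge0_integralD//; [|by move=> h _; apply: integral_ge0|by move=> h _; apply: integral_ge0].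
  rewrite -(integral_indicZ (measure_ge0 _ _) (measurable_rvB_leb mH)).
  apply: ge0_le_integral; first exact: measurableT.
  - by move=> h _; rewrite mule_ge0// lee_fin.
  - apply: emeasurable_funM; first exact: measurable_cst.
    by apply: measurable_indicE; exact: measurable_rvB_leb.
  - exact: emeasurable_funD.
  move=> h _; have -> : \int[mu]_x K (x, h) = (\1_H h)%:E * mu (E `&` [set x | F (x + h)%R]).
    rewrite -(integral_indicZ _ (measurable_rvB_leb (mES h))) ?lee_fin//.
    apply: eq_integral => x _; rewrite /K/= -EFinM; congr (_%:E).
    rewrite mulrAC mulrC; congr (_ * _)%R.
    rewrite !indicE; case: (boolP (x \in E)) => xE; case: (boolP (_ \in F)) => xF.
    - by rewrite mulr1 mem_set//; split; [exact: set_mem xE|exact: set_mem xF].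
    - by rewrite mulr0 memNset// => -[_ /mem_set]; apply/negP.
    - by rewrite mul0r memNset// => -[/mem_set]; rewrite (negbTE xE).
    - by rewrite mul0r memNset// => -[/mem_set]; rewrite (negbTE xE).
  rewrite indicE; case: (boolP (h \in H)) => hH; last by rewrite mul0e mule0 adde0.
  by rewrite !mul1e mule1; apply/ltW/big/set_mem.
have Er : mu E \is a fin_num by rewrite ge0_fin_numE.
have Fr : mu F \is a fin_num by rewrite ge0_fin_numE.
have Hr : mu H \is a fin_num by rewrite ge0_fin_numE.
have := le_trans low (leeD up up).
rewrite -muleDr ?Er//; last by rewrite fin_num_adde_defl.
by rewrite lee_pmul2l// leNgt FH.
Qed.

End SmallIntersections.

(** * Measure of level sets against gradient energy *)

Section Isocapacity.
Local Open Scope ereal_scope.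
Context (R : realType).
Local Notation lebT n := (caratheodory_type (@lebesgue_outer R n)).
Local Notation mu n := (lebesgue_rV R n).

Lemma bounded_kbox n (Om : set 'rV[R]_n) : bounded_set Om ->
  exists k, Om `<=` @kbox R n k.
Proof.
move=> [M [_ HM]]; exists (Num.truncn (`|M| + 1)%R).+1 => x Ox i.
have xM : (`|x| <= `|M| + 1)%R by apply: (HM (`|M| + 1)%R) => //; rewrite ltr_pwDr// ler_norm.
have : ball (0 : 'rV[R]_n)%R (Num.truncn (`|M| + 1)%R).+1%:R x.
  by rewrite mx_norm_ball /ball_/= sub0r normrN; apply: le_lt_trans xM _; exact: truncnS_gt.
move=> /ball_rV[_ /(_ i)]; rewrite !mxE sub0r normrN => /ltW.
by rewrite ler_norml.
Qed.

Lemma kbox_compact n k : compact (@kbox R n k).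
Proof.
have := @rV_compact R n (fun=> `[(- k%:R)%R, k%:R%R]%classic) (fun=> @segment_compact R _ _).
by congr compact; apply/seteqP; split=> x /= h i; have := h i; rewrite /= in_itv/= !mxE.
Qed.

Lemma closure_kbox n k (Om : set 'rV[R]_n) : Om `<=` @kbox R n k ->
  closure Om `<=` @kbox R n k.
Proof.
move=> Ok; have : closed (@kbox R n k).
  by apply: compact_closed (@kbox_compact n k); exact: norm_hausdorff.
by move/closure_id => ->; exact: closureS.
Qed.

Lemma closure_compact n (Om : set 'rV[R]_n) : bounded_set Om -> compact (closure Om).
Proof.
move=> /bounded_kbox[k /closure_kbox Ok].
by apply: (subclosed_compact _ (@kbox_compact n k)) => //; exact: closed_closure.
Qed.

Lemma mu_bounded n k (Om : set 'rV[R]_n) : Om `<=` @kbox R n k -> mu n Om < +oo.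
Proof. by move=> Ok; apply: le_lt_trans (kbox_lty R n k); apply: le_outer_measure. Qed.

Lemma ball_open_rV n (x : 'rV[R]_n) r : open (ball x r).
Proof.
have [r0|r0] := ltP 0%R r; first exact: ball_open.
rewrite (_ : ball x r = set0); first exact: open0.
by apply/seteqP; split=> y // -[]; rewrite ltNge r0.
Qed.

(** An isocapacitary inequality: a passage of [v] from at most 0 off [F] to at least 1 on [E] costs
    gradient energy of order |E| a^(-2/N) when |F| <= a. It is restricted to sets [E] inside [B], so
    that it can be patched by compactness, and to small [a], because the cones have bounded
    length. *)
Definition isocap n (Om B : set 'rV[R]_n) := exists C c : R,
  [/\ (0 < C)%R, (0 < c)%R & forall (a : R) (v : 'rV[R]_n -> R) (E F : set 'rV[R]_n),
    (0 < a <= c)%R -> Ck 1 v ->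
    measurable (E : set (rvB R n)) -> measurable (F : set (rvB R n)) ->
    E `<=` Om -> E `<=` B ->
    (forall x, E x -> (1 <= v x)%R) ->
    (forall x, Om x -> ~ F x -> (v x <= 0)%R) ->
    mu n F <= a%:E ->
    mu n E <= (C * a `^ (2 / n%:R))%:E * \int[mu n]_(x in Om) (gsq v x)%:E].

Lemma mu_box n (a b : 'rV[R]_n) : (forall i, (a 0 i <= b 0 i)%R) ->
  mu n (box a b) = (\prod_i (b 0%R i - a 0%R i))%:E.
Proof. exact: leb_box_. Qed.

(** Among the shifts in a cube of the cone of volume 4 a, some shift moves at least half of [E] out
    of [F]. On that half [v] drops by at least 1, and [translation_estimate] bounds the squared drop
    by |h|^2, of order a^(2/N), times the energy. *)
Lemma isocap_cone n (Om : set 'rV[R]_n.+1) k x0 d r rho eps : open Om ->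
  Om `<=` @kbox R n.+1 k -> cone_at Om x0 d r rho eps -> isocap Om (ball x0 r).
Proof.
move=> oOm Ok [r0 rho0 /andP[eps0 eps1] d1 cone].
set N := n.+1.
have N0 : (0 < N%:R :> R)%R by rewrite ltr0n.
pose C : R := (2 * (N%:R * 2 ^+ 2) * (4 `^ (2 / N%:R) / (2 * eps) ^+ 2))%R.
have C0 : (0 < C)%R.
  apply: mulr_gt0; first by rewrite !mulr_gt0// exprn_gt0.
  by apply: divr_gt0; [exact: powR_gt0|rewrite exprn_gt0// mulr_gt0].
pose c : R := ((2 * rho * eps) ^+ N / 4)%R.
have c0 : (0 < c)%R by rewrite divr_gt0// exprn_gt0// !mulr_gt0.
exists C, c; split => // a v E F /andP[a0 ac] C1v mE mF EO EB v1 v0 Fa.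
(* The cross-section of the cone at height t is a cube of volume (2 t eps)^N, and t makes this equal
   to 4 a, more than twice the measure of [F]; a <= c means t <= rho. *)
pose t : R := ((4 * a) `^ (N%:R^-1) / (2 * eps))%R.
have t0 : (0 < t)%R by rewrite divr_gt0// ?powR_gt0// ?mulr_gt0.
have tE : ((2 * t * eps) ^+ N = 4 * a)%R.
  have -> : (2 * t * eps = (4 * a) `^ (N%:R^-1))%R.
    by rewrite /t; field; rewrite ?gt_eqF//.
  by rewrite -powR_mulrn ?powR_ge0// -powRrM mulVf ?gt_eqF// powRr1// mulr_ge0// ltW.
have trho : (t <= rho)%R.
  have : ((2 * t * eps) ^+ N <= (2 * rho * eps) ^+ N)%R.
    by rewrite tE mulrC -ler_pdivlMr.
  have p1 : (0 <= 2 * t * eps)%R by apply: ltW; apply: mulr_gt0 => //; exact: mulr_gt0.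
  have p2 : (0 <= 2 * rho * eps)%R by apply: ltW; apply: mulr_gt0 => //; exact: mulr_gt0.
  rewrite ler_pXn2r ?nnegrE//.
  by rewrite ler_pM2r// ler_pM2l.
pose lo : 'rV[R]_N := (t *: (d - const_mx eps))%R.
pose hi : 'rV[R]_N := (t *: (d + const_mx eps))%R.
have lohi i : (lo 0 i <= hi 0 i)%R.
  by rewrite !mxE ler_pM2l//; lra.
have muH : mu N (box lo hi) = (4 * a)%:E.
  rewrite mu_box// -tE -[in RHS](card_ord N) -prodr_const.
  by congr (_%:E); apply: eq_bigr => i _; rewrite !mxE; ring.
have Efin : mu N E < +oo by apply: (@mu_bounded N k) => x /EO/Ok.
have Ffin : mu N F < +oo by apply: le_lt_trans Fa _; rewrite ltry.
have [|||h Hh hE] := @exists_small_intersection R N E F (box lo hi) mE mF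
    (measurable_box _ _) _ Efin Ffin.
- by exists lo => i; rewrite lexx lohi.
- by rewrite muH ltry.
- rewrite muH; apply: (le_lt_trans (leeD Fa Fa)); rewrite -EFinD lte_fin; lra.
set S := [set x | F (x + h)%R] in hE.
have mS : measurable (S : set (rvB R N)) by exact: measurable_shiftB.
have mES : measurable (E `\` S : set (lebT N)).
  by apply: measurable_rvB_leb; exact: measurableD.
have EES : mu N E <= mu N (E `\` S) + mu N (E `\` S).
  have EE : mu N E = mu N (E `&` S) + mu N (E `\` S).
    by rewrite addeC; apply: measureDI; exact: measurable_rvB_leb.
  have If : mu N (E `&` S) \is a fin_num.
    rewrite ge0_fin_numE//; apply: le_lt_trans Efin.
    by apply: le_outer_measure => x [].
  move: hE; rewrite EE leeD2lE// => hE.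
  by rewrite leeD2r.
pose q : 'rV[R]_N := (eps^-1 *: (t^-1 *: h - d))%R.
have hq : (h = t *: (d + eps *: q))%R.
  rewrite /q scalerA divff ?gt_eqF// scale1r addrC subrK scalerA divff ?gt_eqF//.
  by rewrite scale1r.
have q1 j : (`|q 0 j| <= 1)%R.
  have hy : (h 0 j = t * (t^-1 * h 0 j))%R by rewrite mulrA divff ?mul1r ?gt_eqF.
  have := Hh j; rewrite !mxE [h 0%R j]hy !ler_pM2l// => /andP[h1 h2].
  rewrite normrM gtr0_norm ?invr_gt0// mulrC ler_pdivrMr// mul1r ler_norml.
  by rewrite -hy; move: h1 h2; clear; move=> h1 h2; apply/andP; split; lra.
have seg x s : (E `\` S) x -> (0 <= s <= 1)%R -> Om (x + s *: h)%R.
  move=> [Ex _] /andP[s0 s1]; rewrite hq scalerA; apply: cone => //; [exact: EO|exact: EB|].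
  rewrite mulr_ge0//=; last exact: ltW.
  by apply: le_trans trho; rewrite ler_piMl// ltW.
have := @translation_estimate R N v h (E `\` S) Om C1v mES (rvB_open oOm) seg.
have lowb : mu N (E `\` S) <= \int[mu N]_(x in E `\` S) ((v (x + h)%R - v x) ^+ 2)%:E.
  have I1 := @integral_cst _ (lebT N) R (mu N) (E `\` S) mES 1%:E.
  rewrite mul1e in I1; rewrite -I1; apply: ge0_le_integral; first exact: mES.
  - by move=> x _; rewrite lee_fin.
  - exact: measurable_cst.
  - apply: measurable_funTS; apply: measurable_contE; under eq_fun do rewrite expr2.
    have cB : continuous (fun x : 'rV[R]_N => v (x + h) - v x)%R.
      by apply: contB; [exact: cont_shift (C1_continuous C1v)|exact: C1_continuous].
    exact: contM.
  move=> x [Ex nSx]; rewrite lee_fin.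
  have h1 := v1 _ Ex.
  have h0 : (v (x + h) <= 0)%R.
    apply: v0 => //; rewrite -[h]scale1r; apply: seg; last by rewrite ler01 lexx.
    by split.
  have h2 : (1 <= v x - v (x + h))%R by move: h1 h0; clear; lra.
  by rewrite -sqrrN opprB expr2 -[leLHS]mulr1; apply: ler_pM.
have upb : \int[mu N]_(x in Om) ((\sum_i h 0%R i * partial i v x) ^+ 2)%:E <=
    (N%:R * (2 * t) ^+ 2)%:E * \int[mu N]_(x in Om) (gsq v x)%:E.
  have mO : measurable (Om : set (lebT N)) by apply: measurable_rvB_leb; exact: rvB_open.
  have mg : measurable_fun (Om : set (lebT N)) (fun x : lebT N => (gsq v x)%:E).
    by apply: measurable_funTS; apply: measurable_contE; exact: continuous_gsq.
  have k0 : 0%:E <= (N%:R * (2 * t) ^+ 2)%:E by rewrite lee_fin mulr_ge0// ?sqr_ge0// ler0n.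
  have g0 x : Om x -> 0 <= (gsq v x)%:E by rewrite lee_fin gsq_ge0.
  have I2 := @ge0_integralZl _ (lebT N) R (mu N) Om mO _ mg _ g0 k0.
  rewrite -I2.
  apply: ge0_le_integral; first exact: mO.
  - by move=> x _; rewrite lee_fin sqr_ge0.
  - apply: measurable_funTS; apply: measurable_contE; under eq_fun do rewrite expr2.
    have cB : continuous (fun x : 'rV[R]_N => \sum_i h 0%R i * partial i v x)%R.
      apply: continuous_fsum => i; apply: contM; first exact: contC.
      exact: C1_continuous_partial.
    exact: contM.
  - by apply: emeasurable_funM => //; exact: measurable_cst.
  move=> x _; rewrite -EFinM lee_fin; apply: sqr_sum_le => i.
  rewrite hq mxE normrM (gtr0_norm t0) mulrC ler_pM2r//.
  have -> : ((d + eps *: q) 0 i = d 0 i + eps * q 0 i)%R.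
    by rewrite [LHS]mxE [X in (_ + X)%R]mxE.
  apply: le_trans (ler_normD _ _) _; rewrite normrM (gtr0_norm eps0).
  have e1 : (eps * `|q 0 i| <= 1)%R by apply: mulr_ile1 => //; exact: ltW.
  by apply: le_trans (lerD (d1 i) e1) _; rewrite -[2%R]/(1 + 1)%R.
move=> mid; have ES := le_trans lowb (le_trans mid upb).
apply: (le_trans EES); apply: (le_trans (leeD ES ES)).
have G0 : 0 <= \int[mu N]_(x in Om) (gsq v x)%:E.
  by apply: integral_ge0 => x _; rewrite lee_fin gsq_ge0.
rewrite -ge0_muleDl; [|by rewrite lee_fin mulr_ge0// ?sqr_ge0// ler0n..].
apply: lee_wpmul2r => //; rewrite -EFinD lee_fin le_eqVlt; apply/orP; left; apply/eqP.
have -> : (C * a `^ (2 / N%:R) = 2 * (N%:R * 2 ^+ 2) * ((4 * a) `^ (2 / N%:R) / (2 * eps) ^+ 2))%R.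
  rewrite /C powRM ?(ltW a0)//.
  by move: (4 `^ _)%R (a `^ _)%R ((2 * eps) ^+ 2)^-1%R => X Y Z; ring.
have -> : ((4 * a) `^ (2 / N%:R) = ((4 * a) `^ (N%:R^-1)) ^+ 2)%R.
  by rewrite -powR_mulrn ?powR_ge0// -powRrM; congr powR; rewrite mulrC.
rewrite /t; move: ((4 * a) `^ N%:R^-1)%R (N%:R : R)%R => Y M.
by field; rewrite gt_eqF.
Qed.

End Isocapacity.

Section SmoothStep.
Context (R : realType).

Definition relu (t : R) : R := Num.max t 0.
Definition relu2 (t : R) : R := relu t ^+ 2.

Lemma reluP (t : R) : (t <= 0 /\ relu t = 0) \/ (0 <= t /\ relu t = t).
Proof.
by rewrite /relu; case: (leP t 0) => t0; [left|right; split => //; exact: ltW].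
Qed.

Lemma continuous_relu : continuous relu.
Proof.
move=> t; apply/cvgrPdist_lt => e e0; apply/nbhs_ballP; exists e => //= s.
rewrite /ball/= => ts; apply: le_lt_trans ts.
have h1 := ler_norm (t - s); have := ler_norm (s - t); rewrite distrC => h2.
by have [[? ->]|[? ->]] := reluP t; have [[? ->]|[? ->]] := reluP s;
  rewrite ler_norml; apply/andP; split; lra.
Qed.

Lemma is_derive_relu2 (t : R) : is_derive t 1 relu2 (2 * relu t).
Proof.
have E : (fun h : R => h^-1 *: ((relu2 \o shift t) (h *: 1) - relu2 t)) @ 0^' --> 2 * relu t.
  apply/cvgrPdist_lt => e e0; apply/nbhs_ballP; exists e => //= h.
  rewrite /ball/= sub0r normrN => he h0; rewrite scaler1 /GRing.scale/=.
  apply: le_lt_trans he.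
  have -> : 2 * relu t - h^-1 * (relu2 (h + t) - relu2 t) =
     h^-1 * (2 * h * relu t - (relu2 (h + t) - relu2 t)) by field.
  rewrite normrM normfV mulrC ler_pdivrMr ?normr_gt0// -normrM -expr2.
  rewrite (ger0_norm (sqr_ge0 _)) /relu2.
  by have [[? ->]|[? ->]] := reluP t; have [[? ->]|[? ->]] := reluP (h + t);
    rewrite ler_norml; apply/andP; split; nra.
apply: DeriveDef; last by apply/cvg_lim.
by apply/cvg_ex; eexists; exact: E.
Qed.

(** The C^1 quadratic spline from 0 on t <= 0 to 1 on t >= 1; its derivative is the hat function on
    [0, 1] with peak value 2 at 1/2. *)
Definition step (t : R) : R := 2 * relu2 t - 4 * relu2 (t - 1/2) + 2 * relu2 (t - 1).
Definition dstep (t : R) : R := 4 * relu t - 8 * relu (t - 1/2) + 4 * relu (t - 1).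

Lemma is_derive_relu2B (a t : R) : is_derive t 1 (fun s => relu2 (s - a)) (2 * relu (t - a)).
Proof.
have d0 : is_derive t 1 (fun t : R => t - a) 1.
  have := @is_deriveB R _ _ id (cst a) t 1 1 0 (is_derive_id _ _) (is_derive_cst _ _ _).
  by rewrite subr0.
have := @is_derive1_comp R relu2 (fun t : R => t - a) t _ _ (is_derive_relu2 (t - a)) d0.
by rewrite mulr1.
Qed.

Lemma is_derive_step (t : R) : is_derive t 1 step (dstep t).
Proof.
have d1 := @is_deriveZ R _ _ relu2 2 t 1 _ (is_derive_relu2 t).
have d2 := @is_deriveZ R _ _ _ 4 t 1 _ (is_derive_relu2B (1/2) t).
have d3 := @is_deriveZ R _ _ _ 2 t 1 _ (is_derive_relu2B 1 t).
have := @is_deriveD R _ _ _ _ t 1 _ _ (@is_deriveB R _ _ _ _ t 1 _ _ d1 d2) d3.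
by congr is_derive; rewrite /dstep /GRing.scale/=; ring.
Qed.

Lemma continuous_dstep : continuous dstep.
Proof.
have c (a : R) : continuous (fun t : R => relu (t - a)).
  apply: cont_comp; first exact: continuous_relu.
  by apply: contB; [move=> t; exact: cvg_id|exact: contC].
apply: contD; last by apply: contM; [exact: contC|exact: c].
apply: contB; apply: contM; try exact: contC; [exact: continuous_relu|exact: c].
Qed.

Lemma step_le0 (t : R) : t <= 0 -> step t = 0.
Proof.
move=> t0; rewrite /step /relu2.
by have [[? ->]|[? ->]] := reluP t; have [[? ->]|[? ->]] := reluP (t - 1 / 2);
  have [[? ->]|[? ->]] := reluP (t - 1); try (exfalso; lra); nra.
Qed.

Lemma step_ge1 (t : R) : 1 <= t -> step t = 1.
Proof.
move=> t0; rewrite /step /relu2.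
by have [[? ->]|[? ->]] := reluP t; have [[? ->]|[? ->]] := reluP (t - 1 / 2);
  have [[? ->]|[? ->]] := reluP (t - 1); try (exfalso; lra); nra.
Qed.

Lemma dstep_bounds (t : R) : 0 <= dstep t <= 2.
Proof.
rewrite /dstep.
by have [[? ->]|[? ->]] := reluP t; have [[? ->]|[? ->]] := reluP (t - 1 / 2);
  have [[? ->]|[? ->]] := reluP (t - 1); try (exfalso; lra); apply/andP; split; lra.
Qed.

Lemma dstep_le0 (t : R) : t <= 0 -> dstep t = 0.
Proof.
move=> t0; rewrite /dstep.
by have [[? ->]|[? ->]] := reluP t; have [[? ->]|[? ->]] := reluP (t - 1 / 2);
  have [[? ->]|[? ->]] := reluP (t - 1); try (exfalso; lra); lra.
Qed.

Lemma dstep_ge1 (t : R) : 1 <= t -> dstep t = 0.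
Proof.
move=> t0; rewrite /dstep.
by have [[? ->]|[? ->]] := reluP t; have [[? ->]|[? ->]] := reluP (t - 1 / 2);
  have [[? ->]|[? ->]] := reluP (t - 1); try (exfalso; lra); lra.
Qed.

(** Truncation of |t| between the levels 2^k and 2^(k+1), rescaled to [0, 1]. It is written in terms
    of t^2, which avoids the corner of |t| at 0. *)
Definition levelT (k : nat) (t : R) : R := step ((t ^+ 2 / 4 ^+ k - 1) / 3).
Definition dlevelT (k : nat) (t : R) : R :=
  (dstep ((t ^+ 2 / 4 ^+ k - 1) / 3) * (2 * t / (3 * 4 ^+ k))).

Lemma is_derive_levelT k (t : R) : is_derive t 1 (levelT k) (dlevelT k t).
Proof.
have d0 : is_derive t 1 (fun t : R => (t ^+ 2 / 4 ^+ k - 1) / 3) (2 * t / (3 * 4 ^+ k)).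
  have E : (fun t : R => (t ^+ 2 / 4 ^+ k - 1) / 3) =
      ((3 * 4 ^+ k)^-1 \*: (id * id : R -> R) - cst (3^-1)).
    apply/funext => s; rewrite /= expr2 !fctE.
    rewrite -[RHS]/((3 * 4 ^+ k)^-1 * (s * s) - 3^-1).
    have := @expf_neq0 R 4 k; rewrite pnatr_eq0 => /(_ isT); move: (4 ^+ k) => p p0.
    by field; rewrite p0.
  rewrite E.
  have d1 := @is_deriveM R _ id id t 1 1 1 (is_derive_id _ _) (is_derive_id _ _).
  have d2 := @is_deriveZ R _ _ _ ((3 * 4 ^+ k)^-1) t 1 _ d1.
  have := @is_deriveB R _ _ _ (cst (3^-1 : R)) t 1 _ _ d2 (is_derive_cst _ _ _).
  have := @expf_neq0 R 4 k; rewrite pnatr_eq0 => /(_ isT).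
  move: (4 ^+ k) => p p0.
  by congr is_derive; rewrite /GRing.scale/=; field; rewrite p0.
have := @is_derive1_comp R step (fun t => (t ^+ 2 / 4 ^+ k - 1) / 3) t _ _ (is_derive_step _) d0.
exact.
Qed.

Lemma continuous_dlevelT k : continuous (dlevelT k).
Proof.
have cid : continuous (fun t : R => t) by move=> t; exact: cvg_id.
apply: contM.
  apply: cont_comp; first exact: continuous_dstep.
  apply: contM; last exact: contC; apply: contB; last exact: contC.
  apply: contM; last exact: contC; under eq_fun do rewrite expr2.
  exact: contM.
apply: contM; last exact: contC; apply: contM; [exact: contC|exact: cid].
Qed.

Lemma dlevelT_le k (t : R) :
  (dlevelT k t ^+ 2 <= 8 / 4 ^+ k * ((4 ^+ k < t ^+ 2 <= 4 ^+ k.+1)%R)%:R).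
Proof.
have p0 : (0 < 4 ^+ k :> R) by rewrite exprn_gt0.
rewrite /dlevelT [4 ^+ k.+1]exprS; move: (4 ^+ k) p0 => p p0.
have [h|] := boolP (p < t ^+ 2 <= 4 * p); last first.
  rewrite negb_and -leNgt -ltNge => /orP h; rewrite mulr0.
  suff -> : (dstep ((t ^+ 2 / p - 1) / 3) = 0) by rewrite mul0r expr0n.
  case: h => h; [apply: dstep_le0|apply: dstep_ge1].
    rewrite pmulr_lle0 ?invr_gt0// subr_le0 ler_pdivrMr// mul1r; exact: h.
  by rewrite ler_pdivlMr// mul1r lerBrDr ler_pdivlMr//; lra.
rewrite mulr1 exprMn.
have /andP[d0 d2] := dstep_bounds ((t ^+ 2 / p - 1) / 3).
have e1 : (dstep ((t ^+ 2 / p - 1) / 3) ^+ 2 <= 4) by nra.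
(* In the band t^2 <= 4 p the right side is at most 64 / (9 p), and 64 / 9 <= 8. *)
apply: (@le_trans _ _ (4 * (2 * t / (3 * p)) ^+ 2)).
  by rewrite ler_wpM2r ?sqr_ge0.
have -> : (4 * (2 * t / (3 * p)) ^+ 2 = (16 / 9) * (t ^+ 2 / p) / p).
  by field; rewrite gt_eqF.
rewrite ler_pM2r ?invr_gt0//.
have : (t ^+ 2 / p <= 4) by rewrite ler_pdivrMr//; case/andP: h.
lra.
Qed.

Lemma sum_disjoint_levels (s : R) K :
  \sum_(k < K) ((4 ^+ k < s <= 4 ^+ k.+1)%R)%:R <= ((s <= 4 ^+ K)%R)%:R :> R.
Proof.
elim: K => [|K IH]; first by rewrite big_ord0.
rewrite big_ord_recr/=; have [h|h] := ltP (4 ^+ K) s.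
  have E0 : \sum_(k < K) ((4 ^+ k < s <= 4 ^+ k.+1)%R)%:R <= 0 :> R.
    by rewrite (lt_geF h) in IH.
  by rewrite /= -[leRHS]add0r lerD2r.
rewrite /= addr0; apply: le_trans IH _; rewrite h.
by rewrite (le_trans h)// ler_eXn2l ?ltr1n.
Qed.

Lemma sum_levels (s : R) K : 0 <= s ->
  \sum_(k < K) 4 ^+ k * ((4 ^+ k < s)%R)%:R <= 2 * s :> R.
Proof.
move=> s0.
have H M : \sum_(k < M) 4 ^+ k * ((4 ^+ k < s)%R)%:R <= 4 ^+ M / 3 :> R.
  elim: M => [|M IH]; first by rewrite big_ord0 expr0 divr_ge0.
  rewrite big_ord_recr/= exprS; have : (4 ^+ M : R) * ((4 ^+ M < s)%R)%:R <= 4 ^+ M.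
    by rewrite ler_piMr ?exprn_ge0//; case: (_ < _).
  lra.
elim: K => [|K IH]; first by rewrite big_ord0 mulr_ge0.
rewrite big_ord_recr/=; have [h|h] := ltP (4 ^+ K) s; last by rewrite mulr0 addr0.
rewrite mulr1; have := H K; move: h s0; clear; lra.
Qed.

End SmoothStep.

Section GlobalIsocapacity.
Local Open Scope ereal_scope.
Context (R : realType) (n : nat).
Local Notation N := n.+1.
Local Notation lebT := (caratheodory_type (@lebesgue_outer R N)).
Local Notation mu := (lebesgue_rV R N).

(** Over a union, [E] is split along the two sets: constants add up and thresholds take the minimum.
    A measurable superset is carried along so that the pieces of [E] remain measurable. *)
Lemma isocap_domain (Om : set 'rV[R]_N) : open Om -> bounded_set Om ->
  C1_boundary Om -> isocap Om (closure Om).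
Proof.
move=> oOm bOm hC1; have [k Ok] := bounded_kbox bOm.
pose Q (A : set 'rV[R]_N) := exists A', [/\ A `<=` A', measurable (A' : set (rvB R N)) & isocap Om A'].
have [] : Q (closure Om); last first.
  move=> A' [clA mA' [C [c [C0 c0 H]]]]; exists C, c; split => //.
  by move=> a v E F ac C1v mE mF EO EB; apply: H => // x /EB/clA.
apply: (compact_local_union (closure_compact bOm)).
- exists set0; split => //; exists 1%R, 1%R; split; rewrite ?ltr01// => a v E F /andP[a0 _] _ _ _ _ E0 _ _ _.
  have -> : E = set0 by apply/seteqP; split.
  rewrite measure0 mule_ge0// ?lee_fin ?mul1r ?powR_ge0//.
  by apply: integral_ge0 => x _; rewrite lee_fin gsq_ge0.
- move=> A B [A' [AA' mA [C1 [c1 [C10 c10 H1]]]]] [B' [BB' mB [C2 [c2 [C20 c20 H2]]]]].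
  exists (A' `|` B'); split; [by move=> x [/AA'|/BB']; [left|right]|exact: measurableU|].
  exists (C1 + C2)%R, (Num.min c1 c2); split; [exact: addr_gt0|by rewrite lt_min c10|].
  move=> a v E F /andP[a0]; rewrite le_min => /andP[ac1 ac2] C1v mE mF EO EAB v1 v0 Fa.
  have G0 : 0 <= \int[mu]_(x in Om) (gsq v x)%:E.
    by apply: integral_ge0 => x _; rewrite lee_fin gsq_ge0.
  rewrite mulrDl EFinD ge0_muleDl ?lee_fin ?mulr_ge0 ?powR_ge0// ?(ltW C10)// ?(ltW C20)//.
  have le1 : mu (E `&` A') <= (C1 * a `^ (2 / N%:R))%:E * \int[mu]_(x in Om) (gsq v x)%:E.
    apply: (H1 a v (E `&` A') F) => //; rewrite ?a0 ?ac1//.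
    + exact: measurableI.
    + by move=> x [/EO].
    + by move=> x [/v1].
  have le2 : mu (E `&` B') <= (C2 * a `^ (2 / N%:R))%:E * \int[mu]_(x in Om) (gsq v x)%:E.
    apply: (H2 a v (E `&` B') F) => //; rewrite ?a0 ?ac2//.
    + exact: measurableI.
    + by move=> x [/EO].
    + by move=> x [/v1].
  apply: le_trans (leeD le1 le2).
  apply: (@le_trans _ _ (mu ((E `&` A') `|` (E `&` B')))).
    by apply: le_outer_measure => x Ex; case: (EAB x Ex); [left|right].
  exact: outer_measureU2.
- by move=> A B AB [A' [BA' mA' iA']]; exists A'; split => // x /AB/BA'.
- move=> x /(cone_closure oOm hC1)[d [r [rho [eps co]]]].
  have r0 : (0 < r)%R by case: co.
  exists (ball x r); first exact: nbhsx_ballx.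
  exists (ball x r); split => //; first by apply: rvB_open; exact: ball_open_rV.
  exact: (isocap_cone oOm Ok co).
Qed.

Definition energy (Om : set 'rV[R]_N) (w : 'rV[R]_N -> R) : \bar R :=
  \int[mu]_(x in Om) (gsq w x + w x ^+ 2)%:E.

Definition level (Om : set 'rV[R]_N) (w : 'rV[R]_N -> R) (k : nat) : set 'rV[R]_N :=
  Om `&` [set x | (4 ^+ k < w x ^+ 2)%R].

Lemma level_measurable (Om : set 'rV[R]_N) w k : open Om -> Ck 1 w ->
  measurable (level Om w k : set (rvB R N)).
Proof.
move=> oOm C1w; apply: rvB_open; apply: openI => //.
have cw : continuous (fun x => w x ^+ 2)%R.
  under eq_fun do rewrite expr2.
  by apply: contM; exact: C1_continuous.
rewrite (_ : [set x | _] = (fun x => w x ^+ 2)%R @^-1` `](4 ^+ k)%R, +oo[%classic).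
  by apply: open_comp => // x _; exact: cw.
by apply/seteqP; split=> x /=; rewrite in_itv/= andbT.
Qed.

(** The energy spent at level k. The bands are disjoint and the numbers 4^k below w^2 form a
    geometric sum, so these densities add up to at most twice the full energy density. The second
    term serves the levels whose superlevel set is too large for the isocapacitary estimate. *)
Definition level_density (w : 'rV[R]_N -> R) (k : nat) (x : 'rV[R]_N) : R :=
  (gsq w x * ((4 ^+ k < w x ^+ 2 <= 4 ^+ k.+1)%R)%:R
   + 4 ^+ k * ((4 ^+ k < w x ^+ 2)%R)%:R)%R.

Lemma level_density_ge0 w k x : (0 <= level_density w k x)%R.
Proof. by rewrite /level_density addr_ge0 ?mulr_ge0 ?gsq_ge0 ?ler0n// exprn_ge0. Qed.

Lemma level_density_sum w K x :
  (\sum_(k < K) level_density w k x <= 2 * (gsq w x + w x ^+ 2))%R.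
Proof.
rewrite big_split/= -mulr_sumr mulrDr; apply: lerD; last exact/sum_levels/sqr_ge0.
rewrite mulrC ler_wpM2r ?gsq_ge0//; apply: le_trans (sum_disjoint_levels _ _) _.
by rewrite ler_nat; case: (_ <= _)%R.
Qed.

Lemma measurable_level_density (Om : set 'rV[R]_N) w k : Ck 1 w ->
  measurable_fun setT (fun x : lebT => (level_density w k x)%:E).
Proof.
move=> C1w; apply/measurable_EFinP.
have cw : continuous (fun x => w x ^+ 2)%R.
  under eq_fun do rewrite expr2.
  by apply: contM; exact: C1_continuous.
have mw := measurable_cont cw.
have mb (b : R -> bool) : measurable ([set t | b t] : set R) ->
    measurable_fun setT (fun x : lebT => ((b (w x ^+ 2)%R)%:R : R)).
  move=> mB; have -> : (fun x : lebT => ((b (w x ^+ 2)%R)%:R : R)) =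
      (\1_[set t | b t] \o (fun x => w x ^+ 2)%R).
    apply/funext => x; rewrite /= indicE; congr (nat_of_bool _)%:R.
    by apply/idP/idP => [h|/set_mem//]; exact: mem_set.
  exact: (measurableT_comp (@measurable_indic _ _ R setT _ mB) mw).
have m1 : measurable_fun setT (fun x : lebT => gsq w x).
  by apply: measurable_cont; exact: continuous_gsq.
have m2 : measurable_fun setT (fun x : lebT => ((4 ^+ k < w x ^+ 2 <= 4 ^+ k.+1)%R)%:R : R).
  apply: (mb (fun t => 4 ^+ k < t <= 4 ^+ k.+1)%R).
  by rewrite (_ : [set t | _] = `](4 ^+ k)%R, (4 ^+ k.+1)%R]%classic)//.
have m3 : measurable_fun setT (fun x : lebT => ((4 ^+ k < w x ^+ 2)%R)%:R : R).
  apply: (mb (fun t => 4 ^+ k < t)%R).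
  rewrite (_ : [set t | _] = `](4 ^+ k)%R, +oo[%classic); first exact: measurable_itv.
  by apply/seteqP; split=> x /=; rewrite in_itv/= andbT.
have m4 : measurable_fun setT (fun x : lebT => (4 ^+ k : R)%R) by exact: measurable_cst.
exact: (measurable_funD (measurable_funM m1 m2) (measurable_funM m4 m3)).
Qed.

(** If the superlevel set has measure at most c, the isocapacitary estimate applies to the
    truncation [levelT k]. Otherwise Chebyshev's inequality is enough, because then a^(2/N) is
    bounded below by c^(2/N). *)
Lemma level_step (Om : set 'rV[R]_N) : open Om -> bounded_set Om -> C1_boundary Om ->
  exists2 C : R, (0 < C)%R & forall w k, Ck 1 w ->
    \int[mu]_(x in Om) (level_density w k x)%:E < +oo ->
    (fine (mu (level Om w k.+1)) <=
      C * (fine (mu (level Om w k))) `^ (2 / N%:R) / 4 ^+ k *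
      fine (\int[mu]_(x in Om) (level_density w k x)%:E))%R.
Proof.
move=> oOm bOm hC1; have [K OK] := bounded_kbox bOm.
have [C [c [C0 c0 H]]] := isocap_domain oOm bOm hC1.
exists (8 * C + c `^ (- (2 / N%:R)))%R; first by rewrite addr_gt0 ?mulr_gt0 ?powR_gt0.
move=> w k C1w Bfin; set I := \int[mu]_(x in Om) _ in Bfin *.
have I0 : 0 <= I by apply: integral_ge0 => x _; rewrite lee_fin level_density_ge0.
have If : I \is a fin_num by rewrite ge0_fin_numE.
have mO : measurable (Om : set lebT) by apply: measurable_rvB_leb; exact: rvB_open.
have mD : measurable_fun (Om : set lebT) (fun x : lebT => (level_density w k x)%:E).
  by apply: measurable_funTS; exact: measurable_level_density.
have Lf j : mu (level Om w j) \is a fin_num.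
  rewrite ge0_fin_numE//; apply: (@mu_bounded R N K) => x [Ox _]; exact: OK.
have p0 : (0 < 4 ^+ k :> R)%R by rewrite exprn_gt0.
have Lsub : level Om w k.+1 `<=` level Om w k.
  move=> x [Ox /= h]; split => //=; apply: le_lt_trans h.
  by rewrite ler_eXn2l ?ltr1n.
have Lle : (fine (mu (level Om w k.+1)) <= fine (mu (level Om w k)))%R.
  by rewrite fine_le//; exact: le_outer_measure.
set a := fine (mu (level Om w k)) in Lle *.
have aE : mu (level Om w k) = a%:E by rewrite /a fineK.
have a0 : (0 <= a)%R by rewrite /a fine_ge0.
have X0 : (0 <= c `^ (- (2 / N%:R)) :> R)%R by exact: powR_ge0.
have [a00|an0] := eqVneq a 0%R.
  by apply: (le_trans Lle); rewrite a00 mulr_ge0 ?fine_ge0// mulr_ge0 ?invr_ge0 ?(ltW p0)//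
    mulr_ge0 ?powR_ge0// addr_ge0// mulr_ge0// ltW.
have ap : (0 < a)%R by rewrite lt_neqAle eq_sym an0.
have Y0 : (0 <= a `^ (2 / N%:R) / 4 ^+ k * fine I)%R.
  by rewrite !mulr_ge0 ?invr_ge0 ?(ltW p0) ?powR_ge0 ?fine_ge0.
have [ac|ac] := leP a c.
  have [C1T pT] := C1_comp C1w (is_derive_levelT k) (@continuous_dlevelT R k).
  have Hk := H a (fun x => levelT k (w x)) (level Om w k.+1) (level Om w k).
  have {}Hk : mu (level Om w k.+1) <= (C * a `^ (2 / N%:R))%:E *
      \int[mu]_(x in Om) (gsq (fun x => levelT k (w x)) x)%:E.
    apply: Hk => //.
    - by rewrite ap.
    - exact: level_measurable.
    - exact: level_measurable.
    - by move=> x [].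
    - by move=> x [Ox _]; exact: subset_closure.
    - move=> x [_ /= h]; rewrite /levelT step_ge1// ler_pdivlMr// mul1r lerBrDr ler_pdivlMr//.
      by move: h; rewrite exprS; lra.
    - move=> x Ox nF; rewrite /levelT step_le0// pmulr_lle0 ?invr_gt0// subr_le0 ler_pdivrMr// mul1r.
      by rewrite leNgt; apply/negP => h; apply: nF.
    - by rewrite aE.
  have gle : \int[mu]_(x in Om) (gsq (fun x => levelT k (w x)) x)%:E <= (8 / 4 ^+ k)%:E * I.
    have k0 : 0 <= (8 / 4 ^+ k : R)%:E by rewrite lee_fin divr_ge0// ltW.
    have I2 := @ge0_integralZl _ lebT R mu Om mO _ mD _
      (fun x _ => level_density_ge0 w k x) k0.
    rewrite -I2; apply: ge0_le_integral; first exact: mO.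
    - by move=> x _; rewrite lee_fin gsq_ge0.
    - by apply: measurable_funTS; apply: measurable_contE; exact: continuous_gsq.
    - by apply: emeasurable_funM => //; exact: measurable_cst.
    move=> x _; rewrite -EFinM lee_fin.
    have -> : gsq (fun x => levelT k (w x)) x = (dlevelT k (w x) ^+ 2 * gsq w x)%R.
      rewrite /gsq mulr_sumr; apply: eq_bigr => i _; rewrite pT exprMn.
      by [].
    apply: (le_trans (ler_wpM2r (gsq_ge0 w x) (dlevelT_le k (w x)))).
    rewrite -[leLHS]mulrA ler_wpM2l ?divr_ge0 ?(ltW p0)// /level_density mulrC lerDl.
    by rewrite mulr_ge0 ?ler0n ?(ltW p0).
  rewrite -lee_fin fineK//; apply: (le_trans Hk).
  have Ca : 0 <= (C * a `^ (2 / N%:R))%:E by rewrite lee_fin mulr_ge0 ?powR_ge0// ltW.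
  apply: (le_trans (lee_wpmul2l Ca gle)).
  rewrite -(fineK If) -!EFinM lee_fin.
  have -> : (C * a `^ (2 / N%:R) * (8 / 4 ^+ k * fine I) =
    8 * C * (a `^ (2 / N%:R) / 4 ^+ k * fine I))%R by ring.
  have -> : ((8 * C + c `^ (- (2 / N%:R))) * a `^ (2 / N%:R) / 4 ^+ k * fine I =
    8 * C * (a `^ (2 / N%:R) / 4 ^+ k * fine I) +
    c `^ (- (2 / N%:R)) * (a `^ (2 / N%:R) / 4 ^+ k * fine I))%R by ring.
  by rewrite lerDl mulr_ge0.
(* The large case: 4^k is integrated over the superlevel set. *)
have aI : (4 ^+ k * a <= fine I)%R.
  rewrite -lee_fin fineK// EFinM -aE.
  have mL : measurable (level Om w k : set lebT).
    by apply: measurable_rvB_leb; exact: level_measurable.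
  have p0' : 0 <= (4 ^+ k : R)%:E by rewrite lee_fin ltW.
  rewrite -(integral_indicZ p0' mL) /I [leRHS]integral_mkcond.
  apply: ge0_le_integral; first exact: measurableT.
  - by move=> x _; rewrite mule_ge0// lee_fin.
  - by apply: emeasurable_funM; [exact: measurable_cst|exact: measurable_indicE].
  - exact/(measurable_restrictT _ mO).1.
  move=> x _; rewrite patchE indicE; case: (boolP (x \in level Om w k)) => xL.
    have [Ox /= h] := set_mem xL.
    by rewrite mem_set// mule1 lee_fin /level_density h mulr1 lerDr mulr_ge0 ?gsq_ge0.
  by rewrite mule0; case: ifP => // _; rewrite lee_fin level_density_ge0.
apply: (le_trans Lle).
have h1 : (1 <= c `^ (- (2 / N%:R)) * a `^ (2 / N%:R))%R.
  rewrite powRN -ler_pdivrMl ?invr_gt0 ?powR_gt0// invrK mulr1.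
  by rewrite ge0_ler_powR ?divr_ge0 ?ler0n// ?nnegrE ltW.
have h2 : (a <= fine I / 4 ^+ k)%R by rewrite ler_pdivlMr// mulrC.
apply: (@le_trans _ _ (c `^ (- (2 / N%:R)) * (a `^ (2 / N%:R) / 4 ^+ k * fine I))%R).
  have -> : (c `^ (- (2 / N%:R)) * (a `^ (2 / N%:R) / 4 ^+ k * fine I) =
    (c `^ (- (2 / N%:R)) * a `^ (2 / N%:R)) * (fine I / 4 ^+ k))%R by ring.
  by rewrite -[leLHS]mul1r; apply: ler_pM.
have -> : ((8 * C + c `^ (- (2 / N%:R))) * a `^ (2 / N%:R) / 4 ^+ k * fine I =
    8 * C * (a `^ (2 / N%:R) / 4 ^+ k * fine I) +
    c `^ (- (2 / N%:R)) * (a `^ (2 / N%:R) / 4 ^+ k * fine I))%R by ring.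
by rewrite lerDr mulr_ge0// mulr_ge0// ltW.
Qed.

(** With weights Q^k the recursion becomes M_(k+1) <= Q C M_k^p B_k for M_k = Q^k A_k. Bounding M_k
    by the whole sum S gives S <= V + 2 Q C S^p, and p < 1 absorbs the power of S. *)
Lemma dyadic_sum_bound (p C V : R) (A B : nat -> R) : (0 < p < 1)%R ->
  (0 < C)%R -> (0 <= V)%R -> (forall k, (0 <= A k)%R) -> (forall k, (0 <= B k)%R) ->
  (A 0%N <= V)%R ->
  (forall k, (A k.+1 <= C * (A k `^ p) / 4 ^+ k * B k)%R) ->
  (forall K, (\sum_(k < K) B k <= 2)%R) ->
  forall K, (\sum_(k < K) (4 `^ (1 - p)^-1) ^+ k * A k <=
    Num.max 1 ((V + 4 `^ (1 - p)^-1 * C * 2) `^ (1 - p)^-1))%R.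
Proof.
move=> /andP[p0 p1] C0 V0 A0 B0 AV rec Bsum.
set Q := (4 `^ (1 - p)^-1)%R.
have q0 : (0 < 1 - p)%R by rewrite subr_gt0.
have Q0 : (0 < Q)%R by exact: powR_gt0.
(* Q = 4^(1/(1-p)) is the base for which the factor 4^(-k) turns Q^k into its p-th power. *)
have QE k : (Q ^+ k / 4 ^+ k = (Q ^+ k) `^ p)%R.
  have Qp : (Q `^ p = Q / 4)%R.
    have e4 : (Q `^ (1 - p) = 4)%R by rewrite /Q -powRrM mulVf ?gt_eqF// powRr1.
    rewrite -[X in (_ / X)%R]e4 -{2}[Q](powRr1 (ltW Q0)) -powRN -powRD; last by rewrite (gt_eqF Q0) implybT.
    by congr powR; ring.
  rewrite -[in RHS](powR_mulrn k (ltW Q0)) -powRrM [(k%:R * p)%R]mulrC powRrM Qp.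
  by rewrite powR_mulrn ?expr_div_n// divr_ge0// ltW.
pose M k := (Q ^+ k * A k)%R.
have M0 k : (0 <= M k)%R by rewrite mulr_ge0// exprn_ge0// ltW.
have Mrec k : (M k.+1 <= Q * C * (M k `^ p) * B k)%R.
  rewrite /M exprS; apply: (@le_trans _ _ (Q * Q ^+ k * (C * (A k `^ p) / 4 ^+ k * B k))%R).
    by rewrite ler_wpM2l// mulr_ge0 ?exprn_ge0// ltW.
  rewrite powRM ?exprn_ge0 ?(ltW Q0)// -QE le_eqVlt; apply/orP; left; apply/eqP; ring.
move=> K; set S := (\sum_(k < K) _)%R.
have Sle : (S <= V + Q * C * 2 * (S `^ p))%R.
  have QC : (0 <= Q * C * S `^ p)%R by rewrite mulr_ge0 ?powR_ge0// mulr_ge0// ltW.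
  case: K @S QC => [|K] S QC.
    by rewrite {1}/S big_ord0 addr_ge0// mulr_ge0 ?powR_ge0// !mulr_ge0// ltW.
  rewrite {1}/S big_ord_recl expr0 mul1r; apply: lerD => //.
  apply: (@le_trans _ _ (\sum_(k < K) (Q * C * (S `^ p)) * B k)%R).
    apply: ler_sum => k _; rewrite lift0; apply: (le_trans (Mrec k)).
    rewrite ler_wpM2r// ler_wpM2l ?mulr_ge0 ?(ltW Q0) ?(ltW C0)//.
    apply: ge0_ler_powR; rewrite ?nnegrE ?(ltW p0)//.
      by apply: sumr_ge0 => i _; exact: M0.
    rewrite /S (bigD1 (widen_ord (leqnSn K) k))//= lerDl sumr_ge0// => i _.
    exact: M0.
  rewrite -mulr_sumr; apply: (@le_trans _ _ ((Q * C * S `^ p) * 2)%R).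
    by rewrite ler_wpM2l.
  by rewrite le_eqVlt; apply/orP; left; apply/eqP; ring.
have S0 : (0 <= S)%R by apply: sumr_ge0 => k _; exact: M0.
(* For S > 1 both sides are divided by S^p >= 1, which leaves S^(1-p) <= V + 2 Q C. *)
rewrite le_max; have [//|S1] := leP S 1%R; apply/orP; right.
have S0' : (0 < S)%R by apply: lt_trans S1.
have h1 : (S `^ (1 - p) <= V + Q * C * 2)%R.
  have Sp : (0 < S `^ p)%R by exact: powR_gt0.
  have Sp1 : (1 <= S `^ p)%R.
    have <- : (1 `^ p = 1 :> R)%R by rewrite powR1.
    by apply: ge0_ler_powR; rewrite ?nnegrE ?(ltW p0)// ltW.
  have -> : (S `^ (1 - p) = S / S `^ p)%R.
    rewrite powRD; last by rewrite (gt_eqF S0') implybT.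
    by rewrite powRN powRr1.
  rewrite ler_pdivrMr// mulrDl; apply: (le_trans Sle); rewrite lerD2r.
  by rewrite ler_peMr.
have -> : (S = (S `^ (1 - p)) `^ (1 - p)^-1)%R.
  by rewrite -powRrM mulfV ?gt_eqF// powRr1.
by apply: ge0_ler_powR; rewrite ?nnegrE ?invr_ge0 ?powR_ge0 ?(ltW q0)//;
  rewrite addr_ge0// !mulr_ge0// ltW.
Qed.

(** A discrete layer-cake bound: at the highest level below s, the last term alone already exceeds
    s^p. *)
Lemma powR_levels (p s : R) K : (0 < p)%R -> (0 <= s)%R -> (s <= 4 ^+ K)%R ->
  (s `^ p <= 1 + \sum_(k < K) (4 `^ p) ^+ k.+1 * ((4 ^+ k < s)%R)%:R)%R.
Proof.
move=> p0 s0; have Q0 : (0 <= 4 `^ p :> R)%R by exact: powR_ge0.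
elim: K => [|K IH].
  rewrite expr0 big_ord0 addr0 => s1; have <- : (1 `^ p = 1 :> R)%R by rewrite powR1.
  by apply: ge0_ler_powR; rewrite ?nnegrE// ltW.
move=> s4; rewrite big_ord_recr/=; have [h|h] := leP s (4 ^+ K)%R.
  by rewrite mulr0 addr0; exact: IH.
rewrite mulr1 addrA; apply: (@le_trans _ _ ((4 `^ p) ^+ K.+1)%R); last first.
  by rewrite lerDr addr_ge0// sumr_ge0// => k _; rewrite mulr_ge0 ?exprn_ge0.
rewrite -powR_mulrn// -powRrM mulrC powRrM powR_mulrn//.
by apply: ge0_ler_powR; rewrite ?nnegrE ?exprn_ge0 ?(ltW p0).
Qed.

(* Truncation at the levels [2 ^ k] turns the isocapacitary estimate into the
   Sobolev inequality with the optimal exponent 2 N / (N - 2). *)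
Theorem sobolev (Om : set 'rV[R]_N) : (2 < N)%N -> open Om -> bounded_set Om ->
  C1_boundary Om -> exists2 S : R, (0 <= S)%R & forall w, Ck 1 w ->
    energy Om w <= 1 ->
    \int[mu]_(x in Om) ((w x ^+ 2) `^ (N%:R / (N%:R - 2)))%:E <= S%:E.
Proof.
move=> N2 oOm bOm hC1; have [K OK] := bounded_kbox bOm.
have [C C0 Hstep] := level_step oOm bOm hC1.
have mO : measurable (Om : set lebT) by apply: measurable_rvB_leb; exact: rvB_open.
have Vfin : mu Om \is a fin_num by rewrite ge0_fin_numE//; exact: mu_bounded OK.
have N2' : (2 < N%:R :> R)%R by rewrite ltr_nat.
have N0 : (0 < N%:R :> R)%R by apply: lt_trans N2'.
pose p : R := (2 / N%:R)%R.
have p01 : (0 < p < 1)%R by rewrite divr_gt0//= /p ltr_pdivrMr// mul1r.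
have qE : ((1 - p)^-1 = N%:R / (N%:R - 2))%R.
  have M0 : (N%:R != 0 :> R)%R by rewrite gt_eqF.
  have M2 : (N%:R - 2 != 0 :> R)%R by rewrite gt_eqF// subr_gt0.
  by rewrite /p; move: (N%:R : R)%R M0 M2 => M M0 M2; field; rewrite M0 M2.
pose V := fine (mu Om); have V0 : (0 <= V)%R by rewrite fine_ge0.
pose Q : R := (4 `^ (N%:R / (N%:R - 2)))%R.
have Q0 : (0 < Q)%R by exact: powR_gt0.
pose B0 : R := Num.max 1%R ((V + Q * C * 2) `^ (N%:R / (N%:R - 2)))%R.
exists (V + Q * B0)%R.
  by rewrite addr_ge0// mulr_ge0 ?(ltW Q0)// le_max ler01.
move=> w C1w e1.
have mden k : measurable_fun (Om : set lebT) (fun x => (level_density w k x)%:E).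
  by apply: measurable_funTS; exact: measurable_level_density.
pose I k := \int[mu]_(x in Om) (level_density w k x)%:E.
have I0 k : 0 <= I k by apply: integral_ge0 => x _; rewrite lee_fin level_density_ge0.
have Isum M : \sum_(k < M) I k <= 2%:E.
  rewrite -(@ge0_integral_sum _ lebT R mu Om mO _ (fun (k : 'I_M) x => (level_density w k x)%:E))//; last first.
    by move=> k x _; rewrite lee_fin level_density_ge0.
  have c1 : continuous (fun x => gsq w x + w x ^+ 2)%R.
    apply: contD; first exact: continuous_gsq.
    by under eq_fun do rewrite expr2; apply: contM; exact: C1_continuous.
  have me : measurable_fun (Om : set lebT) (fun x => (gsq w x + w x ^+ 2)%:E).
    by apply: measurable_funTS; exact: measurable_contE.
  have e0 x : Om x -> 0 <= (gsq w x + w x ^+ 2)%:E by rewrite lee_fin addr_ge0 ?gsq_ge0 ?sqr_ge0.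
  have k0 : 0 <= 2%:E :> \bar R by rewrite lee_fin.
  apply: (@le_trans _ _ (2%:E * energy Om w)); last first.
    by rewrite -[leRHS]mule1; apply: lee_wpmul2l.
  have E2 := @ge0_integralZl _ lebT R mu Om mO _ me _ e0 k0.
  rewrite /energy -E2; apply: ge0_le_integral; first exact: mO.
  - by move=> x _; apply: sume_ge0 => k _; rewrite lee_fin level_density_ge0.
  - by apply: emeasurable_sum => k; exact: mden.
  - by apply: emeasurable_funM => //; exact: measurable_cst.
  by move=> x _; rewrite sumEFin -EFinM lee_fin; exact: level_density_sum.
have Ifin k : I k < +oo.
  apply: (@le_lt_trans _ _ 2%:E); last exact: ltry.
  apply: le_trans (Isum k.+1); rewrite big_ord_recr/= -[leLHS]add0e leeD2r//.
  by apply: sume_ge0.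
have Lfin k : mu (level Om w k) \is a fin_num.
  rewrite ge0_fin_numE//; apply: (@mu_bounded R N K) => x [Ox _]; exact: OK.
have := @dyadic_sum_bound p C V (fun k => fine (mu (level Om w k))) (fun k => fine (I k))
  p01 C0 V0 (fun k => fine_ge0 (measure_ge0 _ _)) (fun k => fine_ge0 (I0 k)).
rewrite qE => /(_ _ _ _) Hsum.
have {}Hsum M : (\sum_(k < M) Q ^+ k * fine (mu (level Om w k)) <= B0)%R.
  apply: Hsum => [|k|M'].
  - by apply: fine_le => //; apply: le_outer_measure => x [].
  - by apply: Hstep => //; exact: Ifin.
  - rewrite -lee_fin -sumEFin; apply: le_trans (Isum M').
    by apply: lee_sum => k _; rewrite fineK// ge0_fin_numE.
have cw2 : continuous (fun x => w x ^+ 2)%R.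
  by under eq_fun do rewrite expr2; apply: contM; exact: C1_continuous.
(* The number of levels depends on [w], which is bounded on a compact box; the bound [B0] on the
   weighted sum does not. *)
have [M HM] : exists M, forall x, Om x -> (w x ^+ 2 <= 4 ^+ M)%R.
  have cpt : compact ((fun x => w x ^+ 2)%R @` @kbox R N K).
    apply: continuous_compact; last exact: kbox_compact.
    exact: continuous_subspaceT.
  have [b [_ Hb]] := compact_bounded cpt.
  exists (Num.truncn (`|b| + 1)%R).+1 => x Ox.
  have h : (`|w x ^+ 2| <= `|b| + 1)%R.
    by apply: (Hb (`|b| + 1)%R); [rewrite ltr_pwDr// ler_norm|exists x => //; exact: OK].
  apply: le_trans (ler_norm _) _; apply: (le_trans h).
  apply: (@le_trans _ _ (Num.truncn (`|b| + 1)%R).+1%:R); first by apply/ltW/truncnS_gt.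
  by rewrite -natrX ler_nat; apply: ltnW; exact: ltn_expl.
have mQ k : measurable (level Om w k : set lebT).
  by apply: measurable_rvB_leb; exact: level_measurable.
pose g (x : lebT) : \bar R := (\1_Om x)%:E + \sum_(k < M) (Q ^+ k.+1)%:E * (\1_(level Om w k) x)%:E.
apply: (@le_trans _ _ (\int[mu]_x g x)).
  rewrite [leLHS]integral_mkcond; apply: ge0_le_integral; first exact: measurableT.
  - by move=> x _; rewrite patchE; case: ifP => // _; rewrite lee_fin powR_ge0.
  - apply/(measurable_restrictT _ mO).1; apply: measurable_funTS; apply/measurable_EFinP.
    exact: (measurableT_comp (measurable_powR _) (measurable_cont cw2)).
  - apply: emeasurable_funD; first exact: measurable_indicE.
    apply: emeasurable_sum => k; apply: emeasurable_funM; first exact: measurable_cst.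
    exact: measurable_indicE.
  move=> x _; rewrite patchE /g; case: ifPn => xO; last first.
    by rewrite adde_ge0// ?lee_fin//; apply: sume_ge0 => k _; rewrite -EFinM lee_fin mulr_ge0// exprn_ge0// ltW.
  under eq_bigr do rewrite -EFinM; rewrite sumEFin -EFinD lee_fin indicE xO/=.
  have q0 : (0 < N%:R / (N%:R - 2) :> R)%R by rewrite divr_gt0// subr_gt0.
  apply: le_trans (powR_levels q0 (sqr_ge0 _) (HM _ (set_mem xO))) _.
  rewrite lerD2l; apply: ler_sum => k _; rewrite ler_wpM2l ?exprn_ge0 ?(ltW Q0)//.
  rewrite indicE; case: (boolP (4 ^+ k < w x ^+ 2)%R) => h; last by rewrite ler0n.
  by rewrite mem_set//; split => //; exact: set_mem.
have gE : \int[mu]_x g x = mu Om + \sum_(k < M) (Q ^+ k.+1)%:E * mu (level Om w k).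
  have t0 k x : 0 <= (Q ^+ k.+1)%:E * (\1_(level Om w k) x : R)%:E.
    by rewrite -EFinM lee_fin mulr_ge0// exprn_ge0// ltW.
  have tm k : measurable_fun setT (fun x : lebT => (Q ^+ k.+1)%:E * (\1_(level Om w k) x : R)%:E).
    by apply: emeasurable_funM; [exact: measurable_cst|exact: measurable_indicE].
  rewrite (@ge0_integralD _ lebT R mu setT measurableT (fun x => (\1_Om x)%:E)
    (fun x => \sum_(k < M) (Q ^+ k.+1)%:E * (\1_(level Om w k) x)%:E)).
  - rewrite (measure_indic mO); congr (_ + _).
    rewrite (@ge0_integral_sum _ lebT R mu setT measurableT _
      (fun (k : 'I_M) x => (Q ^+ k.+1)%:E * (\1_(level Om w k) x : R)%:E))//.
    by apply: eq_bigr => k _; rewrite integral_indicZ// lee_fin exprn_ge0// ltW.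
  - by move=> x _; rewrite lee_fin.
  - exact: measurable_indicE.
  - by move=> x _; apply: sume_ge0.
  - by apply: emeasurable_sum.
rewrite gE -(fineK Vfin) EFinD leeD2lE//.
rewrite EFinM; apply: (@le_trans _ _ (Q%:E * (\sum_(k < M) Q ^+ k * fine (mu (level Om w k)))%:E)).
  rewrite -EFinM mulr_sumr -sumEFin; apply: lee_sum => k _.
  by rewrite -(fineK (Lfin k)) -EFinM lee_fin exprS mulrA.
by apply: lee_wpmul2l; rewrite lee_fin// ltW.
Qed.

End GlobalIsocapacity.

(** * Surface measure of graphs and traces *)

Section ComparePushforward.
Local Open Scope ereal_scope.

Lemma integral_mrestr d (T : measurableType d) (R : realType)
    (m : {measure set T -> \bar R}) (D : set T) (mD : measurable D) (f : T -> \bar R) :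
  measurable_fun setT f -> (forall x, 0 <= f x) ->
  \int[mrestr m mD]_x f x = \int[m]_(x in D) f x.
Proof.
move=> mf f0.
have -> : \int[m]_(x in D) f x = \int[mrestr m mD]_(x in D) f x.
  by apply: eq_measure_integral => A mA AD; rewrite /= /mrestr setIidl.
rewrite (@ge0_negligible_integral _ _ _ (mrestr m mD) setT (~` D))//.
- by rewrite setDE setTI setCK.
- exact: measurableC.
- by rewrite /= /mrestr setICl measure0.
Qed.

(** The integrals are compared through the push-forwards to [Z], so that the measures need to be
    compared only on preimages of measurable sets of [Z]. *)
Lemma le_integral_image d1 d2 d3 (X : measurableType d1) (Y : measurableType d2)
    (Z : measurableType d3) (R : realType)
    (m1 : {measure set X -> \bar R}) (m2 : {measure set Y -> \bar R})
    (K : set X) (P : set Y) (mK : measurable K) (mP : measurable P)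
    (phi1 : X -> Z) (phi2 : Y -> Z) (c : R) (F : Z -> \bar R) :
  measurable_fun setT phi1 -> measurable_fun setT phi2 -> (0 <= c)%R ->
  (forall E, measurable E -> m1 ((phi1 @^-1` E) `&` K) <= c%:E * m2 ((phi2 @^-1` E) `&` P)) ->
  measurable_fun setT F -> (forall z, 0 <= F z) ->
  \int[m1]_(x in K) F (phi1 x) <= c%:E * \int[m2]_(y in P) F (phi2 y).
Proof.
move=> mphi1 mphi2 c0 H mF F0.
rewrite -(integral_mrestr m1 mK (measurableT_comp mF mphi1) (fun x => F0 _)).
rewrite -(integral_mrestr m2 mP (measurableT_comp mF mphi2) (fun x => F0 _)).
have E1 := @ge0_integral_pushforward _ _ _ _ _ _ mphi1 (mrestr m1 mK) setT F measurableT mF (fun z _ => F0 z).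
have E2 := @ge0_integral_pushforward _ _ _ _ _ _ mphi2 (mrestr m2 mP) setT F measurableT mF (fun z _ => F0 z).
rewrite !preimage_setT in E1 E2; rewrite -E1 -E2.
pose q := pushforward_measure (mrestr m2 mP) mphi2.
rewrite -(ge0_integral_mscale q measurableT (NngNum c0) mF (fun z _ => F0 z)).
apply: (@ge0_le_measure_integral _ _ _ (pushforward_measure (mrestr m1 mK) mphi1)
  (mscale (NngNum c0) q)) => //.
Qed.

End ComparePushforward.

Section HausdorffGraph.
Local Open Scope ereal_scope.
Context (R : realType) (n : nat).

Lemma continuous_fprod (T : topologicalType) m (f : 'I_m -> T -> R) :
  (forall i, continuous (f i)) -> continuous (fun t => \prod_i f i t)%R.
Proof.
move=> cf t; elim: m f cf => [|m IH] f cf.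
  by under eq_fun do rewrite big_ord0; exact: cvg_cst.
under eq_fun do rewrite big_ord_recl.
have h1 := cf ord0 t; have h2 := IH (fun i => f (lift ord0 i)) (fun i => cf _).
exact: (continuousM h1 h2).
Qed.

Lemma unit_ball_fin : unit_ball_volume R n < +oo.
Proof.
apply: le_lt_trans (kbox_lty R n 1); apply: le_outer_measure => x /= ex i.
rewrite !mxE -ler_norml; apply: le_trans ex; exact: coord_le_enorm.
Qed.

Definition cell (l : R) (k : 'rV[int]_n) : set 'rV[R]_n :=
  [set x | forall i, ((k 0 i)%:~R * l <= x 0 i < (k 0 i + 1)%:~R * l)%R].

Lemma cell_cover l x : (0 < l)%R -> exists k, cell l k x.
Proof.
move=> l0; exists (\row_i Num.floor (x 0 i / l))%R => i; rewrite !mxE.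
by rewrite -ler_pdivlMr// -ltr_pdivrMr// floor_itv.
Qed.

Lemma cell_disj l k k' x : (0 < l)%R -> cell l k x -> cell l k' x -> k = k'.
Proof.
move=> l0 h h'; apply/rowP => i.
have E (j : 'rV[int]_n) : cell l j x -> (j 0 i = Num.floor (x 0 i / l))%R.
  move=> /(_ i); rewrite -ler_pdivlMr// -ltr_pdivrMr// => hj.
  by apply/esym/floor_def.
by rewrite (E _ h) (E _ h').
Qed.

Lemma measurable_cell l k : measurable (cell l k : set (rvB R n)).
Proof.
rewrite (_ : cell l k = \bigcap_(j in [set: 'I_n]) ((fun x : rvB R n => (x : 'rV[R]_n) 0%R j)
   @^-1` `[((k 0%R j)%:~R * l)%R, ((k 0%R j + 1)%:~R * l)%R[%classic)).
  apply: fin_bigcap_measurable => // j _; rewrite -[X in measurable X]setTI.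
  by apply: measurable_rvB_coord => //; exact: measurable_itv.
apply/seteqP; split=> x /=.
  by move=> h j _ /=; rewrite in_itv/=.
by move=> h j; have := h j I; rewrite /= in_itv.
Qed.

Lemma mu_cell l k : (0 < l)%R -> lebesgue_rV R n (cell l k) = (l ^+ n)%:E.
Proof.
move=> l0; set lo : 'rV[R]_n := (\row_i ((k 0 i)%:~R * l))%R.
have E (e : R) : (0 <= e <= l)%R -> lebesgue_outer (box lo (lo + const_mx e)%R) = (e ^+ n)%:E.
  case/andP => e0 el; rewrite leb_box_; last by move=> i; rewrite !mxE lerDl.
  rewrite -[in RHS](card_ord n) -prodr_const; congr (_%:E); apply: eq_bigr => i _.
  by rewrite [(lo + _)%R _ _]mxE [const_mx e _ _]mxE addrAC subrr add0r.
apply/eqP; rewrite eq_le; apply/andP; split.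
  have ll : (0 <= l <= l)%R by rewrite lexx ltW.
  rewrite -(E l ll); apply: le_outer_measure => x h i.
  have /andP[h1 h2] := h i; rewrite !mxE h1/=; apply: ltW; apply: (lt_le_trans h2).
  by rewrite intrD mulrDl mul1r.
have cX : continuous (fun e : R => e ^+ n)%R by exact: exprn_continuous.
apply/lee_addgt0Pr => eps eps0.
have /cvgrPdist_lt /(_ eps eps0) /nbhs_ballP[r /= r0 Hr] := cX l.
pose e := (l - Num.min (r / 2) (l / 2))%R.
have m0 : (0 < Num.min (r / 2) (l / 2))%R by rewrite lt_min !divr_gt0.
have ml : (Num.min (r / 2) (l / 2) <= l / 2)%R by rewrite ge_min lexx orbT.
have mr : (Num.min (r / 2) (l / 2) <= r / 2)%R by rewrite ge_min lexx.
have el : (0 <= e <= l)%R by apply/andP; rewrite /e; move: m0 ml l0; clear; lra.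
have h : (`|l ^+ n - e ^+ n| < eps)%R.
  apply: Hr; rewrite /ball/= /e opprB addrC subrK gtr0_norm//.
  by move: mr r0; clear; lra.
apply: (@le_trans _ _ (e ^+ n + eps)%:E).
  rewrite lee_fin; have := ler_norm (l ^+ n - e ^+ n)%R; move: h; clear; lra.
rewrite EFinD leeD2r// -(E e el); apply: le_outer_measure => x hx i.
have /andP[] := hx i; rewrite !mxE => -> /=; move/le_lt_trans; apply.
rewrite intrD mulrDl mul1r ltrD2l /e; move: m0; clear; lra.
Qed.

Variables (q : nat) (Psi : 'rV[R]_n -> 'rV[R]_q) (P : set 'rV[R]_n) (L : R).
Hypothesis L0 : (0 < L)%R.
Hypothesis Lip : forall y z (l : R), (0 <= l)%R -> P y -> P z -> (forall j, `|y 0 j - z 0 j| <= l)%R ->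
  (enorm (Psi y - Psi z) <= L * l)%R.

(** The image of a cube of side l has diameter at most L l, hence Hausdorff cost at most vol(B_1) (L
    l / 2)^n. The added 1 makes the constant positive, so that it can be divided by. *)
Definition graph_const : R := (fine (unit_ball_volume R n) * (L / 2) ^+ n + 1)%R.

Lemma graph_const_gt0 : (0 < graph_const)%R.
Proof.
rewrite /graph_const ltr_pwDr// mulr_ge0// ?fine_ge0 ?outer_measure_ge0//.
by rewrite exprn_ge0// divr_ge0// ltW.
Qed.

Lemma cost_cell (delta l : R) k : (0 < l)%R -> (L * l <= delta)%R ->
  cost0 (hausdorff_cost n delta) (Psi @` (P `&` cell l k)) <= (graph_const * l ^+ n)%:E.
Proof.
move=> l0 Ld; have gl : 0 <= (graph_const * l ^+ n)%:E.
  by rewrite lee_fin mulr_ge0// ?exprn_ge0 ?ltW// graph_const_gt0.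
rewrite /cost0; case: ifPn => [//|/set0P ne].
have ed : ediam (Psi @` (P `&` cell l k)) <= (L * l)%:E.
  apply: ge_ereal_sup => _ [_ [y [Py cy] <-] [_ [z [Pz cz] <-] <-]].
  rewrite lee_fin; apply: Lip => //; first exact: ltW.
  move=> j.
  have /andP[y1 y2] := cy j; have /andP[z1 z2] := cz j.
  move: y2 z2; rewrite intrD mulrDl mul1r => y2 z2.
  by rewrite ler_norml; apply/andP; split; move: y1 y2 z1 z2; clear; lra.
rewrite /hausdorff_cost ifT; last by apply: (le_trans ed); rewrite lee_fin.
have ed0 := ediam_ge0 ne.
have U : unit_ball_volume R n \is a fin_num.
  by rewrite ge0_fin_numE ?outer_measure_ge0// unit_ball_fin.
apply: (@le_trans _ _ (unit_ball_volume R n * ((L * l / 2) ^+ n)%:E)).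
  apply: lee_pmul; rewrite ?outer_measure_ge0// ?expe_ge0// ?mule_ge0//.
  rewrite EFin_expe; apply: lee_expe; first by rewrite mule_ge0.
  by rewrite EFinM; apply: lee_pmul.
rewrite -(fineK U) -EFinM lee_fin /graph_const mulrDl mul1r.
rewrite (_ : (L * l / 2) ^+ n = (L / 2) ^+ n * l ^+ n)%R; last first.
  by rewrite -exprMn; congr (_ ^+ n)%R; ring.
by rewrite mulrA lerDl exprn_ge0// ltW.
Qed.

(** The box is covered by the cells of a grid of side l that meet it. These lie in the box enlarged
    by l on every side, and l tends to 0. The cells are half-open, hence disjoint, so that their
    volumes add up. *)
Lemma covering_graph_box (delta : R) (a b : 'rV[R]_n) : (0 < delta)%R ->
  (forall i, a 0 i <= b 0 i)%R ->
  covering_outer (hausdorff_cost n delta) (Psi @` (P `&` box a b)) <=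
  (graph_const * \prod_i (b 0%R i - a 0%R i))%:E.
Proof.
move=> d0 ab; set X := covering_outer _ _.
have X0 : 0 <= X by apply: covering_outer_ge0; exact: hausdorff_cost_ge0.
have main (l : R) : (0 < l)%R -> (L * l <= delta)%R ->
    X <= (graph_const * \prod_i (b 0%R i - a 0%R i + 2 * l))%:E.
  move=> l0 Ld.
  pose C (j : nat) : set 'rV[R]_n := if pickle_inv j is Some k then
    (if cell l k `&` box a b == set0 then set0 else cell l k) else set0.
  have mC j : measurable (C j : set (caratheodory_type (@lebesgue_outer R n))).
    rewrite /C; case: (pickle_inv j) => // k; case: ifP => // _.
    by apply: measurable_rvB_leb; exact: measurable_cell.
  have tC : trivIset setT C.
    apply/trivIsetP => i j _ _ ij; apply/seteqP; split => // x []; rewrite /C.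
    case Ei: (pickle_inv i) => [k|//]; case: ifP => // _ cx.
    case Ej: (pickle_inv j) => [k'|//]; case: ifP => // _ cx'.
    have e := cell_disj l0 cx cx'.
    have := pickle_invK (T := 'rV[int]_n) i; have := pickle_invK (T := 'rV[int]_n) j.
    rewrite Ei Ej /= e => p1 p2; by move: ij; rewrite -p1 -p2 eqxx.
  have cov : Psi @` (P `&` box a b) `<=` \bigcup_j (Psi @` (P `&` C j)).
    move=> _ [y [Py by_] <-]; have [k ck] := cell_cover y l0.
    exists (pickle k) => //; exists y => //; split => //.
    rewrite /C pickleK_inv; case: ifP => // /eqP e.
    by have : (cell l k `&` box a b) y by []; rewrite e.
  have s1 : X <= \sum_(j <oo) cost0 (hausdorff_cost n delta) (Psi @` (P `&` C j)).
    by apply: ereal_inf_lbound; exists (fun j => Psi @` (P `&` C j)).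
  apply: (le_trans s1).
  apply: (@le_trans _ _ (\sum_(j <oo) (graph_const%:E * lebesgue_rV R n (C j)))).
    apply: lee_nneseries => [j _ _|j _]; first by apply: cost0_ge0; exact: hausdorff_cost_ge0.
    rewrite /C; case: (pickle_inv j) => [k|]; last first.
      by rewrite setI0 image_set0 cost0_set0 measure0 mule0.
    case: ifP => _; first by rewrite setI0 image_set0 cost0_set0 measure0 mule0.
    by rewrite mu_cell//; exact: cost_cell.
  rewrite nneseriesZl//; rewrite EFinM; apply: lee_wpmul2l.
    by rewrite lee_fin ltW// graph_const_gt0.
  rewrite -(@measure_semi_bigcup _ _ _ (lebesgue_rV R n) C mC tC (bigcup_measurable (fun j _ => mC j))).
  pose a' : 'rV[R]_n := (a - const_mx l)%R; pose b' : 'rV[R]_n := (b + const_mx l)%R.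
  have aE i : (a' 0 i = a 0 i - l)%R by rewrite /a' !mxE.
  have bE i : (b' 0 i = b 0 i + l)%R by rewrite /b' !mxE.
  have ab' i : (a' 0 i <= b' 0 i)%R.
    by rewrite aE bE lerBlDr -addrA (le_trans (ab i))// lerDl addr_ge0// ltW.
  have -> : (\prod_i (b 0%R i - a 0%R i + 2 * l) = \prod_i (b' 0 i - a' 0 i))%R.
    by apply: eq_bigr => i _; rewrite aE bE; ring.
  rewrite -(leb_box_ ab'); apply: le_outer_measure => x [j _]; rewrite /C.
  case: (pickle_inv j) => [k|//]; case: ifPn => // /set0P [z [cz bz]] cx i.
  have /andP[x1 x2] := cx i; have /andP[z1 z2] := cz i; have /andP[y1 y2] := bz i.
  rewrite aE bE; move: x2 z2; rewrite intrD mulrDl mul1r => x2 z2.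
  by apply/andP; split; lra.
have cG : continuous (fun l : R => graph_const * \prod_i (b 0%R i - a 0%R i + 2 * l))%R.
  apply: contM; first exact: contC.
  apply: continuous_fprod => i; apply: contD; first exact: contC.
  by apply: contM; [exact: contC|move=> ?; exact: cvg_id].
apply/lee_addgt0Pr => eps eps0.
have /cvgrPdist_lt /(_ eps eps0) /nbhs_ballP[r /= r0 Hr] := cG 0%R.
pose l := (Num.min (r / 2) (delta / L))%R.
have l0 : (0 < l)%R by rewrite lt_min !divr_gt0.
have lr : (l <= r / 2)%R by rewrite ge_min lexx.
have lL : (L * l <= delta)%R by rewrite mulrC -ler_pdivlMr// ge_min lexx orbT.
have /Hr /= : ball (0 : R)%R r l.
  by rewrite /ball/= sub0r normrN gtr0_norm//; lra.
rewrite mulr0; under [in X in (_ - X)%R]eq_bigr do rewrite ?addr0.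
move=> h; apply: (le_trans (main l l0 lL)); rewrite -EFinD lee_fin.
move: h; under eq_bigr do rewrite addr0.
rewrite ltr_norml => /andP[h _]; lra.
Qed.

(** For fixed delta, the covering content of the image, divided by [graph_const], is a set function
    to which [le_lebesgue_outer_of_boxes] applies; the supremum over delta follows. *)
Lemma hausdorff_graph :
  hausdorff_outer n (Psi @` P) <= graph_const%:E * lebesgue_outer P.
Proof.
have K0 := graph_const_gt0.
have ki : (0 <= graph_const^-1)%R by rewrite invr_ge0 ltW.
apply: ge_ereal_sup => _ [delta d0 <-].
pose m (A : set 'rV[R]_n) := (graph_const^-1)%:E *
  covering_outer (hausdorff_cost n delta) (Psi @` (P `&` A)).
have c0 X : 0 <= covering_outer (hausdorff_cost n delta) (X : set 'rV[R]_q).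
  by apply: covering_outer_ge0; exact: hausdorff_cost_ge0.
have H : m P <= lebesgue_outer P.
  apply: le_lebesgue_outer_of_boxes.
  - move=> a b ab; have := covering_graph_box d0 ab => h.
    apply: (le_trans (lee_wpmul2l _ h)); first by rewrite lee_fin.
    by rewrite -EFinM mulrA mulVf ?mul1r// gt_eqF.
  - move=> F _ PF; rewrite /m nneseriesZl//; apply: lee_wpmul2l; first by rewrite lee_fin.
    apply: le_trans (covering_outer_sigma_subadditive (@hausdorff_cost_ge0 R n q delta) _).
    apply: le_covering_outer => _ [y [Py _] <-]; have [k _ Fk] := PF y Py.
    by exists k => //; exists y.
  - by rewrite /m setI0 image_set0 covering_outer0 ?mule0//; exact: hausdorff_cost_ge0.
  - by move=> X; rewrite mule_ge0.
move: H; rewrite /m setIid => H.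
have := lee_wpmul2l (_ : 0 <= graph_const%:E) H.
by rewrite muleA -EFinM mulfV ?gt_eqF// mul1e; apply; rewrite lee_fin ltW.
Qed.

End HausdorffGraph.

(** * The trace inequality near a boundary point *)

Section TracePatch.
Context (R : realType) (n : nat).
Local Notation N := n.+1.
Local Notation lebT m := (caratheodory_type (@lebesgue_outer R m)).
Local Notation surT := (caratheodory_type (@hausdorff_outer R N.-1 N)).
Local Notation sur := (surface R N).
Local Notation mu := (lebesgue_rV R N).

Lemma measurable_surface_rvB :
  measurable_fun setT (id : surT -> rvB R N).
Proof. by apply: measurable_caratheodory_rvB => j c; exact: hausdorff_outer_halfspace. Qed.

Lemma measurable_rvB_surface (A : set 'rV[R]_N) :
  measurable (A : set (rvB R N)) -> measurable (A : set surT).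
Proof.
by move=> mA; have := measurable_surface_rvB measurableT mA; rewrite setTI preimage_id.
Qed.

Lemma measurable_boundary (Om : set 'rV[R]_N) : measurable (boundary Om : set (rvB R N)).
Proof.
apply: measurableD; first by apply: rvB_closed; exact: closed_closure.
by apply: rvB_open; exact: open_interior.
Qed.

Lemma enorm_le m (x : 'rV[R]_m) B : 0 <= B -> (forall j, `|x 0 j| <= B) -> enorm x <= m%:R * B.
Proof.
move=> B0 h; have mB : 0 <= m%:R * B by rewrite mulr_ge0.
rewrite -[leRHS](ger0_norm mB) -sqrtr_sqr ler_sqrt ?sqr_ge0//.
case: m x h mB => [|m] x h mB; first by rewrite big_ord0 sqr_ge0.
apply: (@le_trans _ _ (\sum_(i < m.+1) B ^+ 2)).
  by apply: ler_sum => i _; rewrite -real_normK ?num_real// lerXn2r ?nnegrE.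
rewrite sumr_const card_ord -[leLHS]mulr_natl exprMn ler_wpM2r ?sqr_ge0//.
by rewrite -natrX ler_nat leq_pmulr.
Qed.

Lemma insE i (t : R) (y : 'rV[R]_n) : ins i t y = ins i 0 y + t *: delta_mx 0 i.
Proof.
apply/rowP => j; rewrite !mxE eqxx/=; case: (unliftP i j) => [k ->|->].
  by rewrite [lift i k == i]eq_sym (negbTE (neq_lift i k)) mulr0 addr0.
by rewrite eqxx mulr1 add0r.
Qed.

Lemma is_derive_ins (v : 'rV[R]_N -> R) i (y : 'rV[R]_n) (t : R) : Ck 1 v ->
  is_derive t 1 (fun t : R => v (ins i t y)) (partial i v (ins i t y)).
Proof.
move=> Cv; have := C1_is_derive_line (ins i 0 y) (delta_mx 0 i) t Cv.
rewrite (bigD1 i)//= big1 ?addr0; last first.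
  by move=> j ji; rewrite mxE (negbTE ji) andbF mul0r.
rewrite mxE !eqxx mul1r -insE => h.
by rewrite (_ : (fun _ => _) = (fun s : R => v (ins i 0 y + s *: delta_mx 0 i)))//; apply/funext => s; rewrite -insE.
Qed.

Lemma cont_ins (f : 'rV[R]_N -> R) i (y : 'rV[R]_n) : continuous f ->
  continuous (fun t : R => f (ins i t y)).
Proof.
move=> cf; rewrite (_ : (fun _ => _) = (fun s : R => f (ins i 0 y + s *: delta_mx 0 i))).
  exact: cont_on_line.
by apply/funext => s; rewrite -insE.
Qed.

Lemma continuous_rV p (T : topologicalType) (F : T -> 'rV[R]_p) :
  (forall j, continuous (fun t => F t 0 j)) -> continuous F.
Proof.
move=> h t; apply/cvg_ballP => e e0.
have : \forall x \near t, forall j, `|F t 0 j - F x 0 j| < e.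
  by apply: filter_forall => j; have /cvgrPdist_lt := h j t; apply.
by apply: filterS => x hx; apply/ball_rV.
Qed.

(** A boundary point is not in the open set [Om], so it is not strictly above the graph; strictly
    below the graph, a whole neighbourhood would miss [Om]. *)
Lemma boundary_graph (Om : set 'rV[R]_N) x0 r i s gamma : open Om -> Ck 1 gamma ->
  Om `&` ball x0 r = [set x | ball x0 r x /\ gamma (col' i x) < (-1) ^+ s * x 0 i] ->
  forall x, boundary Om x -> ball x0 r x -> gamma (col' i x) = (-1) ^+ s * x 0 i.
Proof.
move=> oOm Cg E x [cx ix] bx.
have nOx : ~ Om x by move: ix; rewrite (interior_id Om).1.
apply/eqP; rewrite eq_le; apply/andP; split; last first.
  rewrite leNgt; apply/negP => h; apply: nOx.
  by have [] : (Om `&` ball x0 r) x by rewrite E.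
rewrite leNgt; apply/negP => h.
have cc : continuous (fun z : 'rV[R]_N => gamma (col' i z) - (-1) ^+ s * z 0 i).
  apply: contB; last by apply: contM; [exact: contC|exact: coord_continuous].
  have c1 : continuous (fun z : 'rV[R]_N => col' i z).
    apply: continuous_rV => j; rewrite (_ : (fun _ => _) = (fun z : 'rV[R]_N => z 0 (lift i j))).
      exact: coord_continuous.
    by apply/funext => z; rewrite mxE.
  by move=> z; apply: continuous_comp; [exact: c1|exact: C1_continuous].
have oU : open [set z : 'rV[R]_N | 0 < gamma (col' i z) - (-1) ^+ s * z 0 i].
  by have := open_comp (fun z _ => cc z) (@open_gt R 0); apply.
have nU : nbhs x ([set z : 'rV[R]_N | 0 < gamma (col' i z) - (-1) ^+ s * z 0 i] `&` ball x0 r).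
  apply: open_nbhs_nbhs; split; first by apply: openI => //; exact: ball_open_rV.
  by split => //=; rewrite subr_gt0.
have [z [Oz [hz bz]]] := cx _ nU.
have : (Om `&` ball x0 r) z by [].
rewrite E => -[_ h2]; move: hz => /=; rewrite subr_gt0 => h3.
by have := lt_trans h2 h3; rewrite ltxx.
Qed.

(** The surface integral is bounded by an integral over the parameter domain [P] of the graph. Over
    each y in [P] the boundary value is bounded by [endpoint_le] on a segment of length rho that
    enters [Om] in direction i, and Tonelli assembles the segments. The factor 4 in rho leaves room
    for segment points, which are within 2 rho of [x0]. *)
Lemma trace_patch (Om : set 'rV[R]_N) x0 (r1 : R) : open Om -> C1_boundary Om ->
  boundary Om x0 -> 0 < r1 ->
  exists r2 C, [/\ 0 < r2, 0 <= C & forall v : 'rV[R]_N -> R, Ck 1 v ->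
    (\int[sur]_(x in boundary Om `&` ball x0 r2) (`|v x|)%:E <=
     C%:E * \int[mu]_(x in Om `&` ball x0 r1) (`|v x| + \sum_i `|partial i v x|)%:E)%E].
Proof.
move=> oOm hC1 bx0 r10; have [r [i [s [gamma [r0 Cg E]]]]] := hC1 _ bx0.
have [de [L [de0 L0 HL]]] := C1_loc_lipschitz (col' i x0) Cg.
pose rho := Num.min (Num.min r de) r1 / 4.
have m0 : 0 < Num.min (Num.min r de) r1 by rewrite !lt_min r0 de0.
have rho0 : 0 < rho by rewrite divr_gt0.
have rr : rho * 4 <= r by rewrite /rho divfK// 2!ge_min lexx.
have rd : rho * 4 <= de by rewrite /rho divfK// 2!ge_min lexx orbT.
have rr1 : rho * 4 <= r1 by rewrite /rho divfK// ge_min lexx orbT.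
set sg : R := (-1) ^+ s.
have sgn1 : `|sg| = 1 by rewrite normrX normrN1 expr1n.
have sgn2 : sg * sg = 1 by rewrite -expr2 sqrr_sign.
pose Psi (y : 'rV[R]_n) : 'rV[R]_N := ins i (sg * gamma y) y.
have cPj j : continuous (fun y => Psi y 0 j).
  case: (unliftP i j) => [k ->|->].
    rewrite (_ : (fun _ => _) = (fun y : 'rV[R]_n => y 0 k)); first exact: coord_continuous.
    by apply/funext => y; exact: ins_lift.
  rewrite (_ : (fun _ => _) = (fun y : 'rV[R]_n => sg * gamma y)).
    by apply: contM; [exact: contC|exact: C1_continuous].
  by apply/funext => y; exact: ins_at.
have cPsi : continuous Psi by exact: continuous_rV.
pose P := [set y : 'rV[R]_n | ball x0 rho (Psi y)].
have oP : open P.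
  by have := open_comp (fun z _ => cPsi z) (@ball_open_rV R N x0 rho); apply.
have mP : measurable (P : set (rvB R n)) by exact: rvB_open.
have Py0 y j : P y -> `|y 0 j - col' i x0 0 j| < rho.
  by move=> /ball_rV[_ /(_ (lift i j))]; rewrite ins_lift distrC mxE.
have Pc y : P y -> `|x0 0 i - sg * gamma y| < rho.
  by move=> /ball_rV[_ /(_ i)]; rewrite ins_at.
pose B := L * n%:R + 1.
have B1 : 1 <= B by rewrite lerDr mulr_ge0// ltW.
have Lip y z (l : R) : 0 <= l -> P y -> P z -> (forall j, `|y 0 j - z 0 j| <= l) ->
    enorm (Psi y - Psi z) <= (N%:R * B) * l.
  move=> l0 Py Pz yz; rewrite -mulrA; have -> : B * l = L * n%:R * l + l by rewrite /B; ring.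
  have Ll0 : 0 <= L * n%:R * l by rewrite mulr_ge0// mulr_ge0// ltW.
  apply: enorm_le => [|j]; first by rewrite addr_ge0.
  have -> : (Psi y - Psi z) 0 j = Psi y 0 j - Psi z 0 j by rewrite !mxE.
  case: (unliftP i j) => [k ->|->].
    by rewrite /Psi !ins_lift; apply: le_trans (yz k) _; rewrite lerDr.
  rewrite /Psi !ins_at -mulrBr normrM sgn1 mul1r.
  have e : z + (y - z) = y by rewrite addrCA subrr addr0.
  rewrite -[X in gamma X - _]e.
  apply: (@le_trans _ _ (L * \sum_j `|(y - z) 0 j|)).
    apply: HL => j'; first by have := Py0 z j' Pz; move: rd rho0; lra.
    rewrite !mxE; have := Py0 y j' Py; have := Py0 z j' Pz.
    rewrite !ltr_norml => /andP[z1 z2] /andP[y1 y2]; apply/andP.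
    by split; move: y1 y2 z1 z2 rd rho0; clear; lra.
  rewrite -mulrA; apply: (@le_trans _ _ (L * (n%:R * l))); last by rewrite lerDl.
  rewrite ler_wpM2l ?(ltW L0)//.
  rewrite [leRHS]mulrC mulr_natr -[X in _ *+ X]card_ord -sumr_const; apply: ler_sum => j' _.
  by rewrite !mxE.
have NB0 : 0 < N%:R * B by rewrite mulr_gt0// (lt_le_trans _ B1).
pose K := @graph_const R n (N%:R * B).
have K0 : 0 < K by exact: graph_const_gt0.
pose S := boundary Om `&` ball x0 rho.
have mS : measurable (S : set surT).
  apply: measurable_rvB_surface; apply: measurableI; first exact: measurable_boundary.
  by apply: rvB_open; exact: ball_open_rV.
have mPsi : measurable_fun setT (Psi : lebT n -> rvB R N).
  apply: measurable_rvB_fun; apply: measurable_to_rvB => j; exact: rvB_continuous (cPj j).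
have step1 (v : 'rV[R]_N -> R) : continuous v ->
    (\int[sur]_(x in S) (`|v x|)%:E <=
     K%:E * \int[lebesgue_rV R n]_(y in P) (`|v (Psi y)|)%:E)%E.
  move=> cv; apply: (@le_integral_image _ _ _ surT (lebT n) (rvB R N) R sur (lebesgue_rV R n)
    S P mS (measurable_rvB_leb mP) id Psi K (fun z => (`|v z|)%:E) measurable_surface_rvB mPsi (ltW K0)).
  - move=> E' mE'; apply: (@le_trans _ _ (hausdorff_outer n (Psi @` ((Psi @^-1` E') `&` P)))).
      apply: le_outer_measure => x [Ex [bx rx]].
      have e : x = Psi (col' i x).
        rewrite /Psi (boundary_graph oOm Cg E bx).
          by rewrite mulrA sgn2 mul1r ins_col'.
        by apply: le_ball rx; move: rr rho0; lra.
      by exists (col' i x) => //; rewrite /= /P/= -e.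
    apply: hausdorff_graph => // y z l l0 [_ Py] [_ Pz]; exact: Lip.
  - by apply/measurable_EFinP; exact: rvB_continuous (cont_norm cv).
  - by move=> z; rewrite lee_fin.
pose A := Om `&` ball x0 r1.
have mA : measurable (A : set (rvB R N)).
  by apply: measurableI; apply: rvB_open => //; exact: ball_open_rV.
exists rho, (K * ((1 + rho) / rho)); split => //.
  by rewrite mulr_ge0 ?(ltW K0)// divr_ge0 ?(ltW rho0)// addr_ge0// ltW.
move=> v Cv; apply: le_trans (step1 v (C1_continuous Cv)) _.
rewrite EFinM -muleA; apply: lee_wpmul2l; first by rewrite lee_fin ltW.
pose W x := `|v x| + \sum_j `|partial j v x|.
have cW : continuous W.
  apply: contD; first exact: (cont_norm (C1_continuous Cv)).
  apply: continuous_fsum => j.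
  exact: (cont_norm (C1_continuous_partial Cv)).
have W0 x : 0 <= W x by rewrite addr_ge0// sumr_ge0.
pose F (x : rvB R N) : \bar R := (\1_A x * ((1 + rho) * W x))%:E.
have F0 x : (0 <= F x)%E by rewrite lee_fin mulr_ge0// mulr_ge0// addr_ge0// ltW.
have mF : measurable_fun setT F.
  apply/measurable_EFinP; apply: measurable_funM; first exact: measurable_indic.
  by apply: measurable_funM => //; exact: rvB_continuous.
have mG : measurable_fun setT (fun y : lebT n => \int[lebesgue_measure]_s F (ins i s y))%E.
  have mi : measurable_fun setT ((fun z => ins i z.2 z.1) : lebT n * measurableTypeR R -> rvB R N).
    apply: measurable_ins; first exact: measurable_snd.
    exact: (measurableT_comp (@measurable_leb_rvB R n) measurable_fst).
  exact: (@measurable_fun_fubini_tonelli_F _ _ _ _ _ lebesgue_measure _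
    (measurableT_comp mF mi) (fun z => F0 _)).
have step2 y : P y -> ((rho * `|v (Psi y)|)%:E <= \int[lebesgue_measure]_s F (ins i s y))%E.
  move=> Py; set c := sg * gamma y.
  (* The orientation s of the chart decides on which side of the boundary height c the domain
     lies. *)
  have [a [b [ab bar cab hab]]] : exists a b : R, [/\ a < b, b - a = rho, c = a \/ c = b &
      forall t, a < t < b -> `|t - c| < rho /\ gamma y < sg * t].
    have gE : gamma y = sg * c by rewrite /c mulrA sgn2 mul1r.
    rewrite gE /sg; clearbody c; case: (s); rewrite ?expr1 ?expr0.
      have e : c - (c - rho) = rho by rewrite opprB addrC subrK.
      exists (c - rho), c; split => //; [by rewrite gtrBl|by right|].
      move=> t /andP[t1 t2]; rewrite !mulN1r ltrN2; split => //.
      by rewrite distrC ger0_norm ?subr_ge0 ?ltW// ltrBlDr addrC -ltrBlDr.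
    have e : c + rho - c = rho by rewrite addrAC subrr add0r.
    exists c, (c + rho); split => //; [by rewrite ltrDl|by left|].
    move=> t /andP[t1 t2]; rewrite !mul1r; split => //.
    by rewrite ger0_norm ?subr_ge0 ?ltW// ltrBlDl.
  have := @endpoint_le R (fun t => v (ins i t y)) (fun t => partial i v (ins i t y)) a b c ab cab
    (fun t => is_derive_ins i y t Cv) (cont_ins (C1_continuous_partial Cv)).
  rewrite bar => /le_trans; apply.
  have cH : continuous (fun t => `|v (ins i t y)| + rho * `|partial i v (ins i t y)|).
    apply: contD; first exact: (cont_norm (cont_ins (C1_continuous Cv))).
    apply: contM; first exact: contC.
    exact: (cont_norm (cont_ins (C1_continuous_partial Cv))).
  have mH D : measurable D -> measurable_fun D (fun t => (`|v (ins i t y)| + rho * `|partial i v (ins i t y)|)%:E).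
    by move=> mD; apply/measurable_EFinP; apply: measurable_funTS; exact: continuous_measurable_fun.
  (* The endpoint c is on the boundary and not in [Om], so the closed interval is replaced by the
     open one. *)
  rewrite integral_itv_bndoo; last by apply: mH.
  have mFy : measurable_fun setT (fun s => F (ins i s y)).
    apply: (measurableT_comp mF).
    exact: (@measurable_ins R n i _ (measurableTypeR R) id (fun=> y) (@measurable_id _ _ _) (@measurable_cst _ _ _ (rvB R n) _ y)).
  apply: (@le_trans _ _ (\int[lebesgue_measure]_(t in `]a, b[) F (ins i t y))%E); last first.
    by apply: ge0_subset_integral => //; exact: measurable_itv.
  apply: ge0_le_integral; first exact: measurable_itv.
  - by move=> t _; rewrite lee_fin addr_ge0// mulr_ge0// ltW.
  - by apply: mH; exact: measurable_itv.
  - by apply: measurable_funTS.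
  - move=> t; rewrite /= in_itv/= => /hab[tc gt].
    have x0t j : `|x0 0 j - ins i t y 0 j| < 2 * rho.
      case: (unliftP i j) => [k ->|->].
        have := Py0 y k Py; rewrite ins_lift mxE distrC => /lt_trans; apply; rewrite ltr_pMl//; exact: ltr1n.
      have -> : x0 0 i - ins i t y 0 i = (x0 0 i - c) + (c - t) by rewrite ins_at addrA subrK.
      apply: (le_lt_trans (ler_normD _ _)); rewrite mulrDl mul1r ltrD//; first exact: Pc.
      by rewrite distrC.
    have bt (q : R) : rho * 4 <= q -> ball x0 q (ins i t y).
      move=> hq; have rq : 2 * rho < q.
        by apply: lt_le_trans hq; rewrite mulrC ltr_pM2l// ltr_nat.
      by apply/ball_rV; split=> [|j]; [apply: lt_trans rq; rewrite mulr_gt0|exact: lt_trans (x0t j) rq].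
    have At : A (ins i t y).
      split; last exact: bt.
      suff : (Om `&` ball x0 r) (ins i t y) by case.
      by rewrite E; split; [exact: bt|rewrite col'_ins ins_at].
    rewrite /F indicE mem_set// mul1r lee_fin /W.
    have h1 : `|partial i v (ins i t y)| <= \sum_j `|partial j v (ins i t y)|.
      by rewrite (bigD1 i)//= lerDl sumr_ge0.
    rewrite mulrDl mul1r; apply: lerD; first by rewrite lerDl sumr_ge0.
    rewrite ler_wpM2l ?(ltW rho0)//; apply: le_trans h1 _; by rewrite lerDr.
have mPl : measurable (P : set (lebT n)) by exact: measurable_rvB_leb.
have m1 : measurable_fun setT (fun z : rvB R N => (`|v z|)%:E).
  by apply/measurable_EFinP; exact: rvB_continuous (cont_norm (C1_continuous Cv)).
have mvP : measurable_fun setT (fun y : lebT n => (`|v (Psi y)|)%:E) := measurableT_comp m1 mPsi.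
have step3 : (rho%:E * \int[lebesgue_rV R n]_(y in P) (`|v (Psi y)|)%:E <=
    (1 + rho)%:E * \int[mu]_(x in A) (W x)%:E)%E.
  have mWl : measurable_fun setT (fun x : lebT N => (W x)%:E) by exact: measurable_contE.
  have E1 := @ge0_integralZl _ (lebT n) R (lebesgue_rV R n) P mPl (fun y => (`|v (Psi y)|)%:E)
    (measurable_funTS mvP) rho%:E (fun y _ => ltac:(by rewrite lee_fin)) (ltac:(by rewrite lee_fin ltW)).
  rewrite -E1.
  have E2 : (\int[mu]_x F x = (1 + rho)%:E * \int[mu]_(x in A) (W x)%:E)%E.
    have E3 := @ge0_integralZl _ (lebT N) R mu A (measurable_rvB_leb mA) (fun y => (W y)%:E)
      (measurable_funTS mWl) (1 + rho)%:E (fun y _ => ltac:(by rewrite lee_fin)) (ltac:(by rewrite lee_fin addr_ge0// ltW)).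
    rewrite -E3 [RHS]integral_mkcond; apply: eq_integral => x _.
    rewrite /F patchE indicE; case: (x \in A); first by rewrite mul1r EFinM.
    by rewrite mul0r.
  rewrite -E2 (@tonelli_ins R n i F mF F0).
  apply: (@le_trans _ _ (\int[lebesgue_rV R n]_(y in P) \int[lebesgue_measure]_s F (ins i s y))%E).
    apply: ge0_le_integral; first exact: mPl.
    - by move=> y _; rewrite -EFinM lee_fin mulr_ge0// ltW.
    - by apply: measurable_funTS; apply: measurable_funeM.
    - exact: measurable_funTS.
    - by move=> y Py; rewrite -EFinM; exact: step2.
  apply: ge0_subset_integral => //; by move=> y _; apply: integral_ge0.
have h0 : (0 <= (rho^-1)%:E)%E by rewrite lee_fin invr_ge0 ltW.
have := lee_wpmul2l h0 step3; rewrite !muleA -!EFinM mulVf ?gt_eqF// mul1e.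
by rewrite [rho^-1 * _]mulrC.
Qed.

End TracePatch.

Section LinearBounds.
Context d (T : measurableType d) (R : realType) (m : {measure set T -> \bar R}).
Variables (D : set T).
Hypothesis mD : measurable D.

Lemma integral_le_lin (f g h : T -> R) (a b : R) :
  measurable_fun D f -> measurable_fun D g -> measurable_fun D h ->
  0 <= a -> 0 <= b ->
  (forall x, D x -> [/\ 0 <= f x, 0 <= g x, 0 <= h x & f x <= a * g x + b * h x]) ->
  (\int[m]_(x in D) (f x)%:E <=
   a%:E * \int[m]_(x in D) (g x)%:E + b%:E * \int[m]_(x in D) (h x)%:E)%E.
Proof.
move=> mf mg mh a0 b0 H.
have g0 x : D x -> (0 <= (g x)%:E)%E by move=> /H[]; rewrite lee_fin.
have h0 x : D x -> (0 <= (h x)%:E)%E by move=> /H[]; rewrite lee_fin.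
have mg' : measurable_fun D (fun x => (g x)%:E) by exact/measurable_EFinP.
have mh' : measurable_fun D (fun x => (h x)%:E) by exact/measurable_EFinP.
have a0' : (0 <= a%:E)%E by rewrite lee_fin.
have b0' : (0 <= b%:E)%E by rewrite lee_fin.
have E1 := @ge0_integralZl _ T R m D mD _ mg' _ g0 a0'.
have E2 := @ge0_integralZl _ T R m D mD _ mh' _ h0 b0'.
rewrite -E1 -E2.
have mag : measurable_fun D (fun x => a%:E * (g x)%:E)%E by exact: measurable_funeM.
have mbh : measurable_fun D (fun x => b%:E * (h x)%:E)%E by exact: measurable_funeM.
have ag0 x : D x -> (0 <= a%:E * (g x)%:E)%E by move=> /g0; exact: mule_ge0.
have bh0 x : D x -> (0 <= b%:E * (h x)%:E)%E by move=> /h0; exact: mule_ge0.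
rewrite -(ge0_integralD m mD ag0 mag bh0 mbh).
apply: ge0_le_integral; first exact: mD.
- by move=> x /H[]; rewrite lee_fin.
- exact/measurable_EFinP.
- exact: emeasurable_funD.
- by move=> x /H[_ _ _]; rewrite -!EFinM -EFinD lee_fin.
Qed.

Lemma integral_leZ (f g : T -> R) (a : R) :
  measurable_fun D f -> measurable_fun D g -> 0 <= a ->
  (forall x, D x -> [/\ 0 <= f x, 0 <= g x & f x <= a * g x]) ->
  (\int[m]_(x in D) (f x)%:E <= a%:E * \int[m]_(x in D) (g x)%:E)%E.
Proof.
move=> mf mg a0 H; have := @integral_le_lin f g g a 0 mf mg mg a0 (lexx 0).
by rewrite mul0e adde0; apply => x /H[f0 g0 fg]; rewrite mul0r addr0.
Qed.

End LinearBounds.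

Section GlobalTrace.
Context (R : realType) (n : nat).
Local Notation N := n.+1.
Local Notation lebT := (caratheodory_type (@lebesgue_outer R N)).
Local Notation surT := (caratheodory_type (@hausdorff_outer R N.-1 N)).
Local Notation sur := (surface R N).
Local Notation mu := (lebesgue_rV R N).

Lemma measurable_cont_sur (f : 'rV[R]_N -> R) : continuous f ->
  measurable_fun setT (f : surT -> R).
Proof.
move=> cf; exact: (measurableT_comp (rvB_continuous cf) (@measurable_surface_rvB R n)).
Qed.

Lemma measurable_boundary_sur (Om : set 'rV[R]_N) : measurable (boundary Om : set surT).
Proof. by apply: measurable_rvB_surface; exact: measurable_boundary. Qed.

Lemma compact_boundary (Om : set 'rV[R]_N) : bounded_set Om -> compact (boundary Om).
Proof.
move=> bOm; apply: (subclosed_compact _ (closure_compact bOm)); last by move=> x [].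
apply: closedI; first exact: closed_closure.
by apply: open_closedC; exact: open_interior.
Qed.

Definition Wdens (v : 'rV[R]_N -> R) x := `|v x| + \sum_i `|partial i v x|.

Lemma Wdens_ge0 v x : 0 <= Wdens v x.
Proof. by rewrite addr_ge0// sumr_ge0. Qed.

Lemma continuous_Wdens v : Ck 1 v -> continuous (Wdens v).
Proof.
move=> Cv; apply: contD; first exact: cont_norm (C1_continuous Cv).
by apply: continuous_fsum => j; exact: cont_norm (C1_continuous_partial Cv).
Qed.

Lemma measurable_open_leb (Om : set 'rV[R]_N) : open Om -> measurable (Om : set lebT).
Proof. by move=> oOm; apply: measurable_rvB_leb; exact: rvB_open. Qed.

Lemma trace_L1 (Om : set 'rV[R]_N) : open Om -> bounded_set Om -> C1_boundary Om ->
  exists2 C, 0 <= C & forall v : 'rV[R]_N -> R, Ck 1 v ->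
    (\int[sur]_(x in boundary Om) (`|v x|)%:E <= C%:E * \int[mu]_(x in Om) (Wdens v x)%:E)%E.
Proof.
move=> oOm bOm hC1.
pose P (C : R) (B : set 'rV[R]_N) := forall v : 'rV[R]_N -> R, Ck 1 v ->
    (\int[sur]_(x in boundary Om `&` B) (`|v x|)%:E <= C%:E * \int[mu]_(x in Om) (Wdens v x)%:E)%E.
pose Q (A : set 'rV[R]_N) := exists B C, [/\ A `<=` B, measurable (B : set (rvB R N)), 0 <= C & P C B].
have mbd := measurable_boundary_sur Om.
have mabs (D : set surT) v : measurable D -> Ck 1 v -> measurable_fun D (fun x : surT => (`|v x|)%:E).
  move=> mD Cv; apply/measurable_EFinP; apply: measurable_funTS.
  exact: measurable_cont_sur (cont_norm (C1_continuous Cv)).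
have [] : Q (boundary Om); last first.
  move=> B [C [BB mB C0 PC]]; exists C => // v Cv.
  by have := PC v Cv; rewrite (setIidl BB).
have I0 v : (0 <= \int[mu]_(x in Om) (Wdens v x)%:E)%E.
  by apply: integral_ge0 => x _; rewrite lee_fin Wdens_ge0.
apply: (compact_local_union (compact_boundary bOm)).
- exists set0, 0; split => // v Cv.
  by rewrite setI0 integral_set0 mul0e.
- move=> A A' [B [C [AB mB C0 PC]]] [B' [C' [AB' mB' C0' PC']]].
  exists (B `|` B'), (C + C'); split; [by move=> x [/AB|/AB']; [left|right]|exact: measurableU|exact: addr_ge0|].
  move=> v Cv; have mS := measurable_rvB_surface mB; have mS' := measurable_rvB_surface mB'.
  have -> : boundary Om `&` (B `|` B') = (boundary Om `&` B) `|` ((boundary Om `&` B') `\` (boundary Om `&` B)).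
    rewrite setIUr; apply/seteqP; split=> x /=.
      have [h|h] := pselect ((boundary Om `&` B) x); first by left.
      by move=> [//|h']; right.
    by move=> [h|[h _]]; [left|right].
  have m1 : measurable (boundary Om `&` B : set surT) by exact: measurableI.
  have m2 : measurable (boundary Om `&` B' : set surT) by exact: measurableI.
  have m3 := measurableD m2 m1.
  rewrite (@ge0_integral_setU _ _ _ sur _ _ m1 m3).
  - rewrite EFinD ge0_muleDl ?lee_fin//; apply: leeD; first exact: PC.
    apply: le_trans (PC' v Cv); apply: (ge0_subset_integral sur m3 m2 (mabs _ _ m2 Cv)).
      by move=> x _; rewrite lee_fin.
    by move=> x [].
  - by apply: mabs => //; exact: measurableU.
  - by move=> x _; rewrite lee_fin.
  - by apply/disj_setPS => x [h [_ ]].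
- move=> A A' AA' [B [C [AB mB C0 PC]]].
  by exists B, C; split => //; exact: subset_trans AB.
- move=> x0 bx0; have [r2 [C [r20 C0 H]]] := trace_patch oOm hC1 bx0 (@ltr01 R).
  exists (ball x0 r2); first exact: nbhsx_ballx.
  exists (ball x0 r2), C; split => //; first by apply: rvB_open; exact: ball_open_rV.
  move=> v Cv; apply: le_trans (H v Cv) _; apply: lee_wpmul2l; first by rewrite lee_fin.
  have m1 : measurable (Om `&` ball x0 1 : set lebT).
    by apply: measurable_open_leb; apply: openI => //; exact: ball_open_rV.
  apply: (ge0_subset_integral mu m1 (measurable_open_leb oOm)
    (measurable_funTS (measurable_contE (continuous_Wdens Cv)))).
    by move=> x _; rewrite lee_fin Wdens_ge0.
  by move=> x [].
Qed.

(** [trace_L1] for the constant 1, together with the finite volume of [Om]. *)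
Lemma surface_boundary_fin (Om : set 'rV[R]_N) : open Om -> bounded_set Om -> C1_boundary Om ->
  (sur (boundary Om) < +oo)%E.
Proof.
move=> oOm bOm hC1; have [C C0 H] := trace_L1 oOm bOm hC1; have [k Ok] := bounded_kbox bOm.
have [C1 P1] := @C1_cst R N 1.
have W1 : Wdens (cst 1) = cst 1.
  apply/funext => x; rewrite /Wdens big1 ?addr0 ?normr1// => i _.
  by rewrite P1 normr0.
have := H _ C1; rewrite W1.
rewrite (_ : (fun x => (`|cst 1 x|)%:E) = cst 1%E); last by apply/funext => x /=; rewrite normr1.
rewrite (@integral_cst _ surT R sur _ (measurable_boundary_sur Om)) mul1e.
have -> : (\int[mu]_(x in Om) (cst 1 x)%:E = mu Om)%E.
  exact: (etrans (@integral_cst _ lebT R mu _ (measurable_open_leb oOm) 1%E) (mul1e _)).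
move=> /le_lt_trans; apply.
have := mu_bounded Ok => h; rewrite -(fineK (_ : mu Om \is a fin_num)) ?ge0_fin_numE//.
by rewrite -EFinM ltry.
Qed.

Lemma Wdens_sqr_le w x : Ck 1 w ->
  Wdens (fun x => w x * w x) x <= (1 + N%:R) * w x ^+ 2 + gsq w x.
Proof.
move=> Cw; have [Cv Pv] := C1M Cw Cw.
apply: (@le_trans _ _ (w x ^+ 2 + \sum_i (w x ^+ 2 + partial i w x ^+ 2))).
  rewrite /Wdens -expr2 ger0_norm ?sqr_ge0// lerD2l; apply: ler_sum => i _; rewrite Pv.
  rewrite -mulrDr normrM.
  have := sqr_ge0 (`|w x| - `|partial i w x|); rewrite sqrrB !real_normK ?num_real// .
  have -> : `|partial i w x + partial i w x| = 2 * `|partial i w x|.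
    by rewrite -mulr2n normrMn mulr_natl.
  move: (`|w x|) (`|partial i w x|) => a b; clear; lra.
by rewrite big_split/= sumr_const card_ord -[(w x ^+ 2) *+ _]mulr_natl -/(gsq w x) addrA mulrDl mul1r.
Qed.

(** [trace_L1] for w^2, with the product |w| |grad w| split into squares. *)
Lemma trace_L2 (Om : set 'rV[R]_N) : open Om -> bounded_set Om -> C1_boundary Om ->
  exists2 C, 0 <= C & forall w : 'rV[R]_N -> R, Ck 1 w ->
    (\int[sur]_(x in boundary Om) (w x ^+ 2)%:E <= C%:E * energy Om w)%E.
Proof.
move=> oOm bOm hC1; have [C C0 H] := trace_L1 oOm bOm hC1.
exists (C * (1 + N%:R)); first by rewrite mulr_ge0// addr_ge0.
move=> w Cw; have [Cv Pv] := C1M Cw Cw.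
have mO := measurable_open_leb oOm.
have -> : (\int[sur]_(x in boundary Om) (w x ^+ 2)%:E =
           \int[sur]_(x in boundary Om) (`|w x * w x|)%:E)%E.
  by apply: eq_integral => x _; rewrite -expr2 ger0_norm ?sqr_ge0.
apply: le_trans (H _ Cv) _; rewrite EFinM -muleA; apply: lee_wpmul2l; first by rewrite lee_fin.
have cw2 : continuous (fun x => gsq w x + w x ^+ 2).
  apply: contD; first exact: continuous_gsq.
  by under eq_fun do rewrite expr2; exact: C1_continuous Cv.
apply: (@integral_leZ _ lebT R mu Om mO (Wdens (fun x => w x * w x)) (fun x => gsq w x + w x ^+ 2)).
- by apply: measurable_funTS; apply: measurable_cont; exact: continuous_Wdens.
- by apply: measurable_funTS; exact: measurable_cont.
- by rewrite addr_ge0.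
move=> x _; split; [exact: Wdens_ge0|by rewrite addr_ge0 ?gsq_ge0 ?sqr_ge0|].
apply: le_trans (Wdens_sqr_le x Cw) _; rewrite mulrDr addrC lerD2r.
by rewrite ler_peMl ?gsq_ge0// lerDl.
Qed.

Lemma le_powR_sum (p t : R) : 1 <= p -> 0 <= t -> (1 + t) `^ p <= 2 `^ p * (1 + t `^ p).
Proof.
move=> p1 t0; have p0 : 0 <= p by lra.
have [t1|t1] := leP t 1.
  rewrite -[leLHS]mulr1; apply: ler_pM; rewrite ?powR_ge0// ?lerDl ?powR_ge0//.
  by apply: ge0_ler_powR; rewrite ?nnegrE//; lra.
apply: (@le_trans _ _ ((2 * t) `^ p)).
  by apply: ge0_ler_powR; rewrite ?nnegrE//; lra.
by rewrite powRM ?(ltW (lt_trans _ t1))// ler_wpM2l ?powR_ge0// lerDr.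
Qed.

(** [trace_L1] for (1 + w^2)^h, where 2 h is the exponent of the claim; adding 1 makes the power
    smooth at w = 0. Young's inequality splits |w|^(2h-1) |grad w| into |grad w|^2 and
    |w|^(2(2h-1)), and 2 h - 1 = N/(N-2) makes the latter the power controlled by [sobolev]. *)
Lemma trace_power (Om : set 'rV[R]_N) : (2 < N)%N -> open Om -> bounded_set Om -> C1_boundary Om ->
  exists2 C, 0 <= C & forall w : 'rV[R]_N -> R, Ck 1 w -> (energy Om w <= 1)%E ->
    (\int[sur]_(x in boundary Om) (`|w x| `^ (2 * (N%:R - 1) / (N%:R - 2)))%:E <= C%:E)%E.
Proof.
move=> hN oOm bOm hC1; have [C C0 H] := trace_L1 oOm bOm hC1.
have [S S0 HS] := sobolev hN oOm bOm hC1; have [k Ok] := bounded_kbox bOm.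
have mO := measurable_open_leb oOm.
have N2 : 0 < N%:R - 2 :> R by rewrite subr_gt0 ltr_nat.
pose p : R := N%:R / (N%:R - 2).
pose h : R := (N%:R - 1) / (N%:R - 2).
have hp : 2 * h - 1 = p by rewrite /h /p; move: (N%:R : R) N2 => M M2; field; exact: lt0r_neq0.
have h1 : 1 <= h by rewrite /h ler_pdivlMr// mul1r lerD2l lerN2; exact: ler1n.
have p1 : 1 <= p by rewrite -hp; lra.
pose V := fine (mu Om).
have Vfin : (mu Om = V%:E)%E by rewrite fineK// ge0_fin_numE// (mu_bounded Ok).
have V0 : 0 <= V by rewrite fine_ge0.
pose K := (1 + N%:R * h) * 2 `^ p.
have K0 : 0 <= K by rewrite mulr_ge0 ?powR_ge0// addr_ge0// mulr_ge0// (le_trans ler01).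
exists (C * (K * (V + S) + h)).
  by rewrite mulr_ge0// addr_ge0 ?(le_trans ler01 h1)// mulr_ge0// addr_ge0.
move=> w Cw ew.
pose T (t : R) := (1 + t ^+ 2) `^ h.
pose T' (t : R) := h * (1 + t ^+ 2) `^ (h - 1) * (2 * t).
have pos (t : R) : 0 < 1 + t ^+ 2 by rewrite ltr_pwDl// sqr_ge0.
have dT (t : R) : is_derive t 1 T (T' t).
  rewrite /T /T'.
  have d1 : is_derive t 1 (fun t : R => (1 + t ^+ 2 : R)) (2 * t).
    have dM := @is_deriveM R _ id id t 1 1 1 (is_derive_id _ _) (is_derive_id _ _).
    have := @is_deriveD R _ _ (cst (1 : R)) _ t 1 _ _ (is_derive_cst _ _ _) dM.
    by congr is_derive; rewrite /GRing.scale/= ?add0r; ring.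
  have d2 := is_derive1_powR h (pos t).
  have := @is_derive1_comp _ (fun s : R => s `^ h) (fun t : R => 1 + t ^+ 2) t _ _ d2 d1.
  by move=> X; apply: (is_derive_eq X); rewrite mulrC.
have cT' : continuous T'.
  have c2 : continuous (fun t : R => 1 + t ^+ 2).
    by apply: contD; [exact: contC|exact: exprn_continuous].
  apply: contM; last by apply: contM; [exact: contC|move=> ?; exact: cvg_id].
  apply: contM; first exact: contC.
  move=> t; apply: (@continuous_comp _ _ _ (fun t : R => 1 + t ^+ 2) (fun s : R => s `^ (h - 1))).
    exact: c2.
  have := @is_derive1_powR _ (h - 1) _ (pos t) => D.
  by apply: differentiable_continuous; apply/derivable1_diffP; case: D.
have [Cv Pv] := C1_comp Cw dT cT'.
have sE : 2 * (N%:R - 1) / (N%:R - 2) = 2 * h by rewrite /h mulrA.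
apply: (@le_trans _ _ (\int[sur]_(x in boundary Om) (`|T (w x)|)%:E)%E).
  have := @integral_leZ _ surT R sur (boundary Om) (measurable_boundary_sur Om)
    (fun x => `|w x| `^ (2 * (N%:R - 1) / (N%:R - 2))) (fun x => `|T (w x)|) 1.
  rewrite mul1e => Hle; apply: Hle.
  - apply: measurable_funTS.
    exact: (measurableT_comp (measurable_powR _) (measurable_cont_sur (cont_norm (C1_continuous Cw)))).
  - apply: measurable_funTS.
    exact: measurable_cont_sur (cont_norm (C1_continuous Cv)).
  - exact: ler01.
  - move=> x _; rewrite powR_ge0 normr_ge0 mul1r; split => //.
    rewrite (ger0_norm (powR_ge0 _ _ : 0 <= T (w x))) sE powRrM.
    apply: ge0_ler_powR; rewrite ?nnegrE ?powR_ge0 ?(ltW (pos _))//; first exact: le_trans h1.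
    by rewrite powR_mulrn// real_normK ?num_real// lerDr.
apply: le_trans (H _ Cv) _; rewrite [leRHS]EFinM; apply: lee_wpmul2l; first by rewrite lee_fin.
pose g1 (x : 'rV[R]_N) : R := 1 + (w x ^+ 2) `^ p.
have cw2 : continuous (fun x => w x ^+ 2).
  by under eq_fun do rewrite expr2; apply: contM; exact: C1_continuous.
have mp : measurable_fun setT (fun x : lebT => (w x ^+ 2) `^ p).
  exact: (measurableT_comp (measurable_powR _) (measurable_cont cw2)).
have B1 := @integral_le_lin _ lebT R mu Om mO (Wdens (fun x => T (w x))) g1 (fun x => gsq w x + w x ^+ 2) K h
  (measurable_funTS (measurable_cont (continuous_Wdens Cv)))
  (measurable_funTS (measurable_funD (measurable_cst _) mp))
  (measurable_funTS (measurable_cont (contD (continuous_gsq Cw) cw2))) K0 (le_trans ler01 h1).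
apply: le_trans (B1 _) _; last first.
  rewrite [leRHS]EFinD; apply: leeD; last first.
    by rewrite -[leRHS]mule1; apply: lee_wpmul2l => //; rewrite lee_fin (le_trans ler01).
  rewrite [leRHS]EFinM; apply: lee_wpmul2l; first by rewrite lee_fin.
  have := @integral_le_lin _ lebT R mu Om mO g1 (cst 1) (fun x => (w x ^+ 2) `^ p) 1 1.
  have -> : (\int[mu]_(x in Om) (cst 1 x)%:E = V%:E)%E.
    by rewrite -Vfin; exact: (etrans (@integral_cst _ lebT R mu _ mO 1%E) (mul1e _)).
  rewrite !mul1e => /(_ _ _ _ _ _ _)/le_trans; apply.
  - exact: measurable_funTS (measurable_funD (measurable_cst _) mp).
  - exact: measurable_cst.
  - exact: measurable_funTS.
  - by [].
  - by [].
  - move=> x _; rewrite /g1 !mul1r; split => //; rewrite ?addr_ge0 ?powR_ge0//.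
  - rewrite [leRHS]EFinD; apply: leeD => //; exact: HS.
move=> x _; split; [exact: Wdens_ge0|by rewrite addr_ge0 ?powR_ge0|by rewrite addr_ge0 ?gsq_ge0 ?sqr_ge0|].
clearbody h p; set q := 1 + w x ^+ 2; have q1 : 1 <= q by rewrite lerDl sqr_ge0.
have q0 : 0 < q by apply: lt_le_trans q1.
have Tp : T (w x) <= q `^ p by rewrite /T -/q; apply: ler_powR => //; rewrite -hp; lra.
have Pi i : `|partial i (fun x => T (w x)) x| <= h * q `^ p + h * partial i w x ^+ 2.
  rewrite Pv /T' -/q.
  have h0 : 0 <= h by apply: le_trans h1.
  rewrite !normrM (ger0_norm (powR_ge0 q (h - 1))) (ger0_norm h0) normr_nat.
  have e1 : `|w x| <= q `^ (1/2).
    rewrite -ler_sqr ?nnegrE ?powR_ge0// real_normK ?num_real//.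
    by rewrite -[leRHS]powR_mulrn ?powR_ge0// -powRrM (_ : 1/2 * 2%:R = 1); [rewrite powRr1 ?(ltW q0)// lerDr|field].
  have e2 : q `^ (h - 1) * `|w x| <= q `^ (p / 2).
    apply: (@le_trans _ _ (q `^ (h - 1) * q `^ (1/2))); first by rewrite ler_wpM2l ?powR_ge0.
    rewrite -powRD ?(gt_eqF q0) ?implybT// (_ : h - 1 + 1/2 = p / 2)//.
    by rewrite -hp; lra.
  have e3 : (q `^ (p/2)) ^+ 2 = q `^ p.
    by rewrite -[LHS]powR_mulrn ?powR_ge0// -powRrM; congr (_ `^ _); field.
  rewrite -mulrDr -!mulrA ler_wpM2l//.
  have := normr_ge0 (partial i w x); have := real_normK (num_real (partial i w x)).
  have := sqr_ge0 (q `^ (p/2) - `|partial i w x|).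
  rewrite -e3; move: e2; move: (q `^ (h-1)) (`|w x|) (q `^ (p/2)) (`|partial i w x|) (partial i w x) => a b c e f; clear; nra.
rewrite /Wdens (ger0_norm (powR_ge0 _ _)).
apply: (@le_trans _ _ (q `^ p + \sum_(i < N) (h * q `^ p + h * partial i w x ^+ 2))).
  by apply: lerD => //; apply: ler_sum.
rewrite big_split/= sumr_const card_ord -mulr_natl -mulr_sumr -/(gsq w x).
have := le_powR_sum p1 (sqr_ge0 (w x)); rewrite -/q -/(g1 x) => q2.
have hw : 0 <= h * w x ^+ 2 by rewrite mulr_ge0 ?sqr_ge0// (le_trans ler01).
have -> : K * g1 x = (1 + N%:R * h) * (2 `^ p * g1 x) by rewrite /K mulrA.
have : (1 + N%:R * h) * q `^ p <= (1 + N%:R * h) * (2 `^ p * g1 x).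
  by rewrite ler_wpM2l// addr_ge0// mulr_ge0// (le_trans ler01).
move: (q `^ p) (2 `^ p * g1 x) (gsq w x) hw => a b c; clear; lra.
Qed.

End GlobalTrace.

(** * A Poincare inequality *)

Section ShiftSquares.
Local Open Scope ereal_scope.
Context (R : realType) (n : nat).
Local Notation lebT := (caratheodory_type (@lebesgue_outer R n)).
Local Notation mu := (lebesgue_rV R n).

Lemma integral_shift_le (F : 'rV[R]_n -> \bar R) (h : 'rV[R]_n) (A B : set 'rV[R]_n) :
  measurable_fun setT (F : lebT -> \bar R) -> (forall x, 0 <= F x) ->
  measurable (A : set lebT) -> measurable (B : set lebT) ->
  (forall x, A x -> B (x + h)%R) ->
  \int[mu]_(x in A) F (x + h)%R <= \int[mu]_(x in B) F x.
Proof.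
move=> mF F0 mA mB AB.
pose FB : lebT -> \bar R := F \_ B.
have mFB : measurable_fun setT FB.
  by apply/(measurable_restrictT _ mB).1; exact: measurable_funTS.
have FB0 x : 0 <= FB x by rewrite /FB patchE; case: ifP.
have mFh : measurable_fun setT (fun x : lebT => F (x + h)%R).
  exact: (measurableT_comp mF (@measurable_shift R n h)).
rewrite [leRHS]integral_mkcond -/FB -(integral_translate h mFB FB0) [leLHS]integral_mkcond.
apply: ge0_le_integral; first exact: measurableT.
- by move=> x _; rewrite patchE; case: ifP.
- by apply/(measurable_restrictT _ mA).1; exact: measurable_funTS.
- exact: (measurableT_comp mFB (@measurable_shift R n h)).
- move=> x _; rewrite /FB !patchE; case: ifPn => [/set_mem/AB Bx|_]; first by rewrite mem_set.
  by case: ifP.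
Qed.

Lemma translation_gsq w (h : 'rV[R]_n) (H : R) (A Om : set 'rV[R]_n) : Ck 1 w ->
  measurable (A : set lebT) -> measurable (Om : set (rvB R n)) ->
  (forall x s, A x -> (0 <= s <= 1)%R -> Om (x + s *: h)%R) ->
  (forall i, `|h 0%R i| <= H)%R ->
  \int[mu]_(x in A) ((w (x + h) - w x) ^+ 2)%:E <=
  (n%:R * H ^+ 2)%:E * \int[mu]_(x in Om) (gsq w x)%:E.
Proof.
move=> Cw mA mOm hA hH; apply: le_trans (translation_estimate Cw mA mOm hA) _.
have cD : continuous (fun y => \sum_i h 0 i * partial i w y)%R.
  apply: continuous_fsum => i; apply: contM; first exact: contC.
  exact: C1_continuous_partial.
apply: (@integral_leZ _ lebT R mu Om (measurable_rvB_leb mOm)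
  (fun x => (\sum_i h 0 i * partial i w x) ^+ 2)%R (gsq w)).
- by apply: measurable_funTS; apply: measurable_funX; exact: measurable_cont.
- by apply: measurable_funTS; apply: measurable_cont; exact: continuous_gsq.
- by rewrite mulr_ge0// sqr_ge0.
- by move=> x _; split; [exact: sqr_ge0|exact: gsq_ge0|exact: sqr_sum_le].
Qed.

Lemma shift_sqr w (h : 'rV[R]_n) (H : R) (A B Om : set 'rV[R]_n) : Ck 1 w ->
  measurable (A : set lebT) -> measurable (B : set lebT) -> measurable (Om : set (rvB R n)) ->
  (forall x s, A x -> (0 <= s <= 1)%R -> Om (x + s *: h)%R) ->
  (forall x, A x -> B (x + h)%R) -> (forall i, `|h 0%R i| <= H)%R ->
  \int[mu]_(x in A) (w x ^+ 2)%:E <=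
  2%:E * \int[mu]_(x in B) (w x ^+ 2)%:E + (2 * (n%:R * H ^+ 2))%:E * \int[mu]_(x in Om) (gsq w x)%:E.
Proof.
move=> Cw mA mB mOm hA AB hH.
have mw := measurable_cont (C1_continuous Cw).
have mw2 : measurable_fun setT (fun x : lebT => w x ^+ 2)%R by exact: measurable_funX.
have mwh : measurable_fun setT (fun x : lebT => w (x + h))%R.
  exact: (measurableT_comp mw (@measurable_shift R n h)).
have := @integral_le_lin _ lebT R mu A mA (fun x => w x ^+ 2)%R (fun x => w (x + h) ^+ 2)%R
  (fun x => (w (x + h) - w x) ^+ 2)%R 2 2 (measurable_funTS mw2)
  (measurable_funTS (measurable_funX 2 mwh))
  (measurable_funTS (measurable_funX 2 (measurable_funB mwh mw))) (ler0n _ 2) (ler0n _ 2).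
move=> Hle; apply: le_trans (Hle _) _.
  move=> x _; rewrite !sqr_ge0; split => //.
  have := sqr_ge0 (w (x + h)%R + (w (x + h)%R - w x))%R; move: (w (x+h)%R) (w x) => a b; clear; nra.
apply: leeD.
  apply: lee_wpmul2l; first by rewrite lee_fin.
  apply: (@integral_shift_le (fun x => (w x ^+ 2)%:E) h A B _ _ mA mB AB).
    exact/measurable_EFinP.
  by move=> x; rewrite lee_fin sqr_ge0.
rewrite EFinM -muleA; apply: lee_wpmul2l; first by rewrite lee_fin.
exact: translation_gsq.
Qed.

Lemma mu_ball_fin (z : 'rV[R]_n) s : mu (ball z s) < +oo.
Proof.
have ab i : ((z - const_mx `|s|)%R 0 i <= (z + const_mx `|s|)%R 0 i)%R.
  by rewrite !mxE lerD2l; have := normr_ge0 s; lra.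
apply: (@le_lt_trans _ _ (mu (box (z - const_mx `|s|)%R (z + const_mx `|s|)%R))).
  apply: le_outer_measure => x /ball_rV[s0 h] i; rewrite !mxE (gtr0_norm s0).
  by have := h i; rewrite ltr_norml => /andP[h1 h2]; apply/andP; split; lra.
by rewrite (mu_box ab) ltry.
Qed.

Lemma mu_ball_gt0 (z : 'rV[R]_n) s : (0 < s)%R -> 0 < mu (ball z s).
Proof.
move=> s0.
have ab i : ((z - const_mx (s/2))%R 0 i <= (z + const_mx (s/2))%R 0 i)%R.
  by rewrite !mxE lerD2l; lra.
apply: (@lt_le_trans _ _ (mu (box (z - const_mx (s/2))%R (z + const_mx (s/2))%R))).
  rewrite (mu_box ab) lte_fin prodr_gt0// => i _; rewrite !mxE; lra.
apply: le_outer_measure => x h; apply/ball_rV; split=> // i; have := h i.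
by rewrite !mxE ltr_norml => /andP[h1 h2]; apply/andP; split; lra.
Qed.

Lemma ball_segment (z x h : 'rV[R]_n) (r s : R) : ball z r x -> ball z r (x + h)%R ->
  (0 <= s <= 1)%R -> ball z r (x + s *: h)%R.
Proof.
move=> /ball_rV[r0 h1] /ball_rV[_ h2] /andP[s0 s1]; apply/ball_rV; split => // j.
have -> : (z 0 j - (x + s *: h) 0 j = (1 - s) * (z 0 j - x 0 j) + s * (z 0 j - (x + h) 0 j))%R.
  by rewrite !mxE; ring.
pose m := Num.max `|z 0 j - x 0 j|%R `|z 0 j - (x + h) 0 j|%R.
have mr : (m < r)%R by rewrite gt_max h1 h2.
apply: le_lt_trans mr; apply: (le_trans (ler_normD _ _)).
have -> : (m = (1 - s) * m + s * m)%R by ring.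
rewrite !normrM (ger0_norm s0) ger0_norm ?subr_ge0//.
by apply: lerD; rewrite ler_wpM2l ?subr_ge0// /m le_max lexx ?orbT.
Qed.

(* Averaging over [y] turns the double integral of [(w x - w y)^2] into an
   integral over the shifts [h = x - y], each bounded by the gradient. *)
Lemma poincare_point (z : 'rV[R]_n) (s : R) : (0 < s)%R -> exists2 K : R, (0 <= K)%R &
  forall w (d : R), Ck 1 w -> (0 < d)%R -> exists2 y, ball z s y &
  \int[mu]_(x in ball z s) ((w x - w y) ^+ 2)%:E <=
  K%:E * \int[mu]_(x in ball z s) (gsq w x)%:E + d%:E.
Proof.
move=> s0; set Z : set 'rV[R]_n := ball z s; pose H : set 'rV[R]_n := ball (0%R : 'rV[R]_n) (2 * s).
have mZB : measurable (Z : set (rvB R n)) by apply: rvB_open; exact: ball_open_rV.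
have mHB : measurable (H : set (rvB R n)) by apply: rvB_open; exact: ball_open_rV.
have mZ := measurable_rvB_leb mZB; have mH := measurable_rvB_leb mHB.
pose V := fine (mu Z); pose VH := fine (mu H).
have VE : mu Z = V%:E by rewrite fineK// ge0_fin_numE// mu_ball_fin.
have VHE : mu H = VH%:E by rewrite fineK// ge0_fin_numE// mu_ball_fin.
have V0 : (0 < V)%R by rewrite -lte_fin -VE mu_ball_gt0.
have VH0 : (0 <= VH)%R by rewrite fine_ge0.
pose c := (n%:R * (2 * s) ^+ 2)%R.
have c0 : (0 <= c)%R by rewrite mulr_ge0// sqr_ge0.
exists (c * VH / V)%R; first by rewrite divr_ge0 ?mulr_ge0// ltW.
move=> w d Cw d0; set M := \int[mu]_(x in Z) (gsq w x)%:E.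
have M0 : 0 <= M by apply: integral_ge0 => x _; rewrite lee_fin gsq_ge0.
have cw := C1_continuous Cw.
apply: contrapT => nex.
have big y : Z y -> (c * VH / V)%:E * M + d%:E <= \int[mu]_(x in Z) ((w x - w y) ^+ 2)%:E.
  by move=> Zy; rewrite leNgt; apply/negP => /ltW h; apply: nex; exists y.
(* The final comparison cancels a multiple of M, so M must be finite: the gradient is continuous,
   hence bounded on the ball. *)
have Mfin : M \is a fin_num.
  rewrite ge0_fin_numE// ltNge leye_eq; apply/negP => /eqP Moo.
  have [K Kb] : exists K : R, forall x, Z x -> (gsq w x <= K)%R.
    have [k Zk] : exists k, Z `<=` @kbox R n k.
      exists (Num.truncn (enorm z + s)%R).+1 => x /ball_rV[_ h] i.
      rewrite !mxE -ler_norml; have := h i; have := coord_le_enorm z i => h1 h2.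
      apply: (@le_trans _ _ (enorm z + s)%R).
        have -> : x 0%R i = (z 0%R i - (z 0%R i - x 0%R i))%R by rewrite opprB addrC subrK.
        apply: (le_trans (ler_normB _ _)); apply: lerD => //; exact: ltW.
      exact/ltW/truncnS_gt.
    have cpt : compact (gsq w @` @kbox R n k).
      apply: continuous_compact; last exact: kbox_compact.
      exact: continuous_subspaceT (continuous_gsq Cw).
    have [b [_ Hb]] := compact_bounded cpt; exists (`|b| + 1)%R => x Zx.
    apply: le_trans (ler_norm _) _; apply: (Hb (`|b| + 1)%R); last by exists x => //; exact: Zk.
    by rewrite ltr_pwDr// ler_norm.
  have : M <= K%:E * mu Z.
    rewrite -(@integral_cst _ lebT R mu _ mZ K%:E); apply: ge0_le_integral; first exact: mZ.
    - by move=> x _; rewrite lee_fin gsq_ge0.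
    - by apply: measurable_funTS; apply: measurable_contE; exact: continuous_gsq.
    - exact: measurable_cst.
    - by move=> x Zx; rewrite lee_fin Kb.
  by rewrite Moo VE -EFinM leye_eq.
pose Kf (p : lebT * lebT) : \bar R :=
  (\1_Z p.1 * \1_Z (p.1 + p.2)%R * (w (p.1 + p.2)%R - w p.1) ^+ 2)%:E.
have mfst : measurable_fun setT (fst : lebT * lebT -> rvB R n).
  exact: (measurableT_comp (@measurable_leb_rvB R n) measurable_fst).
have madd : measurable_fun setT ((fun z => z.1 + z.2)%R : lebT * lebT -> rvB R n).
  apply: measurable_to_rvB => j; under eq_fun do rewrite !mxE.
  apply: measurable_funD.
    exact: (measurableT_comp (@measurable_rvB_coord R n j) mfst).
  exact: (measurableT_comp (@measurable_rvB_coord R n j)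
      (measurableT_comp (@measurable_leb_rvB R n) measurable_snd)).
have mK : measurable_fun setT Kf.
  apply/measurable_EFinP; apply: measurable_funM; first apply: measurable_funM.
  - exact: (measurable_indic_comp mZB mfst).
  - exact: (measurable_indic_comp mZB madd).
  - apply: measurable_funX; apply: measurable_funB.
      exact: (measurableT_comp (rvB_continuous cw) madd).
    exact: (measurableT_comp (rvB_continuous cw) mfst).
have K0 p : 0 <= Kf p by rewrite lee_fin mulr_ge0 ?sqr_ge0// mulr_ge0.
have up : \int[mu]_h \int[mu]_y Kf (y, h) <= (c%:E * M) * mu H.
  have cM0 : 0 <= c%:E * M by rewrite mule_ge0.
  rewrite -(integral_indicZ cM0 mH).
  apply: ge0_le_integral; first exact: measurableT.
  - by move=> h _; apply: integral_ge0.
  - exact: (@measurable_fun_fubini_tonelli_G _ _ _ _ _ (lebS R n) Kf mK K0).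
  - by apply: emeasurable_funM; [exact: measurable_cst|exact: measurable_indicE].
  move=> h _.
  have mZh : measurable ([set y | Z (y + h)%R] : set lebT).
    by apply: measurable_rvB_leb; exact: measurable_shiftB.
  have mI : measurable (Z `&` [set y | Z (y + h)%R] : set lebT) by exact: measurableI.
  have -> : \int[mu]_y Kf (y, h) =
      \int[mu]_(y in Z `&` [set y | Z (y + h)%R]) ((w (y + h) - w y) ^+ 2)%:E.
    rewrite [RHS]integral_mkcond; apply: eq_integral => y _; rewrite patchE /Kf/= in_setI !indicE.
    case: (boolP (y \in Z)) => _ /=; last by rewrite !mul0r.
    case: (boolP (y \in _)) => [/set_mem/= h1|h1]; first by rewrite mem_set// !mul1r.
    by rewrite memNset ?mulr0 ?mul0r// => h2; move/negP: h1; apply; exact: mem_set.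
  rewrite indicE; case: (boolP (h \in H)) => hH; rewrite [nat_of_bool _]/=; last first.
    have -> : Z `&` [set y | Z (y + h)%R] = set0.
      apply/seteqP; split => // y [Zy Zyh].
      move/negP: hH; apply; apply/mem_set/ball_rV; split; first by rewrite mulr_gt0.
      move=> j; move/ball_rV: Zy => [_ /(_ j)]; move/ball_rV: Zyh => [_ /(_ j)].
      rewrite !mxE sub0r normrN !ltr_norml => /andP[a1 a2] /andP[b1 b2].
      by apply/andP; split; lra.
    by rewrite integral_set0 mule0.
  rewrite mule1; apply: translation_gsq => //.
    by move=> y t [Zy Zyh] t01; exact: ball_segment.
  move/set_mem/ball_rV: hH => [_ hH] i.
  by have := hH i; rewrite mxE sub0r normrN => /ltW.
have low : ((c * VH / V)%:E * M + d%:E) * mu Z <= \int[mu]_h \int[mu]_y Kf (y, h).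
  rewrite -tonelli_leb//.
  have B0 : 0 <= (c * VH / V)%:E * M + d%:E.
    by rewrite adde_ge0 ?lee_fin ?(ltW d0)// mule_ge0 ?lee_fin// divr_ge0 ?mulr_ge0// ltW.
  rewrite -(integral_indicZ B0 mZ).
  apply: ge0_le_integral; first exact: measurableT.
  - by move=> y _; rewrite mule_ge0// lee_fin.
  - by apply: emeasurable_funM; [exact: measurable_cst|exact: measurable_indicE].
  - exact: (@measurable_fun_fubini_tonelli_F _ _ _ _ _ (lebS R n) Kf mK K0).
  move=> y _; rewrite indicE; case: (boolP (y \in Z)) => Zy; rewrite [nat_of_bool _]/=; last first.
    by rewrite mule0; apply: integral_ge0.
  rewrite mule1; apply: le_trans (big y (set_mem Zy)) _.
  have -> : \int[mu]_(x in Z) ((w x - w y) ^+ 2)%:E = \int[mu]_(x in Z) Kf (y, x + (- y))%R.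
    apply: eq_integral => x Zx; rewrite /Kf/= [(y + _)%R]addrC subrK !indicE Zy Zx.
    by rewrite !mul1r.
  exact: (@integral_shift_le (fun h => Kf (y, h)) (- y)%R Z setT
    (measurableT_comp mK (measurable_pair1 y)) (fun h => K0 _) mZ measurableT (fun _ _ => I)).
have := le_trans low up; rewrite VE VHE -(fineK Mfin); move: (fine M) => M' h.
have {h} : (((c * VH / V) * M' + d) * V)%:E <= ((c * M') * VH)%:E := h.
rewrite lee_fin mulrDl.
have -> : (c * VH / V * M' * V = c * M' * VH)%R by field; rewrite gt_eqF.
by rewrite gerDl leNgt mulr_gt0.
Qed.

End ShiftSquares.

Lemma integral_le_linR d (T : measurableType d) (R : realType) (m : {measure set T -> \bar R})
    (D : set T) (f g h : T -> R) (a b p q : R) : measurable D ->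
  measurable_fun D f -> measurable_fun D g -> measurable_fun D h ->
  0 <= a -> 0 <= b ->
  (forall x, D x -> [/\ 0 <= f x, 0 <= g x, 0 <= h x & f x <= a * g x + b * h x]) ->
  (\int[m]_(x in D) (g x)%:E <= p%:E -> \int[m]_(x in D) (h x)%:E <= q%:E ->
  \int[m]_(x in D) (f x)%:E <= (a * p + b * q)%:E)%E.
Proof.
move=> mD mf mg mh a0 b0 H gp hq.
apply: le_trans (integral_le_lin m mD mf mg mh a0 b0 H) _.
by rewrite EFinD 2!EFinM; apply: leeD; apply: lee_wpmul2l; rewrite ?lee_fin.
Qed.

Section AlmostEverywhere.
Context d (T : measurableType d) (R : realType) (m : {measure set T -> \bar R}).

Lemma ae_imp (P Q : T -> Prop) : (forall x, P x -> Q x) ->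
  {ae m, forall x, P x} -> {ae m, forall x, Q x}.
Proof. by move=> PQ; exact: filterS. Qed.

Lemma ae_imp2 (P Q S : T -> Prop) : (forall x, P x -> Q x -> S x) ->
  {ae m, forall x, P x} -> {ae m, forall x, Q x} -> {ae m, forall x, S x}.
Proof. by move=> PQ; exact: filterS2. Qed.

End AlmostEverywhere.

Section Components.
Context (R : realType) (n : nat).
Implicit Types (Om : set 'rV[R]_n) (x y z h : 'rV[R]_n).

Lemma segment_component Om y x h : connected_component Om y x ->
  (forall t : R, 0 <= t <= 1 -> Om (x + t *: h)) -> connected_component Om y (x + h).
Proof.
move=> cx hO; rewrite (same_connected_component cx).
pose S := [set x + t *: h | t in `[(0:R), 1]%classic].
have Sc : connected S.
  apply: connected_continuous_connected; first exact: segment_connected.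
  by apply: continuous_subspaceT => t; exact: continuous_line.
apply: (@connected_component_max _ Om S x) => //.
- by exists 0; [rewrite /= in_itv/= lexx ler01|rewrite scale0r addr0].
- by move=> _ [t /= ht <-]; apply: hO; move: ht; rewrite in_itv.
- by exists 1; [rewrite /= in_itv/= lexx ler01|rewrite scale1r].
Qed.

Lemma ball_component Om y x r : connected_component Om y x -> ball x r `<=` Om ->
  ball x r `<=` connected_component Om y.
Proof.
move=> cx bO z bz; have -> : z = x + (z - x) by rewrite addrC subrK.
have r0 : 0 < r by have /ball_rV[] := bz.
apply: segment_component => // t t01; apply: bO; apply: ball_segment => //.
  exact: ballxx.
by rewrite addrC subrK.
Qed.

Lemma open_component Om y : open Om -> open (connected_component Om y).
Proof.
move=> oOm; rewrite openE => x cx.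
have Ox : Om x by exact: (connected_component_sub cx).
have /nbhs_ballP[r /= r0 br] := open_nbhs_nbhs (conj oOm Ox).
by apply/nbhs_ballP; exists r => //=; exact: ball_component.
Qed.

(** If a boundary point of the component were in [Om], a ball around it inside [Om] would meet the
    component and therefore belong to it. *)
Lemma boundary_component Om y : open Om ->
  boundary (connected_component Om y) `<=` boundary Om.
Proof.
move=> oOm x [cx ix]; split.
  by apply: closure_subset cx; exact: connected_component_sub.
rewrite (interior_id Om).1// => Ox; apply: ix.
rewrite (interior_id _).1; last exact: open_component.
have /nbhs_ballP[r /= r0 br] := open_nbhs_nbhs (conj oOm Ox).
have [z [cz bz]] := cx _ (nbhsx_ballx x r r0).
rewrite (same_connected_component cz).
have cxz : connected_component Om x z.
  by apply: (ball_component _ br bz); exact: connected_component_refl.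
exact: connected_component_sym.
Qed.

(** The hypothesis transfers [P] between nearby points in either order, so both the set where [P]
    holds and the set where it fails are open, and the component is connected. *)
Lemma component_propagation Om (P : 'rV[R]_n -> Prop) y0 : open Om ->
  (forall z y r, 0 < r -> ball z r `<=` Om -> ball z (r / 2) y -> P y -> P z) ->
  forall x0 x, connected_component Om y0 x0 -> P x0 -> connected_component Om y0 x -> P x.
Proof.
move=> oOm hP x0 x cx0 Px0 cx.
have nb z : Om z -> exists2 r : R, 0 < r & ball z r `<=` Om.
  move=> Oz; have /nbhs_ballP[r /= r0 br] := open_nbhs_nbhs (conj oOm Oz).
  by exists r.
have oU : open (Om `&` [set x | P x]).
  rewrite openE => z [Oz Pz]; have [r r0 br] := nb z Oz.
  have r4 : 0 < r / 4 by rewrite divr_gt0.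
  apply/nbhs_ballP; exists (r / 4) => //= y /ball_rV[_ yz].
  have by2 : ball y (r / 2) `<=` Om.
    move=> q /ball_rV[_ yq]; apply: br; apply/ball_rV; split => // j.
    have := yz j; have := yq j; rewrite !ltr_norml => /andP[a1 a2] /andP[b1 b2].
    by apply/andP; split; lra.
  split; first by apply: by2; apply: ballxx; rewrite divr_gt0.
  apply: (hP y z (r / 2)) => //; first by rewrite divr_gt0.
  apply/ball_rV; split; first by rewrite !divr_gt0.
  by move=> j; have := yz j; rewrite distrC; lra.
have oV : open (Om `&` [set x | ~ P x]).
  rewrite openE => z [Oz nPz]; have [r r0 br] := nb z Oz.
  have r2 : 0 < r / 2 by rewrite divr_gt0.
  apply/nbhs_ballP; exists (r / 2) => //= y bzy; split.
    by apply: br; apply: le_ball bzy; lra.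
  by move=> Py; apply: nPz; exact: (hP z y r).
have E : connected_component Om y0 `&` [set x | P x] = connected_component Om y0.
  apply: component_connected.
  - by exists x0.
  - exists (Om `&` [set x | P x]) => //; apply/seteqP; split=> z.
      by move=> [cz Pz]; do 2?split => //; exact: (connected_component_sub cz).
    by move=> [cz [_ Pz]].
  - exists (~` (Om `&` [set x | ~ P x])); first exact: open_closedC.
    apply/seteqP; split=> z.
      by move=> [cz Pz]; split => // -[_].
    move=> [cz nz]; split => //; apply: contrapT => nPz; apply: nz; split => //.
    exact: (connected_component_sub cz).
by move: cx; rewrite -E => -[].
Qed.

End Components.

Section Poincare.
Local Open Scope ereal_scope.
Context (R : realType) (n : nat).
Local Notation N := n.+1.
Local Notation lebT := (caratheodory_type (@lebesgue_outer R N)).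
Local Notation surT := (caratheodory_type (@hausdorff_outer R N.-1 N)).
Local Notation sur := (surface R N).
Local Notation mu := (lebesgue_rV R N).
Implicit Types (Om : set 'rV[R]_N) (lam w : 'rV[R]_N -> R).

Definition aform Om lam w : \bar R :=
  \int[mu]_(x in Om) (gsq w x)%:E + \int[sur]_(x in boundary Om) (lam x * w x ^+ 2)%:E.

(** A Poincare inequality localised to [B]. The form on the right is always that of the whole
    domain, so the property can be carried from one set to another by a shift inside [Om]. *)
Definition controlled Om lam (B : set 'rV[R]_N) := exists2 C : R, (0 < C)%R &
  forall w, Ck 1 w -> \int[mu]_(x in B) (w x ^+ 2)%:E <= C%:E * aform Om lam w.

Definition controlled_at Om lam x := exists2 s : R, (0 < s)%R & controlled Om lam (ball x s).

Section FixedDomain.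
Variables (Om : set 'rV[R]_N) (lam : 'rV[R]_N -> R).
Hypotheses (oOm : open Om) (lam0 : forall x, (0 <= lam x)%R).

Let mOB : measurable (Om : set (rvB R N)). Proof. exact: rvB_open. Qed.

Let mw2 w : Ck 1 w -> measurable_fun setT (fun x : lebT => w x ^+ 2)%R.
Proof. by move=> Cw; apply: measurable_funX; exact: measurable_cont (C1_continuous Cw). Qed.

Lemma gsq_le_aform w : \int[mu]_(x in Om) (gsq w x)%:E <= aform Om lam w.
Proof.
rewrite -[leLHS]adde0 leeD2l//; apply: integral_ge0 => x _.
by rewrite lee_fin mulr_ge0// sqr_ge0.
Qed.

Lemma lam_le_aform w : \int[sur]_(x in boundary Om) (lam x * w x ^+ 2)%:E <= aform Om lam w.
Proof.
rewrite -[leLHS]add0e leeD2r//; apply: integral_ge0 => x _.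
by rewrite lee_fin gsq_ge0.
Qed.

Lemma controlled_shift (A B : set 'rV[R]_N) (h : 'rV[R]_N) :
  measurable (A : set lebT) -> measurable (B : set lebT) ->
  (forall x s, A x -> (0 <= s <= 1)%R -> Om (x + s *: h)%R) ->
  (forall x, A x -> B (x + h)%R) -> controlled Om lam B -> controlled Om lam A.
Proof.
move=> mA mB hO AB [C C0 HC].
pose H := (\sum_i `|h 0%R i|)%R.
have hH i : (`|h 0%R i| <= H)%R by rewrite /H (bigD1 i)//= lerDl sumr_ge0.
have c0 : (0 <= 2 * (N%:R * H ^+ 2))%R by rewrite mulr_ge0// mulr_ge0// sqr_ge0.
exists (2 * C + 2 * (N%:R * H ^+ 2))%R; first by rewrite ltr_wpDr// mulr_gt0.
move=> w Cw; apply: le_trans (shift_sqr Cw mA mB mOB hO AB hH) _.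
have a0 : 0 <= aform Om lam w.
  by apply: le_trans (gsq_le_aform w); apply: integral_ge0 => x _; rewrite lee_fin gsq_ge0.
have C2 : (0 <= 2 * C)%R by rewrite mulr_ge0// ltW.
have -> : (2 * C + 2 * (N%:R * H ^+ 2))%:E * aform Om lam w =
    (2 * C)%:E * aform Om lam w + (2 * (N%:R * H ^+ 2))%:E * aform Om lam w.
  by rewrite EFinD ge0_muleDl ?lee_fin.
apply: leeD.
  by rewrite EFinM -muleA; apply: lee_wpmul2l; [rewrite lee_fin|exact: HC].
by apply: lee_wpmul2l; [rewrite lee_fin|exact: gsq_le_aform].
Qed.

Lemma controlledU (A B : set 'rV[R]_N) :
  measurable (A : set lebT) -> measurable (B : set lebT) ->
  controlled Om lam A -> controlled Om lam B -> controlled Om lam (A `|` B).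
Proof.
move=> mA mB [C C0 HC] [D D0 HD]; exists (C + D)%R; first exact: addr_gt0.
move=> w Cw; have -> : A `|` B = A `|` (B `\` A).
  apply/seteqP; split=> x /=; last by move=> [h|[h _]]; [left|right].
  by have [h|h] := pselect (A x); [left|move=> [//|h']; right].
have mBA : measurable (B `\` A : set lebT) by exact: measurableD.
have m2 : measurable_fun setT (fun x : lebT => (w x ^+ 2)%:E) by apply/measurable_EFinP; exact: mw2.
have a0 : 0 <= aform Om lam w.
  by apply: le_trans (gsq_le_aform w); apply: integral_ge0 => x _; rewrite lee_fin gsq_ge0.
rewrite (@ge0_integral_setU _ _ _ mu _ _ mA mBA _ (measurable_funTS m2)).
- rewrite EFinD ge0_muleDl ?lee_fin ?(ltW C0) ?(ltW D0)//; apply: leeD; first exact: HC.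
  apply: le_trans (HD w Cw); apply: (ge0_subset_integral mu mBA mB (measurable_funTS m2)).
    by move=> x _; rewrite lee_fin sqr_ge0.
  by move=> x [].
- by move=> x _; rewrite lee_fin sqr_ge0.
- by apply/disj_setPS => x [h [_ ]].
Qed.

Let mball x (r : R) : measurable (ball x r : set lebT).
Proof. by apply: measurable_open_leb; exact: ball_open_rV. Qed.

Lemma controlled_at_near z y (r : R) : (0 < r)%R -> ball z r `<=` Om -> ball z (r / 2) y ->
  controlled_at Om lam y -> controlled_at Om lam z.
Proof.
move=> r0 bO bzy [s s0 cs].
have m0 : (0 < Num.min s (r / 2))%R by rewrite lt_min s0 divr_gt0.
have ms : (Num.min s (r / 2) <= s)%R by rewrite ge_min lexx.
have mr : (Num.min s (r / 2) <= r / 2)%R by rewrite ge_min lexx orbT.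
exists (Num.min s (r / 2))%R; first exact: m0.
apply: (@controlled_shift _ (ball y s) (y - z)%R (mball z _) (mball y s) _ _ cs) => [x t bx t01|x bx].
  apply: bO; apply: ball_segment => //; first by apply: le_ball bx; lra.
  move/ball_rV: bx => [_ bx]; move/ball_rV: bzy => [_ bzy]; apply/ball_rV; split => // j.
  have := bx j; have := bzy j; move: mr; set m := Num.min _ _ => mr.
  rewrite !mxE !ltr_norml => /andP[a1 a2] /andP[b1 b2]; apply/andP.
  by split; lra.
move/ball_rV: bx => [_ bx]; apply/ball_rV; split => // j.
apply: lt_le_trans ms; suff -> : (y 0 j - (x + (y - z)) 0 j = z 0 j - x 0 j)%R by exact: bx.
by rewrite !mxE; ring.
Qed.

Variable Lam : R.
Hypotheses (bOm : bounded_set Om) (hC1 : C1_boundary Om)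
  (mlam : measurable_fun setT (lam : surT -> R)) (lamL : forall x, (lam x <= Lam)%R).

(** The shift by rho d takes the part of [Om] near [x0] into a ball around the interior point x0 +
    rho d, where control is assumed. *)
Lemma controlled_boundary x0 : closure Om x0 -> (forall x, Om x -> controlled_at Om lam x) ->
  exists2 B : set 'rV[R]_N, nbhs x0 B & measurable (B : set (rvB R N)) /\ controlled Om lam (Om `&` B).
Proof.
move=> cx0 hP; have [d [r [rho [eps [r0 rho0 /andP[eps0 eps1] d1 hcone]]]]] := cone_closure oOm hC1 cx0.
have re0 : (0 < rho * eps)%R by rewrite mulr_gt0.
have m0 : (0 < Num.min r (rho * eps))%R by rewrite lt_min r0.
have [x [Ox bx]] := cx0 _ (nbhsx_ballx x0 _ m0).
(* x0 + rho d belongs to the cone issued from a point x of [Om] close to [x0]: the direction q = (x0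
   - x) / (rho eps) compensates the difference and has norm at most 1. *)
have Oz : Om (x0 + rho *: d)%R.
  have <- : (x + rho *: (d + eps *: ((rho * eps)^-1 *: (x0 - x))) = x0 + rho *: d)%R.
    by apply/rowP => j; rewrite !mxE; field; rewrite !gt_eqF.
  apply: hcone => //; first by apply: le_ball bx; rewrite ge_min lexx.
    by rewrite lexx ltW.
  move=> j; rewrite !mxE normrM gtr0_norm ?invr_gt0// mulrC ler_pdivrMr// mul1r.
  move/ball_rV: bx => [_ /(_ j)] h; apply: ltW; apply: (lt_le_trans h).
  by rewrite ge_min lexx orbT.
have [s s0 cs] := hP _ Oz.
have q0 : (0 < Num.min r s)%R by rewrite lt_min r0.
exists (ball x0 (Num.min r s)); first exact: nbhsx_ballx.
split; first by apply: rvB_open; exact: ball_open_rV.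
apply: (@controlled_shift _ (ball (x0 + rho *: d)%R s) (rho *: d)%R) cs.
- by apply: measurable_open_leb; apply: openI => //; exact: ball_open_rV.
- exact: mball.
- move=> y t [Oy by_] /andP[t0 t1].
  have := hcone y 0%R (t * rho)%R Oy; rewrite scaler0 addr0 scalerA; apply.
  + by apply: le_ball by_; rewrite ge_min lexx.
  + by rewrite mulr_ge0 ?(ltW rho0)//= ler_piMl// ltW.
  + by move=> j; rewrite mxE normr0.
- move=> y [_ /ball_rV[_ by_]]; apply/ball_rV; split => // j.
  rewrite mxE [X in (_ - X)%R]mxE opprD addrACA subrr addr0.
  by apply: lt_le_trans (by_ j) _; rewrite ge_min lexx orbT.
Qed.

Lemma controlled_domain : (forall x, Om x -> controlled_at Om lam x) -> controlled Om lam Om.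
Proof.
move=> hP.
pose Q (A : set 'rV[R]_N) := exists2 B : set 'rV[R]_N, A `<=` B &
  measurable (B : set (rvB R N)) /\ controlled Om lam (Om `&` B).
have mOI (B : set 'rV[R]_N) : measurable (B : set (rvB R N)) -> measurable (Om `&` B : set lebT).
  by move=> mB; apply: measurable_rvB_leb; exact: measurableI.
have [] : Q (closure Om); last first.
  move=> B clB [mB cB].
  have e : Om `&` B = Om.
    by apply/seteqP; split=> [x []//|x Ox]; split => //; apply: clB; exact: subset_closure.
  by rewrite e in cB.
apply: (@compact_local_union _ (closure Om) Q (closure_compact bOm)).
- exists set0 => //; split => //; exists 1%R => // w Cw.
  rewrite setI0 integral_set0 mul1e.
  by apply: le_trans (gsq_le_aform w); apply: integral_ge0 => x _; rewrite lee_fin gsq_ge0.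
- move=> A A' [B AB [mB cB]] [B' AB' [mB' cB']]; exists (B `|` B').
    by move=> x [/AB|/AB']; [left|right].
  by split; [exact: measurableU|rewrite setIUr; apply: controlledU => //; exact: mOI].
- by move=> A A' AA' [B AB h]; exists B => //; exact: subset_trans AB.
- move=> x0 cx0; have [B nB h] := controlled_boundary cx0 hP.
  by exists B => //; exists B.
Qed.

(** If [lam] vanished almost everywhere near each boundary point, finitely many such neighbourhoods
    would cover the compact boundary. *)
Lemma boundary_lam_pos (C : set 'rV[R]_N) : C `<=` Om ->
  ~ {ae sur, forall x, boundary C x -> lam x = 0%R} ->
  exists2 x0, boundary C x0 &
    forall r, (0 < r)%R -> ~ {ae sur, forall x, boundary C x -> ball x0 r x -> lam x = 0%R}.
Proof.
move=> CO nz; apply: contrapT => nex; apply: nz.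
pose Q (A : set 'rV[R]_N) := {ae sur, forall x, boundary C x -> A x -> lam x = 0%R}.
have cC : compact (boundary C).
  apply: (subclosed_compact _ (closure_compact bOm)); last first.
    by move=> x [cx _]; exact: (closure_subset CO cx).
  apply: closedI; first exact: closed_closure.
  by apply: open_closedC; exact: open_interior.
have : Q (boundary C); last by apply: (@ae_imp _ surT R sur) => x h bx; exact: (h bx bx).
apply: (@compact_local_union _ (boundary C) Q cC).
- by apply: aeW.
- by move=> A B; apply: (@ae_imp2 _ surT R sur) => x hA hB bx [/hA|/hB]; apply.
- by move=> A B AB; apply: (@ae_imp _ surT R sur) => x hB bx /AB; exact: hB.
- move=> x0 bx0; apply: contrapT => nQ; apply: nex; exists x0 => // r r0 h.
  by apply: nQ; exists (ball x0 r) => //; exact: nbhsx_ballx.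
Qed.

(** Control starts where [lam] is felt. Near a boundary point charged by [lam], [w] differs from one
    of its values cc by a function v that is controlled by the gradient on an interior ball [Z]. A
    shift and the trace inequality carry v to the boundary piece [S]; there the weight [lam] bounds
    w, hence the constant cc, and with it w on [Z]. *)
Lemma controlled_start y : Om y ->
  ~ {ae sur, forall x, boundary (connected_component Om y) x -> lam x = 0%R} ->
  exists2 x, connected_component Om y x & controlled_at Om lam x.
Proof.
move=> Oy nz; set C := connected_component Om y in nz *.
have CO : C `<=` Om by exact: connected_component_sub.
have [x0 bC0 hx0] := boundary_lam_pos CO nz.
have bx0 : boundary Om x0 by exact: (boundary_component oOm bC0).
have [d [r [rho [eps [r0 rho0 /andP[eps0 eps1] d1 hcone]]]]] := cone_closure oOm hC1 bx0.1.
set z0 := (x0 + rho *: d)%R.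
have cz0 : C z0.
  have re0 : (0 < rho * eps)%R by rewrite mulr_gt0.
  have m0 : (0 < Num.min r (rho * eps))%R by rewrite lt_min r0.
  have [x [Cx bx]] := bC0.1 _ (nbhsx_ballx x0 _ m0).
  have <- : (x + rho *: (d + eps *: ((rho * eps)^-1 *: (x0 - x))) = z0)%R.
    by apply/rowP => j; rewrite !mxE; field; rewrite !gt_eqF.
  apply: segment_component => // t /andP[t0 t1]; rewrite scalerA.
  apply: hcone; first exact: CO.
  - by apply: le_ball bx; rewrite ge_min lexx.
  - by rewrite mulr_ge0 ?(ltW rho0)//= ler_piMl// ltW.
  - move=> j; rewrite !mxE normrM gtr0_norm ?invr_gt0// mulrC ler_pdivrMr// mul1r.
    move/ball_rV: bx => [_ /(_ j)] h; apply: ltW; apply: (lt_le_trans h).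
    by rewrite ge_min lexx orbT.
have /nbhs_ballP[s0 /= s00 bZ] := open_nbhs_nbhs (conj oOm (CO _ cz0)).
exists z0 => //; exists s0 => //.
set Z : set 'rV[R]_N := ball z0 s0.
have [K K0 HK] := poincare_point z0 s00.
have r'0 : (0 < Num.min r s0)%R by rewrite lt_min r0.
have [r2 [Ct [r20 Ct0 Htr]]] := trace_patch oOm hC1 bx0 r'0.
set B := Om `&` ball x0 (Num.min r s0) in Htr.
have mB : measurable (B : set lebT).
  by apply: measurable_open_leb; apply: openI => //; exact: ball_open_rV.
have mZ : measurable (Z : set lebT) by exact: mball.
pose S := boundary Om `&` ball x0 r2.
have mS : measurable (S : set surT).
  apply: measurableI; first exact: measurable_boundary_sur.
  by apply: measurable_rvB_surface; apply: rvB_open; exact: ball_open_rV.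
have mlamS (D : set surT) : measurable D -> measurable_fun D (fun x : surT => (lam x)%:E).
  by move=> mD; apply/measurable_EFinP; exact: measurable_funTS.
pose m1 := \int[sur]_(x in S) (lam x)%:E.
have Lam0 : (0 <= Lam)%R by apply: le_trans (lam0 0%R) (lamL 0%R).
have m1fin : m1 < +oo.
  apply: (@le_lt_trans _ _ (Lam%:E * sur S)).
    rewrite -(@integral_cst _ surT R sur _ mS Lam%:E); apply: ge0_le_integral; first exact: mS.
    - by move=> x _; rewrite lee_fin.
    - exact: mlamS.
    - exact: measurable_cst.
    - by move=> x _; rewrite lee_fin.
  have sfin : sur S < +oo.
    by apply: le_lt_trans (surface_boundary_fin oOm bOm hC1); apply: le_outer_measure => x [].
  by rewrite -(fineK (_ : sur S \is a fin_num)) ?ge0_fin_numE// -EFinM ltry.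
have m1ge : 0 <= m1 by apply: integral_ge0 => x _; rewrite lee_fin.
have m1pos : 0 < m1.
  rewrite lt_neqAle m1ge andbT; apply/eqP => e0; apply: (hx0 r2 r20).
  have := (@ae_eq_integral_abs _ surT R sur S mS (fun x => (lam x)%:E) (mlamS S mS)).1.
  have -> : \int[sur]_(x in S) `|(lam x)%:E| = m1.
    by apply: eq_integral => x _; rewrite gee0_abs// lee_fin.
  move=> /(_ (esym e0)); apply: (@ae_imp _ surT R sur) => x /= h bCx bx.
  have : S x by split => //; exact: (boundary_component oOm bCx).
  by move=> /h [].
pose m := fine m1; have mE : m1 = m%:E by rewrite fineK// ge0_fin_numE.
have mpos : (0 < m)%R by rewrite -lte_fin -mE.
pose V := fine (mu Z).
have VE : mu Z = V%:E by rewrite fineK// ge0_fin_numE// mu_ball_fin.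
have V0 : (0 <= V)%R by rewrite fine_ge0.
pose H := (\sum_i `|(rho *: d)%R 0%R i|)%R.
have hH i : (`|(rho *: d)%R 0%R i| <= H)%R by rewrite /H (bigD1 i)//= lerDl sumr_ge0.
(* Successive constants in front of e, the form plus a slack: v on the ball [Z] (k1), v on [B] after
   the shift (k2), the trace of v on [S] (k3), cc^2 times the mass m of [lam] on [S] (k4), and w on
   [Z] (k5). *)
pose k1 := (K + 1)%R; pose k2 := (2 * k1 + 2 * (N%:R * H ^+ 2) * 1)%R.
pose k3 := (Ct * ((1 + N%:R) * k2 + 1 * 1))%R.
pose k4 := ((2 * Lam) * k3 + 2 * 1)%R.
pose k5 := (2 * k1 + 2 * (V * (k4 / m)))%R.
have k10 : (0 < k1)%R by rewrite ltr_wpDl.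
have NH0 : (0 <= N%:R * H ^+ 2)%R by apply: mulr_ge0 => //; exact: sqr_ge0.
have k20 : (0 <= k2)%R.
  by apply: addr_ge0; [apply: mulr_ge0 => //; exact: ltW|rewrite mulr1; exact: mulr_ge0].
have k30 : (0 <= k3)%R.
  by apply: mulr_ge0 => //; apply: addr_ge0; [apply: mulr_ge0 => //; exact: addr_ge0|rewrite mulr1].
have k40 : (0 <= k4)%R.
  by apply: addr_ge0; [apply: mulr_ge0 => //; exact: mulr_ge0|rewrite mulr1].
have k50 : (0 < k5)%R.
  apply: ltr_wpDr; last exact: mulr_gt0.
  by apply: mulr_ge0 => //; apply: mulr_ge0 => //; apply: divr_ge0 => //; exact: ltW.
exists k5 => // w Cw.
have a0 : 0 <= aform Om lam w.
  by apply: le_trans (gsq_le_aform w); apply: integral_ge0 => x _; rewrite lee_fin gsq_ge0.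
have [aoo|afin] := eqVneq (aform Om lam w) +oo.
  by rewrite aoo gt0_muley ?lte_fin// leey.
pose a := fine (aform Om lam w).
have aE : aform Om lam w = a%:E by rewrite fineK// ge0_fin_numE// lt_neqAle afin leey.
have G : \int[mu]_(x in Om) (gsq w x)%:E <= a%:E by rewrite -aE gsq_le_aform.
have Lw : \int[sur]_(x in boundary Om) (lam x * w x ^+ 2)%:E <= a%:E by rewrite -aE lam_le_aform.
rewrite aE; apply/lee_addgt0Pr => dd dd0.
(* [poincare_point] leaves an arbitrary slack; dd / k5 becomes dd after multiplication by the final
   constant. *)
pose dl := (dd / k5)%R; have dl0 : (0 < dl)%R by rewrite divr_gt0.
have -> : k5%:E * a%:E + dd%:E = (k5 * (a + dl))%:E.
  have kne : k5 != 0%R by rewrite gt_eqF.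
  by rewrite -EFinM -EFinD; congr (_%:E); rewrite mulrDr /dl [(k5 * (_ / _))%R]mulrC divfK.
have [yy Zyy Hyy] := HK w dl Cw dl0.
set cc := w yy in Hyy.
have [Cv Pv] := C1B Cw (C1_cst N cc).1; have Pc := (C1_cst N cc).2.
set v := (fun x : 'rV[R]_N => w x - cst cc x)%R in Cv Pv.
have gv x : gsq v x = gsq w x.
  by apply: eq_bigr => i _; rewrite Pv Pc /= subr0.
have ia0 : (0 <= a)%R by rewrite fine_ge0.
pose e := (a + dl)%R.
have ae : (a <= e)%R by rewrite /e lerDl ltW.
have e0 : (0 <= e)%R by apply: le_trans ae.
have mv2 : measurable_fun setT (fun x : lebT => v x ^+ 2)%R by exact: mw2.
have mvS : measurable_fun setT (fun x : surT => v x ^+ 2)%R.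
  by apply: measurable_funX; exact: measurable_cont_sur (C1_continuous Cv).
have mwS : measurable_fun setT (fun x : surT => w x ^+ 2)%R.
  by apply: measurable_funX; exact: measurable_cont_sur (C1_continuous Cw).
have mgE : measurable_fun setT (fun x : lebT => (gsq w x)%:E).
  by apply: measurable_contE; exact: continuous_gsq.
have Gsub (D : set 'rV[R]_N) : measurable (D : set lebT) -> D `<=` Om ->
    \int[mu]_(x in D) (gsq w x)%:E <= e%:E.
  move=> mD DO; apply: (@le_trans _ _ a%:E); last by rewrite lee_fin.
  apply: le_trans G; apply: (ge0_subset_integral mu mD (measurable_rvB_leb mOB) (measurable_funTS mgE)) => //.
  by move=> x _; rewrite lee_fin gsq_ge0.
have I1 : \int[mu]_(x in Z) (v x ^+ 2)%:E <= (k1 * e)%:E.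
  apply: le_trans Hyy _.
  apply: (@le_trans _ _ (K%:E * e%:E + dl%:E)).
    by rewrite leeD2r//; apply: lee_wpmul2l; [rewrite lee_fin|exact: Gsub].
  rewrite -EFinM -EFinD lee_fin /k1 mulrDl mul1r lerD2l /e lerDr//.
have I2 : \int[mu]_(x in B) (v x ^+ 2)%:E <= (k2 * e)%:E.
  have := @shift_sqr R N v (rho *: d)%R H B Z Om Cv mB mZ mOB _ _ hH => /(_ _ _) Hs.
  apply: (le_trans (Hs _ _)).
  - move=> x t [Ox bx] /andP[t0 t1].
    have := hcone x 0%R (t * rho)%R Ox; rewrite scaler0 addr0 scalerA; apply.
    + by apply: le_ball bx; rewrite ge_min lexx.
    + by rewrite mulr_ge0 ?(ltW rho0)//= ler_piMl// ltW.
    + by move=> j; rewrite mxE normr0.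
  - move=> x [_ /ball_rV[_ bx]]; apply/ball_rV; split => // j.
    rewrite /z0 mxE [X in (_ - X)%R]mxE opprD addrACA subrr addr0.
    by apply: lt_le_trans (bx j) _; rewrite ge_min lexx orbT.
  - under [X in _ + _ * X]eq_integral do rewrite gv.
    have -> : (k2 * e = 2 * (k1 * e) + 2 * (N%:R * H ^+ 2) * e)%R by rewrite /k2; ring.
    rewrite [leRHS]EFinD; apply: leeD; rewrite [leRHS]EFinM; apply: lee_wpmul2l.
    + by rewrite lee_fin.
    + exact: I1.
    + by rewrite lee_fin; apply: mulr_ge0.
    + by apply: Gsub; [exact: measurable_rvB_leb|].
have [Cvv Pvv] := C1M Cv Cv.
have I3 : \int[sur]_(x in S) (v x ^+ 2)%:E <= (k3 * e)%:E.
  have -> : \int[sur]_(x in S) (v x ^+ 2)%:E = \int[sur]_(x in S) (`|v x * v x|)%:E.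
    by apply: eq_integral => x _; rewrite -expr2 ger0_norm ?sqr_ge0.
  apply: le_trans (Htr _ Cvv) _.
  have -> : (k3 * e = Ct * ((1 + N%:R) * (k2 * e) + 1 * e))%R by rewrite /k3; ring.
  rewrite [leRHS]EFinM; apply: lee_wpmul2l; first by rewrite lee_fin.
  apply: (@integral_le_linR _ lebT R mu B (Wdens (fun x => v x * v x)%R) (fun x => v x ^+ 2)%R (gsq v)).
  - exact: mB.
  - by apply: measurable_funTS; apply: measurable_cont; exact: continuous_Wdens.
  - exact: measurable_funTS.
  - by apply: measurable_funTS; apply: measurable_cont; exact: continuous_gsq.
  - exact: addr_ge0.
  - exact: ler01.
  - move=> x _; rewrite Wdens_ge0 sqr_ge0 gsq_ge0 mul1r; split => //; exact: Wdens_sqr_le.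
  - exact: I2.
  - under eq_integral do rewrite gv; apply: Gsub => //; by move=> x [].
have I4 : (cc ^+ 2 * m <= k4 * e)%R.
  rewrite -lee_fin EFinM -mE /m1.
  rewrite -(@ge0_integralZl _ surT R sur S mS (fun x => (lam x)%:E) (mlamS S mS) (cc ^+ 2)%:E)%R; last 2 first.
    by move=> x _; rewrite lee_fin.
    by rewrite lee_fin sqr_ge0.
  have -> : (k4 * e = (2 * Lam) * (k3 * e) + 2 * e)%R by rewrite /k4; ring.
  under eq_integral do rewrite -EFinM.
  apply: (@integral_le_linR _ surT R sur S (fun x => cc ^+ 2 * lam x)%R (fun x => v x ^+ 2)%R
    (fun x => lam x * w x ^+ 2)%R).
  - exact: mS.
  - by apply: measurable_funM; [exact: measurable_cst|exact: measurable_funTS].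
  - exact: measurable_funTS.
  - by apply: measurable_funTS; apply: measurable_funM.
  - exact: mulr_ge0.
  - exact: ler0n.
  - move=> x _; split; [exact: (mulr_ge0 (sqr_ge0 _) (lam0 x))|exact: sqr_ge0|exact: (mulr_ge0 (lam0 x) (sqr_ge0 _))|].
    have l1 := lam0 x; have l2 := lamL x.
    have h : (cc ^+ 2 <= 2 * v x ^+ 2 + 2 * w x ^+ 2)%R.
      by have := sqr_ge0 (w x + v x)%R; rewrite /v /=; set b := w x; rewrite -subr_ge0 => hb; rewrite -subr_ge0; apply: le_trans hb _; rewrite le_eqVlt; apply/orP; left; apply/eqP; ring.
    apply: (@le_trans _ _ ((2 * v x ^+ 2 + 2 * w x ^+ 2) * lam x)%R); first by rewrite ler_wpM2r.
    have -> : ((2 * v x ^+ 2 + 2 * w x ^+ 2) * lam x =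
               2 * (lam x * v x ^+ 2) + 2 * (lam x * w x ^+ 2))%R by ring.
    by rewrite lerD2r -mulrA ler_wpM2l// ler_wpM2r ?sqr_ge0.
  - exact: I3.
  - apply: (@le_trans _ _ a%:E); last by rewrite lee_fin.
    apply: le_trans Lw; apply: (ge0_subset_integral sur mS (measurable_boundary_sur Om)).
    + by apply/measurable_EFinP; apply: measurable_funTS; apply: measurable_funM.
    + by move=> x _; rewrite lee_fin mulr_ge0 ?sqr_ge0.
    + by move=> x [].
have -> : (k5 * e = 2 * (k1 * e) + 2 * (V * (k4 / m) * e))%R by rewrite /k5; ring.
apply: (@integral_le_linR _ lebT R mu Z (fun x => w x ^+ 2)%R (fun x => v x ^+ 2)%R (fun=> cc ^+ 2)%R).
- exact: mZ.
- by apply: measurable_funTS; exact: mw2.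
- exact: measurable_funTS.
- exact: measurable_cst.
- exact: ler0n.
- exact: ler0n.
- move=> x _; rewrite !sqr_ge0; split => //.
  have := sqr_ge0 (v x - cc)%R; rewrite /v /=; set b := w x => hb; rewrite -subr_ge0; apply: le_trans hb _; rewrite le_eqVlt; apply/orP; left; apply/eqP; ring.
- exact: I1.
rewrite (@integral_cst _ lebT R mu _ mZ (cc ^+ 2)%:E) VE -EFinM lee_fin.
have h : (cc ^+ 2 <= k4 / m * e)%R by rewrite mulrAC ler_pdivlMr.
by rewrite [(cc ^+ 2 * V)%R]mulrC -[leRHS]mulrA; exact: ler_wpM2l.
Qed.

Lemma poincare :
  (forall y, Om y -> ~ {ae sur, forall x, boundary (connected_component Om y) x -> lam x = 0%R}) ->
  controlled Om lam Om.
Proof.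
move=> nz; apply: controlled_domain => x Ox.
have [x1 cx1 P1] := controlled_start Ox (nz x Ox).
apply: (component_propagation oOm _ cx1 P1); last exact: connected_component_refl.
by move=> z y r r0 bO bzy; exact: (controlled_at_near r0 bO bzy).
Qed.

End FixedDomain.
End Poincare.

(** * Limits in L^2 *)

Section NonnegativeSequences.
Local Open Scope ereal_scope.
Context (R : realType).
Implicit Types u : nat -> \bar R.

Lemma cvge0P u : (forall k, 0 <= u k) ->
  u @ \oo --> 0 <-> forall e : R, (0 < e)%R -> \forall k \near \oo, u k <= e%:E.
Proof.
move=> u0; split=> [/fine_cvgP[fu cu] e e0|h].
  have /cvgrPdist_le /(_ e e0) := cu; move: fu; apply: filterS2 => k fk.
  by rewrite /= sub0r normrN ger0_norm ?fine_ge0// -lee_fin fineK.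
apply/fine_cvgP; split.
  have := h 1%R ltr01; apply: filterS => k uk.
  by rewrite ge0_fin_numE// (le_lt_trans uk) ?ltry.
apply/cvgrPdist_le => e e0; have := h e e0; apply: filterS => k uk /=.
rewrite sub0r normrN ger0_norm ?fine_ge0// -lee_fin fineK// ge0_fin_numE//.
by rewrite (le_lt_trans uk) ?ltry.
Qed.

Lemma poweR2 (x : \bar R) : 0 <= x -> x `^ 2 = x * x.
Proof.
case: x => [r r0|_|//]; last by rewrite mulyy (@eqy_poweR _ +oo 2).
by rewrite poweR_EFin -EFinM powR_mulrn.
Qed.

Lemma cvge0_sqr u : (forall k, 0 <= u k) ->
  u @ \oo --> 0 <-> (fun k => u k `^ 2) @ \oo --> 0.
Proof.
move=> u0; have u20 k : 0 <= u k `^ 2 by exact: poweR_ge0.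
rewrite (cvge0P u0) (cvge0P u20); split=> h e e0.
  have s0 : (0 < Num.sqrt e)%R by rewrite sqrtr_gt0.
  have := h _ s0; apply: filterS => k uk; rewrite poweR2//.
  apply: le_trans (lee_pmul (u0 k) (u0 k) uk uk) _.
  by rewrite -EFinM lee_fin -expr2 sqr_sqrtr// ltW.
have := h (e ^+ 2)%R (exprn_gt0 _ e0); apply: filterS => k; rewrite poweR2//.
case: (u k) (u0 k) => [r r0| |//]; last by rewrite mulyy.
by rewrite -EFinM !lee_fin -expr2 ler_sqr ?nnegrE// ltW.
Qed.

End NonnegativeSequences.

Lemma norm_mul_le_sqr (R : realDomainType) (a b : R) : `|a| * `|b| <= a ^+ 2 + b ^+ 2.
Proof.
have := sqr_ge0 (`|a| - `|b|); rewrite sqrrB !real_normK ?num_real//.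
have h2 : 0 <= `|a| * `|b| by rewrite mulr_ge0.
move: h2; move: (a ^+ 2) (b ^+ 2) (`|a| * `|b|) => x y z; lra.
Qed.

Lemma nneseries_half (R : realType) : (\sum_(k <oo) (2^-1 ^+ k : R)%:E <= 2%:E)%E.
Proof.
apply: lime_le; first by apply: is_cvg_nneseries => k _ _; rewrite lee_fin exprn_ge0.
apply: nearW => k; rewrite sumEFin lee_fin.
suff -> : \sum_(0 <= i < k) 2^-1 ^+ i = 2 - 2 * 2^-1 ^+ k :> R.
  by rewrite gerBl mulr_ge0// exprn_ge0.
elim: k => [|k IH]; first by rewrite big_nil expr0; ring.
by rewrite big_nat_recr//= IH exprS; field.
Qed.

Section LpSpaces.
Context d (T : measurableType d) (R : realType) (m : {measure set T -> \bar R}).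
Variable (D : set T).
Hypothesis mD : measurable D.
Implicit Types f g h : T -> R.

Lemma LpE (p : R) f : 0 < p ->
  Lp m D p%:E f <-> measurable_fun D f /\ (\int[m]_(x in D) (`|f x| `^ p)%:E < +oo)%E.
Proof.
move=> p0; have p0' : p != 0 by rewrite gt_eqF.
have E : (Lnorm m p%:E (EFin \o (f \_ D)) `^ p = \int[m]_(x in D) (`|f x| `^ p)%:E)%E.
  rewrite (poweR_Lnorm _ _ p0') [RHS]integral_mkcond; apply: eq_integral => x _ /=.
  rewrite !patchE; case: ifP => _ //.
  by rewrite (_ : point = 0)// normr0 powR0.
rewrite /Lp; split=> [/andP[/=]|[mf fi]].
  rewrite /mfun inE /= => mf; rewrite /finLfun inE /= /finite_norm => fi.
  split; first by apply/(measurable_restrictT _ mD).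
  by rewrite -E; exact: poweR_lty.
apply/andP; split; rewrite inE /=; first by apply/(measurable_restrictT _ mD).1.
by rewrite /finite_norm; apply: (lty_poweRy p0'); rewrite E.
Qed.

Definition L2 f := measurable_fun D f /\ (\int[m]_(x in D) (f x ^+ 2)%:E < +oo)%E.

Lemma Lp2E f : Lp m D 2%:E f <-> L2 f.
Proof.
rewrite LpE// /L2; suff -> : (\int[m]_(x in D) (`|f x| `^ 2)%:E = \int[m]_(x in D) (f x ^+ 2)%:E)%E by [].
by apply: eq_integral => x _; rewrite powR_mulrn// real_normK ?num_real.
Qed.

Lemma cvg_Lp_dist (w : nat -> T -> R) f :
  Lp_dist m D 2%:E (w k) f @[k --> \oo] --> 0%E <->
  (\int[m]_(x in D) ((w k x - f x) ^+ 2)%:E)%E @[k --> \oo] --> 0%E.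
Proof.
rewrite (cvge0_sqr (fun k => Lnorm_ge0 m 2%:E (EFin \o ((w k \- f) \_ D)))).
rewrite (_ : (fun k => _ `^ 2)%E = (fun k => \int[m]_(x in D) ((w k x - f x) ^+ 2)%:E)%E)//.
apply/funext => k; rewrite poweR_Lnorm; last by rewrite pnatr_eq0.
rewrite [RHS]integral_mkcond; apply: eq_integral => x _ /=.
rewrite !patchE; case: ifP => _; last by rewrite (_ : point = 0)// normr0 powR0// pnatr_eq0.
by rewrite powR_mulrn// real_normK ?num_real.
Qed.

Lemma L2_sqr f : L2 f -> m.-integrable D (EFin \o (fun x => f x ^+ 2)).
Proof.
move=> [mf fi]; apply/integrableP; split.
  by apply/measurable_EFinP; exact: measurable_funX.
have -> // : (\int[m]_(x in D) `|(EFin \o (fun x => (f x ^+ 2)%R)) x| = \int[m]_(x in D) (f x ^+ 2)%:E)%E.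
by apply: eq_integral => x _ /=; rewrite ger0_norm// sqr_ge0.
Qed.

Lemma L2_mul f g : L2 f -> L2 g -> m.-integrable D (EFin \o (fun x => f x * g x)).
Proof.
move=> f2 g2; apply: (@le_integrable _ _ _ m D mD _ (EFin \o (fun x => f x ^+ 2 + g x ^+ 2))).
- apply/measurable_EFinP; apply: measurable_funM; [exact: f2.1|exact: g2.1].
- move=> x _ /=; rewrite lee_fin (ger0_norm (addr_ge0 (sqr_ge0 _) (sqr_ge0 _))) normrM.
  exact: norm_mul_le_sqr.
- have := integrableD mD (L2_sqr f2) (L2_sqr g2).
  by apply: eq_integrable => // x _ /=; rewrite EFinD.
Qed.

Lemma L2_le f g : measurable_fun D f -> L2 g -> (forall x, D x -> `|f x| <= `|g x|) -> L2 f.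
Proof.
move=> mf [mg gi] fg; split => //; apply: le_lt_trans gi; apply: ge0_le_integral; first exact: mD.
- by move=> x _; rewrite lee_fin sqr_ge0.
- by apply/measurable_EFinP; exact: measurable_funX.
- by apply/measurable_EFinP; exact: measurable_funX.
- move=> x Dx; rewrite lee_fin -[f x ^+ 2]real_normK ?num_real// -[g x ^+ 2]real_normK ?num_real//.
  by rewrite lerXn2r ?nnegrE// fg.
Qed.

Lemma L2_lin f g (a b : R) : L2 f -> L2 g -> L2 (fun x => a * f x + b * g x).
Proof.
move=> f2 g2; have mf := f2.1; have mg := g2.1.
have mab : measurable_fun D (fun x => a * f x + b * g x).
  by apply: measurable_funD; apply: measurable_funM => //; exact: measurable_cst.
split => //.
have fa : (0 <= 2 * a ^+ 2)%R by rewrite mulr_ge0// sqr_ge0.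
have fb : (0 <= 2 * b ^+ 2)%R by rewrite mulr_ge0// sqr_ge0.
have h := @integral_le_lin _ T R m D mD (fun x => (a * f x + b * g x) ^+ 2) (fun x => f x ^+ 2)
  (fun x => g x ^+ 2) (2 * a ^+ 2) (2 * b ^+ 2) (measurable_funX 2 mab) (measurable_funX 2 mf)
  (measurable_funX 2 mg) fa fb.
apply: le_lt_trans (h _) _.
  move=> x _; rewrite !sqr_ge0; split => //; rewrite -subr_ge0.
  have -> : 2 * a ^+ 2 * f x ^+ 2 + 2 * b ^+ 2 * g x ^+ 2 - (a * f x + b * g x) ^+ 2 =
    (a * f x - b * g x) ^+ 2 by ring.
  exact: sqr_ge0.
have F1 : (\int[m]_(x in D) (f x ^+ 2)%:E \is a fin_num)%E.
  by rewrite ge0_fin_numE ?f2.2//; apply: integral_ge0 => x _; rewrite lee_fin sqr_ge0.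
have F2 : (\int[m]_(x in D) (g x ^+ 2)%:E \is a fin_num)%E.
  by rewrite ge0_fin_numE ?g2.2//; apply: integral_ge0 => x _; rewrite lee_fin sqr_ge0.
by rewrite -(fineK F1) -(fineK F2) -!EFinM -EFinD ltry.
Qed.

Lemma L2_mulb f (h : T -> R) (c : R) : L2 f -> measurable_fun D h ->
  (forall x, D x -> `|h x| <= c) -> L2 (fun x => h x * f x).
Proof.
move=> f2 mh hc; apply: (@L2_le _ (fun x => `|c| * f x + 0 * f x)).
- by apply: measurable_funM => //; exact: f2.1.
- exact: L2_lin.
- move=> x Dx; rewrite mul0r addr0 !normrM normr_id; apply: ler_wpM2r => //.
  by apply: le_trans (hc x Dx) _; exact: ler_norm.
Qed.

(* [H = sum_k 4^k d_k^2] is integrable, and [|d_k| <= 2^-k sqrt H]. *)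
Lemma fast_majorant (dd : nat -> T -> R) :
  (forall k, measurable_fun D (dd k)) ->
  (forall k, (\int[m]_(x in D) (dd k x ^+ 2)%:E <= (8^-1 ^+ k)%:E)%E) ->
  exists2 h : T -> R, L2 h /\ (forall x, 0 <= h x) &
    {ae m, forall x, D x -> forall k, `|dd k x| <= 2^-1 ^+ k * h x}.
Proof.
move=> mdd dd8; pose H x := (\sum_(k <oo) (4 ^+ k * dd k x ^+ 2)%:E)%E.
have t0 k x : (0 <= (4 ^+ k * dd k x ^+ 2)%:E)%E by rewrite lee_fin mulr_ge0 ?sqr_ge0// exprn_ge0.
have mt k : measurable_fun D (fun x => (4 ^+ k * dd k x ^+ 2)%:E).
  apply/measurable_EFinP; apply: measurable_funM; first exact: measurable_cst.
  exact: measurable_funX.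
have H0 x : (0 <= H x)%E by apply: nneseries_ge0.
have mH : measurable_fun D H.
  by apply: ge0_emeasurable_sum.
have IH : (\int[m]_(x in D) H x < +oo)%E.
  rewrite (integral_nneseries m mD mt (fun k x _ => t0 k x)).
  apply: (@le_lt_trans _ _ (\sum_(k <oo) (2^-1 ^+ k)%:E)%E).
    apply: lee_nneseries => [k _ _|k _]; first by apply: integral_ge0.
    have mk : measurable_fun D (fun x => (dd k x ^+ 2)%:E) by apply/measurable_EFinP; exact: measurable_funX.
    have k0 x : D x -> (0 <= (dd k x ^+ 2)%:E)%E by rewrite lee_fin sqr_ge0.
    have k4 : (0 <= (4 ^+ k : R)%:E)%E by rewrite lee_fin exprn_ge0.
    have E := @ge0_integralZl _ T R m D mD _ mk _ k0 k4.
    under eq_integral do rewrite EFinM; rewrite E.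
    apply: (@le_trans _ _ ((4 ^+ k)%:E * (8^-1 ^+ k)%:E)%E); first exact: lee_wpmul2l.
    have e : 4 / 8 = 2^-1 :> R by field.
    by rewrite -EFinM lee_fin -exprMn e.
  by apply: le_lt_trans (nneseries_half R) _; exact: ltry.
have Hint : m.-integrable D H.
  apply/integrableP; split => //.
  suff -> : (\int[m]_(x in D) `|H x| = \int[m]_(x in D) H x)%E by [].
  by apply: eq_integral => x _; rewrite gee0_abs.
exists (fun x => Num.sqrt (fine (H x))).
  split; last by move=> x; exact: sqrtr_ge0.
  split.
    apply: (measurableT_comp (continuous_measurable_fun (@sqrt_continuous R))).
    exact: (measurableT_comp (@fine_measurable R setT measurableT)).
  apply: le_lt_trans IH; apply: ge0_le_integral; first exact: mD.
  - by move=> x _; rewrite lee_fin sqr_ge0.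
  - apply/measurable_EFinP; apply: measurable_funX.
    apply: (measurableT_comp (continuous_measurable_fun (@sqrt_continuous R))).
    exact: (measurableT_comp (@fine_measurable R setT measurableT)).
  - exact: mH.
  - move=> x _; rewrite sqr_sqrtr ?fine_ge0//.
    by case: (H x) (H0 x) => [r| |]//= _; rewrite leey.
have := integrable_ae mD Hint; apply: (@ae_imp _ T R m) => x Hx Dx k.
have Hf := Hx Dx.
have h1 : (4 ^+ k * dd k x ^+ 2 <= fine (H x)).
  rewrite -lee_fin fineK// /H.
  apply: le_trans (nneseries_lim_ge k.+1 (fun j _ _ => t0 j x)).
  by rewrite big_nat_recr//= -[leLHS]add0e leeD2r// sume_ge0.
rewrite -(@ler_pM2l _ (2 ^+ k)) ?exprn_gt0// mulrA -exprMn mulfV// expr1n mul1r.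
rewrite -[leLHS]ger0_norm ?mulr_ge0 ?exprn_ge0// -sqrtr_sqr ler_sqrt ?fine_ge0//.
by rewrite exprMn real_normK ?num_real// -exprM mulnC exprM (_ : 2 ^+ 2 = 4 :> R)//; ring.
Qed.

Lemma ae_all (P : nat -> T -> Prop) : (forall k, {ae m, forall x, P k x}) ->
  {ae m, forall x, forall k, P k x}.
Proof. by move=> h; apply/ae_foralln. Qed.

(** Dominated convergence for a constant sequence turns an almost everywhere bound into
    integrability. *)
Lemma le_integrable_ae (f g : T -> \bar R) : measurable_fun D f -> m.-integrable D g ->
  {ae m, forall x, D x -> (`|f x| <= g x)%E} -> m.-integrable D f.
Proof.
move=> mf gi H.
have H1 : {ae m, forall x, forall k : nat, D x -> (`|f x| <= g x)%E}.
  by move: H; apply: (@ae_imp _ T R m) => x h _.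
have H2 : {ae m, forall x, D x -> (fun _ : nat => f x) @ \oo --> f x}.
  by apply: aeW => x _; exact: cvg_cst.
by have [fi _ _] := @dominated_convergence _ T R m D mD (fun _ => f) f g (fun _ => mf) mf H2 gi H1.
Qed.

Lemma dct (F : nat -> T -> R) f g : (forall k, measurable_fun D (F k)) ->
  measurable_fun D f -> m.-integrable D (EFin \o g) ->
  {ae m, forall x, D x -> F k x @[k --> \oo] --> f x /\ forall k, `|F k x| <= g x} ->
  [/\ forall k, m.-integrable D (EFin \o F k), m.-integrable D (EFin \o f) &
    \int[m]_(x in D) F k x @[k --> \oo] --> \int[m]_(x in D) f x].
Proof.
move=> mF mf gi H.
have mFE k : measurable_fun D (EFin \o F k) by exact/measurable_EFinP.
have mfE : measurable_fun D (EFin \o f) by exact/measurable_EFinP.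
have H1 : {ae m, forall x, forall k, D x -> (`|(EFin \o F k) x| <= (EFin \o g) x)%E}.
  by move: H; apply: (@ae_imp _ T R m) => x h k Dx; rewrite /= lee_fin; exact: (h Dx).2.
have H2 : {ae m, forall x, D x -> (EFin \o F k) x @[k --> \oo] --> (EFin \o f) x}.
  move: H; apply: (@ae_imp _ T R m) => x h Dx; apply: cvg_EFin; first exact: nearW.
  exact: (h Dx).1.
have iF k : m.-integrable D (EFin \o F k).
  apply: (le_integrable_ae (mFE k) gi).
  by move: H1; apply: (@ae_imp _ T R m) => x h Dx; exact: h.
have [fi _ cF] := @dominated_convergence _ T R m D mD (fun k => EFin \o F k) (EFin \o f) (EFin \o g)
    mFE mfE H2 gi H1.
split => //; apply: fine_cvg; rewrite /= in cF.
rewrite (fineK (integrable_fin_num mD fi)); exact: cF.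
Qed.

Lemma fast_limit (w : nat -> T -> R) f : (forall k, measurable_fun D (w k)) -> L2 f ->
  (forall k, (\int[m]_(x in D) ((w k x - f x) ^+ 2)%:E <= (8^-1 ^+ k)%:E)%E) ->
  exists2 h : T -> R, L2 h &
    {ae m, forall x, D x -> w k x @[k --> \oo] --> f x /\ forall k, `|w k x| <= h x}.
Proof.
move=> mw f2 w8.
have [h [h2 h0] H] := fast_majorant (fun k => measurable_funB (mw k) f2.1) w8.
have fh2 : L2 (fun x => 1 * (1 * `|f x| + 1 * h x)).
  have nf2 : L2 (fun x => `|f x|).
    by apply: (L2_le _ f2); [apply: measurableT_comp => //; exact: f2.1|move=> x _; rewrite normr_id].
  have := L2_lin 1 1 nf2 h2; rewrite (_ : (fun x => 1 * (_ + _)) = (fun x => 1 * `|f x| + 1 * h x))//.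
  by apply/funext => x; rewrite mul1r.
exists (fun x => 1 * (1 * `|f x| + 1 * h x)) => //.
move: H; apply: (@ae_imp _ T R m) => x Hx Dx; have {}Hx := Hx Dx; split; last first.
  move=> k; rewrite !mul1r -[w k x](subrK (f x)) addrC; apply: (le_trans (ler_normD _ _)).
  rewrite lerD2l; apply: (le_trans (Hx k)); rewrite ler_piMl// exprn_ile1//.
  by rewrite invf_le1// ler1n.
apply/cvgrPdist_le => e e0.
have : (fun k => 2^-1 ^+ k * h x : R) @ \oo --> 0 * h x.
  by apply: cvgMr_tmp; apply: cvg_expr; rewrite ger0_norm// invf_lt1// ltr1n.
rewrite mul0r => /cvgrPdist_le /(_ e e0); apply: filterS => k.
rewrite sub0r normrN => hk; rewrite distrC; apply: (le_trans (Hx k)); exact: le_trans (ler_norm _) hk.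
Qed.

(** Increments bounded by 8^(-k) in squared norm give, by [fast_majorant], pointwise increments at
    most 2^(-k) h with one square integrable h; the sequence then converges almost everywhere and is
    dominated. *)
Lemma fast_cauchy (w : nat -> T -> R) : (forall k, measurable_fun D (w k)) -> L2 (w 0%N) ->
  (forall k, (\int[m]_(x in D) ((w k.+1 x - w k x) ^+ 2)%:E <= (8^-1 ^+ k)%:E)%E) ->
  exists f h : T -> R, [/\ L2 f, L2 h,
    {ae m, forall x, D x -> w k x @[k --> \oo] --> f x /\ forall k, `|w k x| <= h x} &
    (\int[m]_(x in D) ((w k x - f x) ^+ 2)%:E)%E @[k --> \oo] --> 0%E].
Proof.
move=> mw w02 w8.
have [h [h2 h0] H] := fast_majorant (fun k => measurable_funB (mw k.+1) (mw k)) w8.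
(* The upper limit is measurable whether or not the sequence converges at x. *)
pose f x := fine (limn_esup (fun k => (w k x)%:E)).
have mf : measurable_fun D f.
  apply: (measurableT_comp (@fine_measurable R setT measurableT)).
  by apply: measurable_fun_limn_esup => k; apply/measurable_EFinP.
have main x : (forall k, `|w k.+1 x - w k x| <= 2^-1 ^+ k * h x) ->
    w k x @[k --> \oo] --> f x /\ forall k, `|w k x - f x| <= 2^-1 ^+ k * (2 * h x).
  move=> hx.
  (* w_k plus and minus the remaining tail 2^(-k) 2h: the first decreases, the second increases, and
     both enclose the limit. *)
  pose a k := w k x + 2^-1 ^+ k * (2 * h x); pose b k := w k x - 2^-1 ^+ k * (2 * h x).
  have p0 k : 0 <= 2^-1 ^+ k * (2 * h x) by rewrite mulr_ge0 ?exprn_ge0// mulr_ge0.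
  have hk k : 2^-1 ^+ k.+1 * (2 * h x) = 2^-1 ^+ k * h x by rewrite exprS; field.
  have hk2 k : 2^-1 ^+ k * (2 * h x) = 2^-1 ^+ k * h x + 2^-1 ^+ k * h x by ring.
  have na : nonincreasing_seq a.
    apply/nonincreasing_seqP => k; rewrite /a hk hk2; have := hx k.
    by rewrite ler_norml => /andP[_]; lra.
  have nb : nondecreasing_seq b.
    apply/nondecreasing_seqP => k; rewrite /b hk hk2; have := hx k.
    by rewrite ler_norml => /andP[]; lra.
  have c0 : (fun k => 2^-1 ^+ k * (2 * h x)) @ \oo --> (0 : R).
    have : (fun k => 2^-1 ^+ k * (2 * h x) : R) @ \oo --> 0 * (2 * h x).
      by apply: cvgMr_tmp; apply: cvg_expr; rewrite ger0_norm// invf_lt1// ltr1n.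
    by rewrite mul0r.
  have ca : cvgn a.
    apply: nonincreasing_is_cvgn => //; exists (b 0%N) => _ [k _ <-].
    by apply: (le_trans (nb 0%N k (leq0n k))); rewrite /a /b; have := p0 k; lra.
  have cw : w k x @[k --> \oo] --> limn a.
    rewrite (_ : (fun k => w k x) = (fun k => a k - 2^-1 ^+ k * (2 * h x))).
      by rewrite -[limn a]subr0; exact: cvgB.
    by apply/funext => k; rewrite /a addrK.
  have cb : b @ \oo --> limn a by rewrite -[limn a]subr0; exact: cvgB.
  have fE : f x = limn a.
    rewrite /f; have cE : (w k x)%:E @[k --> \oo] --> (limn a)%:E.
      by apply: cvg_EFin; [exact: nearW|exact: cw].
    by rewrite (cvg_limn_einf_sup cE).2.
  rewrite fE; split => // k.
  have ub := nonincreasing_cvgn_ge na ca k.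
  have cbE : limn b = limn a by apply: cvg_lim.
  have lb : b k <= limn a by rewrite -cbE; apply: nondecreasing_cvgn_le => //; apply/cvg_ex; exists (limn a).
  by move: ub lb; rewrite /a /b ler_norml => u1 l1; apply/andP; split; lra.
have {}H : {ae m, forall x, D x -> w k x @[k --> \oo] --> f x /\
    forall k, `|w k x - f x| <= 2^-1 ^+ k * (2 * h x)}.
  by move: H; apply: (@ae_imp _ T R m) => x hx Dx; apply: main; exact: hx.
pose g x := 1 * `|w 0%N x| + 4 * h x.
have nw2 : L2 (fun x => `|w 0%N x|).
  by apply: (L2_le _ w02); [apply: measurableT_comp => //; exact: w02.1|move=> x _; rewrite normr_id].
have g2 : L2 g by exact: L2_lin.
have g0 x : 0 <= g x by rewrite addr_ge0 ?mul1r// mulr_ge0.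
have Hg : {ae m, forall x, D x -> w k x @[k --> \oo] --> f x /\ forall k, `|w k x| <= g x}.
  move: H; apply: (@ae_imp _ T R m) => x hx Dx; have [c1 c2] := hx Dx; split => // k.
  have k1 : 2^-1 ^+ k * (2 * h x) <= 2 * h x.
    by rewrite ler_piMl ?mulr_ge0// exprn_ile1// invf_le1// ler1n.
  have := c2 0%N; have := c2 k; rewrite expr0 mul1r /g mul1r => a1 a2.
  have : `|w k x| <= `|w 0%N x| + (`|w k x - f x| + `|w 0%N x - f x|).
    have e : w k x = w 0%N x + ((w k x - f x) - (w 0%N x - f x)) by ring.
    rewrite [X in `|X| <= _]e; apply: (le_trans (ler_normD _ _)); rewrite lerD2l.
    exact: ler_normB.
  lra.
have f2 : L2 f.
  have H2 : {ae m, forall x, D x -> w k x ^+ 2 @[k --> \oo] --> f x ^+ 2 /\ forall k, `|w k x ^+ 2| <= g x ^+ 2}.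
    move: Hg; apply: (@ae_imp _ T R m) => x hx Dx; have [c1 c2] := hx Dx; split => [|k].
      exact: (cvg_comp _ _ c1 (@exprn_continuous R 2 (f x))).
    by rewrite normrX lerXn2r ?nnegrE.
  have [_ fi _] := dct (fun k => measurable_funX 2 (mw k)) (measurable_funX 2 mf) (L2_sqr g2) H2.
  split => //; have /integrableP[_] := fi.
  suff -> : (\int[m]_(x in D) `|(EFin \o (fun x => (f x ^+ 2)%R)) x| = \int[m]_(x in D) (f x ^+ 2)%:E)%E by [].
  by apply: eq_integral => x _ /=; rewrite ger0_norm// sqr_ge0.
exists f, g; split => //.
have h42 : L2 (fun x => 2 * h x + 0 * h x) by exact: L2_lin.
have H2 : {ae m, forall x, D x -> (w k x - f x) ^+ 2 @[k --> \oo] --> (0 : R) /\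
    forall k, `|(w k x - f x) ^+ 2| <= (2 * h x + 0 * h x) ^+ 2}.
  move: H; apply: (@ae_imp _ T R m) => x hx Dx; have [c1 c2] := hx Dx; split => [|k].
    have c3 : w k x - f x @[k --> \oo] --> (0 : R) by rewrite -(subrr (f x)); apply: cvgB => //; exact: cvg_cst.
    by have := cvg_comp _ _ c3 (@exprn_continuous R 2 0); rewrite expr0n.
  rewrite normrX mul0r addr0 lerXn2r ?nnegrE ?mulr_ge0//; apply: le_trans (c2 k) _.
  by rewrite ler_piMl ?mulr_ge0// exprn_ile1// invf_le1// ler1n.
have [iF i0 cF] := dct (fun k => measurable_funX 2 (measurable_funB (mw k) mf)) (measurable_cst (0:R)) (L2_sqr h42) H2.
have E k : (\int[m]_(x in D) ((w k x - f x) ^+ 2)%:E)%E = (\int[m]_(x in D) (w k x - f x) ^+ 2)%:E.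
  by rewrite /Rintegral fineK// (integrable_fin_num mD (iF k)).
under eq_cvg do rewrite E; apply: cvg_EFin; first exact: nearW.
by move: cF; rewrite Rintegral_cst// mul0r.
Qed.

End LpSpaces.

(** * Test functions and weak gradients *)

Section CkCalculus.
Context (R : realType) (n : nat).
Implicit Types (f g : 'rV[R]_n -> R).

Lemma CkS k f : Ck k.+1 f -> Ck k f.
Proof.
elim: k f => [|k IH] f [cf df]; first exact: cf.
by split=> // i; have [d1 d2] := df i; split => //; exact: IH.
Qed.

Lemma Ck_C1 k f : Ck k.+1 f -> Ck 1 f.
Proof. by elim: k f => [//|k IH] f h; apply: IH; exact: CkS. Qed.

Lemma Ck_cst k (a : R) : Ck k (cst a : 'rV[R]_n -> R).
Proof.
elim: k a => [|k IH] a; first exact: cst_continuous.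
have [[c1 d1] P1] := @C1_cst R n a.
by split=> // i; split; [exact: (d1 i).1|rewrite P1; exact: IH].
Qed.

Lemma CkD k f g : Ck k f -> Ck k g -> Ck k (fun x => f x + g x).
Proof.
elim: k f g => [|k IH] f g; first exact: contD.
move=> Cf Cg; have [[c d] P] := C1D (Ck_C1 Cf) (Ck_C1 Cg); split => // i.
split; first exact: (d i).1.
by rewrite P; apply: IH; [exact: (Cf.2 i).2|exact: (Cg.2 i).2].
Qed.

Lemma CkM k f g : Ck k f -> Ck k g -> Ck k (fun x => f x * g x).
Proof.
elim: k f g => [|k IH] f g; first exact: contM.
move=> Cf Cg; have [[c d] P] := C1M (Ck_C1 Cf) (Ck_C1 Cg); split => // i.
split; first exact: (d i).1.
rewrite P; apply: CkD; apply: IH.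
- exact: CkS.
- exact: (Cg.2 i).2.
- exact: CkS.
- exact: (Cf.2 i).2.
Qed.

Lemma Ck_prod k m (f : 'I_m -> 'rV[R]_n -> R) : (forall i, Ck k (f i)) ->
  Ck k (fun x => \prod_i f i x).
Proof.
elim: m f => [|m IH] f Cf.
  by under eq_fun do rewrite big_ord0; exact: Ck_cst.
under eq_fun do rewrite big_ord_recl.
by apply: CkM => //; exact: (IH (fun i => f (lift ord0 i))).
Qed.

Lemma C1_coord (i : 'I_n) : Ck 1 (fun x : 'rV[R]_n => x 0 i) /\
  forall j, partial j (fun x : 'rV[R]_n => x 0 i) = cst ((i == j)%:R).
Proof.
apply: (@C1P R n _ (fun j => cst ((i == j)%:R))); first exact: coord_continuous.
  move=> j x.
  have E : h^-1 *: (((fun y : 'rV[R]_n => y 0 i) \o shift x) (h *: delta_mx 0 j) - x 0 i)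
      @[h --> (0:R)^'] --> ((i == j)%:R : R).
    apply: cvg_near_cst; near=> h.
    have h0 : h != 0 by near: h; exact: nbhs_dnbhs_neq.
    rewrite /= !mxE eqxx/= addrK /GRing.scale/= [(i == j)]eq_sym.
    by rewrite mulrA mulVf// mul1r eq_sym.
  apply: DeriveDef; last by apply/cvg_lim.
  by apply/cvg_ex; eexists; exact: E.
by move=> j; exact: cst_continuous.
Unshelve. all: by end_near. Qed.

End CkCalculus.

Section Bump.
Context (R : realType).

(** t^(-m) exp(-1/t) for t > 0. The negative powers make the family closed under differentiation:
    the derivative of [bump m] is a combination of [bump m.+1] and [bump m.+2], so smoothness
    follows by an induction for all m at once. *)
Definition bump (m : nat) (t : R) : R :=
  if 0 < t then t^-1 ^+ m * expR (- t^-1) else 0.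

Lemma bump_ge0 m t : 0 <= bump m t.
Proof.
by rewrite /bump; case: ifP => // t0; rewrite mulr_ge0 ?expR_ge0// exprn_ge0// invr_ge0 ltW.
Qed.

Lemma bump_le0 m t : t <= 0 -> bump m t = 0.
Proof. by move=> t0; rewrite /bump ltNge t0. Qed.

(** With x = 1/t, the bound exp(x) >= x^(m+1) / (m+1)! beats the factor x^m by one power of t. Used
    at m + 1, it gives the derivative 0 at the origin. *)
Lemma bump_le m t : 0 < t -> bump m t <= (m.+1)`!%:R * t.
Proof.
move=> t0; rewrite /bump t0 expRN ler_pdivrMr ?expR_gt0//.
have x0 : 0 < t^-1 by rewrite invr_gt0.
have := expR_ge1Dxn m (ltW x0); set F : R := (m.+1)`!%:R => h.
have F0 : 0 < F by rewrite ltr0n fact_gt0.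
have h2 : t^-1 ^+ m.+1 <= F * expR t^-1.
  rewrite mulrC -ler_pdivrMr//; apply: le_trans h; rewrite lerDr; exact: ler01.
have -> : t^-1 ^+ m = t^-1 ^+ m.+1 * t by rewrite exprS mulrC mulrA mulfV ?mul1r// gt_eqF.
by rewrite -mulrA [t * _]mulrC mulrA ler_wpM2r// ltW.
Qed.

Lemma bump0_le1 t : bump 0 t <= 1.
Proof.
rewrite /bump; case: ifP => // t0; rewrite expr0 mul1r -expR0 ler_expR.
by rewrite oppr_le0 invr_ge0 ltW.
Qed.

Lemma is_derive_bump m (t : R) : is_derive t 1 (bump m) (- m%:R * bump m.+1 t + bump m.+2 t).
Proof.
have [t0|t0|t0] := ltgtP t 0.
- rewrite !bump_le0 ?(ltW t0)// mulr0 addr0.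
  apply: (near_eq_is_derive _ (is_derive_cst (0:R) t (1:R))).
  by near=> s; rewrite bump_le0// ltW//; near: s; exact: lt_nbhsl.
- have tn : t != 0 by rewrite gt_eqF.
  have d1 := @is_deriveV R id t 1 1 tn (is_derive_id _ _).
  have d2 := @is_deriveX R _ _ m t 1 _ d1.
  have d3 := @is_derive1_comp R expR (fun s => - s^-1) t _ _ (is_derive_expR _) (@is_deriveN R _ _ _ t 1 _ d1).
  have D := @is_deriveM R _ _ _ t 1 _ _ d2 d3.
  have fE s : (([eta GRing.inv] ^+ m : R -> R) * (expR \o (fun s : R => - s^-1))) s =
      s^-1 ^+ m * expR (- s^-1) by rewrite /= fctE exprfctE.
  suff -> : - m%:R * bump m.+1 t + bump m.+2 t = ([eta GRing.inv] ^+ m : R -> R) t *: (expR (- t^-1) * - (- t ^- 2)%:A)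
    + (expR \o (fun s : R => - s^-1)) t *: ((m%:R * t^-1 ^+ m.-1) *: (- t ^- 2)%:A).
    apply: (near_eq_is_derive _ D).
    by near=> s; rewrite fE /bump ifT//; near: s; exact: lt_nbhsr.
  rewrite exprfctE /bump t0 /GRing.scale/=.
  have e : t ^- 2 = t^-1 ^+ 2 by rewrite exprVn.
  rewrite e; case: (m) => [|k]; first by rewrite !expr0 expr1; ring.
  by rewrite /= !exprS; ring.
- subst t; rewrite !(@bump_le0 _ 0)// mulr0 addr0.
  have E : h^-1 *: ((bump m \o shift 0) (h *: (1:R)) - bump m 0) @[h --> (0:R)^'] --> (0 : R).
    apply/cvgrPdist_le => e e0; set F : R := (m.+2)`!%:R.
    have F0 : 0 < F by rewrite ltr0n fact_gt0.
    apply/nbhs_ballP; exists (e / F) => /=; first exact: divr_gt0.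
    move=> h; rewrite /ball/= sub0r normrN => he h0.
    rewrite sub0r normrN scaler1 addr0 /GRing.scale/= {2}/bump ltxx subr0.
    rewrite /bump; case: ifPn => hp; last by rewrite mulr0 normr0 ltW.
    have := bump_le m.+1 hp; rewrite /bump hp exprS -mulrA => hb.
    rewrite ger0_norm; last by rewrite mulr_ge0 ?invr_ge0 ?(ltW hp)// mulr_ge0 ?expR_ge0// exprn_ge0// invr_ge0 ltW.
    apply: le_trans hb _; rewrite mulrC -ler_pdivlMr//.
    by apply: ltW; move: he; rewrite gtr0_norm.
  apply: DeriveDef; last by apply/cvg_lim.
  by apply/cvg_ex; eexists; exact: E.
Unshelve. all: by end_near. Qed.

Lemma Ck_bump k n m (i : 'I_n) (a c : R) : Ck k (fun x : 'rV[R]_n => bump m (a * x 0 i + c)).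
Proof.
have [Cc Pc] := @C1_coord R n i.
have [Ca Pa] := C1Z a Cc.
have [Cw Pw] := C1D Ca (C1_cst n c).1.
have cb m' : continuous (bump m') by apply: is_derive_continuous => t; exact: is_derive_bump.
have cb' m' : continuous (fun t => - m'%:R * bump m'.+1 t + bump m'.+2 t).
  by apply: contD => //; apply: contM => //; exact: contC.
elim: k m => [|k IH] m; first exact: cont_comp (C1_continuous Cw).
have [C1b P1b] := C1_comp Cw (is_derive_bump m) (@cb' m).
split; first exact: C1_continuous C1b.
move=> j; split; first exact: (C1b.2 j).1.
rewrite P1b; apply: CkM.
  by apply: CkD => //; apply: CkM => //; exact: Ck_cst.
rewrite Pw Pa Pc (C1_cst n c).2.
rewrite (_ : (fun _ => _) = cst (a * (i == j)%:R)); first exact: Ck_cst.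
by apply/funext => x; rewrite /= addr0.
Qed.

End Bump.

Section BoxBumps.
Context (R : realType) (n : nat).
Implicit Types (a b : 'rV[R]_n).

(** The arguments are k^2 (x_i - a_i) + k and k^2 (b_i - x_i) + k. The offset k makes the product
    tend to 1 on the faces of the box as well, while the support extends only by 1/k beyond the
    box. *)
Definition box_bump a b (k : nat) (x : 'rV[R]_n) : R :=
  \prod_i (bump 0 (k%:R ^+ 2 * x 0 i + (k%:R - k%:R ^+ 2 * a 0 i)) *
           bump 0 (- k%:R ^+ 2 * x 0 i + (k%:R + k%:R ^+ 2 * b 0 i))).

Lemma Ck_box_bump a b k j : Ck j (box_bump a b k).
Proof. by apply: Ck_prod => i; apply: CkM; exact: Ck_bump. Qed.

Lemma box_bump_bounds a b k x : 0 <= box_bump a b k x <= 1.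
Proof.
apply/andP; split; first by apply: prodr_ge0 => i _; rewrite mulr_ge0 ?bump_ge0.
by apply: prodr_ile1 => i _; rewrite mulr_ge0 ?bump_ge0// mulr_ile1 ?bump_ge0 ?bump0_le1.
Qed.

Lemma box_bump_support a b k (d : R) : (0 < k)%N -> k%:R^-1 <= d ->
  [set x | box_bump a b k x != 0] `<=` box (a - const_mx d) (b + const_mx d).
Proof.
move=> k0 kd x /= /prodf_neq0 h i.
have kR : 0 < k%:R :> R by rewrite ltr0n.
have := h i isT; rewrite mulf_eq0 negb_or /bump => /andP[].
case: ifPn => [h1 _|]; last by rewrite eqxx.
case: ifPn => [h2 _|]; last by rewrite eqxx.
have kk : k%:R ^+ 2 * k%:R^-1 = k%:R :> R by field; rewrite gt_eqF.
have k2 : 0 < k%:R ^+ 2 :> R by rewrite exprn_gt0.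
rewrite !mxE; apply/andP; split.
  have : a 0 i - k%:R^-1 <= x 0 i.
    by rewrite -(ler_pM2l k2) mulrBr kk; lra.
  lra.
have : x 0 i <= b 0 i + k%:R^-1.
  by rewrite -(ler_pM2l k2) mulrDr kk; lra.
lra.
Qed.

Lemma closed_box a b : closed (box a b).
Proof.
rewrite (_ : box a b = \bigcap_(i in [set: 'I_n]) ([set x | a 0 i <= x 0 i] `&` [set x | x 0 i <= b 0 i])).
  apply: closed_bigI => i _; apply: closedI.
    by have := closed_comp (fun (z : 'rV[R]_n) _ => @coord_continuous _ _ _ 0 i z) (@closed_ge R (a 0 i)); apply.
  by have := closed_comp (fun (z : 'rV[R]_n) _ => @coord_continuous _ _ _ 0 i z) (@closed_le R (b 0 i)); apply.
apply/seteqP; split => x /=.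
  by move=> h i _; have /andP[] := h i.
by move=> h i; have [h1 h2] := h i I; apply/andP.
Qed.

Lemma test_box_bump (Om : set 'rV[R]_n) a b k (d : R) : bounded_set Om ->
  box (a - const_mx d) (b + const_mx d) `<=` Om ->
  (0 < k)%N -> k%:R^-1 <= d -> test_function Om (box_bump a b k).
Proof.
move=> bOm bO k0 kd; have s := @box_bump_support a b k d k0 kd.
have cs : closure [set x | box_bump a b k x != 0] `<=` box (a - const_mx d) (b + const_mx d).
  by have := closure_subset s; rewrite -[X in _ `<=` X]((closure_id _).1 (@closed_box _ _)).
split; first by move=> j; exact: Ck_box_bump.
  apply: (subclosed_compact _ (closure_compact bOm)); first exact: closed_closure.
  by move=> x /cs/bO; exact: subset_closure.
exact: subset_trans cs bO.
Qed.

Lemma cvg_bump_half (s : R) :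
  (fun k : nat => bump 0 (k%:R ^+ 2 * s + k%:R)) @ \oo --> ((0 <= s)%R%:R : R).
Proof.
have [s0|s0] := leP 0 s => /=; last first.
  apply: cvg_near_cst; near=> k; rewrite /bump ifF//; apply/negbTE; rewrite -leNgt.
  have k1 : (- s)^-1 <= k%:R by near: k; exact: nbhs_infty_ger.
  have sp : 0 < - s by rewrite oppr_gt0.
  have h : 1 <= k%:R * (- s) by rewrite -ler_pdivrMr// mul1r.
  have k0 : 0 <= k%:R :> R by [].
  have -> : k%:R ^+ 2 * s + k%:R = k%:R * (1 - k%:R * (- s)) by ring.
  by rewrite mulr_ge0_le0// subr_le0.
apply/cvgrPdist_le => e e0; near=> k.
have k0 : 0 < k%:R :> R by rewrite ltr0n; near: k; exists 1%N.
have ke : e^-1 <= k%:R by near: k; exact: nbhs_infty_ger.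
have p : k%:R <= k%:R ^+ 2 * s + k%:R by rewrite lerDr mulr_ge0// sqr_ge0.
have pp := lt_le_trans k0 p.
rewrite ger0_norm ?subr_ge0 ?bump0_le1// /bump pp expr0 mul1r.
have := expR_ge1Dx (- (k%:R ^+ 2 * s + k%:R)^-1).
have : (k%:R ^+ 2 * s + k%:R)^-1 <= e.
  by rewrite -[e]invrK lef_pV2 ?posrE ?invr_gt0//; exact: le_trans ke p.
lra.
Unshelve. all: by end_near. Qed.

Lemma cvg_fprod (m : nat) (F : nat -> 'I_m -> R) (l : 'I_m -> R) :
  (forall i, F k i @[k --> \oo] --> l i) -> (\prod_i F k i) @[k --> \oo] --> \prod_i l i.
Proof.
elim: m F l => [|m IH] F l h.
  by under eq_cvg do rewrite big_ord0; rewrite big_ord0; exact: cvg_cst.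
under eq_cvg do rewrite big_ord_recl; rewrite big_ord_recl.
apply: cvgM; first exact: h.
exact: (IH (fun k i => F k (lift ord0 i)) (fun i => l (lift ord0 i)) (fun i => h _)).
Qed.

Lemma cvg_box_bump a b x : box_bump a b k x @[k --> \oo] --> (\1_(box a b) x : R).
Proof.
have -> : (\1_(box a b) x : R) = \prod_i ((0 <= x 0 i - a 0 i)%R%:R * (0 <= b 0 i - x 0 i)%R%:R).
  rewrite indicE; case: (boolP (x \in box a b)) => [/set_mem h|h].
    by rewrite big1// => i _; have /andP[h1 h2] := h i; rewrite !subr_ge0 h1 h2 mulr1.
  apply/esym; have /existsNP[i hi] : ~ box a b x by move=> hb; move/negP: h; apply; exact: mem_set.
  rewrite (bigD1 i)//= !subr_ge0.
  by move: hi; do 2 case: (_ <= _); rewrite ?mul0r ?mulr0 ?mul0r.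
apply: cvg_fprod => i; apply: cvgM.
  have := @cvg_bump_half (x 0 i - a 0 i); apply: cvg_trans; apply: near_eq_cvg; apply: nearW => k.
  by congr (bump 0 _); ring.
have := @cvg_bump_half (b 0 i - x 0 i); apply: cvg_trans; apply: near_eq_cvg; apply: nearW => k.
by congr (bump 0 _); ring.
Qed.

End BoxBumps.

Section RintegralFacts.
Context d (T : measurableType d) (R : realType) (m : {measure set T -> \bar R}).
Implicit Types (D A : set T) (f g v : T -> R).

Lemma EFin_Rintegral D f : measurable D -> m.-integrable D (EFin \o f) ->
  (\int[m]_(x in D) (f x)%:E = (\int[m]_(x in D) f x)%:E)%E.
Proof. by move=> mD fi; rewrite /Rintegral fineK// (integrable_fin_num mD fi). Qed.

Lemma Rintegral_split D A v : measurable D -> measurable A ->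
  m.-integrable D (EFin \o v) ->
  \int[m]_(x in D) v x = \int[m]_(x in A `&` D) v x + \int[m]_(x in ~` A `&` D) v x.
Proof.
move=> mD mA vi; rewrite -Rintegral_setU.
- by rewrite -setIUl setUCr setTI.
- exact: measurableI.
- by apply: measurableI => //; exact: measurableC.
- by rewrite -setIUl setUCr setTI.
- by apply/disj_setPS => x [[Ax _] [nAx _]].
Qed.

Lemma ae0_of_subsets D v : measurable D -> m.-integrable D (EFin \o v) ->
  (forall A, measurable A -> A `<=` D -> \int[m]_(x in A) v x = 0) ->
  {ae m, forall x, D x -> v x = 0}.
Proof.
move=> mD vi H; have mv : measurable_fun D v by apply/measurable_EFinP; case/integrableP: vi.
pose A := D `&` v @^-1` `]0, +oo[%classic.
have mA : measurable A by apply: mv => //; exact: measurable_itv.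
have AD : A `<=` D by move=> x [].
have mB : measurable (D `\` A) by exact: measurableD.
have nvi : m.-integrable D (EFin \o (fun x => `|v x|)).
  by have := integrable_abse vi; apply: eq_integrable.
have E : \int[m]_(x in D) `|v x| = 0.
  rewrite (Rintegral_split mD mA nvi) [A `&` D]setIidl//.
  have -> : ~` A `&` D = D `\` A by rewrite setIC setDE.
  have -> : \int[m]_(x in A) `|v x| = \int[m]_(x in A) v x.
    apply: eq_Rintegral => x /set_mem[_ /=]; rewrite in_itv/= andbT => h.
    by rewrite gtr0_norm.
  have -> : \int[m]_(x in D `\` A) `|v x| = \int[m]_(x in D `\` A) (-1 * v x).
    apply: eq_Rintegral => x /set_mem[Dx nAx]; rewrite mulN1r ler0_norm// leNgt.
    by apply/negP => h; apply: nAx; split => //=; rewrite in_itv/= h.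
  rewrite RintegralZl//; last by apply: (integrableS mD) => // x [].
  by rewrite !H ?mulr0 ?addr0// => x [].
have := (@ae_eq_integral_abs _ T R m D mD (EFin \o v) _).1.
move=> /(_ _ _); rewrite (_ : (\int[m]_(x in D) `|(EFin \o v) x|)%E = 0%E); last first.
  by have := EFin_Rintegral mD nvi; rewrite E.
move=> h; have := h _ erefl; move=> h2.
have {h2} : {ae m, forall x, D x -> (EFin \o v) x = cst 0%E x} by apply: h2; case/integrableP: vi.
by apply: ae_imp => x hx Dx; have [] := hx Dx.
Qed.

Lemma integrable_mulb D v (h : T -> R) (c : R) : measurable D ->
  m.-integrable D (EFin \o v) -> measurable_fun D h ->
  (forall x, D x -> `|h x| <= c) -> m.-integrable D (EFin \o (fun x => v x * h x)).
Proof.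
move=> mD vi mh hc.
have mv : measurable_fun D v by apply/measurable_EFinP; case/integrableP: vi.
have nvi : m.-integrable D (EFin \o (fun x => `|c| * `|v x|)).
  have := @integrableZl _ T R m D mD `|c| _ (integrable_abse vi).
  by apply: eq_integrable => // x _ /=; rewrite EFinM.
apply: (le_integrable mD _ _ nvi).
  by apply/measurable_EFinP; exact: measurable_funM.
move=> x Dx /=; rewrite lee_fin !normrM !normr_id mulrC ler_wpM2r//.
by apply: le_trans (hc x Dx) _; exact: ler_norm.
Qed.

End RintegralFacts.

Section FundamentalLemma.
Context (R : realType) (n : nat).
Local Notation lebT := (caratheodory_type (@lebesgue_outer R n)).
Local Notation mu := (lebesgue_rV R n).
Implicit Types (Om A B : set 'rV[R]_n) (v : 'rV[R]_n -> R).

Lemma continuous_bounded_on Om (f : 'rV[R]_n -> R) : bounded_set Om -> continuous f ->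
  exists2 c, 0 <= c & forall x, closure Om x -> `|f x| <= c.
Proof.
move=> bOm cf; have cpt : compact (f @` closure Om).
  apply: continuous_compact; last exact: closure_compact.
  exact: continuous_subspaceT.
have [b [_ Hb]] := compact_bounded cpt; exists (`|b| + 1); first by rewrite addr_ge0.
move=> x Ox; apply: (Hb (`|b| + 1)); last by exists x.
by rewrite ltr_pwDr// ler_norm.
Qed.

Lemma integrable_cont Om (f : 'rV[R]_n -> R) : open Om -> bounded_set Om -> continuous f ->
  mu.-integrable Om (EFin \o f).
Proof.
move=> oOm bOm cf; have [k Ok] := bounded_kbox bOm.
have mO : measurable (Om : set lebT) by apply: measurable_rvB_leb; exact: rvB_open.
apply: (measurable_bounded_integrable mO (mu_bounded Ok)).
  by apply: measurable_funTS; exact: measurable_cont.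
have [c c0 hc] := continuous_bounded_on bOm cf.
exists c; split; first exact: num_real.
by move=> y cy x Ox; apply: le_trans (ltW cy); apply: hc; exact: subset_closure.
Qed.

(** The bumps are bounded by 1 and converge to the indicator of the closed box; they are test
    functions of [Om] once 1/k is at most the margin d. *)
Lemma box_integral0 Om v a b (d : R) : open Om -> bounded_set Om -> 0 < d ->
  box (a - const_mx d) (b + const_mx d) `<=` Om -> mu.-integrable Om (EFin \o (v : lebT -> R)) ->
  (forall phi, test_function Om phi -> \int[mu]_(x in (Om : set lebT)) (v x * phi x) = 0) ->
  \int[mu]_(x in (box a b : set lebT)) v x = 0.
Proof.
move=> oOm bOm d0 bO vi H.
have mO : measurable (Om : set lebT) by apply: measurable_rvB_leb; exact: rvB_open.
have mB : measurable (box a b : set lebT) by apply: measurable_rvB_leb; exact: measurable_box.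
have mv : measurable_fun (Om : set lebT) (v : lebT -> R) by apply/measurable_EFinP; case/integrableP: vi.
have bbO : box a b `<=` Om.
  apply: subset_trans bO => x h i; have /andP[h1 h2] := h i; rewrite !mxE.
  by apply/andP; split; lra.
have mind : measurable_fun (Om : set lebT) (\1_(box a b) : lebT -> R).
  by apply: measurable_funTS; exact: measurable_indic.
have mbb k : measurable_fun (Om : set lebT) (box_bump a b k : lebT -> R).
  by apply: measurable_funTS; apply: measurable_cont; exact: (Ck_box_bump a b k 0).
have H2 : {ae mu, forall x : lebT, Om x -> v x * box_bump a b k x @[k --> \oo] --> v x * \1_(box a b) x /\
    forall k, `|v x * box_bump a b k x| <= `|v x|}.
  apply: aeW => x Ox; split; first by apply: cvgMl_tmp; exact: cvg_box_bump.
  move=> k; rewrite normrM ler_piMr//; have /andP[h1 h2] := box_bump_bounds a b k x.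
  by rewrite ger0_norm.
have nvi : mu.-integrable (Om : set lebT) (EFin \o (fun x : lebT => `|v x|)).
  by have := integrable_abse vi; apply: eq_integrable.
have [_ _ c1] := @dct _ lebT R mu Om mO _ _ _ (fun k => measurable_funM mv (mbb k))
  (measurable_funM mv mind) nvi H2.
have c2 : \int[mu]_(x in (Om : set lebT)) (v x * box_bump a b k x) @[k --> \oo] --> (0 : R).
  apply: cvg_near_cst; near=> k; apply: H; apply: (test_box_bump bOm bO); near: k; first by exists 1%N.
  near=> k; have kd : d^-1 <= k%:R by near: k; exact: nbhs_infty_ger.
  have k0 : 0 < k%:R :> R by apply: lt_le_trans kd; rewrite invr_gt0.
  by rewrite -[d]invrK lef_pV2 ?posrE ?invr_gt0.
have e : \int[mu]_(x in (Om : set lebT)) (v x * \1_(box a b) x) = 0.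
  exact: (etrans (esym (cvg_lim (@norm_hausdorff _ R^o) c1)) (cvg_lim (@norm_hausdorff _ R^o) c2)).
rewrite -{}e -[in LHS](setIidr bbO) Rintegral_mkcondr; apply: eq_Rintegral => x _.
by rewrite patchE indicE; case: ifP; rewrite ?mulr1 ?mulr0.
Unshelve. all: by end_near. Qed.

Lemma box_setI (a b a' b' : 'rV[R]_n) :
  box a' b' `&` box a b = box (\row_i Num.max (a' 0 i) (a 0 i)) (\row_i Num.min (b' 0 i) (b 0 i)).
Proof.
apply/seteqP; split=> x.
  move=> [h h'] i; rewrite !mxE ge_max le_min.
  by have /andP[-> ->] := h i; have /andP[-> ->] := h' i.
move=> h; split=> i; have := h i; rewrite !mxE ge_max le_min.
  by move=> /andP[/andP[-> _] /andP[-> _]].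
by move=> /andP[/andP[_ ->] /andP[_ ->]].
Qed.

(** The infimum of the measures of Borel supersets is at most the volume on boxes and countably
    subadditive, hence at most Lebesgue outer measure. Intersecting supersets that are optimal up to
    1/(k+1) gives the hull. *)
Lemma borel_hull A : measurable (A : set lebT) -> (mu A < +oo)%E ->
  exists B, [/\ A `<=` B, measurable (B : set (rvB R n)) & mu (B `\` A) = 0%E].
Proof.
move=> mA Afin.
pose m (X : set 'rV[R]_n) := ereal_inf [set mu B | B in [set B | X `<=` B /\ measurable (B : set (rvB R n))]].
have mle : (m A <= mu A)%E.
  have h : forall X B, X `<=` B -> measurable (B : set (rvB R n)) -> (m X <= mu B)%E.
    by move=> X B XB mB; apply: ereal_inf_lbound; exists B.
  apply: le_lebesgue_outer_of_boxes.
  - by move=> a b ab; rewrite -leb_box_//; apply: h => //; exact: measurable_box.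
  - move=> F hF AF.
    have mF k : measurable (F k : set (rvB R n)).
      by have [->|[a [b ->]]] := hF k; [exact: measurable0|exact: measurable_box].
    apply: (le_trans (h A _ AF (bigcup_measurable (fun k _ => mF k)))).
    apply: (@le_trans _ _ (\sum_(k <oo) mu (F k))%E).
      exact: outer_measure_sigma_subadditive.
    apply: lee_nneseries => [k _ _|k _]; first exact: measure_ge0.
    apply: le_ereal_inf_tmp => _ [B [FB mB] <-]; exact: le_outer_measure.
  - apply/eqP; rewrite eq_le; apply/andP; split.
      by rewrite -[leRHS](measure0 mu); apply: h.
    by apply: le_ereal_inf_tmp => _ [B _ <-]; exact: measure_ge0.
  - by move=> X; apply: le_ereal_inf_tmp => _ [B _ <-]; exact: measure_ge0.
have hk (k : nat) : exists B, [/\ A `<=` B, measurable (B : set (rvB R n)) & (mu B <= mu A + (k.+1%:R^-1)%:E)%E].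
  have Af : mu A \is a fin_num by rewrite ge0_fin_numE.
  have : (m A < mu A + (k.+1%:R^-1)%:E)%E.
    by apply: (le_lt_trans mle); rewrite lteDl// lte_fin invr_gt0.
  by move=> /ereal_inf_lt[_ [B [AB mB] <-] h]; exists B; split => //; exact: ltW.
have [F hF] := choice hk.
exists (\bigcap_k F k); split.
- by move=> x Ax k _; have [AF _ _] := hF k; exact: AF.
- by apply: bigcap_measurable; [exists 0%N|move=> k _; have [] := hF k].
have mcap : measurable (\bigcap_k F k : set lebT).
  apply: measurable_rvB_leb; apply: bigcap_measurable; [by exists 0%N|by move=> k _; have [] := hF k].
have Acap : A `<=` \bigcap_k F k by move=> x Ax k _; have [AF _ _] := hF k; exact: AF.
have le k : (mu (\bigcap_k F k) <= mu A + (k.+1%:R^-1)%:E)%E.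
  have [_ _ h] := hF k; apply: le_trans h; apply: le_outer_measure => x; exact.
have Af : mu A \is a fin_num by rewrite ge0_fin_numE.
have capfin : (mu (\bigcap_k F k) < +oo)%E.
  by apply: le_lt_trans (le 0%N) _; rewrite -(fineK Af) -EFinD ltry.
rewrite measureD// (_ : _ `&` A = A); last by rewrite setIC setIidl.
have capf : mu (\bigcap_k F k) \is a fin_num by rewrite ge0_fin_numE.
suff e : mu (\bigcap_k F k) = mu A by exact: (etrans (congr1 (fun z => z - mu A)%E e) (subee Af)).
apply/eqP; rewrite eq_le; apply/andP; split; last exact: le_outer_measure.
apply/lee_addgt0Pr => e e0.
apply: le_trans (le (Num.truncn e^-1)) _; rewrite leeD2l// lee_fin.
rewrite -[leRHS]invrK lef_pV2 ?posrE ?invr_gt0//; exact/ltW/truncnS_gt.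
Qed.

(** Boxes form a pi-system on which the integral of [v] vanishes. Dynkin's theorem extends this to
    Borel subsets of the box, and [borel_hull] to Lebesgue measurable ones, among them the set where
    [v] is positive. *)
Lemma fundamental_box Om v a b (d : R) : open Om -> bounded_set Om -> 0 < d ->
  box (a - const_mx d) (b + const_mx d) `<=` Om -> mu.-integrable Om (EFin \o (v : lebT -> R)) ->
  (forall phi, test_function Om phi -> \int[mu]_(x in (Om : set lebT)) (v x * phi x) = 0) ->
  {ae mu, forall x : lebT, box a b x -> v x = 0}.
Proof.
move=> oOm bOm d0 bO vi H; set Q := box a b.
have mO : measurable (Om : set lebT) by apply: measurable_rvB_leb; exact: rvB_open.
have mQB : measurable (Q : set (rvB R n)) by exact: measurable_box.
have mQ : measurable (Q : set lebT) by exact: measurable_rvB_leb.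
have QO : Q `<=` Om.
  apply: subset_trans bO => x h i; have /andP[h1 h2] := h i; rewrite !mxE.
  by apply/andP; split; lra.
have viQ : mu.-integrable Q (EFin \o (v : lebT -> R)) by apply: (integrableS mO).
have viS (A : set lebT) : measurable A -> mu.-integrable (A `&` Q) (EFin \o (v : lebT -> R)).
  by move=> mA; apply: (integrableS mQ) => //; exact: measurableI.
pose P (A : set (rvB R n)) := \int[mu]_(x in (A `&` Q : set lebT)) v x = 0.
have Pbox a' b' : P (box a' b').
  rewrite /P /Q box_setI; apply: (@box_integral0 Om v _ _ d) => //.
  apply: subset_trans bO => x h i; have := h i; rewrite !mxE => /andP[h1 h2].
  apply/andP; split; first by apply: le_trans h1; rewrite lerD2r le_max lexx orbT.
  by apply: le_trans h2 _; rewrite lerD2r ge_min lexx orbT.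
have PT : P setT.
  have := Pbox a b; rewrite /P /Q setIid setTI; exact.
have Pborel (A : set (rvB R n)) : measurable A -> P A.
  move=> mA; have : <<s @boxes R n >> A by rewrite -boxes_generate.
  apply: (@dynkin_induction _ (rvB R n) (@boxes R n) P (boxes_generate R n) (@boxes_setI R n) PT).
  - by move=> _ [a' [b' ->]]; exact: Pbox.
  - move=> S mS PS; rewrite /P; have mSl := measurable_rvB_leb mS.
    have := Rintegral_split mQ mSl viQ.
    have -> : \int[mu]_(x in (Q : set lebT)) v x = 0 by move: PT; rewrite /P setTI.
    by rewrite (PS : \int[mu]_(x in (S `&` Q : set lebT)) v x = 0) add0r => /esym.
  - move=> F mF tF PF; rewrite /P setI_bigcupl.
    have mFl k : measurable (F k `&` Q : set lebT) by apply: measurableI => //; exact: measurable_rvB_leb.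
    have tFQ : trivIset setT (fun k => F k `&` Q) by exact: trivIset_setIr.
    have mU : measurable (\bigcup_k (F k `&` Q) : set lebT) by exact: bigcup_measurable.
    have iU : mu.-integrable (\bigcup_k (F k `&` Q)) (EFin \o (v : lebT -> R)).
      by apply: (integrableS mQ) => // x [k _ []].
    have Eb := @integral_bigcup _ lebT R mu (fun k => F k `&` Q) _ tFQ mFl iU.
    rewrite /Rintegral Eb eseries0// => k _ _.
    rewrite EFin_Rintegral//; last exact: viS (measurable_rvB_leb (mF k)).
    by rewrite (PF k : \int[mu]_(x in (F k `&` Q : set lebT)) v x = 0).
apply: (ae0_of_subsets mQ viQ) => A mA AQ.
have Afin : (mu A < +oo)%E.
  apply: (@le_lt_trans _ _ (mu Om)); first by apply: le_outer_measure; exact: subset_trans QO.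
  by have [k Ok] := bounded_kbox bOm; exact: mu_bounded Ok.
have [B [AB mB BA0]] := borel_hull mA Afin.
have mBl := measurable_rvB_leb mB.
have := Rintegral_split (measurableI _ _ mBl mQ) mA (viS _ mBl).
rewrite (Pborel B mB : \int[mu]_(x in (B `&` Q : set lebT)) v x = 0).
have -> : A `&` (B `&` Q) = A by apply/seteqP; split=> x; [case|move=> Ax; split => //; split; [exact: AB|exact: AQ]].
have mN : measurable (~` A `&` (B `&` Q) : set lebT).
  by apply: measurableI; [exact: measurableC|exact: measurableI].
rewrite [X in _ = _ + X](_ : _ = 0) ?addr0 => [/esym//|].
rewrite /Rintegral null_set_integral//.
- by have := viS _ mBl => /integrableP[+ _]; apply: measurable_funS; [exact: measurableI|move=> x []].
- apply/eqP; rewrite eq_le measure_ge0 andbT -BA0; apply: le_outer_measure => x [nAx [Bx _]].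
  by split.
Qed.

Lemma fundamental_lemma Om v : open Om -> bounded_set Om ->
  mu.-integrable Om (EFin \o (v : lebT -> R)) ->
  (forall phi, test_function Om phi -> \int[mu]_(x in (Om : set lebT)) (v x * phi x) = 0) ->
  {ae mu, forall x : lebT, Om x -> v x = 0}.
Proof.
move=> oOm bOm vi H.
pose lo (j : nat) (k : 'rV[int]_n) : 'rV[R]_n := \row_i ((k 0 i)%:~R * 2^-1 ^+ j).
(* A dyadic cell counts when it lies in [Om] together with a margin of one cell on each side, which
   is the margin asked by [fundamental_box]. There are countably many such cells. *)
pose good j k := box (lo j k - const_mx (2^-1 ^+ j)) (lo j k + const_mx (2^-1 ^+ j) + const_mx (2^-1 ^+ j)) `<=` Om.
pose P (q : nat) (x : lebT) := forall j k, pickle_inv q = Some (j, k) -> good j k ->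
  box (lo j k) (lo j k + const_mx (2^-1 ^+ j)) x -> v x = 0.
have HP : {ae mu, forall x : lebT, forall q, P q x}.
  apply: ae_all => q; case E: (pickle_inv q : option (nat * 'rV[int]_n)%type) => [[j k]|]; last first.
    by apply: aeW => x j k; rewrite E.
  have [g|ng] := pselect (good j k); last first.
    by apply: aeW => x j' k'; rewrite E => -[<- <-].
  have d0 : 0 < 2^-1 ^+ j :> R by rewrite exprn_gt0.
  have := fundamental_box oOm bOm d0 g vi H.
  by apply: (@ae_imp _ lebT R mu) => x hx j' k'; rewrite E => -[<- <-] _; exact: hx.
move: HP; apply: (@ae_imp _ lebT R mu) => x hx Ox.
have /nbhs_ballP[r /= r0 br] := open_nbhs_nbhs (conj oOm Ox).
(* Points of the enlarged cell around x are within two cell sides of x. *)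
have [j jr] : exists j, 2 * 2^-1 ^+ j < r.
  have : (fun j => 2 * 2^-1 ^+ j : R) @ \oo --> 2 * (0:R).
    by apply: cvgMl_tmp; apply: cvg_expr; rewrite ger0_norm// invf_lt1// ltr1n.
  rewrite mulr0 => /cvgrPdist_lt /(_ r r0) [j _ hj]; exists j.
  have := hj j (leqnn j); rewrite /= sub0r normrN ger0_norm// mulr_ge0// exprn_ge0//.
have l0 : 0 < 2^-1 ^+ j :> R by rewrite exprn_gt0.
have [k ck] := cell_cover x l0.
have xb i : lo j k 0 i <= x 0 i < lo j k 0 i + 2^-1 ^+ j.
  have := ck i; rewrite /lo mxE intrD mulrDl mul1r; exact.
apply: (hx (pickle (j, k)) j k (pickleK_inv _)).
  move=> y hy; apply: br; apply/ball_rV; split => // i; have := hy i; have := xb i.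
  rewrite !mxE; set z := _ * _; move=> /andP[x1 x2] /andP[y1 y2].
  by rewrite ltr_norml; apply/andP; split; lra.
move=> i; have /andP[x1 x2] := xb i; rewrite [(_ + const_mx _) _ _]mxE [const_mx _ _ _]mxE x1/=.
exact: ltW.
Qed.

End FundamentalLemma.

Section IntegrationByParts.
Context (R : realType) (n : nat).
Local Notation N := n.+1.
Local Notation lebT m := (caratheodory_type (@lebesgue_outer R m)).
Local Notation mu := (lebesgue_rV R N).

Definition pos (t : R) : R := Num.max t 0.

Lemma pos_ge0 t : 0 <= pos t. Proof. by rewrite /pos le_max lexx orbT. Qed.

Lemma pos_split t : t = pos t - pos (- t).
Proof.
by rewrite /pos; case: (leP t 0) => h; case: (leP (- t) 0) => h'; lra.
Qed.

Lemma continuous_pos : continuous pos.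
Proof. exact: continuous_relu. Qed.

Lemma integral_support d (T : measurableType d) (m : {measure set T -> \bar R}) (D : set T) (f : T -> \bar R) :
  (forall x, ~ D x -> f x = 0%E) -> (\int[m]_x f x = \int[m]_(x in D) f x)%E.
Proof.
move=> h; rewrite [RHS]integral_mkcond; apply: eq_integral => x _; rewrite patchE.
by case: (boolP (x \in D)) => // /negP xD; apply: h => Dx; apply: xD; exact: mem_set.
Qed.

(** Tonelli's theorem is applied to nonnegative functions; a vanishing signed integral is therefore
    carried through it as an equality, in the extended reals, of the integrals of the positive and
    negative parts. *)
Lemma pos_parts_eq d (T : measurableType d) (m : {measure set T -> \bar R}) (D : set T) (p : T -> R) :
  measurable D -> m.-integrable D (EFin \o p) ->
  (\int[m]_(x in D) (pos (p x))%:E = \int[m]_(x in D) (pos (- p x))%:E)%E <->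
  \int[m]_(x in D) p x = 0.
Proof.
move=> mD pi; have mp : measurable_fun D p by apply/measurable_EFinP; case/integrableP: pi.
have mpos (f : T -> R) : measurable_fun D f -> measurable_fun D (fun x => pos (f x)).
  by move=> mf; apply: (measurableT_comp _ mf); apply: continuous_measurable_fun; exact: continuous_pos.
have ip : m.-integrable D (EFin \o (fun x => pos (p x))).
  apply: (le_integrable mD _ _ pi); first by apply/measurable_EFinP; exact: mpos.
  move=> x _ /=; rewrite lee_fin ger0_norm ?pos_ge0// /pos ge_max normr_ge0 andbT; exact: ler_norm.
have im : m.-integrable D (EFin \o (fun x => pos (- p x))).
  apply: (le_integrable mD _ _ pi); first by apply/measurable_EFinP; apply: mpos; apply: (measurableT_comp _ mp); apply: continuous_measurable_fun; exact: opp_continuous.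
  move=> x _ /=; rewrite lee_fin ger0_norm ?pos_ge0// /pos ge_max normr_ge0 andbT -normrN; exact: ler_norm.
have -> : \int[m]_(x in D) p x = \int[m]_(x in D) pos (p x) - \int[m]_(x in D) pos (- p x).
  by rewrite -RintegralB//; apply: eq_Rintegral => x _; exact: pos_split.
rewrite !EFin_Rintegral//; split=> [[->]|/eqP]; first by rewrite subrr.
by rewrite subr_eq0 => /eqP ->.
Qed.

Lemma ftc_parts (q p : R -> R) (M : R) : 0 < M ->
  (forall t : R, is_derive t 1 q (p t)) -> continuous p ->
  (forall t, M <= `|t| -> q t = 0 /\ p t = 0) ->
  (\int[lebesgue_measure]_t (pos (p t))%:E = \int[lebesgue_measure]_t (pos (- p t))%:E)%E.
Proof.
move=> M0 dq cp hM; have MM : - M < M by lra.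
have cq := is_derive_continuous dq.
pose I : set R := `[- M, M]%classic.
have FTC : (\int[lebesgue_measure]_(x in I) (p x)%:E = (q M)%:E - (q (- M)%R)%:E)%E.
  apply: continuous_FTC2 => //.
  - exact: continuous_subspaceT.
  - split.
    + by move=> t _; have [] := dq t.
    + by apply: cvg_at_right_filter; exact: cq.
    + by apply: cvg_at_left_filter; exact: cq.
  - by move=> t _; rewrite derive1E; have [_ ->] := dq t.
have pi : lebesgue_measure.-integrable I (EFin \o p).
  apply: continuous_compact_integrable; first exact: segment_compact.
  exact: continuous_subspaceT.
have out (t : R) : ~ I t -> p t = 0.
  move=> h; apply: (hM t _).2; rewrite leNgt; apply/negP => ht; apply: h.
  by rewrite /I /= in_itv/=; move: ht; rewrite ltr_norml => /andP[h1 h2]; rewrite !ltW.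
rewrite !(@integral_support _ _ lebesgue_measure I); last 2 first.
  by move=> t /out ->; rewrite oppr0 /pos maxxx.
  by move=> t /out ->; rewrite /pos maxxx.
apply/(pos_parts_eq _ pi); first exact: measurable_itv.
rewrite /Rintegral FTC (hM M _).1 ?ger0_norm ?(ltW M0)//.
by rewrite (hM (- M) _).1 ?normrN ?ger0_norm ?(ltW M0)// subee.
Qed.

Lemma divergence_zero (psi : 'rV[R]_N -> R) (i : 'I_N) (k : nat) : Ck 1 psi ->
  (forall x, ~ kbox k x -> psi x = 0 /\ partial i psi x = 0) ->
  (\int[mu]_x (pos (partial i psi x))%:E = \int[mu]_x (pos (- partial i psi x))%:E)%E.
Proof.
move=> Cpsi h; have cp := C1_continuous_partial (i := i) Cpsi.
have m1 : measurable_fun setT (fun x : rvB R N => (pos (partial i psi x))%:E).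
  by apply/measurable_EFinP; apply: rvB_continuous; exact: cont_comp continuous_pos cp.
have m2 : measurable_fun setT (fun x : rvB R N => (pos (- partial i psi x))%:E).
  apply/measurable_EFinP; apply: rvB_continuous; apply: (cont_comp continuous_pos).
  by move=> x; apply: continuousN; exact: cp.
rewrite (@tonelli_ins R n i _ m1); last by move=> x; rewrite lee_fin pos_ge0.
rewrite (@tonelli_ins R n i _ m2); last by move=> x; rewrite lee_fin pos_ge0.
apply: eq_integral => y _.
(* Beyond |t| = k + 1 the point is strictly outside [kbox k], where [psi] and its derivative
   vanish. *)
apply: (@ftc_parts (fun t => psi (ins i t y)) (fun t => partial i psi (ins i t y)) k.+1%:R) => //.
- by move=> t; exact: is_derive_ins.
- exact: cont_ins.
- move=> t ht; apply: h => /(_ i); rewrite ins_at !mxE -ler_norml => h2.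
  by have := le_trans ht h2; rewrite ler_nat ltnn.
Qed.

(** The product w phi is C^1 on the whole space and has compact support in [Om], so the integral of
    its partial derivative vanishes by slicing, whatever the boundary of [Om]. *)
Lemma integration_by_parts_test (Om : set 'rV[R]_N) w phi i : open Om -> bounded_set Om ->
  Ck 1 w -> test_function Om phi ->
  (\int[mu]_(x in Om) (w x * partial i phi x)%:E = - \int[mu]_(x in Om) (partial i w x * phi x)%:E)%E.
Proof.
move=> oOm bOm Cw [Cphi cK KO]; have C1phi := Cphi 1%N.
set K := closure _ in cK KO.
have mO := measurable_open_leb oOm.
have phi0 x : ~ K x -> phi x = 0.
  by move=> nK; apply/eqP; apply/negP => h; apply: nK; apply: subset_closure; exact/negP.
have dphi0 x : ~ K x -> partial i phi x = 0.
  move=> nK; have nb : nbhs x (~` K) by apply: open_nbhs_nbhs; split => //; apply: closed_openC; exact: closed_closure.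
  have D : is_derive x (delta_mx 0 i) phi 0.
    apply: (near_eq_is_derive _ (is_derive_cst (0:R) x (delta_mx 0 i))).
    by apply: filterS nb => y /phi0 ->.
  by rewrite /partial (@derive_val _ _ _ _ _ _ _ D).
have [Cpsi Ppsi] := C1M Cw C1phi.
have [k Ok] := bounded_kbox bOm.
have nkK x : ~ kbox k x -> ~ K x by move=> nk /KO/Ok.
have D0 := divergence_zero (i := i) (k := k) Cpsi.
have {}D0 := D0 (fun x nk => ltac:(rewrite Ppsi (phi0 _ (nkK _ nk)) (dphi0 _ (nkK _ nk)) !mulr0 mul0r addr0; split; reflexivity)).
have ic (f : 'rV[R]_N -> R) : continuous f -> mu.-integrable Om (EFin \o f) by exact: integrable_cont.
have c1 : continuous (fun x => w x * partial i phi x).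
  by apply: contM; [exact: C1_continuous|exact: C1_continuous_partial].
have c2 : continuous (fun x => partial i w x * phi x).
  by apply: contM; [exact: C1_continuous_partial|exact: C1_continuous].
have pO x : ~ Om x -> partial i (fun x => w x * phi x) x = 0.
  by move=> nO; have nK : ~ K x := fun h => nO (KO _ h); rewrite Ppsi (phi0 _ nK) (dphi0 _ nK) mulr0 mul0r addr0.
have pi : mu.-integrable Om (EFin \o (partial i (fun x => w x * phi x) : lebT N -> R)).
  by apply: ic; exact: C1_continuous_partial.
have I0 : \int[mu]_(x in (Om : set (lebT N))) partial i (fun x => w x * phi x) x = 0.
  apply/(pos_parts_eq mO pi); move: D0.
  rewrite !(@integral_support _ _ mu (Om : set (lebT N)))//.
    by move=> x /pO ->; rewrite oppr0 /pos maxxx.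
  by move=> x /pO ->; rewrite /pos maxxx.
have E : \int[mu]_(x in (Om : set (lebT N))) (w x * partial i phi x) +
    \int[mu]_(x in (Om : set (lebT N))) (partial i w x * phi x) = 0.
  rewrite -RintegralD//; [|exact: ic|exact: ic].
  by rewrite -I0; apply: eq_Rintegral => x _; rewrite Ppsi [partial i w x * _]mulrC.
rewrite (EFin_Rintegral mO (ic _ c1)) (EFin_Rintegral mO (ic _ c2)) -EFinN.
by congr (_%:E); apply/eqP; rewrite -subr_eq0 opprK; apply/eqP.
Qed.

(** The definition of a trace comes with a weak gradient of its own; this identifies it with the
    gradient given for the test function. *)
Lemma weak_gradient_unique (Om : set 'rV[R]_N) u G G' : open Om -> bounded_set Om ->
  H1_grad Om u G -> H1_grad Om u G' ->
  forall i, {ae mu, forall x : lebT N, Om x -> G x 0 i = G' x 0 i}.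
Proof.
move=> oOm bOm [Lu LG HG] [_ LG' HG'] i; have mO := measurable_open_leb oOm.
have [k Ok] := bounded_kbox bOm.
have L2_1 : @L2 _ (lebT N) R mu Om (cst 1).
  split; first exact: measurable_cst.
  under eq_integral do rewrite expr1n; rewrite integral_cst// mul1e; exact: mu_bounded Ok.
have l2i (F : 'rV[R]_N -> 'rV[R]_N) : (forall i, Lp mu Om 2%:E (fun x => F x 0 i)) ->
    mu.-integrable Om (EFin \o (fun x : lebT N => F x 0 i)).
  move=> LF; have F2 := (Lp2E mu mO _).1 (LF i); have := L2_mul mO F2 L2_1.
  by apply: eq_integrable => // x _ /=; rewrite mulr1.
have gi := l2i G LG; have gi' := l2i G' LG'.
have vi : mu.-integrable Om (EFin \o (fun x : lebT N => G x 0 i - G' x 0 i)).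
  by have := integrableB mO gi gi'; apply: eq_integrable.
have tb phi (F : 'rV[R]_N -> 'rV[R]_N) : test_function Om phi -> mu.-integrable Om (EFin \o (fun x : lebT N => F x 0 i)) ->
    mu.-integrable Om (EFin \o (fun x : lebT N => F x 0 i * phi x)).
  move=> [Cphi _ _] Fi; have cphi : continuous phi by exact: (Cphi 0%N).
  have [c c0 hc] := continuous_bounded_on bOm cphi.
  apply: (@integrable_mulb _ (lebT N) R mu Om _ phi c mO Fi).
    by apply: measurable_funTS; exact: measurable_cont.
  by move=> x Ox; apply: hc; exact: subset_closure.
have := fundamental_lemma oOm bOm vi; move=> H.
have : {ae mu, forall x : lebT N, Om x -> G x 0 i - G' x 0 i = 0}.
  apply: H => phi tphi; have h1 := HG phi i tphi; have h2 := HG' phi i tphi.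
  have i1 := tb phi G tphi gi; have i2 := tb phi G' tphi gi'.
  have : (- (\int[mu]_(x in (Om : set (lebT N))) (G x 0 i * phi x))%:E =
          - (\int[mu]_(x in (Om : set (lebT N))) (G' x 0 i * phi x))%:E)%E.
    by rewrite -(EFin_Rintegral mO i1) -(EFin_Rintegral mO i2) -h1.
  move=> /eqe_oppP [e].
  rewrite (_ : \int[mu]_(x in (Om : set (lebT N))) _ = \int[mu]_(x in (Om : set (lebT N))) (G x 0 i * phi x - G' x 0 i * phi x)).
    by rewrite RintegralB// e subrr.
  by apply: eq_Rintegral => x _; rewrite mulrBl.
by apply: (@ae_imp _ (lebT N) R mu) => x hx Ox; apply/eqP; rewrite -subr_eq0; apply/eqP/hx.
Qed.

End IntegrationByParts.

(** * The Dirichlet form and the variational problem *)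

Section DirichletForm.
Context (R : realType) (n : nat).
Local Notation N := n.+1.
Local Notation lebT := (caratheodory_type (@lebesgue_outer R N)).
Local Notation surT := (caratheodory_type (@hausdorff_outer R N.-1 N)).
Local Notation sur := (surface R N).
Local Notation mu := (lebesgue_rV R N).
Implicit Types (Om : set 'rV[R]_N) (w v : 'rV[R]_N -> R).

Definition positive_C1 Om w := Ck 1 w /\ forall x, closure Om x -> 0 < w x.

Lemma boundary_closure Om x : boundary Om x -> closure Om x. Proof. by case. Qed.

Lemma positive_C1_bounds Om w : bounded_set Om -> positive_C1 Om w ->
  exists a b : R, 0 < a /\ forall x, closure Om x -> a <= w x <= b.
Proof.
move=> bOm [Cw w0]; have cw := C1_continuous Cw.
have [c c0 hc] := continuous_bounded_on bOm cw.
have [->|/set0P ne] := eqVneq (closure Om) set0; first by exists 1, 1.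
have cK : compact (w @` closure Om).
  by apply: continuous_compact; [exact: continuous_subspaceT|exact: closure_compact].
have [x0 cx0 hx0] : exists2 x0, closure Om x0 & forall x, closure Om x -> w x0 <= w x.
  have := @EVT_min_rV R N w (closure Om) ne (closure_compact bOm) (continuous_subspaceT cw).
  by move=> [x0 h1 h2]; exists x0; [exact: set_mem h1|move=> x cx; apply: h2; exact: mem_set].
exists (w x0), c; split; first exact: w0.
by move=> x cx; rewrite hx0//=; apply: le_trans (ler_norm _) (hc x cx).
Qed.

Section FixedDomain.
Variables (Om : set 'rV[R]_N) (lam : 'rV[R]_N -> R) (Lam : R).
Hypotheses (oOm : open Om) (bOm : bounded_set Om) (hC1 : C1_boundary Om)
  (mlam : measurable_fun setT (lam : surT -> R))
  (lam0 : forall x, 0 <= lam x) (lamL : forall x, lam x <= Lam).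

(** Real-valued integrals, meaningful next to [intO] and [intB]: an infinite integral would be sent
    to a default value. *)
Definition iO (f : 'rV[R]_N -> R) : R := \int[mu]_(x in (Om : set lebT)) f x.
Definition iB (f : 'rV[R]_N -> R) : R := \int[sur]_(x in (boundary Om : set surT)) f x.

Definition intO (f : 'rV[R]_N -> R) := mu.-integrable (Om : set lebT) (EFin \o (f : lebT -> R)).
Definition intB (f : 'rV[R]_N -> R) := sur.-integrable (boundary Om : set surT) (EFin \o (f : surT -> R)).

Lemma mO : measurable (Om : set lebT). Proof. exact: measurable_open_leb. Qed.
Lemma mB : measurable (boundary Om : set surT). Proof. exact: measurable_boundary_sur. Qed.

Lemma EFin_iO f : intO f -> (\int[mu]_(x in (Om : set lebT)) (f x)%:E = (iO f)%:E)%E.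
Proof. exact: (EFin_Rintegral mO). Qed.
Lemma EFin_iB f : intB f -> (\int[sur]_(x in (boundary Om : set surT)) (f x)%:E = (iB f)%:E)%E.
Proof. exact: (EFin_Rintegral mB). Qed.

Lemma intO_cont f : continuous f -> intO f. Proof. exact: integrable_cont. Qed.

Lemma intB_mul h f : intB h -> continuous f -> intB (fun x => h x * f x).
Proof.
move=> hi cf; have [c c0 hc] := continuous_bounded_on bOm cf.
apply: (@integrable_mulb _ surT R sur _ _ f c mB hi).
  by apply: measurable_funTS; exact: measurable_cont_sur.
by move=> x bx; apply: hc; exact: boundary_closure.
Qed.

Lemma intO_mul h f : intO h -> continuous f -> intO (fun x => h x * f x).
Proof.
move=> hi cf; have [c c0 hc] := continuous_bounded_on bOm cf.
apply: (@integrable_mulb _ lebT R mu _ _ f c mO hi).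
  by apply: measurable_funTS; exact: measurable_cont.
by move=> x bx; apply: hc; exact: subset_closure.
Qed.

Lemma intB_bounded h (c : R) : measurable_fun (boundary Om : set surT) (h : surT -> R) ->
  (forall x, boundary Om x -> `|h x| <= c) -> intB h.
Proof.
move=> mh hc; apply: (measurable_bounded_integrable mB (surface_boundary_fin oOm bOm hC1) mh).
exists c; split; first exact: num_real.
by move=> y cy x bx; apply: le_trans (ltW cy); exact: hc.
Qed.

Lemma intB_lam f : continuous f -> intB (fun x => lam x * f x).
Proof.
apply: intB_mul; apply: (@intB_bounded _ Lam); first exact: measurable_funTS.
by move=> x _; rewrite ger0_norm.
Qed.

Lemma iOD f g : intO f -> intO g -> iO (fun x => f x + g x) = iO f + iO g.
Proof. exact: (RintegralD mO). Qed.
Lemma iOZ c f : intO f -> iO (fun x => c * f x) = c * iO f.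
Proof. exact: (RintegralZl c mO). Qed.
Lemma iBD f g : intB f -> intB g -> iB (fun x => f x + g x) = iB f + iB g.
Proof. exact: (RintegralD mB). Qed.
Lemma iBZ c f : intB f -> iB (fun x => c * f x) = c * iB f.
Proof. exact: (RintegralZl c mB). Qed.
Lemma iB_le f g : intB f -> intB g -> (forall x, boundary Om x -> f x <= g x) -> iB f <= iB g.
Proof. exact: (le_Rintegral mB). Qed.
Lemma iB0 : iB (cst 0) = 0.
Proof. by rewrite /iB /Rintegral integral0_eq. Qed.
Lemma iO_le f g : intO f -> intO g -> (forall x, Om x -> f x <= g x) -> iO f <= iO g.
Proof. exact: (le_Rintegral mO). Qed.
Lemma intOD f g : intO f -> intO g -> intO (fun x => f x + g x).
Proof. by move=> hf hg; have := integrableD mO hf hg; apply: eq_integrable => //; exact: mO. Qed.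
Lemma intBD f g : intB f -> intB g -> intB (fun x => f x + g x).
Proof. by move=> hf hg; have := integrableD mB hf hg; apply: eq_integrable => //; exact: mB. Qed.
Lemma intOZ c f : intO f -> intO (fun x => c * f x).
Proof.
move=> hf; have := integrableZl mO c hf; apply: eq_integrable; first exact: mO.
by move=> x _ /=; rewrite EFinM.
Qed.
Lemma intBZ c f : intB f -> intB (fun x => c * f x).
Proof.
move=> hf; have := integrableZl mB c hf; apply: eq_integrable; first exact: mB.
by move=> x _ /=; rewrite EFinM.
Qed.

Definition gdot w v x : R := \sum_i partial i w x * partial i v x.

Definition dform w v : R := iO (gdot w v) + iB (fun x => lam x * (w x * v x)).

Lemma continuous_gdot w v : Ck 1 w -> Ck 1 v -> continuous (gdot w v).
Proof.
move=> Cw Cv; apply: continuous_fsum => i.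
by apply: contM; exact: C1_continuous_partial.
Qed.

Lemma cont_mulC1 w v : Ck 1 w -> Ck 1 v -> continuous (fun x => w x * v x).
Proof. by move=> Cw Cv; apply: contM; exact: C1_continuous. Qed.

Lemma aformE w : Ck 1 w -> aform Om lam w = (dform w w)%:E.
Proof.
move=> Cw; have h1 := intO_cont (continuous_gdot Cw Cw).
have h2 := intB_lam (cont_mulC1 Cw Cw).
rewrite /aform /dform EFinD /iO /iB -(EFin_Rintegral mO h1) -(EFin_Rintegral mB h2).
by congr (_ + _)%E; apply: eq_integral => x _; rewrite expr2.
Qed.

Lemma dform_lin u w v (a b : R) : Ck 1 u -> Ck 1 w -> Ck 1 v ->
  dform (fun x => a * u x + b * w x) v = a * dform u v + b * dform w v.
Proof.
move=> Cu Cw Cv.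
have [Cau Pau] := C1Z a Cu; have [Cbw Pbw] := C1Z b Cw; have [Cs Ps] := C1D Cau Cbw.
rewrite /dform.
have -> : iO (gdot (fun x => a * u x + b * w x) v) = a * iO (gdot u v) + b * iO (gdot w v).
  have -> : gdot (fun x => a * u x + b * w x) v = (fun x => a * gdot u v x + b * gdot w v x).
    apply/funext => x; rewrite /gdot !mulr_sumr -big_split/=; apply: eq_bigr => i _.
    by rewrite Ps Pau Pbw; ring.
  have h1 := intO_cont (continuous_gdot Cu Cv); have h2 := intO_cont (continuous_gdot Cw Cv).
  by rewrite iOD ?iOZ//; exact: intOZ.
have -> : iB (fun x => lam x * ((a * u x + b * w x) * v x)) =
    a * iB (fun x => lam x * (u x * v x)) + b * iB (fun x => lam x * (w x * v x)).
  have h1 := intB_lam (cont_mulC1 Cu Cv); have h2 := intB_lam (cont_mulC1 Cw Cv).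
  rewrite -!iBZ// -iBD; [|exact: intBZ|exact: intBZ].
  by apply: eq_Rintegral => x _; ring.
move: (iO _) (iO _) (iB _) (iB _) => p q s t; ring.
Qed.

Lemma dformC w v : dform w v = dform v w.
Proof.
have E1 : gdot w v = gdot v w.
  by apply/funext => x; apply: eq_bigr => i _; rewrite mulrC.
have E2 : (fun x => lam x * (w x * v x)) = (fun x => lam x * (v x * w x)).
  by apply/funext => x; rewrite [w x * _]mulrC.
by rewrite /dform E1 E2.
Qed.

Lemma dform_lin2 u w (a b : R) : Ck 1 u -> Ck 1 w ->
  dform (fun x => a * u x + b * w x) (fun x => a * u x + b * w x) =
  a ^+ 2 * dform u u + 2 * a * b * dform u w + b ^+ 2 * dform w w.
Proof.
move=> Cu Cw; have Cs := (C1D (C1Z a Cu).1 (C1Z b Cw).1).1.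
rewrite dform_lin// [dform u _]dformC [dform w _]dformC !dform_lin// [dform w u]dformC; ring.
Qed.

Definition energyR w : R := iO (fun x => gsq w x + w x ^+ 2).

Lemma cont_sqr w : Ck 1 w -> continuous (fun x => w x ^+ 2).
Proof. by move=> Cw; under eq_fun do rewrite expr2; exact: cont_mulC1. Qed.

Lemma intO_energy w : Ck 1 w -> intO (fun x => gsq w x + w x ^+ 2).
Proof.
by move=> Cw; apply: intO_cont; apply: contD; [exact: continuous_gsq|exact: cont_sqr].
Qed.

Lemma energyE w : Ck 1 w -> energy Om w = (energyR w)%:E.
Proof. by move=> Cw; rewrite /energy (EFin_Rintegral mO (intO_energy Cw)). Qed.

Lemma energyR_ge0 w : 0 <= energyR w.
Proof. by apply: Rintegral_ge0 => x _; rewrite addr_ge0 ?gsq_ge0 ?sqr_ge0. Qed.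

Lemma coercive : controlled Om lam Om -> exists2 C : R, 0 < C &
  forall w, Ck 1 w -> energyR w <= C * dform w w.
Proof.
move=> [C C0 HC]; exists (1 + C); first exact: addr_gt0.
move=> w Cw; rewrite /energyR iOD; last 2 first.
- by apply: intO_cont; exact: continuous_gsq.
- by apply: intO_cont; exact: cont_sqr.
rewrite mulrDl mul1r; apply: lerD.
  have := gsq_le_aform Om lam0 w; rewrite aformE// (EFin_Rintegral mO) ?lee_fin//.
  by apply: intO_cont; exact: continuous_gsq.
have := HC w Cw; rewrite aformE// (EFin_Rintegral mO) -?EFinM ?lee_fin//.
by apply: intO_cont; exact: cont_sqr.
Qed.

End FixedDomain.
End DirichletForm.

Section SmoothPositivePart.
Context (R : realType).
Implicit Types s x : R.

(** T_s of the overview: the positive root y of y (y - x) = s^2. This equation, proved in [spos_eq],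
    gives most of the bounds below. *)
Definition spos s x : R := (x + Num.sqrt (x ^+ 2 + 4 * s ^+ 2)) / 2.
Definition dspos s x : R := (1 + x / Num.sqrt (x ^+ 2 + 4 * s ^+ 2)) / 2.

Lemma spos_root_gt s x : 0 < s -> `|x| < Num.sqrt (x ^+ 2 + 4 * s ^+ 2).
Proof.
move=> s0; have h : 0 < 4 * s ^+ 2 by rewrite mulr_gt0// exprn_gt0.
by rewrite -sqrtr_sqr ltr_sqrt ?ltrDl// ltr_wpDl ?sqr_ge0.
Qed.

Lemma spos_gt0 s x : 0 < s -> 0 < spos s x.
Proof.
move=> s0; rewrite /spos divr_gt0//; have := spos_root_gt x s0.
by rewrite ltr_norml => /andP[h _]; move: h; rewrite -subr_gt0 opprK.
Qed.

Lemma spos_ge s x : 0 < s -> x <= spos s x.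
Proof.
move=> s0; have := spos_root_gt x s0; rewrite ltr_norml => /andP[_ h].
by rewrite /spos ler_pdivlMr// mulr_natr mulr2n lerD2l ltW.
Qed.

Lemma spos_eq s x : 0 < s -> spos s x * (spos s x - x) = s ^+ 2.
Proof.
move=> s0; have h : 0 <= x ^+ 2 + 4 * s ^+ 2 by rewrite addr_ge0 ?sqr_ge0// mulr_ge0 ?sqr_ge0.
have := sqr_sqrtr h; rewrite /spos; move: (Num.sqrt _) => q hq.
have -> : (x + q) / 2 * ((x + q) / 2 - x) = (q ^+ 2 - x ^+ 2) / 4 by field.
by rewrite hq; field.
Qed.

Lemma spos_sqr_le s x : 0 < s -> spos s x ^+ 2 <= x ^+ 2 + 2 * s ^+ 2.
Proof.
move=> s0; have h1 := spos_eq x s0; have h2 := spos_ge x s0.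
rewrite -h1 -subr_ge0.
have -> : x ^+ 2 + 2 * (spos s x * (spos s x - x)) - spos s x ^+ 2 = (spos s x - x) ^+ 2 by ring.
exact: sqr_ge0.
Qed.

Lemma spos_le s x : 0 < s -> spos s x <= Num.max x 0 + s.
Proof.
move=> s0; have h1 := spos_eq x s0; have h2 := spos_gt0 x s0.
rewrite leNgt; apply/negP => h.
have hx : x <= Num.max x 0 by rewrite le_max lexx.
have h0 : 0 <= Num.max x 0 by rewrite le_max lexx orbT.
have a1 : s < spos s x by apply: le_lt_trans h; rewrite lerDr.
have a2 : s < spos s x - x by rewrite ltrBrDl; apply: le_lt_trans h; rewrite lerD2r.
by have := ltr_pM (ltW s0) (ltW s0) a1 a2; rewrite h1 expr2 ltxx.
Qed.

(** For w >= 0 and |phi| <= M the argument w - s phi is at least - s M; the resulting positive lower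
    bound dominates the singular power uniformly in w when s is fixed. *)
Lemma spos_lower s x M : 0 < s -> 0 <= M -> - (s * M) <= x -> s / (M + 1) <= spos s x.
Proof.
move=> s0 M0 hx; have h1 := spos_eq x s0; have h2 := spos_gt0 x s0.
rewrite leNgt; apply/negP => h; have M1 : 0 < M + 1 by rewrite ltr_wpDl.
have a1 : spos s x < s.
  by apply: (lt_le_trans h); rewrite ler_pdivrMr// ler_peMr ?(ltW s0)// lerDr.
have a2 : spos s x - x <= s * (M + 1).
  by rewrite mulrDr mulr1 addrC lerD ?(ltW a1)// lerNl.
have : s ^+ 2 < s / (M + 1) * (s * (M + 1)).
  rewrite -h1; apply: (le_lt_trans (ler_wpM2l (ltW h2) a2)).
  by rewrite ltr_pM2r// mulr_gt0.
have -> : s / (M + 1) * (s * (M + 1)) = s ^+ 2 by field; rewrite gt_eqF.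
by rewrite ltxx.
Qed.

Lemma dspos_ge0_le1 s x : 0 < s -> 0 <= dspos s x <= 1.
Proof.
move=> s0; have h := spos_root_gt x s0; rewrite /dspos.
have q0 := le_lt_trans (normr_ge0 _) h; move: h q0; move: (Num.sqrt _) => q h q0.
have : `|x / q| <= 1 by rewrite normrM normfV (gtr0_norm q0) ler_pdivrMr// mul1r ltW.
rewrite ler_norml => /andP[h1 h2]; apply/andP; split.
  by rewrite divr_ge0// -lerBlDl sub0r.
by rewrite ler_pdivrMr// mul1r -[leRHS]/(1 + 1) lerD2l.
Qed.

Lemma is_derive_spos s (x : R) : 0 < s -> is_derive x 1 (spos s) (dspos s x).
Proof.
move=> s0.
have h0 : 0 < x ^+ 2 + 4 * s ^+ 2 by rewrite ltr_wpDl ?sqr_ge0// mulr_gt0 ?exprn_gt0.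
have d1 : is_derive x 1 (fun y : R => y ^+ 2 + 4 * s ^+ 2) (2 * x).
  by apply: is_derive_eq; rewrite /GRing.scale/=; ring.
have d2 := @is_derive1_comp R Num.sqrt (fun y : R => y ^+ 2 + 4 * s ^+ 2) x _ _ (is_derive1_sqrt h0) d1.
have q0 : Num.sqrt (x ^+ 2 + 4 * s ^+ 2) != 0 by rewrite gt_eqF// sqrtr_gt0.
rewrite /spos; apply: is_derive_eq; rewrite /GRing.scale/= /dspos.
by move: q0; move: (Num.sqrt _) => q q0; field.
Qed.

Lemma continuous_dspos s : 0 < s -> continuous (dspos s).
Proof.
move=> s0 x; have h0 : 0 < x ^+ 2 + 4 * s ^+ 2 by rewrite ltr_wpDl ?sqr_ge0// mulr_gt0 ?exprn_gt0.
apply: (@cvgM R R^o); last exact: cvg_cst.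
apply: (@cvgD _ R^o); first exact: cvg_cst.
apply: (@cvgM R R^o); first exact: cvg_id.
apply: (@cvgV R R^o); first by rewrite gt_eqF// sqrtr_gt0.
apply: continuous_comp; last exact: sqrt_continuous.
apply: (@cvgD _ R^o); last exact: cvg_cst.
by under eq_fun do rewrite expr2; apply: (@cvgM R R^o); exact: cvg_id.
Qed.

End SmoothPositivePart.

Section PowerFacts.
Context (R : realType).

Lemma ler_powRN (a x y : R) : 0 <= a -> 0 < x -> x <= y -> y `^ (- a) <= x `^ (- a).
Proof.
move=> a0 x0 xy; have y0 := lt_le_trans x0 xy.
rewrite !powRN lef_pV2 ?posrE ?powR_gt0//.
by apply: ge0_ler_powR => //; rewrite nnegrE ltW.
Qed.

Lemma cvg_powR (v : nat -> R) (t a : R) : 0 < t -> v k @[k --> \oo] --> t ->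
  v k `^ a @[k --> \oo] --> t `^ a.
Proof.
move=> t0 vt.
have e : expR (a * ln (v k)) @[k --> \oo] --> expR (a * ln t).
  apply: continuous_cvg; first exact: continuous_expR.
  apply: cvgMl_tmp; apply: continuous_cvg => //; exact: continuous_ln.
rewrite {2}/powR gt_eqF//; apply: cvg_trans e; apply: near_eq_cvg.
near=> k; have vk : 0 < v k by near: k; exact: (cvgr_gt t vt).
by rewrite /powR gt_eqF.
Unshelve. all: by end_near. Qed.

End PowerFacts.

Section Arithmetic.
Context (R : realFieldType).
Implicit Types x y z : R.

Lemma midpoint_algebra (F W V Q fv fW fV b bW bV d d' e : R) :
  F = 4^-1 * W + 2^-1 * Q + 4^-1 * V ->
  fv = 2^-1 * fW + 2^-1 * fV -> b <= bW + bV + e ->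
  W / 2 - fW + bW + (V / 2 - fV + bV) <= F - 2 * fv + b + (d + d') ->
  W - 2 * Q + V <= 4 * (d + d' + e).
Proof. by move=> -> -> hb h; lra. Qed.

Lemma quadratic_lower (C M E q : R) : 0 < C -> q ^+ 2 = 1 + E ->
  - ((2 * C)^-1 + C * M ^+ 2 / 2) <= (C^-1 * E) / 2 - M * q.
Proof.
move=> C0 hq; have -> : E = q ^+ 2 - 1 by rewrite hq; ring.
rewrite -subr_ge0.
have -> : C^-1 * (q ^+ 2 - 1) / 2 - M * q - - ((2 * C)^-1 + C * M ^+ 2 / 2) =
  (q - C * M) ^+ 2 / (2 * C) by field; rewrite gt_eqF.
by rewrite divr_ge0 ?sqr_ge0// mulr_ge0// ltW.
Qed.

Lemma perturb_algebra (s W P Q L Fz Fv fw fp fv b bv Z d : R) : 0 < s ->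
  Fz = 1 ^+ 2 * W + 2 * 1 * - s * P + (- s) ^+ 2 * Q -> Fv <= Fz + 2 * s ^+ 2 * L ->
  fw - s * fp <= fv -> bv <= b + s * Z ->
  W / 2 - fw + b <= Fv / 2 - fv + bv + d ->
  P - fp <= d / s + s * (Q / 2 + L) + Z.
Proof.
move=> s0 -> h1 h2 h3 h4; rewrite -(ler_pM2l s0).
have -> : s * (d / s + s * (Q / 2 + L) + Z) = d + s ^+ 2 * (Q / 2 + L) + s * Z.
  by field; rewrite gt_eqF.
lra.
Qed.

End Arithmetic.

Section Variational.
Context (R : realType) (n : nat).
Local Notation N := n.+1.
Local Notation lebT := (caratheodory_type (@lebesgue_outer R N)).
Local Notation surT := (caratheodory_type (@hausdorff_outer R N.-1 N)).
Local Notation sur := (surface R N).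
Local Notation mu := (lebesgue_rV R N).
Implicit Types (w v phi : 'rV[R]_N -> R).
Variables (Om : set 'rV[R]_N) (lam : 'rV[R]_N -> R) (Lam : R).
Hypotheses (oOm : open Om) (bOm : bounded_set Om) (hC1 : C1_boundary Om)
  (mlam : measurable_fun setT (lam : surT -> R))
  (lam0 : forall x, 0 <= lam x) (lamL : forall x, lam x <= Lam)
  (hlam : controlled Om lam Om).
Variables (f g : 'rV[R]_N -> R) (eta : R).
Hypotheses (if_ : intO Om f) (f0 : forall x, 0 <= f x)
  (Hf : exists M : R, forall w, Ck 1 w ->
     iO Om (fun x => f x * `|w x|) <= M * Num.sqrt (1 + energyR Om w))
  (eta0 : 0 <= eta) (ig : intB Om g) (g0 : forall x, 0 <= g x).
(** [gs] approximates [g] from below. It is constantly [g] unless eta = 1, where it is min(g, k).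
    Near-minimisers of different functionals have then to be compared, which is why the midpoint
    inequality allows two weights and an error |gs i - gs k|. *)
Variables (Phi : R -> R) (gs : nat -> 'rV[R]_N -> R).
Hypotheses (mPhi : measurable_fun setT Phi)
  (Phi_tangent : forall x y, 0 < x -> 0 < y -> Phi x - x `^ (- eta) * (y - x) <= Phi y)
  (mgs : forall k, measurable_fun (boundary Om : set surT) (gs k : surT -> R))
  (gs_ge : forall k x, Num.min (g x) k%:R <= gs k x)
  (gs_le : forall k x, gs k x <= g x)
  (Phi_mid : forall i k x (a b : R), 0 < a -> 0 < b ->
     (gs i x + gs k x) * Phi (2^-1 * a + 2^-1 * b) <=
     gs i x * Phi a + gs k x * Phi b + `|gs i x - gs k x|)
  (Phi_low : forall k, exists M : R, forall w, positive_C1 Om w ->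
     - (M * Num.sqrt (1 + energyR Om w)) <= iB Om (fun x => gs k x * Phi (w x))).
Local Notation K0 := (positive_C1 Om).
Local Notation iO := (iO Om).
Local Notation iB := (iB Om).
Local Notation intO := (intO Om).
Local Notation intB := (intB Om).
Local Notation dform := (dform Om lam).
Local Notation mO := (mO oOm).
Local Notation mB := (mB Om).

Lemma Phi_decr x y : 0 < x -> x <= y -> Phi y <= Phi x.
Proof.
move=> x0 xy; have y0 := lt_le_trans x0 xy.
apply: le_trans (Phi_tangent y0 x0).
by rewrite lerDl oppr_ge0 mulr_ge0_le0 ?powR_ge0// subr_le0.
Qed.

Lemma gs0 k x : 0 <= gs k x.
Proof. by apply: le_trans (gs_ge k x); rewrite le_min g0 ler0n. Qed.

Lemma intB_gs k : intB (gs k).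
Proof.
apply: (le_integrable mB _ _ ig); first by apply/measurable_EFinP; exact: mgs.
by move=> x _; rewrite lee_fin !ger0_norm ?gs0.
Qed.

Lemma gs_cvg x : gs k x @[k --> \oo] --> g x.
Proof.
have [m hm] : exists m : nat, g x <= m%:R.
  by exists (Num.truncn (g x)).+1; apply: ltW; exact: truncnS_gt.
apply: cvg_near_cst; near=> k; apply: le_anti; rewrite gs_le/=; apply: le_trans (gs_ge k x).
rewrite le_min lexx/=; apply: le_trans hm _; rewrite ler_nat.
by near: k; exact: nbhs_infty_ge.
Unshelve. all: by end_near. Qed.

Lemma intB_gsPhi k w : K0 w -> intB (fun x => gs k x * Phi (w x)).
Proof.
move=> hw; have [a [b [a0 hab]]] := positive_C1_bounds bOm hw.
apply: (@integrable_mulb _ surT R sur _ _ (Phi \o w) (`|Phi a| + `|Phi b|) mB (intB_gs k)).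
  apply: measurable_funTS; apply: (measurableT_comp mPhi).
  by apply: measurable_cont_sur; exact: C1_continuous hw.1.
move=> x bx; have /andP[aw wb] := hab x (boundary_closure bx).
have w0 : 0 < w x by exact: lt_le_trans aw.
have h1 := Phi_decr a0 aw; have h2 := Phi_decr w0 wb.
rewrite /= ler_norml; apply/andP; split.
  apply: le_trans h2; rewrite opprD -[leRHS]add0r lerD ?oppr_le0//.
  by rewrite -[leRHS]opprK lerN2 -normrN ler_norm.
by apply: (le_trans h1); rewrite -[leLHS]addr0 lerD ?ler_norm.
Qed.

Definition J k w : R := dform w w / 2 - iO (fun x => f x * w x) + iB (fun x => gs k x * Phi (w x)).

Lemma intO_fabs w : Ck 1 w -> intO (fun x => f x * `|w x|).
Proof.
move=> Cw; apply: (intO_mul oOm bOm if_) => x.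
by apply: continuous_comp; [exact: C1_continuous|exact: norm_continuous].
Qed.

Lemma intO_fmul w : Ck 1 w -> intO (fun x => f x * w x).
Proof. by move=> Cw; apply: (intO_mul oOm bOm if_); exact: C1_continuous. Qed.

(** The form is at least E / C with E the energy, while the two lower-order terms are bounded by
    multiples of sqrt(1 + E); completing the square gives the lower bound. *)
Lemma J_bounded k : exists m, forall w, K0 w -> m <= J k w.
Proof.
have [C C0 HC] := coercive oOm bOm hC1 mlam lam0 lamL hlam.
have [M HM] := Hf; have [M' HM'] := Phi_low k.
exists (- ((2 * C)^-1 + C * (M + M') ^+ 2 / 2)) => w Kw; have Cw := Kw.1.
have E0 := energyR_ge0 Om w.
have hq : Num.sqrt (1 + energyR Om w) ^+ 2 = 1 + energyR Om w by rewrite sqr_sqrtr// addr_ge0.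
apply: le_trans (quadratic_lower (M + M') C0 hq) _.
have h1 : C^-1 * energyR Om w <= dform w w by rewrite ler_pdivrMl// HC.
have h2 := HM w Cw; have h3 := HM' w Kw.
have h4 : iO (fun x => f x * w x) <= iO (fun x => f x * `|w x|).
  apply: (iO_le oOm (intO_fmul Cw) (intO_fabs Cw)) => x _.
  by rewrite ler_wpM2l ?ler_norm.
rewrite /J; move: h1 h2 h3 h4.
move: (energyR Om w) (Num.sqrt _) (dform w w) (iO _) (iO _) (iB _) => e q F i1 i2 i3 h1 h2 h3 h4.
have h5 : C^-1 * e / 2 <= F / 2 by rewrite ler_wpM2r.
by rewrite mulrDl; lra.
Qed.

Lemma positive_cst1 : K0 (cst 1).
Proof. by split; [exact: (@C1_cst R N 1).1|move=> x _; exact: ltr01]. Qed.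

Lemma near_minimizer k (d : R) : 0 < d -> exists2 w, K0 w & forall v, K0 v -> J k w <= J k v + d.
Proof.
move=> d0; have [m hm] := J_bounded k.
pose A := [set J k w | w in K0].
have A0 : A !=set0 by exists (J k (cst 1)), (cst 1) => //; exact: positive_cst1.
have Al : has_lbound A by exists m => _ [w Kw <-]; exact: hm.
have [_ [w Kw <-] hw] := inf_adherent d0 (conj A0 Al).
exists w => // v Kv; apply: (le_trans (ltW hw)); rewrite lerD2r.
by apply: ge_inf => //; exists v.
Qed.

Lemma gs_approx (d : R) : 0 < d -> forall k0, exists2 k, (k0 <= k)%N & iB (fun x => g x - gs k x) <= d.
Proof.
move=> d0.
have mg : measurable_fun (boundary Om : set surT) (g : surT -> R).
  by apply/measurable_EFinP; exact: measurable_int ig.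
have [_ _] : [/\ forall k, intB (fun x => g x - gs k x), intB (cst 0) &
    iB (fun x => g x - gs k x) @[k --> \oo] --> iB (cst 0)].
  apply: (@dct _ surT R sur (boundary Om) mB _ _ g).
  - by move=> k; apply: measurable_funB; [exact: mg|exact: mgs].
  - exact: measurable_cst.
  - exact: ig.
  - apply: aeW => x _; split.
      rewrite -[cst 0 x](subrr (g x)); apply: (@cvgB _ R^o); [exact: cvg_cst|exact: gs_cvg].
    by move=> k; rewrite ger0_norm ?subr_ge0 ?gs_le// lerBlDr lerDl gs0.
rewrite iB0 => /(@cvgr_norm_lt _ R^o) h k0; have [//|k _ hk] := h d _; first by rewrite normr0.
exists (maxn k0 k); first exact: leq_maxl.
by apply: (le_trans (ler_norm _)); apply: ltW; apply: hk; exact: leq_maxr.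
Qed.

Lemma positive_mid w v : K0 w -> K0 v -> K0 (fun x => 2^-1 * w x + 2^-1 * v x).
Proof.
move=> [Cw w0] [Cv v0]; split; first exact: (C1D (C1Z _ Cw).1 (C1Z _ Cv).1).1.
by move=> x cx; rewrite addr_gt0// mulr_gt0 ?invr_gt0// ?w0// ?v0.
Qed.

(** The midpoint of [w] and [v] competes in both functionals. The terms in [Phi] are convex up to
    the change of weights, the term in [f] is linear, and the parallelogram identity for the form
    leaves the form of w - v on the good side. *)
Lemma minimizers_close i k w v (d d' : R) : K0 w -> K0 v ->
  (forall z, K0 z -> J i w <= J i z + d) -> (forall z, K0 z -> J k v <= J k z + d') ->
  dform (fun x => 1 * w x + (-1) * v x) (fun x => 1 * w x + (-1) * v x) <=
  4 * (d + d' + iB (fun x => `|gs i x - gs k x|)).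
Proof.
move=> Kw Kv hw hv; have Kz := positive_mid Kw Kv; have [Cw Cv] := (Kw.1, Kv.1).
pose z x := 2^-1 * w x + 2^-1 * v x.
have h := lerD (hw z Kz) (hv z Kz).
have Ez : dform z z = 4^-1 * dform w w + 2^-1 * dform w v + 4^-1 * dform v v.
  rewrite /z (dform_lin2 oOm bOm hC1 mlam lam0 lamL)//.
  by move: (dform _ _) (dform _ _) (dform _ _) => p q r; field.
rewrite (dform_lin2 oOm bOm hC1 mlam lam0 lamL)//.
have -> : 1 ^+ 2 * dform w w + 2 * 1 * -1 * dform w v + (-1) ^+ 2 * dform v v =
  dform w w - 2 * dform w v + dform v v.
  by move: (dform _ _) (dform _ _) (dform _ _) => p q r; ring.
have Ef : iO (fun x => f x * z x) = 2^-1 * iO (fun x => f x * w x) + 2^-1 * iO (fun x => f x * v x).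
  rewrite -(iOZ oOm _ (intO_fmul Cw)) -(iOZ oOm _ (intO_fmul Cv)) -(iOD oOm).
  - by congr iO; apply/funext => x; rewrite /z; ring.
  - by apply: (intOZ oOm); exact: intO_fmul.
  - by apply: (intOZ oOm); exact: intO_fmul.
have iD : intB (fun x => `|gs i x - gs k x|).
  apply: (le_integrable mB _ _ ig).
    apply/measurable_EFinP; apply: (measurableT_comp (@normr_measurable R setT)).
    by apply: measurable_funB; exact: mgs.
  move=> x _; rewrite lee_fin normr_id ger0_norm//; apply/ler_normlP.
  by have := gs0 i x; have := gs0 k x; have := gs_le i x; have := gs_le k x; split; lra.
have iPw := intB_gsPhi i Kw; have iPv := intB_gsPhi k Kv.
have Eb : iB (fun x => gs i x * Phi (z x)) + iB (fun x => gs k x * Phi (z x)) <=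
  iB (fun x => gs i x * Phi (w x)) + iB (fun x => gs k x * Phi (v x)) +
  iB (fun x => `|gs i x - gs k x|).
  rewrite -(iBD (intB_gsPhi i Kz) (intB_gsPhi k Kz)) -(iBD iPw iPv) -(iBD (intBD iPw iPv) iD).
  apply: iB_le.
  - by apply: intBD; exact: intB_gsPhi.
  - by apply: intBD => //; exact: intBD.
  move=> x bx; have cx := boundary_closure bx.
  by rewrite -mulrDl; apply: Phi_mid; [exact: Kw.2|exact: Kv.2].
apply: (midpoint_algebra Ez Ef Eb); move: h; rewrite /J.
move: (dform _ _) (dform _ _) (dform _ _) (iO _) (iO _) (iO _) (iB _) (iB _) (iB _) (iB _).
by move=> a1 a2 a3 a4 a5 a6 a7 a8 a9 a10 h; lra.
Qed.

(** The competitor is v = T_s(w - s phi). Passing from w - s phi to v does not increase the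
    gradient, as 0 <= T_s' <= 1; it increases the boundary form by at most 2 s^2 times the integral
    of [lam], and helps the term in [f] because T_s(x) >= x and f >= 0. The tangent of [Phi] is
    taken at v, where w - v <= s phi, so the power falls on the regularised function. *)
Lemma perturbation k w d phi s : K0 w -> (forall v, K0 v -> J k w <= J k v + d) ->
  Ck 1 phi -> 0 < s ->
  dform w phi - iO (fun x => f x * phi x) <= d / s + s * (dform phi phi / 2 + iB lam) +
    iB (fun x => gs k x * (phi x * spos s (w x - s * phi x) `^ (- eta))).
Proof.
move=> Kw hw Cp s0; have Cw := Kw.1.
pose z x := 1 * w x + - s * phi x.
have Ez : z = (fun x => w x - s * phi x) by apply/funext => x; rewrite /z; ring.
have Cz : Ck 1 z := (C1D (C1Z 1 Cw).1 (C1Z (- s) Cp).1).1.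
have [Cv Pv] := C1_comp Cz (fun t => is_derive_spos t s0) (continuous_dspos s0).
pose v x := spos s (z x).
have Kv : K0 v by split => // x _; exact: spos_gt0.
have Fz := dform_lin2 oOm bOm hC1 mlam lam0 lamL 1 (- s) Cw Cp.
have il : intB lam.
  have := intB_lam oOm bOm hC1 mlam lam0 lamL (@cst_continuous _ _ (1 : R)).
  by congr intB; apply/funext => x; rewrite mulr1.
have ilz := intB_lam oOm bOm hC1 mlam lam0 lamL (cont_mulC1 Cz Cz).
have ilv := intB_lam oOm bOm hC1 mlam lam0 lamL (cont_mulC1 Cv Cv).
have Fv : dform v v <= dform z z + 2 * s ^+ 2 * iB lam.
  rewrite /dform -addrA; apply: lerD.
    apply: (iO_le oOm).
    - by apply: (intO_cont oOm bOm); exact: continuous_gdot.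
    - by apply: (intO_cont oOm bOm); exact: continuous_gdot.
    move=> x _; apply: ler_sum => i _; rewrite /v Pv -!expr2 exprMn.
    have /andP[a b] := dspos_ge0_le1 (z x) s0.
    by rewrite ler_piMl ?sqr_ge0// expr_le1.
  rewrite -(iBZ _ il) -(iBD ilz (intBZ _ il)); apply: iB_le => //.
    by apply: intBD => //; exact: intBZ.
  move=> x _; rewrite [2 * _ * _]mulrC -mulrDr -!expr2; apply: ler_wpM2l => //.
  exact: spos_sqr_le.
have fv : iO (fun x => f x * w x) - s * iO (fun x => f x * phi x) <= iO (fun x => f x * v x).
  rewrite -mulNr -(iOZ oOm _ (intO_fmul Cp)) -(iOD oOm (intO_fmul Cw)); last first.
    by apply: (intOZ oOm); exact: intO_fmul.
  apply: (iO_le oOm).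
  - by apply: (intOD oOm); [exact: intO_fmul|apply: (intOZ oOm); exact: intO_fmul].
  - exact: intO_fmul.
  move=> x _; have -> : f x * w x + - s * (f x * phi x) = f x * z x by rewrite /z; ring.
  by rewrite ler_wpM2l// spos_ge.
have ip : intB (fun x => gs k x * (phi x * v x `^ (- eta))).
  have [a [b [a0 hab]]] := positive_C1_bounds bOm Kv.
  have [c c0 hc] := continuous_bounded_on bOm (C1_continuous Cp).
  apply: (@integrable_mulb _ surT R sur _ _ (fun x => phi x * v x `^ (- eta)) (c * a `^ (- eta)) mB (intB_gs k)).
    apply: measurable_funTS; apply: measurable_funM.
      by apply: measurable_cont_sur; exact: C1_continuous.
    exact: (measurableT_comp (@measurable_powR R (- eta)) (measurable_cont_sur (C1_continuous Cv))).
  move=> x bx; have cx := boundary_closure bx; have /andP[h1 _] := hab x cx.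
  rewrite normrM ler_pM ?hc// ger0_norm ?powR_ge0//.
  exact: ler_powRN.
have iw := intB_gsPhi k Kw; have iv := intB_gsPhi k Kv.
have Bv : iB (fun x => gs k x * Phi (v x)) <= iB (fun x => gs k x * Phi (w x)) +
   s * iB (fun x => gs k x * (phi x * v x `^ (- eta))).
  rewrite -(iBZ _ ip) -(iBD iw (intBZ _ ip)); apply: iB_le => //.
    by apply: intBD => //; exact: intBZ.
  move=> x bx; have cx := boundary_closure bx.
  have -> : gs k x * Phi (w x) + s * (gs k x * (phi x * v x `^ (- eta))) =
     gs k x * (Phi (w x) + v x `^ (- eta) * (s * phi x)) by ring.
  rewrite ler_wpM2l ?gs0// -lerBlDr; apply: le_trans (Phi_tangent (Kv.2 x cx) (Kw.2 x cx)).
  rewrite lerD2l lerN2 ler_wpM2l ?powR_ge0// lerBlDr -lerBlDl.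
  by have := spos_ge (z x) s0; rewrite {1}Ez.
have -> : (fun x => gs k x * (phi x * spos s (w x - s * phi x) `^ (- eta))) =
    (fun x => gs k x * (phi x * v x `^ (- eta))) by apply/funext => x; rewrite /v Ez.
exact: (perturb_algebra s0 Fz Fv fv Bv (hw v Kv)).
Qed.

Lemma gs_dist i k : iB (fun x => `|gs i x - gs k x|) <=
  iB (fun x => g x - gs i x) + iB (fun x => g x - gs k x).
Proof.
have id j : intB (fun x => g x - gs j x).
  have := intBD ig (intBZ (-1) (intB_gs j)).
  by congr intB; apply/funext => x; rewrite mulN1r.
rewrite -iBD//; apply: iB_le; last 1 first.
- move=> x _; have h1 := gs_le i x; have h2 := gs_le k x.
  by rewrite ler_norml; apply/andP; split; lra.
- apply: (le_integrable mB _ _ ig).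
    apply/measurable_EFinP; apply: (measurableT_comp (@normr_measurable R setT)).
    by apply: measurable_funB; exact: mgs.
  move=> x _; rewrite lee_fin normr_id ger0_norm//; apply/ler_normlP.
  by have := gs0 i x; have := gs0 k x; have := gs_le i x; have := gs_le k x; split; lra.
- exact: intBD.
Qed.

Lemma minimizing_sequence (a : R) : 0 < a -> exists h W : nat -> 'rV[R]_N -> R,
  [/\ forall k, K0 (W k),
      forall k, measurable_fun (boundary Om : set surT) (h k : surT -> R),
      forall k x, Num.min (g x) k%:R <= h k x <= g x,
      forall k, dform (fun x => 1 * W k.+1 x + (-1) * W k x) (fun x => 1 * W k.+1 x + (-1) * W k x)
        <= a * 8^-1 ^+ k &
      forall k phi s, Ck 1 phi -> 0 < s ->
        dform (W k) phi - iO (fun x => f x * phi x) <=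
        8^-1 ^+ k / s + s * (dform phi phi / 2 + iB lam) +
        iB (fun x => h k x * (phi x * spos s (W k x - s * phi x) `^ (- eta)))].
Proof.
move=> a0; pose d k : R := Num.min 1 (a / 16) * 8^-1 ^+ k.
(* The factor 1/16 absorbs the 4 of [minimizers_close] times four errors of size at most d k, two of
   minimality and two of approximation of [g]; the bound by 1 keeps the error of [perturbation]
   below 8^(-k) / s. *)
have b0 : 0 < Num.min 1 (a / 16) by rewrite lt_min ltr01 divr_gt0.
have e0 k : 0 < (8^-1 : R) ^+ k by rewrite exprn_gt0// invr_gt0.
have d0 k : 0 < d k by rewrite mulr_gt0.
have hk k : exists p : nat * ('rV[R]_N -> R), [/\ (k <= p.1)%N, K0 p.2,
    iB (fun x => g x - gs p.1 x) <= d k & forall v, K0 v -> J p.1 p.2 <= J p.1 v + d k].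
  have [j kj hj] := gs_approx (d0 k) k; have [w Kw hw] := near_minimizer j (d0 k).
  by exists (j, w).
have [p hp] := choice hk; exists (fun k => gs (p k).1), (fun k => (p k).2); split.
- by move=> k; case: (hp k).
- by move=> k; exact: mgs.
- move=> k x; rewrite gs_le andbT; apply: le_trans (gs_ge _ _).
  rewrite le_min ge_min lexx/= ge_min; apply/orP; right.
  by rewrite ler_nat; case: (hp k).
- move=> k; have [_ K1 g1 h1] := hp k.+1; have [_ K2 g2 h2] := hp k.
  apply: (le_trans (minimizers_close K1 K2 h1 h2)).
  have h3 := le_trans (gs_dist (p k.+1).1 (p k).1) (lerD g1 g2).
  have h4 : d k.+1 <= d k.
    by rewrite /d ler_wpM2l ?(ltW b0)// exprS ler_piMl ?(ltW (e0 k))// invf_le1// ler1n.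
  have h5 : d k * 16 <= a * 8^-1 ^+ k.
    rewrite /d mulrAC ler_wpM2r ?(ltW (e0 k))// -ler_pdivlMr//.
    by rewrite ge_min lexx orbT.
  apply: le_trans h5; move: h3 h4; move: (iB _) (d k) (d k.+1) => i x y h3 h4; lra.
- move=> k phi s Cp s0; have [_ K1 g1 h1] := hp k.
  apply: (le_trans (perturbation K1 h1 Cp s0)).
  rewrite -!addrA lerD2r ler_pM2r ?invr_gt0// /d ler_piMl ?(ltW (e0 k))//.
  by rewrite ge_min lexx.
Qed.

End Variational.

(** * Passage to the limit *)

Lemma cvg_fsum (R : realType) (I : finType) (F : I -> nat -> R) (l : I -> R) :
  (forall i, F i k @[k --> \oo] --> l i) -> \sum_i F i k @[k --> \oo] --> \sum_i l i.
Proof.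
move=> H; elim: (index_enum I) => [|i r IH].
  by rewrite big_nil; under eq_fun do rewrite big_nil; exact: cvg_cst.
rewrite big_cons; under eq_fun do rewrite big_cons.
by apply: (@cvgD _ R^o).
Qed.

Section LpLimits.
Context d (T : measurableType d) (R : realType) (m : {measure set T -> \bar R}).
Variable (D : set T).
Hypothesis mD : measurable D.

Lemma L2_of_integrable (f : T -> R) : measurable_fun D f ->
  m.-integrable D (EFin \o (fun x => f x ^+ 2)) -> L2 m D f.
Proof.
move=> mf /integrableP[_ h]; split => //; apply: le_lt_trans h.
by rewrite le_eqVlt; apply/orP; left; apply/eqP; apply: eq_integral => x _; rewrite gee0_abs// lee_fin sqr_ge0.
Qed.

Lemma dct_mul (w : nat -> T -> R) f h v : (forall k, measurable_fun D (w k)) ->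
  L2 m D f -> L2 m D h -> L2 m D v ->
  {ae m, forall x, D x -> w k x @[k --> \oo] --> f x /\ forall k, `|w k x| <= h x} ->
  [/\ forall k, m.-integrable D (EFin \o (fun x => w k x * v x)),
    m.-integrable D (EFin \o (fun x => f x * v x)) &
    \int[m]_(x in D) (w k x * v x) @[k --> \oo] --> \int[m]_(x in D) (f x * v x)].
Proof.
move=> mw fL hL vL ae.
apply: (@dct _ T R m D mD (fun k x => w k x * v x) (fun x => f x * v x) (fun x => `|h x * v x|)).
- by move=> k; apply: measurable_funM; [exact: mw|exact: vL.1].
- by apply: measurable_funM; [exact: fL.1|exact: vL.1].
- exact: (integrable_norm (L2_mul mD hL vL)).
- apply: (@ae_imp _ T R m _ _ _ ae) => x H Dx; have [h1 h2] := H Dx; split.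
    exact: cvgMr_tmp.
  by move=> k; rewrite !normrM ler_wpM2r// (le_trans (h2 k))// ler_norm.
Qed.

(** Replacing the limit by its absolute value makes it nonnegative everywhere, and does not increase
    the distance to the nonnegative functions [w k]. *)
Lemma fast_cauchy_ge0 (w : nat -> T -> R) : (forall k, measurable_fun D (w k)) -> L2 m D (w 0%N) ->
  (forall k x, D x -> 0 <= w k x) ->
  (forall k, (\int[m]_(x in D) ((w k.+1 x - w k x) ^+ 2)%:E <= (8^-1 ^+ k)%:E)%E) ->
  exists f h : T -> R, [/\ L2 m D f /\ (forall x, 0 <= f x), L2 m D h,
    {ae m, forall x, D x -> w k x @[k --> \oo] --> f x /\ forall k, `|w k x| <= h x} &
    (\int[m]_(x in D) ((w k x - f x) ^+ 2)%:E)%E @[k --> \oo] --> 0%E].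
Proof.
move=> mw w0 wp H; have [f [h [fL hL ae cv]]] := fast_cauchy mD mw w0 H.
have mf : measurable_fun D (fun x => `|f x|).
  by apply: (measurableT_comp (@normr_measurable R setT)); exact: fL.1.
exists (fun x => `|f x|), h; split => //.
- by split => //; apply: (L2_le mD mf fL) => x _; rewrite normr_id.
- apply: (@ae_imp _ T R m _ _ _ ae) => x hx Dx; have [h1 h2] := hx Dx; split => //.
  have -> : (fun k => w k x) = (fun k => `|w k x|) by apply/funext => k; rewrite ger0_norm// wp.
  exact: (@cvg_norm _ R^o).
- have i0 (v : T -> R) k : (0 <= \int[m]_(x in D) ((w k x - v x) ^+ 2)%:E)%E.
    by apply: integral_ge0 => x _; rewrite lee_fin sqr_ge0.
  move/(cvge0P (i0 f)): cv => cv; apply/(cvge0P (i0 _)) => e e0.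
  have := cv e e0; apply: filterS => k; apply: le_trans.
  apply: ge0_le_integral; first exact: mD.
  + by move=> x _; rewrite lee_fin sqr_ge0.
  + apply/measurable_EFinP; apply: measurable_funX; apply: measurable_funB => //; exact: mw.
  + apply/measurable_EFinP; apply: measurable_funX; apply: measurable_funB; [exact: mw|exact: fL.1].
  + move=> x Dx; rewrite lee_fin -[leLHS](real_normK (num_real _)) -[leRHS](real_normK (num_real _)).
    rewrite ler_sqr ?nnegrE//.
    rewrite -{1}(ger0_norm (wp k x Dx)); exact: ler_dist_dist.
Qed.

End LpLimits.

Section Limit.
Context (R : realType) (n : nat).
Local Notation N := n.+1.
Local Notation lebT := (caratheodory_type (@lebesgue_outer R N)).
Local Notation surT := (caratheodory_type (@hausdorff_outer R N.-1 N)).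
Local Notation sur := (surface R N).
Local Notation mu := (lebesgue_rV R N).
Implicit Types (w v phi : 'rV[R]_N -> R).
Variables (Om : set 'rV[R]_N) (lam : 'rV[R]_N -> R) (Lam : R).
Hypotheses (oOm : open Om) (bOm : bounded_set Om) (hC1 : C1_boundary Om)
  (mlam : measurable_fun setT (lam : surT -> R))
  (lam0 : forall x, 0 <= lam x) (lamL : forall x, lam x <= Lam).
Variables (f g : 'rV[R]_N -> R) (eta : R).
Hypotheses (if_ : intO Om f) (f0 : forall x, 0 <= f x)
  (eta0 : 0 <= eta) (ig : intB Om g) (g0 : forall x, 0 <= g x).
Local Notation iO := (iO Om).
Local Notation iB := (iB Om).
Local Notation intO := (intO Om).
Local Notation intB := (intB Om).
Local Notation dform := (dform Om lam).
Local Notation mO := (mO oOm).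
Local Notation mB := (mB Om).

Lemma L2_contO v : continuous v -> L2 mu (Om : set lebT) (v : lebT -> R).
Proof.
move=> cv; apply: (L2_of_integrable (m := mu)).
  by apply: measurable_funTS; exact: measurable_cont.
apply: (intO_cont oOm bOm); under eq_fun do rewrite expr2; exact: contM.
Qed.

Lemma intB_cont v : continuous v -> intB v.
Proof.
move=> cv; have [c c0 hc] := continuous_bounded_on bOm cv.
apply: (intB_bounded oOm bOm hC1 (c := c)).
  by apply: measurable_funTS; exact: measurable_cont_sur.
by move=> x bx; apply: hc; exact: boundary_closure.
Qed.

Lemma L2_contB v : continuous v -> L2 sur (boundary Om : set surT) (v : surT -> R).
Proof.
move=> cv; apply: (L2_of_integrable (m := sur)).
  by apply: measurable_funTS; exact: measurable_cont_sur.
apply: intB_cont; under eq_fun do rewrite expr2; exact: contM.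
Qed.

Lemma sqr_le_energy w : Ck 1 w ->
  (\int[mu]_(x in (Om : set lebT)) (w x ^+ 2)%:E <= energy Om w)%E.
Proof.
move=> Cw; apply: ge0_le_integral; first exact: mO.
- by move=> x _; rewrite lee_fin sqr_ge0.
- by apply/measurable_EFinP; apply: measurable_funTS; apply: measurable_cont; exact: cont_sqr.
- apply/measurable_EFinP; apply: measurable_funTS; apply: measurable_cont.
  by apply: contD; [exact: continuous_gsq|exact: cont_sqr].
- by move=> x _; rewrite lee_fin lerDr gsq_ge0.
Qed.

Lemma partial_sqr_le_energy w i : Ck 1 w ->
  (\int[mu]_(x in (Om : set lebT)) (partial i w x ^+ 2)%:E <= energy Om w)%E.
Proof.
move=> Cw; have cp := C1_continuous_partial (i := i) Cw; apply: ge0_le_integral; first exact: mO.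
- by move=> x _; rewrite lee_fin sqr_ge0.
- apply/measurable_EFinP; apply: measurable_funTS; apply: measurable_cont.
  by under eq_fun do rewrite expr2; exact: contM.
- apply/measurable_EFinP; apply: measurable_funTS; apply: measurable_cont.
  by apply: contD; [exact: continuous_gsq|exact: cont_sqr].
- move=> x _; rewrite lee_fin /gsq (bigD1 i)//= -addrA lerDl addr_ge0 ?sqr_ge0//.
  by apply: sumr_ge0 => j _; exact: sqr_ge0.
Qed.

Lemma iO_sum (F : 'I_N -> 'rV[R]_N -> R) : (forall i, intO (F i)) ->
  iO (fun x => \sum_i F i x) = \sum_i iO (F i).
Proof.
move=> hF; apply: EFin_inj.
have iS : intO (fun x => \sum_i F i x).
  have := integrable_sum mO (index_enum 'I_N) (P := predT) (fun i _ => hF i).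
  by congr (mu.-integrable _ _); apply/funext => x /=; rewrite sumEFin.
rewrite -(EFin_iO oOm iS) -sumEFin.
under eq_integral do rewrite -sumEFin.
rewrite (integral_sum mO (f := fun i x => (F i x)%:E)) => [|i]; last exact: hF.
by apply: eq_bigr => i _; rewrite (EFin_Rintegral mO (hF i)).
Qed.

Lemma measurable_spos_pow (v phi : surT -> R) s : 0 < s -> Ck 1 phi ->
  measurable_fun (boundary Om : set surT) v ->
  measurable_fun (boundary Om : set surT) (fun x : surT => phi x * spos s (v x - s * phi x) `^ (- eta)).
Proof.
move=> s0 Cphi mv; have mphi : measurable_fun (boundary Om : set surT) (phi : surT -> R).
  by apply: measurable_funTS; apply: measurable_cont_sur; exact: C1_continuous.
have ms : measurable_fun setT (spos s).
  apply: continuous_measurable_fun => y; exact: (is_derive_continuous (fun y => is_derive_spos y s0)).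
have md : measurable_fun (boundary Om : set surT) (fun x : surT => v x - s * phi x).
  apply: measurable_funB; first exact: mv.
  by apply: measurable_funM; [exact: measurable_cst|exact: mphi].
have mq := measurableT_comp (@measurable_powR R (- eta)) (measurableT_comp ms md).
by apply: measurable_funM; [exact: mphi|exact: mq].
Qed.

Lemma spos_boundary_lower phi M s x y : 0 < s -> (forall x, closure Om x -> `|phi x| <= M) ->
  boundary Om x -> 0 <= y -> s / (M + 1) <= spos s (y - s * phi x).
Proof.
move=> s0 hM bx y0; have h1 := hM x (boundary_closure bx).
apply: spos_lower => //; first exact: le_trans h1.
rewrite -[leLHS]add0r lerD// lerN2 ler_wpM2l ?(ltW s0)//.
exact: le_trans (ler_norm _) h1.
Qed.

Variables (h W : nat -> 'rV[R]_N -> R) (a C Ct : R).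
Hypotheses (KW : forall k, positive_C1 Om (W k))
  (mh : forall k, measurable_fun (boundary Om : set surT) (h k : surT -> R))
  (hh : forall k x, Num.min (g x) k%:R <= h k x <= g x)
  (Wdiff : forall k, dform (fun x => 1 * W k.+1 x + (-1) * W k x) (fun x => 1 * W k.+1 x + (-1) * W k x)
        <= a * 8^-1 ^+ k)
  (Wmin : forall k phi s, Ck 1 phi -> 0 < s ->
        dform (W k) phi - iO (fun x => f x * phi x) <=
        8^-1 ^+ k / s + s * (dform phi phi / 2 + iB lam) +
        iB (fun x => h k x * (phi x * spos s (W k x - s * phi x) `^ (- eta))))
  (C0 : 0 <= C) (HC : forall w, Ck 1 w -> energyR Om w <= C * dform w w)
  (Ct0 : 0 <= Ct) (HCt : forall w, Ck 1 w ->
    (\int[sur]_(x in (boundary Om : set surT)) (w x ^+ 2)%:E <= Ct%:E * energy Om w)%E)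
  (aC : C * a <= 1) (aCt : Ct * (C * a) <= 1).

(** The weak equation with all terms but the singular one on one side; the weak gradient is given by
    its components. *)
Definition EL (G : 'I_N -> 'rV[R]_N -> R) (t phi : 'rV[R]_N -> R) : R :=
  \sum_i iO (fun x => G i x * partial i phi x) + iB (fun x => lam x * (t x * phi x)) -
  iO (fun x => f x * phi x).

(** One sequence serves for the functions, the partial derivatives and the traces, because its
    increments decay in energy and hence, by the trace inequality, on the boundary. The identity for
    the weak gradient is the limit of integration by parts, and the inequality for fixed s is the
    limit of the one for near-minimisers, whose error 8^(-k) / s vanishes. *)
Lemma limit_solution : exists (u t : 'rV[R]_N -> R) (G : 'I_N -> 'rV[R]_N -> R),
  [/\ (forall x, 0 <= u x) /\ (forall x, 0 <= t x),
      [/\ L2 mu (Om : set lebT) (u : lebT -> R), forall i, L2 mu (Om : set lebT) (G i : lebT -> R) &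
          L2 sur (boundary Om : set surT) (t : surT -> R)],
      [/\ (\int[mu]_(x in (Om : set lebT)) ((W k x - u x) ^+ 2)%:E)%E @[k --> \oo] --> 0%E,
          forall i, (\int[mu]_(x in (Om : set lebT)) ((partial i (W k) x - G i x) ^+ 2)%:E)%E
             @[k --> \oo] --> 0%E &
          (\int[sur]_(x in (boundary Om : set surT)) ((W k x - t x) ^+ 2)%:E)%E @[k --> \oo] --> 0%E],
      forall i phi, test_function Om phi ->
        iO (fun x => u x * partial i phi x) = - iO (fun x => G i x * phi x) &
      forall phi s, Ck 1 phi -> 0 < s ->
        EL G t phi <= s * (dform phi phi / 2 + iB lam) +
          iB (fun x => g x * (phi x * spos s (t x - s * phi x) `^ (- eta)))].
Proof.
have CW k : Ck 1 (W k) := (KW k).1.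
pose z k x := 1 * W k.+1 x + (-1) * W k x.
have Cz k : Ck 1 (z k) := (C1D (C1Z 1 (CW k.+1)).1 (C1Z (-1) (CW k)).1).1.
have zE k x : W k.+1 x - W k x = z k x by rewrite /z mul1r mulN1r.
have zP k i x : partial i (W k.+1) x - partial i (W k) x = partial i (z k) x.
  rewrite /z (C1D (C1Z 1 (CW k.+1)).1 (C1Z (-1) (CW k)).1).2.
  by rewrite (C1Z 1 (CW k.+1)).2 (C1Z (-1) (CW k)).2 mul1r mulN1r.
have e0 k : 0 <= (8^-1 : R) ^+ k by rewrite exprn_ge0// invr_ge0.
have Ez0 k : energyR Om (z k) <= C * a * 8^-1 ^+ k.
  by apply: (le_trans (HC (Cz k))); rewrite -mulrA ler_wpM2l// Wdiff.
have Ez k : (energy Om (z k) <= (8^-1 ^+ k)%:E)%E.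
  by rewrite (energyE oOm bOm (Cz k)) lee_fin (le_trans (Ez0 k))// ler_piMl.
have cW k : continuous (W k) by exact: C1_continuous.
have cP i k : continuous (partial i (W k)) by exact: C1_continuous_partial.
have [u [hu [[uL u0] huL uae ucv]]] : exists f h : lebT -> R, [/\ L2 mu (Om : set lebT) f /\ (forall x, 0 <= f x), L2 mu (Om : set lebT) h,
    {ae mu, forall x, Om x -> W k x @[k --> \oo] --> f x /\ forall k, `|W k x| <= h x} &
    (\int[mu]_(x in (Om : set lebT)) ((W k x - f x) ^+ 2)%:E)%E @[k --> \oo] --> 0%E].
  apply: (@fast_cauchy_ge0 _ lebT R mu Om mO W).
  - by move=> k; apply: measurable_funTS; exact: measurable_cont.
  - exact: L2_contO.
  - by move=> k x Ox; apply: ltW; apply: (KW k).2; exact: subset_closure.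
  - move=> k; under eq_integral do rewrite zE; exact: le_trans (sqr_le_energy (Cz k)) (Ez k).
have [t [ht [[tL t0] htL tae tcv]]] : exists f h : surT -> R, [/\ L2 sur (boundary Om : set surT) f /\ (forall x, 0 <= f x), L2 sur (boundary Om : set surT) h,
    {ae sur, forall x, boundary Om x -> W k x @[k --> \oo] --> f x /\ forall k, `|W k x| <= h x} &
    (\int[sur]_(x in (boundary Om : set surT)) ((W k x - f x) ^+ 2)%:E)%E @[k --> \oo] --> 0%E].
  apply: (@fast_cauchy_ge0 _ surT R sur (boundary Om) mB W).
  - by move=> k; apply: measurable_funTS; exact: measurable_cont_sur.
  - exact: L2_contB.
  - by move=> k x bx; apply: ltW; apply: (KW k).2; exact: boundary_closure.
  - move=> k; under eq_integral do rewrite zE; apply: (le_trans (HCt (Cz k))).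
    rewrite (energyE oOm bOm (Cz k)) -EFinM lee_fin.
    apply: (le_trans (ler_wpM2l Ct0 (Ez0 k))); rewrite mulrA.
    by rewrite ler_piMl.
have Gex i : exists p : ('rV[R]_N -> R) * ('rV[R]_N -> R), [/\ L2 mu (Om : set lebT) (p.1 : lebT -> R), L2 mu (Om : set lebT) (p.2 : lebT -> R),
    {ae mu, forall x : lebT, Om x -> partial i (W k) x @[k --> \oo] --> p.1 x /\ forall k, `|partial i (W k) x| <= p.2 x} &
    (\int[mu]_(x in (Om : set lebT)) ((partial i (W k) x - p.1 x) ^+ 2)%:E)%E @[k --> \oo] --> 0%E].
  have [p1 [p2 H]] : exists f h : lebT -> R, [/\ L2 mu (Om : set lebT) f, L2 mu (Om : set lebT) h,
    {ae mu, forall x, Om x -> partial i (W k) x @[k --> \oo] --> f x /\ forall k, `|partial i (W k) x| <= h x} &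
    (\int[mu]_(x in (Om : set lebT)) ((partial i (W k) x - f x) ^+ 2)%:E)%E @[k --> \oo] --> 0%E].
    apply: (@fast_cauchy _ lebT R mu Om mO (fun k => partial i (W k))).
    - by move=> k; apply: measurable_funTS; exact: measurable_cont.
    - exact: L2_contO.
    - move=> k; under eq_integral do rewrite zP.
      exact: le_trans (partial_sqr_le_energy i (Cz k)) (Ez k).
  by exists (p1, p2).
have [p hp] := choice Gex.
have mWO k : measurable_fun (Om : set lebT) (W k : lebT -> R) by apply: measurable_funTS; exact: measurable_cont.
have mWB k : measurable_fun (boundary Om : set surT) (W k : surT -> R) by apply: measurable_funTS; exact: measurable_cont_sur.
have mPO i k : measurable_fun (Om : set lebT) (partial i (W k) : lebT -> R) by apply: measurable_funTS; exact: measurable_cont.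
have uM v : continuous v -> iO (fun x => W k x * v x) @[k --> \oo] --> iO (fun x => u x * v x).
  by move=> cv; case: (dct_mul mO mWO uL huL (L2_contO cv) uae).
have GM i v : continuous v -> iO (fun x => partial i (W k) x * v x) @[k --> \oo] --> iO (fun x => (p i).1 x * v x).
  by move=> cv; have [h1 h2 h3 _] := hp i; case: (dct_mul mO (mPO i) h1 h2 (L2_contO cv) h3).
exists u, t, (fun i => (p i).1); split.
- by [].
- by split => // i; case: (hp i).
- by split => // i; case: (hp i).
- move=> i phi tphi; have Cphi : Ck 1 phi by case: tphi => + _ _; exact.
  have c1 := uM _ (C1_continuous_partial (i := i) Cphi).
  have c2 : - iO (fun x => partial i (W k) x * phi x) @[k --> \oo] --> - iO (fun x => (p i).1 x * phi x).
    by apply: (@cvgN _ R^o); exact: GM (C1_continuous Cphi).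
  have e k : iO (fun x => W k x * partial i phi x) = - iO (fun x => partial i (W k) x * phi x).
    have := integration_by_parts_test i oOm bOm (CW k) tphi.
    rewrite (EFin_Rintegral mO) => [|]; last first.
      by apply: (intO_cont oOm bOm); apply: contM => //; exact: C1_continuous_partial.
    rewrite (EFin_Rintegral mO) => [|]; last first.
      by apply: (intO_cont oOm bOm); apply: contM => //; exact: C1_continuous.
    by move=> hE; exact: EFin_inj hE.
  rewrite (funext e) in c1.
  exact: (@cvg_unique R^o (@norm_hausdorff _ R^o) _ _ _ _ c1 c2).
- move=> phi s Cphi s0.
  have [M M0 hM] := continuous_bounded_on bOm (C1_continuous Cphi).
  have vlow x y := @spos_boundary_lower phi M s x y s0 hM.
  have sM0 : 0 < s / (M + 1) by rewrite divr_gt0// ltr_wpDl.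
  have mspos (v : surT -> R) := @measurable_spos_pow v phi s s0 Cphi.
  have mg : measurable_fun (boundary Om : set surT) (g : surT -> R).
    by apply/measurable_EFinP; exact: measurable_int ig.
  have cB : iB (fun x => h k x * (phi x * spos s (W k x - s * phi x) `^ (- eta))) @[k --> \oo] -->
            iB (fun x => g x * (phi x * spos s (t x - s * phi x) `^ (- eta))).
    have [_ _] : [/\ forall k, intB (fun x => h k x * (phi x * spos s (W k x - s * phi x) `^ (- eta))),
        intB (fun x => g x * (phi x * spos s (t x - s * phi x) `^ (- eta))) &
      iB (fun x => h k x * (phi x * spos s (W k x - s * phi x) `^ (- eta))) @[k --> \oo] -->
            iB (fun x => g x * (phi x * spos s (t x - s * phi x) `^ (- eta)))]; last by [].
    (* [K] times [g] is the majorant: T_s is at least s / (M + 1) on the boundary, uniformly in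
       k. *)
    pose K := M * (s / (M + 1)) `^ (- eta).
    apply: (@dct _ surT R sur (boundary Om) mB _ _ (fun x => K * g x)).
    + by move=> k; apply: measurable_funM; [exact: mh|apply: mspos; exact: mWB].
    + by apply: measurable_funM; [exact: mg|apply: mspos; exact: tL.1].
    + exact: intBZ ig.
    + apply: (@ae_imp _ surT R sur _ _ _ tae) => x hx bx; have [h1 h2] := hx bx; split.
        apply: cvgM.
          apply: cvg_near_cst; have [m hm] : exists m : nat, g x <= m%:R.
            by exists (Num.truncn (g x)).+1; apply: ltW; exact: truncnS_gt.
          near=> k; apply: le_anti; have /andP[b1 ->] := hh k x; rewrite andTb.
          apply: le_trans b1; rewrite le_min lexx andTb; apply: (le_trans hm); rewrite ler_nat.
          by near: k; exact: nbhs_infty_ge.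
        apply: cvgMl_tmp; apply: cvg_powR; first exact: spos_gt0.
        apply: continuous_cvg; first exact: (is_derive_continuous (fun y => is_derive_spos y s0)).
        by apply: (@cvgB _ R^o) => //; exact: cvg_cst.
      move=> k; have /andP[b1 b2] := hh k x.
      have h0 : 0 <= h k x by apply: le_trans b1; rewrite le_min g0 ler0n.
      rewrite normrM (ger0_norm h0) mulrC; apply: ler_pM => //.
      rewrite normrM; apply: ler_pM => //; first by apply: hM; exact: boundary_closure.
      rewrite ger0_norm ?powR_ge0//; apply: ler_powRN => //; apply: vlow => //.
      by apply: ltW; apply: (KW k).2; exact: boundary_closure.
  have cL : dform (W k) phi - iO (fun x => f x * phi x) @[k --> \oo] --> EL (fun i => (p i).1) t phi.
    apply: (@cvgB _ R^o); last exact: cvg_cst.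
    apply: (@cvgD _ R^o).
      have e k : iO (gdot (W k) phi) = \sum_i iO (fun x => partial i (W k) x * partial i phi x).
        apply: iO_sum => i; apply: (intO_cont oOm bOm).
        by apply: contM => //; exact: C1_continuous_partial.
      under eq_fun do rewrite e.
      apply: cvg_fsum => i; apply: GM; exact: C1_continuous_partial.
    have lphi : L2 sur (boundary Om : set surT) (fun x : surT => lam x * phi x).
      apply: (L2_mulb mB (c := Lam) (L2_contB (C1_continuous Cphi))); first exact: measurable_funTS.
      by move=> x _; rewrite ger0_norm.
    have [_ _] := dct_mul mB mWB tL htL lphi tae.
    have e v : (fun x => lam x * (v x * phi x)) = (fun x => v x * (lam x * phi x)).
      by apply/funext => x; ring.
    have eW : (fun k => iB (fun x => lam x * (W k x * phi x))) =
        (fun k => iB (fun x => W k x * (lam x * phi x))) by apply/funext => k; rewrite e.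
    by rewrite eW e.
  have cR : 8^-1 ^+ k / s + s * (dform phi phi / 2 + iB lam) +
        iB (fun x => h k x * (phi x * spos s (W k x - s * phi x) `^ (- eta))) @[k --> \oo] -->
        s * (dform phi phi / 2 + iB lam) + iB (fun x => g x * (phi x * spos s (t x - s * phi x) `^ (- eta))).
    apply: (@cvgD _ R^o) => //; rewrite -[X in _ --> X]add0r.
    apply: (@cvgD _ R^o); last exact: cvg_cst.
    rewrite -(mul0r s^-1); apply: cvgMr_tmp; apply: cvg_expr.
    by rewrite ger0_norm// invf_lt1// ltr1n.
  by apply: (ler_cvg_to cL cR); apply: nearW => k; exact: Wmin.
Unshelve. all: by end_near. Qed.

End Limit.

Section Fatou.
Context d (T : measurableType d) (R : realType) (m : {measure set T -> \bar R}).
Variable (D : set T).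
Hypothesis mD : measurable D.

Lemma fatou_bound (F : nat -> T -> \bar R) (f : T -> \bar R) (K : \bar R) :
  (forall k, measurable_fun D (F k)) -> (forall k x, D x -> (0 <= F k x)%E) ->
  measurable_fun D f -> {ae m, forall x, D x -> F k x @[k --> \oo] --> f x} ->
  (forall k, (\int[m]_(x in D) F k x <= K)%E) -> (\int[m]_(x in D) f x <= K)%E.
Proof.
move=> mF F0 mf cv hK.
have -> : (\int[m]_(x in D) f x = \int[m]_(x in D) limn_einf (F^~ x))%E.
  apply: ae_eq_integral => //.
    under eq_fun do rewrite limn_einf_lim.
    apply: (emeasurable_fun_cvg (fun k x => einfs (F^~ x) k)); first exact: measurable_fun_einfs.
    by move=> x _; have h := @is_cvg_einfs R (F^~ x); exact: h.
  apply: (@ae_imp _ T R m _ _ _ cv) => x h Dx.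
  by rewrite (cvg_limn_einf_sup (h Dx)).1.
apply: (le_trans (fatou m mD mF F0)).
rewrite limn_einf_lim; apply: lime_le; first exact: is_cvg_einfs.
apply: nearW => k; apply: le_trans (hK k).
by apply: ereal_inf_lbound; exists k => //=.
Qed.

End Fatou.

Section SingularTerm.
Context (R : realType).
Implicit Types g t a : R.

(** Division in the extended reals is what makes this true at t = 0: for a > 0 the limit is +oo if g
    > 0, and the sequence is constantly 0 if g = 0. *)
Lemma cvg_singular g t a (v : nat -> R) : 0 <= g -> 0 <= t -> 0 <= a ->
  (forall k, 0 < v k) -> v k @[k --> \oo] --> t ->
  (g * v k `^ (- a))%:E @[k --> \oo] --> (g%:E / (t `^ a)%:E)%E.
Proof.
move=> g0 t0 a0 v0 vt; rewrite inver; case: ifPn => [|ta].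
  rewrite powR_eq0 => /andP[/eqP tE aN].
  have ap : 0 < a by rewrite lt_neqAle eq_sym aN.
  move: g0; rewrite le_eqVlt => /orP[/eqP <-|gp].
    by rewrite mul0e; under eq_fun do rewrite mul0r; exact: cvg_cst.
  rewrite gt0_muley ?lte_fin//; apply/cvgeryP/cvgryPge => A.
  (* v <= e^(1/a) gives v^(-a) >= 1/e, and g / e = |A| + 1. *)
  pose e := g / (`|A| + 1); have e0 : 0 < e by rewrite divr_gt0// ltr_wpDl.
  near=> k; have vk : v k <= e `^ a^-1.
    apply: ltW; near: k; apply: (cvgr_lt t vt); rewrite tE; exact: powR_gt0.
  have h1 : v k `^ a <= e.
    have : v k `^ a <= (e `^ a^-1) `^ a.
      by apply: ge0_ler_powR => //; rewrite nnegrE ?powR_ge0// ltW.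
    by rewrite -powRrM mulVf ?gt_eqF// powRr1// ltW.
  rewrite powRN -ler_pdivrMl//.
  apply: (@le_trans _ _ e^-1).
    rewrite /e invf_div mulrC ler_pM2r ?invr_gt0//.
    by apply: le_trans (ler_norm A) _; rewrite lerDl.
  by rewrite lef_pV2 ?posrE// powR_gt0.
rewrite -powRN -EFinM; apply: cvg_EFin; first exact: nearW.
apply: cvgMl_tmp; have [->|aN] := eqVneq a 0.
  by rewrite oppr0 powRr0; under eq_fun do rewrite powRr0; exact: cvg_cst.
apply: cvg_powR => //; rewrite lt_neqAle t0 andbT eq_sym.
by apply: contraNneq ta => ->; rewrite powR0.
Unshelve. all: by end_near. Qed.

Lemma powRN_le_scale (a t v K : R) : 0 <= a -> 0 <= t -> 0 < v -> 0 <= K -> t <= K * v ->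
  t `^ a != 0 -> v `^ (- a) <= K `^ a * t `^ (- a).
Proof.
move=> a0 t0 v0 K0 h ta; have tp : 0 < t `^ a by rewrite lt_neqAle eq_sym ta powR_ge0.
rewrite !powRN ler_pdivlMr// mulrC ler_pdivrMr ?powR_gt0// -powRM ?(ltW v0)//.
by apply: ge0_ler_powR => //; rewrite nnegrE// mulr_ge0// ltW.
Qed.

End SingularTerm.

Lemma opp_sum3 (R : ringType) (a b c a' b' c' : R) :
  a = - a' -> b = - b' -> c = - c' -> a + b - c = - (a' + b' - c').
Proof. by move=> -> -> ->; rewrite !opprD !opprK. Qed.

Section Euler.
Context (R : realType) (n : nat).
Local Notation N := n.+1.
Local Notation lebT := (caratheodory_type (@lebesgue_outer R N)).
Local Notation surT := (caratheodory_type (@hausdorff_outer R N.-1 N)).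
Local Notation sur := (surface R N).
Local Notation mu := (lebesgue_rV R N).
Implicit Types (w v phi : 'rV[R]_N -> R).
Variables (Om : set 'rV[R]_N) (lam : 'rV[R]_N -> R) (Lam : R).
Hypotheses (oOm : open Om) (bOm : bounded_set Om) (hC1 : C1_boundary Om)
  (mlam : measurable_fun setT (lam : surT -> R))
  (lam0 : forall x, 0 <= lam x) (lamL : forall x, lam x <= Lam).
Variables (f g : 'rV[R]_N -> R) (eta : R).
Hypotheses (if_ : intO Om f) (f0 : forall x, 0 <= f x)
  (eta0 : 0 <= eta) (ig : intB Om g) (g0 : forall x, 0 <= g x).
Local Notation iO := (iO Om).
Local Notation iB := (iB Om).
Local Notation intO := (intO Om).
Local Notation intB := (intB Om).
Local Notation dform := (dform Om lam).
Local Notation mO := (mO oOm).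
Local Notation mB := (mB Om).
Variables (t : 'rV[R]_N -> R) (G : 'I_N -> 'rV[R]_N -> R).
Hypotheses (t0 : forall x, 0 <= t x)
  (GL : forall i, L2 mu (Om : set lebT) (G i : lebT -> R))
  (tL : L2 sur (boundary Om : set surT) (t : surT -> R))
  (hEL : forall phi s, Ck 1 phi -> 0 < s ->
     EL Om lam f G t phi <= s * (dform phi phi / 2 + iB lam) +
       iB (fun x => g x * (phi x * spos s (t x - s * phi x) `^ (- eta)))).

Lemma measurable_g : measurable_fun (boundary Om : set surT) (g : surT -> R).
Proof. by apply/measurable_EFinP; exact: measurable_int ig. Qed.

Lemma intB_spos phi s : 0 < s -> Ck 1 phi ->
  intB (fun x => g x * (phi x * spos s (t x - s * phi x) `^ (- eta))).
Proof.
move=> s0 Cphi; have [M M0 hM] := continuous_bounded_on bOm (C1_continuous Cphi).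
have sM0 : 0 < s / (M + 1) by rewrite divr_gt0// ltr_wpDl.
apply: (@integrable_mulb _ surT R sur _ _ (fun x => phi x * spos s (t x - s * phi x) `^ (- eta))
  (M * (s / (M + 1)) `^ (- eta)) mB ig).
  by apply: measurable_spos_pow => //; exact: tL.1.
move=> x bx; rewrite normrM ler_pM ?hM//; first exact: boundary_closure.
rewrite ger0_norm ?powR_ge0//; apply: ler_powRN => //.
exact: (@spos_boundary_lower _ _ Om phi M s x).
Qed.

Definition sj (j : nat) : R := j.+1%:R^-1.
Lemma sj_gt0 j : 0 < sj j. Proof. by rewrite invr_gt0 ltr0n. Qed.
Lemma sj_le1 j : sj j <= 1. Proof. by rewrite invf_le1// ler1n. Qed.
Lemma sj_cvg : sj j @[j --> \oo] --> 0. Proof. exact: cvg_harmonic. Qed.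

Lemma cvg_spos_sj (x p : R) : 0 <= x -> spos (sj j) (x - sj j * p) @[j --> \oo] --> x.
Proof.
move=> x0.
have c (b : R) : x + sj j * b @[j --> \oo] --> x.
  rewrite -[X in _ --> X]addr0 -(mul0r b); apply: (@cvgD _ R^o); first exact: cvg_cst.
  by apply: cvgMr_tmp; exact: sj_cvg.
apply: (squeeze_cvgr _ (c (- p)) (c (`|p| + 1))).
apply: nearW => j; have s0 := sj_gt0 j; rewrite mulrN spos_ge//=.
apply: (le_trans (spos_le _ s0)); rewrite mulrDr mulr1 addrA lerD2r ge_max.
rewrite addr_ge0 ?mulr_ge0 ?(ltW s0)// andbT lerD2l -mulrN ler_wpM2l ?(ltW s0)//.
by rewrite -normrN ler_norm.
Qed.

Lemma singular_ge0 x : (0 <= singular_term g t eta x)%E.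
Proof.
rewrite /singular_term inver; case: ifPn => h; first by rewrite mule_ge0 ?lee_fin.
by rewrite mule_ge0 ?lee_fin ?invr_ge0 ?powR_ge0.
Qed.

Lemma cvg_singular_spos x p :
  (g x * spos (sj j) (t x - sj j * p) `^ (- eta))%:E @[j --> \oo] --> singular_term g t eta x.
Proof.
apply: cvg_singular => //; first by move=> k; apply: spos_gt0; exact: sj_gt0.
exact: cvg_spos_sj.
Qed.

(** The direction phi = -1 turns the upper bound [hEL] into an upper bound, uniform in s <= 1, for
    the integral of g T_s(t + s)^(-eta); Fatou's lemma passes to s = 0. *)
Lemma singular_integrable : sur.-integrable (boundary Om : set surT) (singular_term g t eta : surT -> \bar R).
Proof.
pose phi : 'rV[R]_N -> R := cst (-1); have Cphi : Ck 1 phi := (@C1_cst R N (-1)).1.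
pose F j x := g x * spos (sj j) (t x - sj j * phi x) `^ (- eta).
have FE j : (fun x => g x * (phi x * spos (sj j) (t x - sj j * phi x) `^ (- eta))) = (fun x => -1 * F j x).
  by apply/funext => x; rewrite /F /phi/=; ring.
have iF j : intB (F j).
  have h : intB (fun x => -1 * F j x) by rewrite -FE; exact: intB_spos (sj_gt0 j) Cphi.
  have := intBZ (-1) h; congr intB; by apply/funext => x; rewrite mulrA mulN1r opprK mul1r.
have mF j : measurable_fun (boundary Om : set surT) (EFin \o (F j : surT -> R)).
  exact: measurable_int (iF j).
have ms : measurable_fun (boundary Om : set surT) (singular_term g t eta : surT -> \bar R).
  apply: (emeasurable_fun_cvg (fun j => EFin \o (F j : surT -> R)) _ mF).
  by move=> x _; exact: cvg_singular_spos.
pose K := `|dform phi phi / 2 + iB lam| + `|EL Om lam f G t phi|.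
have bF j : iB (F j) <= K.
  have := hEL Cphi (sj_gt0 j); rewrite FE (iBZ _ (iF j)) mulN1r -lerBlDr opprK.
  rewrite -lerBrDl => /le_trans; apply; rewrite /K; apply: lerD; last first.
    by rewrite -normrN ler_norm.
  apply: (le_trans (ler_norm _)); rewrite normrM (gtr0_norm (sj_gt0 j)).
  by rewrite ler_piMl ?sj_le1.
apply/integrableP; split => //.
have -> : (\int[sur]_(x in (boundary Om : set surT)) `|singular_term g t eta x| =
   \int[sur]_(x in (boundary Om : set surT)) singular_term g t eta x)%E.
  by apply: eq_integral => x _; rewrite gee0_abs ?singular_ge0.
apply: (@le_lt_trans _ _ K%:E); last exact: ltry.
apply: (@fatou_bound _ surT R sur (boundary Om) mB (fun j => EFin \o (F j : surT -> R))).
- exact: mF.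
- by move=> k x _; rewrite lee_fin mulr_ge0// powR_ge0.
- exact: ms.
- by apply: aeW => x _; exact: cvg_singular_spos.
- move=> j; have := EFin_Rintegral mB (iF j) => ->; rewrite lee_fin; exact: bF.
Qed.

(** Real-valued version of the singular term. The real power gives 0 where t = 0 and eta > 0, which
    is harmless: by integrability [g] vanishes almost everywhere there. *)
Definition sing x : R := g x * t x `^ (- eta).

Lemma singular_sing : {ae sur, forall x : surT, boundary Om x ->
  singular_term g t eta x = (sing x)%:E /\ (t x `^ eta = 0 -> g x = 0)}.
Proof.
apply: (@ae_imp _ surT R sur _ _ _ (integrable_ae mB singular_integrable)) => x h bx.
have := h bx; rewrite /singular_term inver; case: ifPn => [/eqP te|te] hf.
  have gx : g x = 0.
    apply: contraTeq hf => gx; have gp : 0 < g x by rewrite lt_neqAle eq_sym gx g0.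
    by rewrite gt0_muley ?lte_fin.
  by rewrite /sing gx mul0e mul0r.
by split; [rewrite /sing powRN EFinM|move=> te0; rewrite te0 eqxx in te].
Qed.

Lemma intB_sing : intB sing.
Proof.
apply: (le_integrable_ae mB _ singular_integrable).
  apply/measurable_EFinP; apply: measurable_funM; first exact: measurable_g.
  exact: (measurableT_comp (@measurable_powR R (- eta)) tL.1).
apply: (@ae_imp _ surT R sur _ _ _ singular_sing) => x h bx; have [-> _] := h bx.
by rewrite /= ger0_norm// mulr_ge0// powR_ge0.
Qed.

(** The limit s -> 0 for a general direction. Integrability of the singular term, already obtained
    from phi = -1, now provides the majorant. *)
Lemma EL_le phi : Ck 1 phi -> EL Om lam f G t phi <= iB (fun x => sing x * phi x).
Proof.
move=> Cphi; have [M M0 hM] := continuous_bounded_on bOm (C1_continuous Cphi).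
(* T_s(t - s phi) is at least t - s M and at least s / (M + 1), hence t <= K1 T_s(t - s phi), and
   T_s^(-eta) <= K1^eta t^(-eta). *)
pose K1 := 1 + M * (M + 1); have K10 : 0 <= K1 by rewrite addr_ge0// mulr_ge0// addr_ge0.
have mphi : measurable_fun (boundary Om : set surT) (phi : surT -> R).
  by apply: measurable_funTS; apply: measurable_cont_sur; exact: C1_continuous.
have [_ _ cB] : [/\ forall j, intB (fun x => g x * (phi x * spos (sj j) (t x - sj j * phi x) `^ (- eta))),
    intB (fun x => sing x * phi x) &
    iB (fun x => g x * (phi x * spos (sj j) (t x - sj j * phi x) `^ (- eta))) @[j --> \oo] -->
    iB (fun x => sing x * phi x)].
  apply: (@dct _ surT R sur (boundary Om) mB _ _ (fun x => M * K1 `^ eta * sing x)).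
  - move=> j; apply: measurable_funM; first exact: measurable_g.
    by apply: measurable_spos_pow => //; [exact: sj_gt0|exact: tL.1].
  - apply: measurable_funM => //; apply/measurable_EFinP; exact: measurable_int intB_sing.
  - exact: intBZ intB_sing.
  apply: (@ae_imp _ surT R sur _ _ _ singular_sing) => x h bx; have [e1 e2] := h bx; split.
    have := cvg_singular_spos (x := x) (phi x); rewrite e1 => /fine_cvg /= c.
    under eq_fun do rewrite mulrCA; rewrite [sing x * _]mulrC.
    exact: cvgMl_tmp.
  move=> j; have [te|te] := eqVneq (t x `^ eta) 0.
    by rewrite /sing (e2 te) !mul0r normr0 mulr0.
  have s0 := sj_gt0 j.
  have v0 := spos_gt0 (t x - sj j * phi x) s0.
  have low := @spos_boundary_lower _ _ Om phi M (sj j) x (t x) s0 hM bx (t0 x).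
  have hv : t x <= K1 * spos (sj j) (t x - sj j * phi x).
    have M1 : 0 < M + 1 by rewrite ltr_wpDl.
    rewrite /K1 mulrDl mul1r -lerBlDr; apply: le_trans (spos_ge _ s0).
    rewrite lerD2l lerN2; apply: (@le_trans _ _ (sj j * M)).
      rewrite ler_wpM2l ?(ltW s0)//; apply: le_trans (ler_norm _) (hM _ _).
      exact: boundary_closure.
    rewrite mulrC -mulrA ler_wpM2l//.
    by rewrite mulrC -ler_pdivrMr.
  have := powRN_le_scale eta0 (t0 x) v0 K10 hv te => hp.
  rewrite normrM (ger0_norm (g0 x)) /sing mulrCA; apply: ler_wpM2l => //.
  rewrite normrM -mulrA (ger0_norm (powR_ge0 _ _)); apply: ler_pM => //.
    exact: powR_ge0.
  by apply: hM; exact: boundary_closure.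
have cR : sj j * (dform phi phi / 2 + iB lam) +
   iB (fun x => g x * (phi x * spos (sj j) (t x - sj j * phi x) `^ (- eta))) @[j --> \oo] -->
   iB (fun x => sing x * phi x).
  rewrite -[X in _ --> X]add0r; apply: (@cvgD _ R^o) => //.
  by rewrite -(mul0r (dform phi phi / 2 + iB lam)); apply: cvgMr_tmp; exact: sj_cvg.
have cL : EL Om lam f G t phi @[j --> \oo] --> EL Om lam f G t phi by exact: cvg_cst.
by apply: (ler_cvg_to cL cR); apply: nearW => j; apply: hEL => //; exact: sj_gt0.
Qed.

Lemma L2_lam_mul phi : continuous phi -> intB (fun x => lam x * (t x * phi x)).
Proof.
move=> cp; have lphi : L2 sur (boundary Om : set surT) (fun x : surT => lam x * phi x).
  apply: (L2_mulb mB (c := Lam) (L2_contB oOm bOm hC1 cp)); first exact: measurable_funTS.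
  by move=> x _; rewrite ger0_norm.
have := L2_mul mB tL lphi; congr intB; apply/funext => x; ring.
Qed.

Lemma EL_opp phi : Ck 1 phi -> EL Om lam f G t (fun x => -1 * phi x) = - EL Om lam f G t phi.
Proof.
move=> Cphi; have cp := C1_continuous Cphi; have Pp := (C1Z (-1) Cphi).2.
have E1 : \sum_i iO (fun x => G i x * partial i (fun x => -1 * phi x) x) =
    - \sum_i iO (fun x => G i x * partial i phi x).
  rewrite -sumrN; apply: eq_bigr => i _.
  have h : intO (fun x => G i x * partial i phi x).
    apply: (L2_mul mO (GL i)); apply: (L2_contO oOm bOm); exact: C1_continuous_partial.
  by rewrite -[RHS]mulN1r -(iOZ oOm _ h) Pp; congr iO; apply/funext => x; ring.
have E2 : iB (fun x => lam x * (t x * (-1 * phi x))) = - iB (fun x => lam x * (t x * phi x)).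
  by rewrite -[RHS]mulN1r -(iBZ _ (L2_lam_mul cp)); congr iB; apply/funext => x; ring.
have E3 : iO (fun x => f x * (-1 * phi x)) = - iO (fun x => f x * phi x).
  rewrite -[RHS]mulN1r -(iOZ oOm _ (intO_mul oOm bOm if_ cp)); congr iO; apply/funext => x; ring.
exact: (opp_sum3 E1 E2 E3).
Qed.

Lemma EL_eq phi : Ck 1 phi -> EL Om lam f G t phi = iB (fun x => sing x * phi x).
Proof.
move=> Cphi; apply: le_anti; rewrite EL_le//= -lerN2 -EL_opp//.
apply: (le_trans (EL_le (C1Z (-1) Cphi).1)); rewrite -[leRHS]mulN1r.
rewrite -(iBZ _ (intB_mul bOm intB_sing (C1_continuous Cphi))) le_eqVlt; apply/orP; left; apply/eqP.
by congr iB; apply/funext => x; ring.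
Qed.

End Euler.

(** * Test functions in H^1 *)

Section Truncation.
Context (R : realType).
Implicit Types c x : R.

(** A smooth truncation: bounded by 1/c and by |x|, with derivative bounded by 1, and tending to x
    as c -> 0. It maps C^1 functions to C^1 functions. *)
Definition trunc c x : R := x / (1 + (c * x) ^+ 2).
Definition dtrunc c x : R := (1 - (c * x) ^+ 2) / (1 + (c * x) ^+ 2) ^+ 2.

Lemma trunc_den c x : 0 < 1 + (c * x) ^+ 2. Proof. by rewrite ltr_wpDr ?sqr_ge0. Qed.
Lemma trunc_den_ge1 c x : 1 <= 1 + (c * x) ^+ 2. Proof. by rewrite lerDl sqr_ge0. Qed.

Lemma is_derive_trunc c (x : R) : is_derive x 1 (trunc c) (dtrunc c x).
Proof.
have q0 := trunc_den c x; have qN : 1 + (c * x) ^+ 2 != 0 by rewrite gt_eqF.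
have d1 : is_derive x 1 (fun y : R => 1 + (c * y) ^+ 2) (2 * c ^+ 2 * x).
  by apply: is_derive_eq; rewrite /GRing.scale/=; ring.
have d2 := @is_deriveV R (fun y : R => 1 + (c * y) ^+ 2) x _ 1 qN d1.
have d3 : is_derive x 1 (fun y : R => y) 1 by exact: is_derive_id.
have d4 := is_deriveM d3 d2.
rewrite /trunc; apply: is_derive_eq; rewrite /GRing.scale/= /dtrunc -exprVn.
by field.
Qed.

Lemma continuous_dtrunc c : continuous (dtrunc c).
Proof.
move=> x; have cs : {for x, continuous (fun y : R => (c * y) ^+ 2)}.
  rewrite (_ : (fun y : R => (c * y) ^+ 2) = fun y => (c * y) * (c * y)); last by apply/funext.
  have cm : (fun y : R => c * y) y @[y --> x] --> c * x by apply: cvgMl_tmp; exact: cvg_id.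
  exact: (@cvgM R R^o).
apply: (@cvgM R R^o).
  by apply: (@cvgB _ R^o) => //; exact: cvg_cst.
apply: (@cvgV R R^o); first by rewrite gt_eqF// exprn_gt0// trunc_den.
have cd : (fun y : R => 1 + (c * y) ^+ 2) y @[y --> x] --> 1 + (c * x) ^+ 2.
  by apply: (@cvgD _ R^o) => //; exact: cvg_cst.
exact: (@cvgM R R^o).
Qed.

Lemma trunc_le c x : `|trunc c x| <= `|x|.
Proof.
rewrite normrM normfV (gtr0_norm (trunc_den c x)) ler_pdivrMr ?trunc_den//.
by rewrite ler_peMr// trunc_den_ge1.
Qed.

Lemma trunc_bound c x : 0 < c -> `|trunc c x| <= c^-1.
Proof.
move=> c0; rewrite normrM normfV (gtr0_norm (trunc_den c x)) ler_pdivrMr ?trunc_den//.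
rewrite ler_pdivlMl//.
have -> : (c * x) ^+ 2 = (c * `|x|) ^+ 2 by rewrite !exprMn real_normK ?num_real.
move: (c * _) => y; have h : 0 <= (y - 2^-1) ^+ 2 by exact: sqr_ge0.
rewrite -subr_ge0; have -> : 1 + y ^+ 2 - y = (y - 2^-1) ^+ 2 + 3 / 4 by field.
by rewrite addr_ge0.
Qed.

Lemma dtrunc_le1 c x : `|dtrunc c x| <= 1.
Proof.
have q0 := trunc_den c x; have h2 : 0 < (1 + (c * x) ^+ 2) ^+ 2 by rewrite exprn_gt0.
rewrite normrM normfV (gtr0_norm h2) ler_pdivrMr ?exprn_gt0// mul1r.
apply: (@le_trans _ _ (1 + (c * x) ^+ 2)).
  by apply: (le_trans (ler_normB _ _)); rewrite normr1 ger0_norm ?sqr_ge0.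
by rewrite expr2 ler_peMr ?(ltW q0)// trunc_den_ge1.
Qed.

Lemma cvg_den (c : nat -> R) x : c j @[j --> \oo] --> 0 -> 1 + (c j * x) ^+ 2 @[j --> \oo] --> (1 : R).
Proof.
move=> c0; rewrite -[X in _ --> X](addr0 1); apply: (@cvgD _ R^o); first exact: cvg_cst.
have cm : c j * x @[j --> \oo] --> 0 * x by exact: cvgMr_tmp.
rewrite -[X in _ --> X](mul0r (0 * x)) -{1}(mul0r x).
rewrite (_ : (fun j => (c j * x) ^+ 2) = (fun j => (c j * x) * (c j * x))); last by apply/funext.
exact: cvgM.
Qed.

Lemma cvg_trunc (c : nat -> R) x : c j @[j --> \oo] --> 0 -> trunc (c j) x @[j --> \oo] --> x.
Proof.
move=> c0; rewrite -[X in _ --> X](mulr1 x) -[X in x * X](invr1 R); apply: cvgMl_tmp.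
by apply: cvgV; [exact: oner_neq0|exact: cvg_den].
Qed.

Lemma cvg_dtrunc (c : nat -> R) x : c j @[j --> \oo] --> 0 -> dtrunc (c j) x @[j --> \oo] --> (1 : R).
Proof.
move=> c0; have cd : 1 + (c j * x) ^+ 2 @[j --> \oo] --> (1 : R) by exact: cvg_den.
have cd2 : (1 + (c j * x) ^+ 2) ^+ 2 @[j --> \oo] --> (1 : R).
  rewrite -[X in _ --> X](mulr1 1).
  rewrite (_ : (fun j => _) = (fun j => (1 + (c j * x) ^+ 2) * (1 + (c j * x) ^+ 2))); last by apply/funext.
  exact: cvgM.
have cn : 1 - (c j * x) ^+ 2 @[j --> \oo] --> (1 : R).
  rewrite (_ : (fun j => _) = (fun j => 2 - (1 + (c j * x) ^+ 2))); last by apply/funext => j; ring.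
  have c3 : 2 - (1 + (c j * x) ^+ 2) @[j --> \oo] --> (2 - 1 : R).
    by apply: (@cvgB _ R^o) => //; exact: cvg_cst.
  by rewrite (_ : 2 - 1 = 1 :> R) in c3; [exact: c3|ring].
rewrite -[X in _ --> X](mulr1 1) -[X in _ * X](invr1 R); apply: cvgM => //.
by apply: cvgV => //; exact: oner_neq0.
Qed.

End Truncation.

Section WeightedConvergence.
Context d (T : measurableType d) (R : realType) (m : {measure set T -> \bar R}).
Variable (D : set T).
Hypothesis mD : measurable D.

Lemma dct_weight (a : T -> R) (b_ : nat -> T -> R) (b h : T -> R) :
  measurable_fun D a -> (forall k, measurable_fun D (b_ k)) -> measurable_fun D b ->
  m.-integrable D (EFin \o (fun x => a x * h x)) ->
  {ae m, forall x, D x -> b_ k x @[k --> \oo] --> b x /\ forall k, `|b_ k x| <= h x} ->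
  m.-integrable D (EFin \o (fun x => a x * b x)) /\
  \int[m]_(x in D) (a x * b_ k x) @[k --> \oo] --> \int[m]_(x in D) (a x * b x).
Proof.
move=> ma mb_ mb ih ae.
have [||||_ h2 h3] := @dct _ T R m D mD (fun k x => a x * b_ k x) (fun x => a x * b x) (fun x => `|a x * h x|).
- by move=> k; apply: measurable_funM.
- exact: measurable_funM.
- exact: integrable_norm ih.
- apply: (@ae_imp _ T R m _ _ _ ae) => x H Dx; have [h1 h2] := H Dx; split.
    exact: cvgMl_tmp.
  move=> k; rewrite !normrM ler_wpM2l//; exact: le_trans (h2 k) (ler_norm _).
- by [].
Qed.

Lemma Lp_infty_bounded (f : T -> R) : Lp m D +oo%E f ->
  measurable_fun D f /\ exists2 c : R, 0 <= c & {ae m, forall x, D x -> `|f x| <= c}.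
Proof.
move=> /andP[]; rewrite /mfun inE /= => mf; rewrite /finLfun inE /= /finite_norm => fi.
split; first by apply/(measurable_restrictT _ mD).
move: fi; rewrite unlock; case: ifPn => [_|h _].
  have -> : abse \o (EFin \o f \_ D) = EFin \o (Num.norm \o f \_ D) by apply/funext.
  move=> /ess_sup_inf.ess_supr_bounded[c hc]; exists (Num.max c 0); first by rewrite le_max lexx orbT.
  apply: (@ae_imp _ T R m _ _ _ hc) => x /=; rewrite patchE => + Dx.
  by rewrite mem_set// le_max => ->.
(* If the whole space has measure zero the norm is 0 by convention, and any bound holds almost
   everywhere. *)
have m0 : m setT = 0%E by apply/eqP; rewrite eq_le measure_ge0 andbT leNgt.
by exists 0 => //; exists setT; split.
Qed.

End WeightedConvergence.

Lemma sum3_move (R : ringType) (s s' b b' f q : R) :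
  s = s' -> b = b' -> s + b - f = q -> s' + b' = f + q.
Proof. by move=> -> -> <-; rewrite [f + _]addrC subrK. Qed.

Lemma cvg_eq_unique (R : realType) (a b : nat -> R) (x y : R) : (forall k, a k = b k) ->
  a k @[k --> \oo] --> x -> b k @[k --> \oo] --> y -> x = y.
Proof. by move=> /funext-> ca cb; exact: (@cvg_unique R^o (@norm_hausdorff _ R^o) _ _ _ _ ca cb). Qed.

Section Extension.
Context (R : realType) (n : nat).
Local Notation N := n.+1.
Local Notation lebT := (caratheodory_type (@lebesgue_outer R N)).
Local Notation surT := (caratheodory_type (@hausdorff_outer R N.-1 N)).
Local Notation sur := (surface R N).
Local Notation mu := (lebesgue_rV R N).
Implicit Types (w v phi : 'rV[R]_N -> R).
Variables (Om : set 'rV[R]_N) (lam : 'rV[R]_N -> R) (Lam : R).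
Hypotheses (oOm : open Om) (bOm : bounded_set Om) (hC1 : C1_boundary Om)
  (mlam : measurable_fun setT (lam : surT -> R))
  (lam0 : forall x, 0 <= lam x) (lamL : forall x, lam x <= Lam).
Variables (f q t : 'rV[R]_N -> R) (G : 'I_N -> 'rV[R]_N -> R).
Hypotheses (if_ : intO Om f) (f0 : forall x, 0 <= f x)
  (Hf : exists M : R, forall w, Ck 1 w ->
     iO Om (fun x => f x * `|w x|) <= M * Num.sqrt (1 + energyR Om w))
  (iq : intB Om q)
  (GL : forall i, L2 mu (Om : set lebT) (G i : lebT -> R))
  (tL : L2 sur (boundary Om : set surT) (t : surT -> R))
  (hEL : forall phi, Ck 1 phi -> EL Om lam f G t phi = iB Om (fun x => q x * phi x)).
Local Notation iO := (iO Om).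
Local Notation iB := (iB Om).
Local Notation intO := (intO Om).
Local Notation intB := (intB Om).
Local Notation mO := (mO oOm).
Local Notation mB := (mB Om).

(** One choice of indices for function, gradient and trace, at the speed 8^(-k) required by
    [fast_limit]. *)
Lemma fast_subsequence phi (D : 'rV[R]_N -> 'rV[R]_N) tphi (w : nat -> 'rV[R]_N -> R) :
  Lp_dist (mu : {measure set lebT -> \bar R}) Om 2%:E (w k) phi @[k --> \oo] --> 0%E ->
  (forall i, Lp_dist (mu : {measure set lebT -> \bar R}) Om 2%:E (partial i (w k)) (fun x => D x 0 i) @[k --> \oo] --> 0%E) ->
  Lp_dist (sur : {measure set surT -> \bar R}) (boundary Om) 2%:E (w k) tphi @[k --> \oo] --> 0%E ->
  exists j : nat -> nat, forall k,
    [/\ (\int[mu]_(x in (Om : set lebT)) ((w (j k) x - phi x) ^+ 2)%:E <= (8^-1 ^+ k)%:E)%E,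
      forall i, (\int[mu]_(x in (Om : set lebT)) ((partial i (w (j k)) x - D x 0 i) ^+ 2)%:E <= (8^-1 ^+ k)%:E)%E &
      (\int[sur]_(x in (boundary Om : set surT)) ((w (j k) x - tphi x) ^+ 2)%:E <= (8^-1 ^+ k)%:E)%E].
Proof.
move=> /(cvg_Lp_dist mu Om w phi) c1 c2 /(cvg_Lp_dist sur (boundary Om) w tphi) c3.
have {}c2 i := (cvg_Lp_dist mu Om _ _).1 (c2 i).
have s0 d (T : measurableType d) (m : {measure set T -> \bar R}) (D0 : set T) (v : T -> R) :
    (0 <= \int[m]_(x in D0) (v x ^+ 2)%:E)%E by apply: integral_ge0 => x _; rewrite lee_fin sqr_ge0.
move/(cvge0P (fun k => s0 _ _ _ _ _)): c1 => c1.
have {}c2 i := (cvge0P (fun k => s0 _ _ _ _ _)).1 (c2 i).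
move/(cvge0P (fun k => s0 _ _ _ _ _)): c3 => c3.
suff /choice[j hj] : forall k, exists j, 
    [/\ (\int[mu]_(x in (Om : set lebT)) ((w j x - phi x) ^+ 2)%:E <= (8^-1 ^+ k)%:E)%E,
      forall i, (\int[mu]_(x in (Om : set lebT)) ((partial i (w j) x - D x 0 i) ^+ 2)%:E <= (8^-1 ^+ k)%:E)%E &
      (\int[sur]_(x in (boundary Om : set surT)) ((w j x - tphi x) ^+ 2)%:E <= (8^-1 ^+ k)%:E)%E] by exists j.
move=> k; have e0 : 0 < (8^-1 : R) ^+ k by rewrite exprn_gt0// invr_gt0.
have a1 := c1 _ e0; have a3 := c3 _ e0.
have a2 : \forall j \near \oo, forall i, (\int[mu]_(x in (Om : set lebT)) ((partial i (w j) x - D x 0 i) ^+ 2)%:E <= (8^-1 ^+ k)%:E)%E.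
  by apply: filter_forall => i; exact: c2.
have [m1 _ b1] := a1; have [m2 _ b2] := a2; have [m3 _ b3] := a3.
exists (maxn m1 (maxn m2 m3)); split; [apply: b1|apply: b2|apply: b3].
- exact: leq_maxl.
- exact: leq_trans (leq_maxl _ _) (leq_maxr _ _).
- exact: leq_trans (leq_maxr _ _) (leq_maxr _ _).
Qed.

(** The C^1 approximants of [phi] need not have uniformly bounded traces, while [q] is only
    integrable. The equation is therefore first tested with their truncations at a fixed parameter b
    and the approximation is removed; then b -> 0, with the essential bound c of [tphi] as majorant
    on the boundary. *)
Lemma extension phi Dphi tphi : H1_grad Om phi Dphi -> is_trace Om phi tphi ->
  Lp (sur : {measure set surT -> \bar R}) (boundary Om) +oo%E tphi ->
  [/\ forall i, intO (fun x => G i x * Dphi x 0 i), intB (fun x => lam x * t x * tphi x),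
    intO (fun x => f x * phi x), intB (fun x => q x * tphi x) &
    \sum_i iO (fun x => G i x * Dphi x 0 i) + iB (fun x => lam x * t x * tphi x) =
    iO (fun x => f x * phi x) + iB (fun x => q x * tphi x)].
Proof.
move=> Hphi [Lt [G' [w [HG' Hw cw cp ct]]]] /(Lp_infty_bounded mB)[mtphi [c c0 hc]].
have [j hj] := fast_subsequence cw cp ct.
pose v k := w (j k); have Cv k : Ck 1 (v k) by case: (Hw (j k)).
have phiL : L2 mu (Om : set lebT) (phi : lebT -> R) by apply/(Lp2E mu mO); case: HG'.
have GL' i : L2 mu (Om : set lebT) ((fun x => G' x 0 i) : lebT -> R).
  by apply/(Lp2E mu mO); case: HG' => _ + _; exact.
have DL i : L2 mu (Om : set lebT) ((fun x => Dphi x 0 i) : lebT -> R).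
  by apply/(Lp2E mu mO); case: Hphi => _ + _; exact.
have tphiL : L2 sur (boundary Om : set surT) (tphi : surT -> R) by apply/(Lp2E sur mB).
have mvO k : measurable_fun (Om : set lebT) (v k : lebT -> R).
  by apply: measurable_funTS; apply: measurable_cont; exact: C1_continuous.
have mvB k : measurable_fun (boundary Om : set surT) (v k : surT -> R).
  by apply: measurable_funTS; apply: measurable_cont_sur; exact: C1_continuous.
have mpO i k : measurable_fun (Om : set lebT) (partial i (v k) : lebT -> R).
  by apply: measurable_funTS; apply: measurable_cont; exact: C1_continuous_partial.
have [hp hpL hpae] := fast_limit mO mvO phiL (fun k => let: And3 h _ _ := hj k in h).
have [ht htL htae] := fast_limit mB mvB tphiL (fun k => let: And3 _ _ h := hj k in h).
have hGex i : exists h : lebT -> R, L2 mu (Om : set lebT) h /\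
    {ae mu, forall x : lebT, Om x -> partial i (v k) x @[k --> \oo] --> G' x 0 i /\
      forall k, `|partial i (v k) x| <= h x}.
  have [h h1 h2] := fast_limit mO (mpO i) (GL' i) (fun k => let: And3 _ h _ := hj k in h i).
  by exists h.
have [hG hGP] := choice hGex.
have mf : measurable_fun (Om : set lebT) (f : lebT -> R).
  by apply/measurable_EFinP; exact: measurable_int if_.
have mq : measurable_fun (boundary Om : set surT) (q : surT -> R).
  by apply/measurable_EFinP; exact: measurable_int iq.
have mlB : measurable_fun (boundary Om : set surT) (lam : surT -> R) by exact: measurable_funTS.
have mlt : measurable_fun (boundary Om : set surT) (fun x : surT => lam x * t x).
  by apply: measurable_funM; [exact: mlB|exact: tL.1].
have ltL : L2 sur (boundary Om : set surT) (fun x : surT => lam x * t x).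
  by apply: (L2_mulb mB (c := Lam) tL mlB) => x _; rewrite ger0_norm.
have mtr (d : measure_display) (T : measurableType d) (D : set T) (b : R) (u : T -> R) :
    measurable_fun D u -> measurable_fun D (fun x => trunc b (u x)).
  move=> mu'; apply: (measurableT_comp (f := trunc b)) mu'.
  apply: continuous_measurable_fun => y; exact: (is_derive_continuous (is_derive_trunc b)).
have mdtr (d : measure_display) (T : measurableType d) (D : set T) (b : R) (u : T -> R) :
    measurable_fun D u -> measurable_fun D (fun x => dtrunc b (u x)).
  move=> mu'; apply: (measurableT_comp (f := dtrunc b)) mu'.
  by apply: continuous_measurable_fun; exact: continuous_dtrunc.
have ctr b (u : nat -> R) l : u k @[k --> \oo] --> l -> trunc b (u k) @[k --> \oo] --> trunc b l.
  by move=> h; apply: continuous_cvg => //; exact: (is_derive_continuous (is_derive_trunc b)).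
have cdtr b (u : nat -> R) l : u k @[k --> \oo] --> l -> dtrunc b (u k) @[k --> \oo] --> dtrunc b l.
  by move=> h; apply: continuous_cvg => //; exact: continuous_dtrunc.
(* Fatou's lemma along the approximants, whose energies are bounded by the integral of the majorants
   [P]; the bound [Hf] for C^1 functions thus passes to [phi]. *)
have ifphi : intO (fun x => f x * `|phi x|).
  have mfa (u : lebT -> R) : measurable_fun (Om : set lebT) u ->
      measurable_fun (Om : set lebT) (EFin \o (fun x : lebT => f x * `|u x|)).
    move=> mu'; apply/measurable_EFinP; apply: measurable_funM; first exact: mf.
    by apply: (measurableT_comp (@normr_measurable R setT)); exact: mu'.
  have [M HM] := Hf.
  pose P x := \sum_i hG i x ^+ 2 + hp x ^+ 2.
  have iP : intO P.
    have i1 := integrable_sum mO (index_enum 'I_N) (P := predT) (fun i _ => L2_sqr (hGP i).1).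
    have i2 := integrableD mO i1 (L2_sqr hpL).
    by move: i2; congr (mu.-integrable _ _); apply/funext => x /=; rewrite sumEFin.
  have Ek k : energyR Om (v k) <= iO P.
    rewrite -lee_fin -(energyE oOm bOm (Cv k)) -(EFin_iO oOm iP).
    apply: ae_ge0_le_integral; first exact: mO.
    - by move=> x _; rewrite lee_fin addr_ge0 ?gsq_ge0 ?sqr_ge0.
    - apply/measurable_EFinP; apply: measurable_funTS; apply: measurable_cont.
      by apply: contD; [exact: continuous_gsq|exact: cont_sqr].
    - by move=> x _; rewrite lee_fin addr_ge0 ?sqr_ge0// sumr_ge0// => i _; exact: sqr_ge0.
    - exact: measurable_int iP.
    have hall : {ae mu, forall x : lebT, forall i, Om x -> partial i (v k) x @[k --> \oo] --> G' x 0 i /\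
      forall k, `|partial i (v k) x| <= hG i x}.
      by apply: filter_forall => i; case: (hGP i).
    have sq (a b : R) : `|a| <= b -> a ^+ 2 <= b ^+ 2.
      move=> ab; rewrite -(real_normK (num_real a)) ler_sqr ?nnegrE//; exact: le_trans ab.
    apply: (@ae_imp2 _ lebT R mu _ _ _ _ hpae hall) => x h1 h2 Ox; rewrite lee_fin; apply: lerD.
      by apply: ler_sum => i _; apply: sq; case: (h2 i Ox) => _; apply.
    by apply: sq; case: (h1 Ox) => _; apply.
  pose K : R := `|M| * Num.sqrt (1 + iO P).
  apply/integrableP; split; first exact: mfa phiL.1.
  have -> : (\int[mu]_(x in (Om : set lebT)) `|(EFin \o (fun x : lebT => (f x * `|phi x|)%R)) x| =
    \int[mu]_(x in (Om : set lebT)) (f x * `|phi x|)%:E)%E.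
    by apply: eq_integral => x _; rewrite gee0_abs// lee_fin mulr_ge0.
  apply: (@le_lt_trans _ _ K%:E); last exact: ltry.
  apply: (@fatou_bound _ lebT R mu Om mO (fun k x => (f x * `|v k x|)%:E)).
  - by move=> k; exact: mfa (mvO k).
  - by move=> k x _; rewrite lee_fin mulr_ge0.
  - exact: mfa phiL.1.
  - apply: (@ae_imp _ lebT R mu _ _ _ hpae) => x h Ox; have [h1 _] := h Ox.
    apply: cvg_EFin; first exact: nearW.
    by apply: cvgMl_tmp; exact: (@cvg_norm _ R^o).
  - move=> k; have ifv : intO (fun x => f x * `|v k x|).
      apply: (intO_mul oOm bOm if_) => x.
      by apply: continuous_comp; [exact: C1_continuous|exact: norm_continuous].
    have := EFin_Rintegral mO ifv => ->; rewrite lee_fin; apply: (le_trans (HM _ (Cv k))).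
    apply: (@le_trans _ _ (`|M| * Num.sqrt (1 + energyR Om (v k)))).
      by rewrite ler_wpM2r ?sqrtr_ge0// ler_norm.
    by rewrite ler_wpM2l// ler_wsqrtr// lerD2l.
have step (b : R) : 0 < b ->
    \sum_i iO (fun x => G i x * (dtrunc b (phi x) * G' x 0 i)) + iB (fun x => lam x * t x * trunc b (tphi x)) =
    iO (fun x => f x * trunc b (phi x)) + iB (fun x => q x * trunc b (tphi x)).
  move=> b0.
  have c1 i : iO (fun x => G i x * (dtrunc b (v k x) * partial i (v k) x)) @[k --> \oo] -->
      iO (fun x => G i x * (dtrunc b (phi x) * G' x 0 i)).
    have [h1 h2] := hGP i.
    apply: (proj2 (@dct_weight _ lebT R mu Om mO (G i) (fun k x => dtrunc b (v k x) * partial i (v k) x)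
      (fun x => dtrunc b (phi x) * G' x 0 i) (hG i) (GL i).1 _ _ _ _)).
    - by move=> k; apply: measurable_funM; [apply: mdtr; exact: mvO|exact: mpO].
    - by apply: measurable_funM; [apply: mdtr; exact: phiL.1|exact: (GL' i).1].
    - exact: (L2_mul mO (GL i) h1).
    - apply: (@ae_imp2 _ lebT R mu _ _ _ _ hpae h2) => x a1 a2 Ox.
      have [e1 e2] := a1 Ox; have [e3 e4] := a2 Ox; split.
        by apply: cvgM => //; exact: cdtr.
      by move=> k; rewrite normrM -[leRHS]mul1r ler_pM// dtrunc_le1.
  have c2 : iB (fun x => lam x * t x * trunc b (v k x)) @[k --> \oo] -->
      iB (fun x => lam x * t x * trunc b (tphi x)).
    apply: (proj2 (@dct_weight _ surT R sur (boundary Om) mB (fun x => lam x * t x) (fun k x => trunc b (v k x))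
      (fun x => trunc b (tphi x)) ht mlt _ _ _ _)).
    - by move=> k; apply: mtr; exact: mvB.
    - by apply: mtr; exact: mtphi.
    - exact: (L2_mul mB ltL htL).
    - apply: (@ae_imp _ surT R sur _ _ _ htae) => x a1 bx; have [e1 e2] := a1 bx; split; first exact: ctr.
      by move=> k; exact: le_trans (trunc_le _ _) (e2 k).
  have c3 : iO (fun x => f x * trunc b (v k x)) @[k --> \oo] --> iO (fun x => f x * trunc b (phi x)).
    apply: (proj2 (@dct_weight _ lebT R mu Om mO f (fun k x => trunc b (v k x))
      (fun x => trunc b (phi x)) (cst b^-1) mf _ _ _ _)).
    - by move=> k; apply: mtr; exact: mvO.
    - by apply: mtr; exact: phiL.1.
    - by apply: (intO_mul oOm bOm if_); exact: cst_continuous.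
    - apply: (@ae_imp _ lebT R mu _ _ _ hpae) => x a1 Ox; have [e1 e2] := a1 Ox; split; first exact: ctr.
      by move=> k; exact: trunc_bound.
  have c4 : iB (fun x => q x * trunc b (v k x)) @[k --> \oo] --> iB (fun x => q x * trunc b (tphi x)).
    apply: (proj2 (@dct_weight _ surT R sur (boundary Om) mB q (fun k x => trunc b (v k x))
      (fun x => trunc b (tphi x)) (cst b^-1) mq _ _ _ _)).
    - by move=> k; apply: mtr; exact: mvB.
    - by apply: mtr; exact: mtphi.
    - by apply: (intB_mul bOm iq); exact: cst_continuous.
    - apply: (@ae_imp _ surT R sur _ _ _ htae) => x a1 bx; have [e1 e2] := a1 bx; split; first exact: ctr.
      by move=> k; exact: trunc_bound.
  have E k : \sum_i iO (fun x => G i x * (dtrunc b (v k x) * partial i (v k) x)) +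
      iB (fun x => lam x * t x * trunc b (v k x)) =
      iO (fun x => f x * trunc b (v k x)) + iB (fun x => q x * trunc b (v k x)).
    have [CT PT] := C1_comp (Cv k) (is_derive_trunc b) (@continuous_dtrunc R b).
    have E1 : \sum_i iO (fun x => G i x * partial i (fun x => trunc b (v k x)) x) =
       \sum_i iO (fun x => G i x * (dtrunc b (v k x) * partial i (v k) x)).
      by apply: eq_bigr => i _; rewrite PT.
    have E2 : iB (fun x => lam x * (t x * trunc b (v k x))) = iB (fun x => lam x * t x * trunc b (v k x)).
      by congr iB; apply/funext => x; rewrite mulrA.
    exact: (sum3_move E1 E2 (hEL CT)).
  apply: (cvg_eq_unique E).
    by apply: (@cvgD _ R^o) => //; exact: cvg_fsum.
  exact: (@cvgD _ R^o).
have sj0 := @sj_gt0 R; have sjc := @sj_cvg R.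
(* The approximants converge to the gradient G' attached to the trace, which agrees almost
   everywhere with [Dphi]. *)
have HGD i := weak_gradient_unique oOm bOm HG' Hphi i.
have H1 i := @dct_weight _ lebT R mu Om mO (G i) (fun k x => dtrunc (sj R k) (phi x) * G' x 0 i)
      (fun x => Dphi x 0 i) (fun x => `|G' x 0 i|) (GL i).1.
have H2 := @dct_weight _ surT R sur (boundary Om) mB (fun x => lam x * t x) (fun k x => trunc (sj R k) (tphi x))
      tphi (fun x => `|tphi x|) mlt.
have H3 := @dct_weight _ lebT R mu Om mO f (fun k x => trunc (sj R k) (phi x))
      phi (fun x => `|phi x|) mf.
have H4 := @dct_weight _ surT R sur (boundary Om) mB q (fun k x => trunc (sj R k) (tphi x))
      tphi (cst c) mq.
have {}H1 i : intO (fun x => G i x * Dphi x 0 i) /\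
    iO (fun x => G i x * (dtrunc (sj R k) (phi x) * G' x 0 i)) @[k --> \oo] --> iO (fun x => G i x * Dphi x 0 i).
  apply: H1.
  - by move=> k; apply: measurable_funM; [apply: mdtr; exact: phiL.1|exact: (GL' i).1].
  - exact: (DL i).1.
  - apply: (L2_mul mO (GL i)); apply: (L2_le mO _ (GL' i)).
      by apply: (measurableT_comp (@normr_measurable R setT)); exact: (GL' i).1.
    by move=> x _; rewrite normr_id.
  - apply: (@ae_imp _ lebT R mu _ _ _ (HGD i)) => x a1 Ox; rewrite -(a1 Ox); split.
      by rewrite -[X in _ --> X]mul1r; apply: cvgMr_tmp; exact: cvg_dtrunc.
    by move=> k; rewrite normrM ler_piMl// dtrunc_le1.
have {}H2 : intB (fun x => lam x * t x * tphi x) /\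
    iB (fun x => lam x * t x * trunc (sj R k) (tphi x)) @[k --> \oo] --> iB (fun x => lam x * t x * tphi x).
  apply: H2.
  - by move=> k; apply: mtr; exact: mtphi.
  - exact: mtphi.
  - apply: (L2_mul mB ltL); apply: (L2_le mB _ tphiL).
      by apply: (measurableT_comp (@normr_measurable R setT)); exact: mtphi.
    by move=> x _; rewrite normr_id.
  - by apply: aeW => x _; split; [exact: cvg_trunc|move=> k; exact: trunc_le].
have {}H3 : intO (fun x => f x * phi x) /\
    iO (fun x => f x * trunc (sj R k) (phi x)) @[k --> \oo] --> iO (fun x => f x * phi x).
  apply: H3.
  - by move=> k; apply: mtr; exact: phiL.1.
  - exact: phiL.1.
  - exact: ifphi.
  - by apply: aeW => x _; split; [exact: cvg_trunc|move=> k; exact: trunc_le].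
have {}H4 : intB (fun x => q x * tphi x) /\
    iB (fun x => q x * trunc (sj R k) (tphi x)) @[k --> \oo] --> iB (fun x => q x * tphi x).
  apply: H4.
  - by move=> k; apply: mtr; exact: mtphi.
  - exact: mtphi.
  - by apply: (intB_mul bOm iq); exact: cst_continuous.
  - apply: (@ae_imp _ surT R sur _ _ _ hc) => x a1 bx; split; first exact: cvg_trunc.
    by move=> k; exact: le_trans (trunc_le _ _) (a1 bx).
split; first by move=> i; case: (H1 i).
- by case: H2.
- by case: H3.
- by case: H4.
apply: (cvg_eq_unique (fun k => step _ (sj0 k))).
  by apply: (@cvgD _ R^o); [apply: cvg_fsum => i; case: (H1 i)|case: H2].
by apply: (@cvgD _ R^o); [case: H3|case: H4].
Qed.

End Extension.

(** * The potential of the singular term *)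

Section Potential.
Context (R : realType).
Implicit Types p x y a b : R.

Lemma expR_tangent x y : expR x * (1 + (y - x)) <= expR y.
Proof.
have -> : y = x + (y - x) by ring.
by rewrite [leRHS]expRD ler_wpM2l ?expR_ge0// addrC [x + _]addrC addrK addrC expR_ge1Dx.
Qed.

(** With y / x = e^z this is (e^(p z) - 1) / p <= e^z - 1. For p < 0 both sides are compared with z;
    for 0 < p <= 1 it is convexity of the exponential between 0 and z. *)
Lemma powR_tangent p x y : p <= 1 -> p != 0 -> 0 < x -> 0 < y ->
  (y `^ p - x `^ p) / p <= x `^ (p - 1) * (y - x).
Proof.
move=> p1 p0 x0 y0; pose z := ln (y / x).
have yx0 : 0 < y / x by rewrite divr_gt0.
have ez : expR z = y / x by rewrite lnK// posrE.
have ey : y = x * expR z by rewrite ez mulrC divfK// gt_eqF.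
have yp : y `^ p = x `^ p * expR (p * z).
  by rewrite {1}ey powRM ?expR_ge0 ?(ltW x0)// {2}/powR gt_eqF ?expR_gt0// expRK.
have xp : x `^ (p - 1) = x `^ p / x.
  rewrite powRD; last by rewrite (gt_eqF x0) implybT.
  by rewrite powR_inv1// ltW.
have key : (expR (p * z) - 1) / p <= expR z - 1.
  move: p0; rewrite neq_lt => /orP[pn|pp].
    rewrite ler_ndivrMr//; have h := expR_ge1Dx (p * z); have h2 := expR_ge1Dx z.
    apply: (@le_trans _ _ (p * z)); last by rewrite lerBrDl.
    by rewrite mulrC ler_wnM2l ?(ltW pn)// lerBrDl.
  rewrite ler_pdivrMr//.
  have h1 := expR_tangent (p * z) z; have h2 := expR_tangent (p * z) 0.
  rewrite expR0 in h2.
  have h3 := ler_wpM2l (ltW pp) h1.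
  have q0 : 0 <= 1 - p by rewrite subr_ge0.
  have h4 := ler_wpM2l q0 h2; have h5 := lerD h3 h4; rewrite lerBlDr; apply: le_trans (_ : _ <= p * expR z + (1 - p) * 1) _; last by lra.
  apply: le_trans h5; rewrite le_eqVlt; apply/orP; left; apply/eqP; ring.
have -> : (y `^ p - x `^ p) / p = x `^ p * ((expR (p * z) - 1) / p) by rewrite yp; field.
have -> : x `^ (p - 1) * (y - x) = x `^ p * (expR z - 1) by rewrite xp ey; field; rewrite gt_eqF.
by rewrite ler_wpM2l ?powR_ge0.
Qed.

Lemma ln_tangent x y : 0 < x -> 0 < y -> ln y - ln x <= x^-1 * (y - x).
Proof.
move=> x0 y0; rewrite -ln_div ?posrE//.
have -> : y / x = 1 + x^-1 * (y - x) by field; rewrite gt_eqF.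
apply: le_ln1Dx; rewrite mulrBr mulVf ?gt_eqF// ltrBrDl subrr.
by rewrite mulr_gt0 ?invr_gt0.
Qed.

(** The primitive of - t^(-eta) without additive constant: for eta different from 1 it is
    homogeneous of degree 1 - eta, and for eta > 1 it is nonnegative. *)
Definition potential (eta t : R) : R := if eta == 1 then - ln t else - (t `^ (1 - eta) / (1 - eta)).

Lemma measurable_potential eta : measurable_fun setT (potential eta).
Proof.
rewrite /potential; case: eqP => _.
  by apply: measurable_funN; exact: measurable_ln.
apply: measurable_funN; apply: measurable_funM; last exact: measurable_cst.
exact: (@measurable_powR R (1 - eta)).
Qed.

Lemma potential_tangent eta x y : 0 <= eta -> 0 < x -> 0 < y ->
  potential eta x - x `^ (- eta) * (y - x) <= potential eta y.
Proof.
move=> e0 x0 y0; rewrite /potential; case: eqP => [->|/eqP e1].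
  rewrite powRN powRr1 ?(ltW x0)//; have := ln_tangent x0 y0.
  by move: (x^-1 * _) => u; lra.
have p1 : 1 - eta <= 1 by rewrite lerBlDr lerDl.
have p0 : 1 - eta != 0 by rewrite subr_eq0 eq_sym.
have := powR_tangent p1 p0 x0 y0; rewrite (_ : 1 - eta - 1 = - eta); last by ring.
by rewrite mulrBl; move: (y `^ _ / _) (x `^ _ / _) (x `^ _ * _) => u v w; lra.
Qed.

Lemma potential_mid eta a b : 0 <= eta -> 0 < a -> 0 < b ->
  2 * potential eta (2^-1 * a + 2^-1 * b) <= potential eta a + potential eta b.
Proof.
move=> e0 a0 b0; have m0 : 0 < 2^-1 * a + 2^-1 * b by rewrite addr_gt0// mulr_gt0 ?invr_gt0.
have h1 := potential_tangent e0 m0 a0; have h2 := potential_tangent e0 m0 b0.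
apply: le_trans (lerD h1 h2); rewrite le_eqVlt; apply/orP; left; apply/eqP; by field.
Qed.

Lemma log_potential_half a b : 0 < a -> 0 < b -> - ln (2^-1 * a + 2^-1 * b) <= - ln b + 1.
Proof.
move=> a0 b0; have m0 : 0 < 2^-1 * a + 2^-1 * b by rewrite addr_gt0// mulr_gt0 ?invr_gt0.
have := ln_tangent m0 b0; have : (2^-1 * a + 2^-1 * b)^-1 * (b - (2^-1 * a + 2^-1 * b)) <= 1.
  by rewrite ler_pdivrMl//; lra.
by move: (ln _) (ln _) (_ * (b - _)) => u v w; lra.
Qed.

Lemma weighted_mid_same (c Pa Pb Pm : R) : 0 <= c -> 2 * Pm <= Pa + Pb ->
  (c + c) * Pm <= c * Pa + c * Pb + `|c - c|.
Proof. by move=> c0 /(ler_wpM2l c0) h; rewrite subrr normr0; lra. Qed.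

(** Convexity is used with the smaller of the two weights, and the excess |c - d| is paid by the
    crude bound of the midpoint value by an endpoint value plus 1. *)
Lemma weighted_mid (c d Pa Pb Pm : R) : 0 <= c -> 0 <= d -> 2 * Pm <= Pa + Pb ->
  Pm <= Pa + 1 -> Pm <= Pb + 1 -> (c + d) * Pm <= c * Pa + d * Pb + `|c - d|.
Proof.
move=> c0 d0 h ha hb; have [cd|dc] := leP c d.
  have h1 := ler_wpM2l c0 h.
  have h2 : (d - c) * Pm <= (d - c) * (Pb + 1) by rewrite ler_wpM2l// subr_ge0.
  rewrite ler0_norm ?subr_le0//; nra.
have h1 := ler_wpM2l d0 h.
have h2 : (c - d) * Pm <= (c - d) * (Pa + 1) by rewrite ler_wpM2l// subr_ge0 ltW.
rewrite gtr0_norm ?subr_gt0//; nra.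
Qed.

Lemma continuous_powR_norm (s : R) : 0 <= s -> continuous (fun y : R => `|y| `^ s).
Proof.
move=> s0 y; have [y0|y0] := eqVneq y 0.
  have [->|sN] := eqVneq s 0.
    rewrite (_ : (fun y : R => _) = cst 1); first exact: cst_continuous.
    by apply/funext => z; rewrite powRr0.
  have sp : 0 < s by rewrite lt_neqAle eq_sym sN.
  rewrite y0 /continuous_at normr0 powR0//; apply/cvgr0Pnorm_le => e e0.
  near=> z; rewrite ger0_norm ?powR_ge0//.
  have -> : e = (e `^ s^-1) `^ s by rewrite -powRrM mulVf// powRr1// ltW.
  apply: ge0_ler_powR; rewrite ?nnegrE ?powR_ge0//.
  near: z; exists (e `^ s^-1) => /=; first exact: powR_gt0.
  by move=> z /=; rewrite sub0r normrN => /ltW.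
have ny : 0 < `|y| by rewrite normr_gt0.
have c1 : {for `|y|, continuous (fun z : R => z `^ s)}.
  apply: differentiable_continuous; apply/derivable1_diffP.
  by case: (is_derive1_powR s ny).
exact: (@continuous_comp _ _ _ (fun z : R => `|z|) (fun z : R => z `^ s) y (@norm_continuous _ R^o y) c1).
Unshelve. all: by end_near. Qed.

End Potential.

Lemma mul_div_cancel (F : fieldType) (c d s : F) : d != 0 -> s != 0 -> c / d = s * (c / (s * d)).
Proof. by move=> d0 s0; field; rewrite d0 s0. Qed.

Section LpFinite.
Context d (T : measurableType d) (R : realType) (m : {measure set T -> \bar R}).
Variable (D : set T).
Hypotheses (mD : measurable D) (Dfin : (m D < +oo)%E).

Lemma Lp_powR_integrable (p : R) (f : T -> R) : 0 < p -> Lp m D p%:E f ->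
  measurable_fun D f /\ m.-integrable D (EFin \o (fun x => `|f x| `^ p)).
Proof.
move=> p0 /(LpE m mD _ p0)[mf hf]; split => //; apply/integrableP; split.
  apply/measurable_EFinP.
  exact: (measurableT_comp (@measurable_powR R p) (measurableT_comp (@normr_measurable R setT) mf)).
apply: le_lt_trans hf; rewrite le_eqVlt; apply/orP; left; apply/eqP; apply: eq_integral => x _.
by rewrite gee0_abs// lee_fin powR_ge0.
Qed.

Lemma cst_integrable (c : R) : m.-integrable D (EFin \o cst c).
Proof.
apply: (measurable_bounded_integrable mD Dfin (measurable_cst c)).
by exists `|c|; split; [exact: num_real|move=> y cy x _; exact: ltW].
Qed.

Lemma Lp_integrable (p : R) (f : T -> R) : 1 <= p -> Lp m D p%:E f -> m.-integrable D (EFin \o f).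
Proof.
move=> p1 fp; have [mf hf] := Lp_powR_integrable (lt_le_trans ltr01 p1) fp.
have hi := integrableD mD (cst_integrable 1) hf.
apply: (le_integrable mD _ _ hi); first exact/measurable_EFinP.
move=> x _; rewrite /= lee_fin [leRHS]ger0_norm ?addr_ge0 ?powR_ge0//.
have [f1|f1] := leP `|f x| 1; first by rewrite -[leLHS]addr0 lerD// powR_ge0.
by rewrite -[leLHS]add0r lerD// le1r_powR// ltW.
Qed.

End LpFinite.

Section Homogeneity.
Context (R : realType) (n : nat).
Local Notation N := n.+1.
Local Notation lebT := (caratheodory_type (@lebesgue_outer R N)).
Local Notation surT := (caratheodory_type (@hausdorff_outer R N.-1 N)).
Local Notation sur := (surface R N).
Local Notation mu := (lebesgue_rV R N).
Implicit Types (w v phi : 'rV[R]_N -> R).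
Variables (Om : set 'rV[R]_N).
Hypotheses (hN : (2 < N)%N) (oOm : open Om) (bOm : bounded_set Om) (hC1 : C1_boundary Om).
Local Notation iO := (iO Om).
Local Notation iB := (iB Om).
Local Notation intO := (intO Om).
Local Notation intB := (intB Om).
Local Notation mO := (mO oOm).
Local Notation mB := (mB Om).

Lemma energyR_scale c w : Ck 1 w -> energyR Om (fun x => c * w x) = c ^+ 2 * energyR Om w.
Proof.
move=> Cw; have Pc := (C1Z c Cw).2; rewrite /energyR -(iOZ oOm _ (intO_energy oOm bOm Cw)).
congr iO; apply/funext => x; rewrite mulrDr -exprMn; congr (_ + _).
by rewrite /gsq mulr_sumr; apply: eq_bigr => i _; rewrite Pc exprMn.
Qed.

(** [w] is divided by r = sqrt(1 + E), which brings its energy below 1; homogeneity returns the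
    factor r^s, at most r because r >= 1 and s <= 1. *)
Lemma homogeneous_bound (F : ('rV[R]_N -> R) -> R) (s K : R) : s <= 1 -> 0 <= K ->
  (forall c w, 0 < c -> Ck 1 w -> F (fun x => c * w x) = c `^ s * F w) ->
  (forall w, Ck 1 w -> energyR Om w <= 1 -> F w <= K) ->
  forall w, Ck 1 w -> F w <= K * Num.sqrt (1 + energyR Om w).
Proof.
move=> s1 K0 hF hK w Cw; have E0 := energyR_ge0 Om w; set r := Num.sqrt _.
have rr : r ^+ 2 = 1 + energyR Om w by rewrite sqr_sqrtr// addr_ge0.
have r1 : 1 <= r by rewrite -sqrtr1 ler_wsqrtr// lerDl.
have r0 : 0 < r by exact: lt_le_trans r1.
have Cv := (C1Z r^-1 Cw).1.
have Ev : energyR Om (fun x => r^-1 * w x) <= 1.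
  by rewrite energyR_scale// exprVn rr ler_pdivrMl ?mulr1 ?lerDr// ltr_pwDl.
have -> : w = (fun x => r * (r^-1 * w x)) by apply/funext => x; rewrite mulrA divff ?mul1r// gt_eqF.
rewrite hF// mulrC; apply: (@le_trans _ _ (K * r `^ s)).
  by rewrite ler_wpM2r ?powR_ge0// hK.
by rewrite ler_wpM2l// ler1_powR.
Qed.

Lemma mu_Om_fin : (mu (Om : set lebT) < +oo)%E.
Proof. by have [k Ok] := bounded_kbox bOm; exact: mu_bounded Ok. Qed.

(** q = 2N/(N-2) is conjugate to the exponent of [f]. Young's inequality bounds the integral by a
    constant on the unit ball of the energy, and homogeneity of degree 1 gives the growth in
    general. *)
Lemma young_bound (f : 'rV[R]_N -> R) :
  Lp (mu : {measure set lebT -> \bar R}) Om ((2 * N%:R) / (N%:R + 2))%:E f -> (forall x, 0 <= f x) ->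
  intO f /\ exists M : R, forall w, Ck 1 w ->
     iO (fun x => f x * `|w x|) <= M * Num.sqrt (1 + energyR Om w).
Proof.
move=> hf f0.
have N2 : 2 < N%:R :> R by rewrite ltr_nat.
set p : R := _ / _ in hf; pose q : R := 2 * N%:R / (N%:R - 2).
have p1 : 1 < p by rewrite /p ltr_pdivlMr; lra.
have p0 : 0 < p := lt_trans ltr01 p1.
have q0 : 0 < q by rewrite /q divr_gt0; lra.
have pq : p^-1 + q^-1 = 1 by rewrite /p /q; field; rewrite !gt_eqF//; lra.
have if_ : intO f := Lp_integrable mO mu_Om_fin (ltW p1) hf.
have [mf ifp] := Lp_powR_integrable mO p0 hf.
split => //; have [S S0 HS] := sobolev hN oOm bOm hC1.
pose K := iO (fun x => `|f x| `^ p) / p + S / q.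
have K0 : 0 <= K.
  rewrite addr_ge0// divr_ge0 ?(ltW p0) ?(ltW q0)//.
  by apply: Rintegral_ge0 => x _; exact: powR_ge0.
exists K; have cabs w : Ck 1 w -> continuous (fun x => `|w x|).
  by move=> Cw x; apply: continuous_comp; [exact: C1_continuous|exact: norm_continuous].
have ifw w : Ck 1 w -> intO (fun x => f x * `|w x|).
  by move=> Cw; apply: (intO_mul oOm bOm if_); exact: cabs.
apply: (@homogeneous_bound (fun w => iO (fun x => f x * `|w x|)) 1) => //.
  move=> c w c0 Cw; rewrite powRr1 ?(ltW c0)// -(iOZ oOm _ (ifw _ Cw)).
  by congr iO; apply/funext => x; rewrite normrM (gtr0_norm c0); ring.
move=> w Cw; rewrite -lee_fin -(energyE oOm bOm Cw) => Ew.
have Sw := HS w Cw Ew.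
have cq : continuous (fun x => `|w x| `^ q).
  move=> x; apply: (continuous_comp (f := w) (g := fun y => `|y| `^ q)); first exact: C1_continuous.
  by apply: continuous_powR_norm; exact: ltW.
have iq : intO (fun x => `|w x| `^ q) by exact: (intO_cont oOm bOm).
have h1 : iO (fun x => `|w x| `^ q) <= S.
  rewrite -lee_fin -(EFin_iO oOm iq); apply: le_trans Sw.
  rewrite le_eqVlt; apply/orP; left; apply/eqP; apply: eq_integral => x _; congr (_%:E).
  rewrite -[w x ^+ 2](real_normK (num_real _)) -powR_mulrn// -powRrM; congr (_ `^ _).
  by rewrite /q mulrA.
have i1 := intOZ oOm p^-1 ifp; have i2 := intOZ oOm q^-1 iq.
apply: (@le_trans _ _ (iO (fun x => p^-1 * `|f x| `^ p + q^-1 * `|w x| `^ q))).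
  apply: (iO_le oOm (ifw _ Cw) (intOD oOm i1 i2)) => x _.
  rewrite ![_^-1 * _]mulrC -{1}(ger0_norm (f0 x)); exact: conjugate_powR.
rewrite (iOD oOm i1 i2) (iOZ oOm _ ifp) (iOZ oOm _ iq) /K ![_^-1 * _]mulrC.
by rewrite lerD2l ler_pM2r ?invr_gt0.
Qed.

Lemma cont_powR_norm (s : R) w : 0 <= s -> Ck 1 w -> continuous (fun x => `|w x| `^ s).
Proof.
move=> s0 Cw x; apply: (continuous_comp (f := w) (g := fun y => `|y| `^ s)); first exact: C1_continuous.
exact: continuous_powR_norm.
Qed.

Lemma trace_norm_bound : exists2 M : R, 0 <= M & forall w, Ck 1 w ->
  iB (fun x => `|w x|) <= M * Num.sqrt (1 + energyR Om w).
Proof.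
have [Ct Ct0 HCt] := trace_L2 oOm bOm hC1.
have i1 : intB (cst 1) by apply: (intB_cont oOm bOm hC1); exact: cst_continuous.
have K0 : 0 <= iB (cst 1) + Ct by rewrite addr_ge0//; apply: Rintegral_ge0 => x _.
exists (iB (cst 1) + Ct) => //.
have iw w : Ck 1 w -> intB (fun x => `|w x|).
  move=> Cw; apply: (intB_cont oOm bOm hC1) => x.
  by apply: continuous_comp; [exact: C1_continuous|exact: norm_continuous].
apply: (@homogeneous_bound (fun w => iB (fun x => `|w x|)) 1) => //.
  move=> c w c0 Cw; rewrite powRr1 ?(ltW c0)// -(iBZ _ (iw _ Cw)).
  by congr iB; apply/funext => x; rewrite normrM (gtr0_norm c0).
move=> w Cw Ew; have i2 : intB (fun x => w x ^+ 2).
  by apply: (intB_cont oOm bOm hC1); exact: cont_sqr.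
apply: (@le_trans _ _ (iB (fun x => cst 1 x + w x ^+ 2))).
  apply: (iB_le (iw _ Cw) (intBD i1 i2)) => x _ /=.
  rewrite -(real_normK (num_real (w x))); move: `|w x| => y.
  have h : 0 <= (y - 2^-1) ^+ 2 by exact: sqr_ge0.
  rewrite -subr_ge0; have -> : 1 + y ^+ 2 - y = (y - 2^-1) ^+ 2 + 3 / 4 by field.
  by rewrite addr_ge0.
rewrite (iBD i1 i2) lerD2l -lee_fin -(EFin_iB i2).
apply: (le_trans (HCt w Cw)); rewrite (energyE oOm bOm Cw) -EFinM lee_fin.
by rewrite ler_piMr.
Qed.

(** The exponent r of [g] is conjugate to the q with (1 - eta) q = 2(N-1)/(N-2), the exponent of
    [trace_power]. *)
Lemma trace_power_bound (eta : R) g : 0 <= eta -> eta < 1 -> (forall x, 0 <= g x) ->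
  Lp (sur : {measure set surT -> \bar R}) (boundary Om)
     ((2 * (N%:R - 1)) / (N%:R + eta * (N%:R - 2)))%:E g -> intB g ->
  exists2 M : R, 0 <= M & forall w, Ck 1 w ->
    iB (fun x => g x * `|w x| `^ (1 - eta)) <= M * Num.sqrt (1 + energyR Om w).
Proof.
move=> e0 e1 g0 hg ig; have N2 : 2 < N%:R :> R by rewrite ltr_nat.
have N20 : 0 < N%:R - 2 :> R by rewrite subr_gt0.
have s0 : 0 < 1 - eta by rewrite subr_gt0.
have D0 : 0 < N%:R + eta * (N%:R - 2) by rewrite ltr_wpDr ?mulr_ge0 ?(ltW N20)//; exact: lt_trans N2.
have M0 : 0 < 2 * (N%:R - 1) :> R by rewrite mulr_gt0// subr_gt0; apply: lt_trans N2; rewrite ltr1n.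
set r : R := _ / _ in hg; pose q : R := 2 * (N%:R - 1) / ((1 - eta) * (N%:R - 2)).
have r0 : 0 < r by rewrite divr_gt0.
have q0 : 0 < q by rewrite divr_gt0// mulr_gt0.
have rq : r^-1 + q^-1 = 1.
  by rewrite /r /q !invf_div -mulrDl -[RHS](divff (lt0r_neq0 M0)); congr (_ / _); ring.
have [mg igr] := Lp_powR_integrable mB r0 hg.
have [C C0 HC] := trace_power hN oOm bOm hC1.
pose K := iB (fun x => `|g x| `^ r) / r + C / q.
have K0 : 0 <= K.
  rewrite addr_ge0// divr_ge0 ?(ltW r0) ?(ltW q0)//.
  by apply: Rintegral_ge0 => x _; exact: powR_ge0.
exists K => //.
have igw w : Ck 1 w -> intB (fun x => g x * `|w x| `^ (1 - eta)).
  by move=> Cw; apply: (intB_mul bOm ig); exact: cont_powR_norm (ltW s0) Cw.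
apply: (@homogeneous_bound (fun w => iB (fun x => g x * `|w x| `^ (1 - eta))) (1 - eta)) => //.
- by rewrite lerBlDr lerDl.
- move=> c w c0 Cw; rewrite -(iBZ _ (igw _ Cw)).
  congr iB; apply/funext => x; rewrite normrM (gtr0_norm c0) powRM ?(ltW c0)//; ring.
move=> w Cw; rewrite -lee_fin -(energyE oOm bOm Cw) => Ew.
pose e : R := 2 * (N%:R - 1) / (N%:R - 2).
have e0' : 0 <= e by rewrite divr_ge0 ?(ltW M0)// ltW.
have ie : intB (fun x => `|w x| `^ e) by apply: (intB_cont oOm bOm hC1); exact: cont_powR_norm.
have h1 : iB (fun x => `|w x| `^ e) <= C.
  by rewrite -lee_fin -(EFin_iB ie); exact: HC.
have i1 := intBZ r^-1 igr; have i2 := intBZ q^-1 ie.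
apply: (@le_trans _ _ (iB (fun x => r^-1 * `|g x| `^ r + q^-1 * `|w x| `^ e))).
  apply: (iB_le (igw _ Cw) (intBD i1 i2)) => x _.
  have -> : e = (1 - eta) * q by apply: mul_div_cancel; exact: lt0r_neq0.
  rewrite (powRrM `|w x| (1 - eta) q) ![_^-1 * _]mulrC -{1}(ger0_norm (g0 x)); apply: conjugate_powR => //.
rewrite (iBD i1 i2) (iBZ _ igr) (iBZ _ ie) /K ![_^-1 * _]mulrC.
by rewrite lerD2l ler_pM2r ?invr_gt0.
Qed.

(** Three regimes of the lower bound. For eta < 1 the maximum in the exponent is r and
    [trace_power_bound] applies; for eta > 1 the potential is nonnegative; for eta = 1 the
    inequality ln t <= t and the truncated weight, at most k, reduce it to the trace norm. *)
Lemma singular_data (eta : R) g : 0 <= eta -> (forall x, 0 <= g x) ->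
  Lp (sur : {measure set surT -> \bar R}) (boundary Om)
     (Num.max ((2 * (N%:R - 1)) / (N%:R + eta * (N%:R - 2))) 1)%:E g ->
  intB g /\ exists gs : nat -> 'rV[R]_N -> R,
  [/\ forall k, measurable_fun (boundary Om : set surT) (gs k : surT -> R),
      forall k x, Num.min (g x) k%:R <= gs k x,
      forall k x, gs k x <= g x,
      forall i k x (a b : R), 0 < a -> 0 < b ->
        (gs i x + gs k x) * potential eta (2^-1 * a + 2^-1 * b) <=
        gs i x * potential eta a + gs k x * potential eta b + `|gs i x - gs k x| &
      forall k, exists M : R, forall w, positive_C1 Om w ->
        - (M * Num.sqrt (1 + energyR Om w)) <= iB (fun x => gs k x * potential eta (w x))].
Proof.
move=> e0 g0 hg; set r : R := _ / _ in hg.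
have rm : 1 <= Num.max r 1 by rewrite le_max lexx orbT.
have ig : intB g := Lp_integrable mB (surface_boundary_fin oOm bOm hC1) rm hg.
have mg : measurable_fun (boundary Om : set surT) (g : surT -> R).
  by apply/measurable_EFinP; exact: measurable_int ig.
split => //; have N2 : 2 < N%:R :> R by rewrite ltr_nat.
have [e1|e1|e1] := ltgtP eta 1.
- have s0 : 0 < 1 - eta by rewrite subr_gt0.
  have hr : Num.max r 1 = r.
    apply/max_idPl; rewrite /r ler_pdivlMr ?mul1r; last first.
      by rewrite ltr_wpDr ?mulr_ge0 ?subr_ge0 ?(ltW N2)//; exact: lt_trans N2.
    have h : eta * (N%:R - 2) <= 1 * (N%:R - 2) by rewrite ler_wpM2r ?subr_ge0 ?ltW.
    lra.
  rewrite hr in hg; have [M M0 HM] := trace_power_bound e0 e1 g0 hg ig.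
  exists (fun=> g); split => //.
  + by move=> k x; rewrite ge_min lexx.
  + move=> i k x a b a0 b0; apply: weighted_mid_same => //.
    exact: potential_mid.
  + move=> _; exists ((1 - eta)^-1 * M) => w [Cw w0].
    have igw : intB (fun x => g x * `|w x| `^ (1 - eta)).
      by apply: (intB_mul bOm ig); exact: cont_powR_norm (ltW s0) Cw.
    have -> : iB (fun x => g x * potential eta (w x)) = - (1 - eta)^-1 * iB (fun x => g x * `|w x| `^ (1 - eta)).
      rewrite -(iBZ _ igw); apply: eq_Rintegral => x; rewrite inE => bx.
      rewrite /potential lt_eqF// ger0_norm ?ltW ?w0//; [ring|exact: boundary_closure].
    by rewrite mulNr lerN2 -mulrA ler_pM2l ?invr_gt0// HM.
- exists (fun=> g); split => //.
  + by move=> k x; rewrite ge_min lexx.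
  + move=> i k x a b a0 b0; apply: weighted_mid_same => //.
    exact: potential_mid.
  + move=> _; exists 0 => w _; rewrite mul0r oppr0; apply: Rintegral_ge0 => x _.
    rewrite mulr_ge0// /potential gt_eqF// -mulrN -invrN opprB divr_ge0 ?powR_ge0//.
    by rewrite subr_ge0 ltW.
- have [M M0 HM] := trace_norm_bound; rewrite e1.
  have gsk0 k x : 0 <= Num.min (g x) k%:R by rewrite le_min g0 ler0n.
  have mgk k : measurable_fun (boundary Om : set surT) (fun x : surT => Num.min (g x) k%:R).
    by apply: measurable_minr => //; exact: measurable_cst.
  exists (fun k x => Num.min (g x) k%:R); split => //.
  + by move=> k x; rewrite ge_min lexx.
  + move=> i k x a b a0 b0; apply: weighted_mid => //.
    * exact: potential_mid.
    * by rewrite /potential eqxx [2^-1 * a + _]addrC; exact: log_potential_half.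
    * by rewrite /potential eqxx; exact: log_potential_half.
  + move=> k; exists (k%:R * M) => w [Cw w0].
    have iw : intB (fun x => `|w x|).
      apply: (intB_cont oOm bOm hC1) => x.
      by apply: continuous_comp; [exact: C1_continuous|exact: norm_continuous].
    have igk : intB (fun x => Num.min (g x) k%:R).
      apply: (le_integrable mB _ _ ig); first by apply/measurable_EFinP; exact: mgk.
      by move=> x _; rewrite lee_fin !ger0_norm// ge_min lexx.
    have [a [b [a0 hab]]] := positive_C1_bounds bOm (conj Cw w0).
    have igP : intB (fun x => Num.min (g x) k%:R * potential 1 (w x)).
      apply: (@integrable_mulb _ surT R sur _ _ (fun x => potential 1 (w x)) (`|ln a| + `|ln b|) mB igk).
        apply: measurable_funTS; apply: (measurableT_comp (measurable_potential 1)).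
        by apply: measurable_cont_sur; exact: C1_continuous.
      move=> x bx; have /andP[aw wb] := hab x (boundary_closure bx).
      have wp : 0 < w x by exact: lt_le_trans aw.
      rewrite /potential eqxx normrN.
      have l1 : ln a <= ln (w x) by rewrite ler_ln ?posrE.
      have l2 : ln (w x) <= ln b by rewrite ler_ln ?posrE//; exact: lt_le_trans wb.
      have := ler_norm (ln b); have := ler_norm (- ln a); rewrite normrN => n1 n2.
      by rewrite ler_norml; have := normr_ge0 (ln a); have := normr_ge0 (ln b) => n3 n4; apply/andP; split; lra.
    apply: (@le_trans _ _ (- k%:R * iB (fun x => `|w x|))).
      by rewrite mulNr lerN2 -mulrA ler_wpM2l// HM.
    rewrite -(iBZ _ iw); apply: (iB_le (intBZ _ iw) igP) => x bx.
    have wp := w0 x (boundary_closure bx); rewrite (ger0_norm (ltW wp)) /potential eqxx.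
    rewrite mulNr mulrN lerN2; apply: (@le_trans _ _ (Num.min (g x) k%:R * w x)).
      by rewrite ler_wpM2l// ltW// ln_sublinear.
    by rewrite ler_wpM2r ?(ltW wp)// ge_min lexx orbT.
Qed.

End Homogeneity.

(** * Existence *)

Section NormalisedData.
Context (R : realType) (n : nat).
Local Notation N := n.+1.
Local Notation lebT := (caratheodory_type (@lebesgue_outer R N)).
Local Notation surT := (caratheodory_type (@hausdorff_outer R N.-1 N)).
Local Notation sur := (surface R N).
Local Notation mu := (lebesgue_rV R N).
Variables (Om : set 'rV[R]_N) (lam : 'rV[R]_N -> R) (Lam : R).
Hypotheses (hN : (2 < N)%N) (oOm : open Om) (bOm : bounded_set Om) (hC1 : C1_boundary Om)
  (mlam : measurable_fun setT (lam : surT -> R))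
  (lam0 : forall x, 0 <= lam x) (lamL : forall x, lam x <= Lam)
  (hlam : controlled Om lam Om).
Variables (f g : 'rV[R]_N -> R) (eta : R).
Hypotheses (eta0 : 0 <= eta)
  (f0 : forall x, 0 <= f x) (g0 : forall x, 0 <= g x)
  (hf : Lp (mu : {measure set lebT -> \bar R}) Om ((2 * N%:R) / (N%:R + 2))%:E f)
  (hg : Lp (sur : {measure set surT -> \bar R}) (boundary Om)
     (Num.max ((2 * (N%:R - 1)) / (N%:R + eta * (N%:R - 2))) 1)%:E g).
Local Notation iO := (iO Om).
Local Notation iB := (iB Om).
Local Notation intO := (intO Om).
Local Notation intB := (intB Om).
Local Notation mO := (mO oOm).
Local Notation mB := (mB Om).

Lemma normalised_solution : exists (u t q : 'rV[R]_N -> R) (Du : 'rV[R]_N -> 'rV[R]_N),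
  [/\ [/\ H1_grad Om u Du, is_trace Om u t, forall x, 0 <= u x & forall x, 0 <= t x],
      sur.-integrable (boundary Om : set surT) (singular_term g t eta : surT -> \bar R),
      {ae sur, forall x : surT, boundary Om x -> singular_term g t eta x = (q x)%:E} &
      forall phi Dphi tphi, H1_grad Om phi Dphi -> is_trace Om phi tphi ->
        Lp (sur : {measure set surT -> \bar R}) (boundary Om) +oo%E tphi ->
        [/\ forall i, intO (fun x => Du x 0 i * Dphi x 0 i), intB (fun x => lam x * t x * tphi x),
          intO (fun x => f x * phi x), intB (fun x => q x * tphi x) &
          \sum_i iO (fun x => Du x 0 i * Dphi x 0 i) + iB (fun x => lam x * t x * tphi x) =
          iO (fun x => f x * phi x) + iB (fun x => q x * tphi x)]].
Proof.
have [if_ Hf] := young_bound hN oOm bOm hC1 hf f0.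
have [ig [gs [mgs gs_ge gs_le gs_mid gs_low]]] := singular_data hN oOm bOm hC1 eta0 g0 hg.
have [C C0 HC] := coercive oOm bOm hC1 mlam lam0 lamL hlam.
have [Ct Ct0 HCt] := trace_L2 oOm bOm hC1.
(* [a] makes both C a and Ct C a at most 1, so that the increments decay like 8^(-k) in [Om] and on
   the boundary. *)
pose a := (C * (1 + Ct))^-1.
have Ct1 : 0 < 1 + Ct by rewrite ltr_pwDl.
have a0 : 0 < a by rewrite invr_gt0 mulr_gt0.
have aE : C * a = (1 + Ct)^-1 by rewrite /a invfM mulrA divff ?mul1r// gt_eqF.
have aC : C * a <= 1 by rewrite aE invf_le1// lerDl.
have aCt : Ct * (C * a) <= 1 by rewrite aE ler_pdivrMr// mul1r lerDr.
have [h [W [KW mh hh Wdiff Wmin]]] := minimizing_sequence oOm bOm hC1 mlam lam0 lamL hlam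
  if_ f0 Hf eta0 ig g0 (measurable_potential eta) (fun x y => @potential_tangent R eta x y eta0)
  mgs gs_ge gs_le gs_mid gs_low a0.
have [u [t [G [[u0 t0] [uL GL tL] [cu cG ct] ibp hEL]]]] := limit_solution oOm bOm hC1 mlam lam0 lamL
  eta0 ig g0 KW mh hh Wdiff Wmin (ltW C0) HC Ct0 HCt aC aCt.
have hS := singular_integrable bOm eta0 ig g0 t0 tL hEL.
have hq := singular_sing bOm eta0 ig g0 t0 tL hEL.
have iq := intB_sing bOm eta0 ig g0 t0 tL hEL.
have hE phi : Ck 1 phi -> EL Om lam f G t phi = iB (fun x => sing g eta t x * phi x).
  by move=> Cp; exact: (EL_eq oOm bOm hC1 mlam lam0 lamL if_ eta0 ig g0 t0 GL tL hEL Cp).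
pose Du x : 'rV[R]_N := \row_i G i x.
have DuE i : (fun x => Du x 0 i) = G i by apply/funext => x; rewrite mxE.
have CW k : Ck 1 (W k) by case: (KW k).
have LW k : Lp (mu : {measure set lebT -> \bar R}) Om 2%:E (W k).
  by apply/(Lp2E mu mO); apply: (L2_contO oOm bOm); exact: C1_continuous.
have LP k i : Lp (mu : {measure set lebT -> \bar R}) Om 2%:E (partial i (W k)).
  by apply/(Lp2E mu mO); apply: (L2_contO oOm bOm); exact: C1_continuous_partial.
have HG : H1_grad Om u Du.
  split.
  - by apply/(Lp2E mu mO).
  - by move=> i; rewrite DuE; apply/(Lp2E mu mO); exact: GL.
  - move=> phi i tphi; have Cphi : Ck 1 phi by case: tphi => + _ _; exact.
    have i1 : intO (fun x => u x * partial i phi x).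
      by apply: (L2_mul mO uL); apply: (L2_contO oOm bOm); exact: C1_continuous_partial.
    have i2 : intO (fun x => G i x * phi x).
      by apply: (L2_mul mO (GL i)); apply: (L2_contO oOm bOm); exact: C1_continuous.
    have e2 : (fun x => (Du x 0 i * phi x)%:E) = (fun x => (G i x * phi x)%:E).
      by apply/funext => x; rewrite mxE.
    have e1 := EFin_Rintegral mO i1; have e3 := EFin_Rintegral mO i2.
    rewrite e2; apply: (etrans e1); rewrite (_ : \int[mu]_(x in Om) (G i x * phi x)%:E = (iO (fun x => G i x * phi x))%:E)%E //.
    by rewrite -EFinN; congr (_%:E); exact: ibp.
exists u, t, (sing g eta t), Du; split.
- split => //; split; first by apply/(Lp2E sur mB).
  exists Du, W; split.
  + exact: HG.
  + by move=> k; split; [exact: CW|split; [exact: LW|move=> i; exact: LP]].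
  + by apply/(cvg_Lp_dist mu Om W u).
  + by move=> i; rewrite DuE; apply/(cvg_Lp_dist mu Om (fun k => partial i (W k)) (G i)); exact: cG.
  + by apply/(cvg_Lp_dist sur (boundary Om) W t).
- exact: hS.
- by apply: (@ae_imp _ surT R sur _ _ _ hq) => x hx bx; case: (hx bx).
- move=> phi Dphi tphi Hp Ht Hb.
  have [h1 h2 h3 h4 h5] := extension oOm bOm mlam lam0 lamL if_ f0 Hf iq GL tL hE Hp Ht Hb.
  have e i : (fun x => Du x 0 i * Dphi x 0 i) = (fun x => G i x * Dphi x 0 i).
    by apply/funext => x; rewrite mxE.
  split => //; first by move=> i; rewrite e.
  by rewrite -h5; congr (_ + _); apply: eq_bigr => i _; rewrite e.
Qed.

End NormalisedData.

Section AlmostEverywhereEqual.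
Context d (T : measurableType d) (R : realType) (m : {measure set T -> \bar R}).
Variable (D : set T).
Hypothesis mD : measurable D.

Lemma Lp_pos_part (p : R) (f : T -> R) : 0 < p -> Lp m D p%:E f ->
  Lp m D p%:E (fun x => Num.max (f x) 0).
Proof.
move=> p0 /(LpE m mD _ p0)[mf hf]; apply/(LpE m mD _ p0).
have mp : measurable_fun D (fun x => Num.max (f x) 0).
  by apply: measurable_maxr => //; exact: measurable_cst.
have mn (v : T -> R) : measurable_fun D v -> measurable_fun D (fun x => (`|v x| `^ p)%:E).
  move=> mv; apply/measurable_EFinP.
  exact: (measurableT_comp (@measurable_powR R p) (measurableT_comp (@normr_measurable R setT) mv)).
split; first exact: mp.
apply: le_lt_trans hf; apply: ge0_le_integral; first exact: mD.
- by move=> x _; rewrite lee_fin powR_ge0.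
- exact: mn.
- exact: mn.
- move=> x _; rewrite lee_fin; apply: ge0_ler_powR; rewrite ?nnegrE ?(ltW p0)//.
  by have [h|h] := leP (f x) 0; rewrite ?normr0.
Qed.

Lemma integral_ae_EFin (F : T -> \bar R) (v : T -> R) : measurable_fun D F ->
  m.-integrable D (EFin \o v) -> {ae m, forall x, D x -> F x = (v x)%:E} ->
  (\int[m]_(x in D) F x = (\int[m]_(x in D) v x)%:E)%E.
Proof.
move=> mF iv ae; rewrite -(EFin_Rintegral mD iv); apply: ae_eq_integral => //.
exact: measurable_int iv.
Qed.

End AlmostEverywhereEqual.

Section Existence.
Context (R : realType) (n : nat).
Local Notation N := n.+1.
Local Notation lebT := (caratheodory_type (@lebesgue_outer R N)).
Local Notation surT := (caratheodory_type (@hausdorff_outer R N.-1 N)).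
Local Notation sur := (surface R N).
Local Notation mu := (lebesgue_rV R N).

(** [g] carries no sign here, so 1 / t^eta is obtained on its own as a limit of regularised powers
    and then multiplied by [g]. *)
Lemma measurable_singular (Om : set 'rV[R]_N) (g t : surT -> R) (eta : R) : 0 <= eta ->
  (forall x, 0 <= t x) -> measurable_fun (boundary Om : set surT) g ->
  measurable_fun (boundary Om : set surT) t ->
  measurable_fun (boundary Om : set surT) (singular_term g t eta : surT -> \bar R).
Proof.
move=> eta0 t0 mg mt.
have md : measurable_fun (boundary Om : set surT) (fun x : surT => (1%:E / ((t x) `^ eta)%:E)%E).
  apply: (emeasurable_fun_cvg (fun j (x : surT) => (1 * (t x + sj R j) `^ (- eta))%:E)).
    move=> j; apply/measurable_EFinP; apply: measurable_funM; first exact: measurable_cst.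
    exact: (measurableT_comp (@measurable_powR R (- eta)) (measurable_funD mt (measurable_cst _))).
  move=> x _; apply: cvg_singular => //; first by move=> k; rewrite ltr_wpDl// sj_gt0.
  by rewrite -[X in _ --> X]addr0; apply: (@cvgD _ R^o); [exact: cvg_cst|exact: sj_cvg].
rewrite (_ : singular_term g t eta = (fun x => (g x)%:E * (1%:E / ((t x) `^ eta)%:E))%E).
  by apply: emeasurable_funM; [exact/measurable_EFinP|exact: md].
by apply/funext => x; rewrite mul1e.
Qed.

(** Signs and bounds hold only almost everywhere in the data. Changing the data on null sets makes
    them hold everywhere, and at the end every integral is transported back. *)
Lemma existence (Omega : set 'rV[R]_N) (hN : (2 < N)%N)
    (hopen : open Omega) (hbounded : bounded_set Omega) (hC1 : C1_boundary Omega)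
    (eta : R) (heta : 0 <= eta) (f lambda g : 'rV[R]_N -> R)
    (f_ge0 : {ae lebesgue_rV R N, forall x, Omega x -> 0 <= f x})
    (hf : Lp (lebesgue_rV R N) Omega ((2 * N%:R) / (N%:R + 2))%:E f)
    (lambda_ge0 : {ae surface R N, forall x, boundary Omega x -> 0 <= lambda x})
    (hlambda : Lp (surface R N) (boundary Omega) +oo%E lambda)
    (lambda_neq0_component : forall y, Omega y ->
       ~ {ae surface R N,
          forall x, boundary (connected_component Omega y) x -> lambda x = 0})
    (g_ge0 : {ae surface R N, forall x, boundary Omega x -> 0 <= g x})
    (hg : Lp (surface R N) (boundary Omega)
       (Num.max ((2 * (N%:R - 1)) / (N%:R + eta * (N%:R - 2))) 1)%:E g) :
  exists u : 'rV[R]_N -> R, weak_solution Omega f lambda g eta u.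
Proof.
have mO : measurable (Omega : set lebT) := mO hopen.
have mB : measurable (boundary Omega : set surT) := mB Omega.
have [mlB [c c0 hc]] := Lp_infty_bounded mB hlambda.
(* Restricted to the boundary for global measurability, and cut at 0 and at the essential bound c;
   it agrees with [lambda] almost everywhere on the boundary. *)
pose lam x := Num.min (Num.max ((lambda \_ (boundary Omega)) x) 0) c.
have mlam : measurable_fun setT (lam : surT -> R).
  apply: measurable_minr; last exact: measurable_cst.
  apply: measurable_maxr; last exact: measurable_cst.
  exact: (measurable_restrictT _ mB).1.
have lam0 x : 0 <= lam x by rewrite le_min c0 le_max lexx orbT.
have lamL x : lam x <= c by rewrite ge_min lexx orbT.
have lamE : {ae sur, forall x : surT, boundary Omega x -> lam x = lambda x}.
  apply: (@ae_imp2 _ surT R sur _ _ _ _ hc lambda_ge0) => x h1 h2 bx.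
  rewrite /lam patchE mem_set// (max_idPl (h2 bx)); apply/min_idPl.
  exact: le_trans (ler_norm _) (h1 bx).
have hlam : controlled Omega lam Omega.
  apply: (poincare hopen lam0 (Lam := c) hbounded hC1 mlam lamL) => y Oy h.
  apply: (lambda_neq0_component y Oy).
  apply: (@ae_imp2 _ surT R sur _ _ _ _ lamE h) => x h1 h2 bx.
  by rewrite -h1 ?h2//; exact: boundary_component bx.
pose f' x := Num.max (f x) 0; pose g' x := Num.max (g x) 0.
have f'E : {ae mu, forall x : lebT, Omega x -> f' x = f x}.
  by apply: (@ae_imp _ lebT R mu _ _ _ f_ge0) => x h Ox; apply/max_idPl; exact: h.
have g'E : {ae sur, forall x : surT, boundary Omega x -> g' x = g x}.
  by apply: (@ae_imp _ surT R sur _ _ _ g_ge0) => x h Ox; apply/max_idPl; exact: h.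
have f'0 x : 0 <= f' x by rewrite le_max lexx orbT.
have g'0 x : 0 <= g' x by rewrite le_max lexx orbT.
have p0 : 0 < 2 * N%:R / (N%:R + 2) :> R by rewrite divr_gt0// ?mulr_gt0 ?addr_gt0// ltr0n.
have r0 : 0 < Num.max ((2 * (N%:R - 1)) / (N%:R + eta * (N%:R - 2))) 1 :> R.
  by rewrite lt_max ltr01 orbT.
have [mf _] := (LpE mu mO _ p0).1 hf; have [mg _] := (LpE sur mB _ r0).1 hg.
have [u [t [q [Du [[HG Ht u0 t0] hS hq hE]]]]] := normalised_solution hN hopen hbounded hC1
  mlam lam0 lamL hlam heta f'0 g'0 (Lp_pos_part mO p0 hf) (Lp_pos_part mB r0 hg).
have mt : measurable_fun (boundary Omega : set surT) (t : surT -> R).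
  by case: Ht => /(Lp2E sur mB)[].
have mS : measurable_fun (boundary Omega : set surT) (singular_term g t eta : surT -> \bar R).
  exact: measurable_singular.
have SE : {ae sur, forall x : surT, boundary Omega x -> singular_term g t eta x = singular_term g' t eta x}.
  by apply: (@ae_imp _ surT R sur _ _ _ g'E) => x h bx; rewrite /singular_term h.
exists u, Du, t; split => //.
- by apply: aeW => x _.
- apply: (le_integrable_ae mB mS (integrable_abse hS)).
  by apply: (@ae_imp _ surT R sur _ _ _ SE) => x h bx; rewrite h.
move=> phi Dphi tphi Hphi Htphi Hb.
have [i1 i2 i3 i4 E] := hE phi Dphi tphi Hphi Htphi Hb.
have [mtphi _] := Lp_infty_bounded mB Hb.
have mphi : measurable_fun (Omega : set lebT) (phi : lebT -> R).
  by case: Hphi => /(Lp2E mu mO)[].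
have iS : intO Omega (fun x => \sum_i Du x 0 i * Dphi x 0 i).
  have := integrable_sum mO (index_enum 'I_N) (P := predT) (fun i _ => i1 i).
  by congr (mu.-integrable _ _); apply/funext => x /=; rewrite sumEFin.
have e1 := integral_ae_EFin mO (measurable_int _ iS) iS (aeW _ (fun x _ => erefl)).
have e2 : (\int[sur]_(x in (boundary Omega : set surT)) (lambda x * t x * tphi x)%:E =
   (iB Omega (fun x => lam x * t x * tphi x))%:E)%E.
  apply: (integral_ae_EFin mB _ i2).
    apply/measurable_EFinP; apply: measurable_funM; last exact: mtphi.
    by apply: measurable_funM; [exact: mlB|exact: mt].
  by apply: (@ae_imp _ surT R sur _ _ _ lamE) => x h bx; rewrite h.
have e3 : (\int[mu]_(x in (Omega : set lebT)) (f x * phi x)%:E =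
   (iO Omega (fun x => f' x * phi x))%:E)%E.
  apply: (integral_ae_EFin mO _ i3).
    by apply/measurable_EFinP; apply: measurable_funM; [exact: mf|exact: mphi].
  by apply: (@ae_imp _ lebT R mu _ _ _ f'E) => x h bx; rewrite h.
have e4 : (\int[sur]_(x in (boundary Omega : set surT)) ((tphi x)%:E * singular_term g t eta x) =
   (iB Omega (fun x => q x * tphi x))%:E)%E.
  apply: (integral_ae_EFin mB _ i4).
    by apply: emeasurable_funM; [exact/measurable_EFinP|exact: mS].
  apply: (@ae_imp2 _ surT R sur _ _ _ _ SE hq) => x h1 h2 bx.
  by rewrite h1// h2// -EFinM mulrC.
rewrite e2 e3 e4; have -> : (\int[mu]_(x in (Omega : set lebT)) (\sum_(i < N) Du x 0 i * Dphi x 0 i)%:E =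
   (\sum_i iO Omega (fun x => Du x 0 i * Dphi x 0 i))%:E)%E.
  by rewrite -(iO_sum hopen i1); exact: e1.
by rewrite -!EFinD E.
Qed.

End Existence.
Theorem theorem2p2 (R : realType) (N : nat) (hN : (2 < N)%N)
    (Omega : set 'rV[R]_N)
    (hopen : open Omega) (hbounded : bounded_set Omega)
    (hC1 : C1_boundary Omega)
    (eta : R) (heta : 0 <= eta)
    (f lambda g : 'rV[R]_N -> R)
    (f_ge0 : {ae lebesgue_rV R N, forall x, Omega x -> 0 <= f x})
    (hf : Lp (lebesgue_rV R N) Omega ((2 * N%:R) / (N%:R + 2))%:E f)
    (lambda_ge0 : {ae surface R N,
       forall x, boundary Omega x -> 0 <= lambda x})
    (hlambda : Lp (surface R N) (boundary Omega) +oo%E lambda)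
    (lambda_neq0 : ~ {ae surface R N,
       forall x, boundary Omega x -> lambda x = 0})
    (lambda_neq0_component : forall y, Omega y ->
       ~ {ae surface R N,
          forall x, boundary (connected_component Omega y) x -> lambda x = 0})
    (g_ge0 : {ae surface R N, forall x, boundary Omega x -> 0 <= g x})
    (hg : Lp (surface R N) (boundary Omega)
       (Num.max ((2 * (N%:R - 1)) / (N%:R + eta * (N%:R - 2))) 1)%:E g) :
  exists u : 'rV[R]_N -> R, weak_solution Omega f lambda g eta u.
Proof.
move: hN Omega hopen hbounded hC1 f lambda g f_ge0 hf lambda_ge0 hlambda lambda_neq0
  lambda_neq0_component g_ge0 hg.
case: N => [//|n] hN Omega hopen hbounded hC1 f lambda g f_ge0 hf l0 hl _ lc g_ge0 hg.
exact: (@existence R n Omega hN hopen hbounded hC1 eta heta f lambda g).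
Qed.
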